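(* Let $(\widetilde{\mathfrak g},H_0)$ be a simple regular graded Lie algebra over $F$ of rank $k+1\ge 2$ with $\ell=1$ and $e=0$ or $e=4$. Then $\chi_0(G)=F^*$ and the group $G$ has exactly $k+1$ non-zero orbits in $V^+$. These orbits are characterized by their rank, and a representative of the unique open orbit is $X_0+\cdots+X_k$. Moreover, any two generic elements of $\bigoplus_{j=0}^k\widetilde{\mathfrak g}^{\lambda_j}$ are conjugate under the subgroup $L=Z_G(\mathfrak a^0)$.
   Context: Setting. $F$ is a finite extension of $\mathbb Q_p$ whose residue field has characteristic $\neq 2$; $\overline F$ is an algebraic closure and $\overline U=U\otimes_F\overline F$. A regular graded Lie algebra is a reductive Lie algebra $\widetilde{\mathfrak g}$ over $F$ with an element $H_0$ such that (H1) $\widetilde{\mathfrak g}=V^-\oplus\mathfrak g\oplus V^+$ with $V^+\ne 0$, where $V^-,\mathfrak g,V^+$ are the eigenspaces of $\operatorname{ad}H_0$ for $-2,0,2$; (H2) the bracket representation of $\mathfrak g$ on $\overline{V^+}$ is irreducible; (H3) there are $I^\pm\in V^\pm$ such that $(I^-,H_0,I^+)$ is an $\mathfrak{sl}_2$-triple. Convention: $(Y,H,X)$ is an $\mathfrak{sl}_2$-triple if $[H,X]=2X$, $[H,Y]=-2Y$, $[Y,X]=H$. Roots and descent. $\mathfrak a$ is a maximal split abelian subalgebra of $\mathfrak g$ containing $H_0$; $\widetilde\Sigma$ is the root system of $(\widetilde{\mathfrak g},\mathfrak a)$, $\widetilde{\mathfrak g}^\lambda$ the root spaces, $H_\lambda\in\mathfrak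 a$ the coroot of $\lambda$. Fix a basis $\widetilde\Pi$ of $\widetilde\Sigma$ with $\nu(H_0)\in\{0,2\}$ for all $\nu\in\widetilde\Pi$; exactly one simple root, $\lambda_0$, satisfies $\lambda_0(H_0)=2$. Inductively, $\lambda_j$ is the unique simple root with $\lambda_j(H_0)=2$ of the system $\widetilde\Sigma_j$ of roots of $\widetilde\Sigma$ strongly orthogonal to $\lambda_0,\dots,\lambda_{j-1}$, ordered by $\widetilde\Sigma^+\cap\widetilde\Sigma_j$; the process stops at $\lambda_k$, when no root $\lambda$ with $\lambda(H_0)=2$ is strongly orthogonal to $\lambda_0,\dots,\lambda_k$. The rank of $\widetilde{\mathfrak g}$ is $k+1$. $\mathfrak a^0=\bigoplus_{j=0}^kFH_{\lambda_j}$. $\ell=\dim\widetilde{\mathfrak g}^{\lambda_j}$ (independent of $j$) and, for $i\ne j$, $e=\dim\widetilde{\mathfrak g}^{(\lambda_i+\lambda_j)/2}$ (independent of $i,j$; $0$ if this is not a root). Groups. $\mathrm{Aut}_0(\widetilde{\mathfrak g})$ is the group of automorphisms of $\widetilde{\mathfrak g}$ which become elementary (finite products of $e^{\operatorname{ad}x}$, $\operatorname{ad}x$ nilpotent) over $\overline F$; $G=\{g\in\mathrm{Aut}_0(\widetilde{\mathfrak g}):g.H_0=H_0\}$. $X\in V^+$ is generic if its $G$-orbit in $V^+$ is open. $\Delta_0$ is the (unique up to scalar) absolutely irreducible polynomial on $V^+$ relatively invariant under $G$, with character $\chi_0$: $\Delta_0(g.X)=\chi_0(g)\Delta_0(X)$.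 Every $Z\in V^+$ is $G$-conjugate to some $Z_0+\dots+Z_{m-1}$ with $Z_i\in\widetilde{\mathfrak g}^{\lambda_i}\setminus\{0\}$ for a unique integer $m$, the rank of $Z$; the rank of an orbit is the rank of its elements. The elements $X_j$. For $i\ne j$ let $E_{i,j}(-1,-1)=\{Y\in\widetilde{\mathfrak g}:[H_{\lambda_i},Y]=-Y,[H_{\lambda_j},Y]=-Y,[H_{\lambda_s},Y]=0\ (s\neq i,j)\}$, let $b=-\frac{k+1}{4\dim V^+}\,B$ with $B$ the Killing form of $\widetilde{\mathfrak g}$, and $q_{X_i,X_j}(Y)=-\tfrac12 b([X_i,Y],[X_j,Y])$ on $E_{i,j}(-1,-1)$. The elements $X_j\in\widetilde{\mathfrak g}^{\lambda_j}\setminus\{0\}$ are fixed so that all the quadratic forms $q_{X_i,X_j}$ $(i\ne j)$ are $G$-equivalent (i.e. related by composition with an element of $G$) and represent $1$ (such a choice exists). *)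

(* Defs.v *)
From HB Require Import structures.
From mathcomp Require Import all_boot all_order all_algebra all_field.
From mathcomp Require Import boolp classical_sets functions cardinality.
From mathcomp.multinomials Require Import mpoly.

Set Implicit Arguments.
Unset Strict Implicit.
Unset Printing Implicit Defensive.

Import Order.TTheory GRing.Theory Num.Theory passmx.
Local Open Scope ring_scope.
Local Open Scope classical_set_scope.

Definition padic_abs_rat (p : nat) (x : rat) : rat :=
  if x == 0 then 0
  else p%:R ^+ logn p `|denq x|%N / p%:R ^+ logn p `|numq x|%N.

(* [K] is the completion of the rationals for the p-adic absolute value; the
   extended absolute value [nu] takes its values in {0} and the powers of p,
   so that it is rational-valued. *)
Record is_Qp (p : nat) (K : fieldType) (nu : K -> rat) : Prop := IsQp {
  Qp_prime : prime p;
  Qp_abs_eq0 : forall x, nu x = 0 -> x = 0;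
  Qp_absM : forall x y, nu (x * y) = nu x * nu y;
  Qp_absD : forall x y, nu (x + y) <= nu x + nu y;
  Qp_abs_rat : forall q : rat, nu (ratr q) = padic_abs_rat p q;
  Qp_dense : forall (x : K) (eps : rat), 0 < eps ->
    exists q : rat, nu (x - ratr q) < eps;
  Qp_complete : forall u : nat -> K,
    (forall eps : rat, 0 < eps -> exists N, forall m n,
       (N <= m)%N -> (N <= n)%N -> nu (u m - u n) < eps) ->
    exists l : K, forall eps : rat, 0 < eps -> exists N, forall n,
       (N <= n)%N -> nu (u n - l) < eps }.

Section Integers.
Variables (K : fieldType) (nu : K -> rat) (F : fieldExtType K).

(* The valuation ring of F: the integral closure in F of the unit ball of K. *)
Definition valuation_ring : set F :=
  [set x | exists P : {poly K},
     [/\ P \is monic, forall i, nu P`_i <= 1 & root (map_poly (in_alg F) P) x]].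

Definition maximal_ideal : set F :=
  [set x | valuation_ring x /\ forall y, valuation_ring y -> x * y <> 1].

Definition residue_char_neq2 : Prop := ~ maximal_ideal 2.

(* Openness in a subspace [U] of a finite-dimensional F-space for the p-adic
   topology: the sets of vectors all of whose coordinates lie in p^n O_F form a
   basis of neighbourhoods of 0. *)
Definition padic_open_in (p : nat) (V : vectType F) (U : {vspace V})
    (A : set V) : Prop :=
  (forall x, A x -> x \in U) /\
  forall x, A x -> exists n : nat, forall y, y \in U ->
    (forall i, valuation_ring
                 (coord (vbasis {:V}) i (y - x) / p%:R ^+ n)) -> A y.

End Integers.

HB.mixin Record Vector_isLie (F : fieldType) (V : Type) of Vector F V := {
  lie : V -> V -> V;
  lie_linearl : forall (c : F) (x y z : V),
    lie (c *: x + y) z = c *: lie x z + lie y z;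
  lie_linearr : forall (c : F) (x y z : V),
    lie z (c *: x + y) = c *: lie z x + lie z y;
  liexx : forall x : V, lie x x = 0;
  lie_jacobi : forall x y z : V,
    lie x (lie y z) + lie y (lie z x) + lie z (lie x y) = 0 }.

#[short(type="lieAlgType")]
HB.structure Definition LieAlgebra (F : fieldType) :=
  {V of Vector_isLie F V & Vector F V}.

HB.instance Definition _ (F : fieldType) (g : lieAlgType F) (x : g) :=
  GRing.isLinear.Build F g g *:%R (lie x) (fun c y z => lie_linearr c y z x).

Section LieAlgebraTheory.
Variables (F : fieldType) (g : lieAlgType F).
Implicit Types (x y z : g) (U I : {vspace g}).

Definition ad x : 'End(g) := linfun (lie x).

Lemma adE x y : ad x y = lie x y.
Proof. by rewrite lfunE. Qed.

Lemma lie0l x : lie 0 x = 0.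
Proof.
by have := lie_linearl (-1) 0 0 x;
   rewrite scaleN1r oppr0 addr0 scaleN1r addNr.
Qed.

Definition lie_ideal I : Prop := forall x y, y \in I -> lie x y \in I.

(* Reductivity in the sense of Bourbaki: the adjoint representation is
   semisimple. *)
Definition lie_reductive : Prop :=
  forall I, lie_ideal I ->
  exists2 J : {vspace g}, lie_ideal J & (I + J = fullv /\ I :&: J = 0)%VS.

Definition lie_simple : Prop :=
  (exists x y, lie x y <> 0) /\
  forall I, lie_ideal I -> I = 0%VS \/ I = fullv.

(* Beware of the convention [Y, X] = H. *)
Definition sl2_triple (y h x : g) : Prop :=
  [/\ lie h x = 2 *: x, lie h y = - 2 *: y & lie y x = h].

Definition killing x y : F :=
  \tr (mxof (vbasis {:g}) (vbasis {:g}) (ad x \o ad y)%VF).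

Definition ad_nilpotent x : Prop := exists n, forall y, iter n (lie x) y = 0.

(* For [ad_nilpotent x] the terms of index at least \dim {:g} vanish. *)
Definition exp_ad x y : g :=
  \sum_(i < (\dim {:g}).+1) (i`!%:R)^-1 *: iter i (lie x) y.

Definition elementary (phi : g -> g) : Prop :=
  exists2 xs : seq g, {in xs, forall x, ad_nilpotent x} &
    forall y, phi y = foldr exp_ad y xs.

Definition lie_automorphism (phi : 'End(g)) : Prop :=
  lker phi = 0%VS /\ forall x y, phi (lie x y) = lie (phi x) (phi y).

Definition lfun_diagonalizable (phi : 'End(g)) : Prop :=
  exists s : seq F, (\sum_(c <- s) leigenspace phi c)%VS = fullv.

Definition split_abelian U : Prop :=
  {in U &, forall x y, lie x y = 0} /\
  {in U, forall x, lfun_diagonalizable (ad x)}.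

Definition maximal_split_abelian_in (m U : {vspace g}) : Prop :=
  [/\ (U <= m)%VS, split_abelian U &
      forall U', (U <= U')%VS -> (U' <= m)%VS -> split_abelian U' -> U' = U].

End LieAlgebraTheory.

(* g (x)_F L, as row vectors of coordinates in [vbasis {:g}]. *)
Definition baseChange (F L : fieldType) (iota : {rmorphism F -> L})
  (g : lieAlgType F) : Type := 'rV[L]_(\dim {:g}).

Section BaseChange.
Variables (F L : fieldType) (iota : {rmorphism F -> L}) (g : lieAlgType F).
Notation gL := (baseChange iota g).
Notation b := (vbasis {:g}).

HB.instance Definition _ := Vector.copy gL 'rV[L]_(\dim {:g}).

Definition toBC (u : g) : gL := \row_k iota (coord b k u).

Definition lieBC (x y : gL) : gL :=
  \sum_i \sum_j
    ((x : 'rV[L]_(\dim {:g})) 0 i * (y : 'rV[L]_(\dim {:g})) 0 j)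
      *: toBC (lie b`_i b`_j).

Let lieBC_linearl (c : L) (x y z : gL) :
  lieBC (c *: x + y) z = c *: lieBC x z + lieBC y z.
Proof.
rewrite /lieBC scaler_sumr -big_split; apply: eq_bigr => i _ /=.
rewrite scaler_sumr -big_split; apply: eq_bigr => j _ /=.
by rewrite !mxE scalerA -scalerDl mulrDl mulrA.
Qed.

Let lieBC_linearr (c : L) (x y z : gL) :
  lieBC z (c *: x + y) = c *: lieBC z x + lieBC z y.
Proof.
rewrite /lieBC scaler_sumr -big_split; apply: eq_bigr => i _ /=.
rewrite scaler_sumr -big_split; apply: eq_bigr => j _ /=.
by rewrite !mxE scalerA -scalerDl mulrDr mulrCA.
Qed.

Let lieBC_sym (x y : gL) : lieBC x y = - lieBC y x.
Proof.
have lieC (u v : g) : lie u v = - lie v u.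
  apply/eqP; rewrite -addr_eq0; apply/eqP.
  have := liexx (u + v); rewrite linearD /=.
  have lieDl w : lie (u + v) w = lie u w + lie v w.
    by rewrite -{1}[u]scale1r lie_linearl scale1r.
  by rewrite !lieDl !liexx add0r addr0 addrC.
rewrite /lieBC exchange_big -sumrN; apply: eq_bigr => j _ /=.
rewrite -sumrN; apply: eq_bigr => i _ /=.
rewrite lieC mulrC -scalerN; congr (_ *: _).
by apply/rowP => k; rewrite !mxE linearN rmorphN.
Qed.

Let toBC_linear c u v : toBC (c *: u + v) = iota c *: toBC u + toBC v.
Proof. by apply/rowP => k; rewrite !mxE linearP rmorphD rmorphM. Qed.

Let toBC0 : toBC 0 = 0.
Proof. by apply/rowP => k; rewrite !mxE linear0 rmorph0. Qed.

Lemma toBC_basis (x : gL) :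
  x = \sum_i (x : 'rV[L]_(\dim {:g})) 0 i *: toBC b`_i.
Proof.
rewrite [LHS]row_sum_delta; apply: eq_bigr => i _; congr (_ *: _).
apply/rowP => k; rewrite !mxE coord_free ?(basis_free (vbasisP _)) //.
by rewrite !eqxx eq_sym rmorph_nat.
Qed.

Let ext0 (f : gL -> gL) :
  (forall c x y, f (c *: x + y) = c *: f x + f y) ->
  (forall i : 'I_(\dim {:g}), f (toBC b`_i) = 0) -> forall x, f x = 0.
Proof.
move=> flin f0 x; rewrite [x]toBC_basis.
have f00 : f 0 = 0.
  by have := flin (-1) 0 0; rewrite scaleN1r oppr0 addr0 scaleN1r addNr.
elim/big_rec: _ => [//|i y _ fy].
by rewrite flin fy f0 scaler0 addr0.
Qed.

Let lieBC0l y : lieBC 0 y = 0.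
Proof.
by have := lieBC_linearl (-1) 0 0 y;
   rewrite scaleN1r oppr0 addr0 scaleN1r addNr.
Qed.

Let lieBC0r y : lieBC y 0 = 0.
Proof. by rewrite lieBC_sym lieBC0l oppr0. Qed.

Lemma toBC_lie (u v : g) : toBC (lie u v) = lieBC (toBC u) (toBC v).
Proof.
rewrite [u in LHS](coord_vbasis (memvf u)) [v in LHS](coord_vbasis (memvf v)).
rewrite /lieBC.
under [RHS]eq_bigr => i _ do under eq_bigr => j _ do rewrite !mxE.
elim/big_rec2: _ => [|i y1 y2 _ <-]; first by rewrite lie0l toBC0.
rewrite lie_linearl toBC_linear addrC [RHS]addrC; congr (_ + _).
elim/big_rec2: _ => [|j z1 z2 _ IH]; first by rewrite linear0 toBC0 scaler0.
by rewrite lie_linearr toBC_linear scalerDr scalerA IH.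
Qed.

Let lieBCxx (x : gL) : lieBC x x = 0.
Proof.
rewrite [x]toBC_basis; elim/big_rec: _ => [|i y _ IH]; first exact: lieBC0l.
rewrite lieBC_linearl 2!lieBC_linearr IH addr0.
rewrite -toBC_lie liexx toBC0 scaler0 add0r.
by rewrite [lieBC y _]lieBC_sym scalerN addrN.
Qed.

Let lieBC_jacobi (x y z : gL) :
  lieBC x (lieBC y z) + lieBC y (lieBC z x) + lieBC z (lieBC x y) = 0.
Proof.
move: x; apply: ext0 => [c x x'|i].
  rewrite !(lieBC_linearl, lieBC_linearr) !scalerDr.
  by rewrite [X in X + _ = _]addrACA [LHS]addrACA.
move: y; apply: ext0 => [c y y'|j].
  rewrite !(lieBC_linearl, lieBC_linearr) !scalerDr.
  by rewrite [X in X + _ = _]addrACA [LHS]addrACA.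
move: z; apply: ext0 => [c z z'|k].
  rewrite !(lieBC_linearl, lieBC_linearr) !scalerDr.
  by rewrite [X in X + _ = _]addrACA [LHS]addrACA.
rewrite -!toBC_lie -[RHS]toBC0 -[in RHS](lie_jacobi b`_i b`_j b`_k).
by apply/rowP => m; rewrite !mxE !linearD !rmorphD.
Qed.

HB.instance Definition _ := Vector_isLie.Build L gL
  lieBC_linearl lieBC_linearr lieBCxx lieBC_jacobi.

(* U (x)_F L *)
Definition subspaceBC (U : {vspace g}) : {vspace gL} :=
  <<[seq toBC u | u <- vbasis U]>>%VS.

(* phi (x)_F L *)
Definition endBC (phi : 'End(g)) (x : gL) : gL :=
  \sum_i (x : 'rV[L]_(\dim {:g})) 0 i *: toBC (phi b`_i).

Definition Aut0 : set 'End(g) :=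
  [set phi | lie_automorphism phi /\ elementary (endBC phi)].

End BaseChange.

Section Graded.
Variables (F L : fieldType) (iota : {rmorphism F -> L}) (g : lieAlgType F).
Variable H0 : g.

Definition Vplus : {vspace g} := leigenspace (ad H0) 2.
Definition Vminus : {vspace g} := leigenspace (ad H0) (- 2).
Definition g0 : {vspace g} := leigenspace (ad H0) 0.

Record regular_graded : Prop := RegularGraded {
  graded_reductive : lie_reductive g;
  graded_sum : (Vminus + g0 + Vplus)%VS = fullv;
  graded_direct : directv (Vminus + g0 + Vplus);
  graded_Vplus_neq0 : Vplus != 0%VS;
  graded_irreducible : forall W : {vspace baseChange iota g},
    (W <= subspaceBC iota Vplus)%VS ->
    (forall (x : g) (w : baseChange iota g), x \in g0 -> w \in W ->
       lie (toBC iota x : baseChange iota g) w \in W) ->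
    W = 0%VS \/ W = subspaceBC iota Vplus;
  graded_sl2 : exists Im Ip : g,
    [/\ Im \in Vminus, Ip \in Vplus & sl2_triple Im H0 Ip] }.

Definition Ggrp : set 'End(g) :=
  [set phi | Aut0 iota phi /\ phi H0 = H0].

Definition Gorbit (X : g) : set g := [set phi X | phi in Ggrp].

End Graded.

Section Roots.
Variables (F : fieldType) (g : lieAlgType F) (a : {vspace g}).

Definition dual := 'Hom(subvs_of a, F^o).
Implicit Types (lam mu : dual) (Pi : seq dual) (S : pred dual).

Definition root_eval lam (h : g) : F := lam (vsproj a h).

Definition root_space lam : {vspace g} :=
  (\bigcap_(i < \dim a)
     leigenspace (ad (vbasis a)`_i) (root_eval lam (vbasis a)`_i))%VS.

Lemma leigenspace_adP (h x : g) (c : F) :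
  (x \in leigenspace (ad h) c) = (lie h x == c *: x).
Proof.
by rewrite memv_ker add_lfunE opp_lfunE scale_lfunE id_lfunE adE subr_eq0.
Qed.

Lemma root_spaceP lam x :
  x \in root_space lam <-> {in a, forall h, lie h x = root_eval lam h *: x}.
Proof.
have basis_in (i : 'I_(\dim a)) : (vbasis a)`_i \in a.
  by apply: vbasis_mem; rewrite mem_nth ?size_tuple.
split=> [xlam h ha|xlam]; last first.
  rewrite memvE; apply/subv_bigcapP => i _.
  by rewrite -memvE leigenspace_adP; apply/eqP/xlam.
have xb (i : 'I_(\dim a)) :
    lie (vbasis a)`_i x = root_eval lam (vbasis a)`_i *: x.
  move: xlam; rewrite memvE => /subv_bigcapP/(_ i isT).
  by rewrite -memvE leigenspace_adP => /eqP.
rewrite (coord_vbasis ha).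
elim/big_rec: _ => [|i y _ IH].
  rewrite /root_eval !linear0 scale0r.
  exact: lie0l.
rewrite lie_linearl IH xb scalerA -scalerDl; congr (_ *: _).
by rewrite /root_eval !linearP.
Qed.

Definition is_root : pred dual :=
  [pred lam | (lam != 0) && (root_space lam != 0%VS)].

(* [h] is the coroot of lam in the (possibly non-reduced) root system: 2 on lam, and the
   associated reflection preserves the roots. *)
Definition is_coroot lam (h : g) : Prop :=
  [/\ h \in a, root_eval lam h = 2 &
      forall mu, is_root mu -> is_root (mu - root_eval mu h *: lam)].

Definition nonneg_comb Pi mu : Prop :=
  exists n : 'I_(size Pi) -> nat, mu = \sum_(i < size Pi) Pi`_i *+ n i.

Definition root_basis Pi : Prop :=
  [/\ free Pi, {in Pi, forall nu, is_root nu} &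
      forall mu, is_root mu -> nonneg_comb Pi mu \/ nonneg_comb Pi (- mu)].

Definition positive_root Pi mu : Prop := is_root mu /\ nonneg_comb Pi mu.

Definition strongly_orthogonal lam mu : Prop :=
  [/\ ~~ is_root (lam + mu), ~~ is_root (lam - mu), lam + mu <> 0 &
      lam - mu <> 0].

Variables (H0 : g) (Pi : seq dual) (k : nat) (lam : 'I_k.+1 -> dual).

(* Positive elements of the set of roots strongly orthogonal to lam_0, ..., lam_(j-1). *)
Definition descent_positive (j : nat) mu : Prop :=
  positive_root Pi mu /\
  forall i : 'I_k.+1, (i < j)%N -> strongly_orthogonal (lam i) mu.

(* Simple roots of an ordered root system: the positive roots which are not
   the sum of two positive roots. *)
Definition descent_simple (j : nat) mu : Prop :=
  descent_positive j mu /\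
  forall mu1 mu2, descent_positive j mu1 -> descent_positive j mu2 ->
    mu <> mu1 + mu2.

Record descent : Prop := Descent {
  descent_head : lam ord0 \in Pi;
  descent_lam : forall j : 'I_k.+1, descent_simple j (lam j);
  descent_H0 : forall j, root_eval (lam j) H0 = 2;
  descent_stop : forall mu, is_root mu -> root_eval mu H0 = 2 ->
    ~ forall i, strongly_orthogonal (lam i) mu }.

End Roots.

Section Polynomials.
Variables (F : fieldType).

Definition eval_on (V : vectType F) (U : {vspace V})
    (P : {mpoly F[\dim U]}) (x : V) : F :=
  P.@[fun i => coord (vbasis U) i x].

Definition mirreducible (R : idomainType) n (P : {mpoly R[n]}) : Prop :=
  [/\ P != 0, P \isn't a GRing.unit &
      forall Q1 Q2 : {mpoly R[n]}, P = Q1 * Q2 ->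
        Q1 \is a GRing.unit \/ Q2 \is a GRing.unit].

Definition abs_irreducible (Fbar : closedFieldType)
    (iota : {rmorphism F -> Fbar}) n (P : {mpoly F[n]}) : Prop :=
  mirreducible (map_mpoly iota P).

End Polynomials.

Section Orbits.
Variables (F L : fieldType) (iota : {rmorphism F -> L}) (g : lieAlgType F).
Variables (H0 : g) (a : {vspace g}) (k : nat) (lam : 'I_k.+1 -> dual a).
Variable H : 'I_k.+1 -> g.
Notation G := (Ggrp iota H0).

Definition has_rank (Z : g) (m : nat) : Prop :=
  (m <= k.+1)%N /\ exists W : 'I_k.+1 -> g,
    (forall i : 'I_k.+1, (i < m)%N -> W i \in root_space (lam i) /\ W i != 0)
    /\ Gorbit iota H0 Z (\sum_(i < k.+1 | (i < m)%N) W i).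

(* The unique m such that [has_rank Z m]; 0 is a dummy default. *)
Definition orbit_rank (Z : g) : nat := xget 0%N [set m | has_rank Z m].

Definition relatively_invariant (P : {mpoly F[\dim (Vplus H0)]})
    (chi : 'End(g) -> F) : Prop :=
  forall phi X, G phi -> X \in Vplus H0 ->
    eval_on P (phi X) = chi phi * eval_on P X.

Definition a0 : {vspace g} := (\sum_(j < k.+1) <[H j]>)%VS.

Definition Lgrp : set 'End(g) :=
  [set phi | G phi /\ {in a0, forall h, phi h = h}].

(* E_{i,j}(-1,-1) *)
Definition Eminus (i j : 'I_k.+1) : {vspace g} :=
  (leigenspace (ad (H i)) (- 1) :&: leigenspace (ad (H j)) (- 1) :&:
   \bigcap_(s < k.+1 | (s != i) && (s != j)) leigenspace (ad (H s)) 0)%VS.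

(* b = - (k+1) / (4 dim V^+) times the Killing form *)
Definition bform (x y : g) : F :=
  - (k.+1%:R / (4 * \dim (Vplus H0))%:R) * killing x y.

(* q_{Xi,Xj} *)
Definition qform (Xi Xj Y : g) : F := - 2^-1 * bform (lie Xi Y) (lie Xj Y).

(* The q_{X_i,X_j}, i <> j, are pairwise G-equivalent and represent 1; an
   equivalence must carry the domain E_{i,j}(-1,-1) onto E_{s,t}(-1,-1). *)
Definition normalized (X : 'I_k.+1 -> g) : Prop :=
  [/\ forall j, X j \in root_space (lam j) /\ X j != 0,
      forall i j s t, i != j -> s != t ->
        exists2 phi, G phi &
          (phi @: Eminus i j)%VS = Eminus s t /\
          {in Eminus i j, forall Y,
             qform (X s) (X t) (phi Y) = qform (X i) (X j) Y} &
      forall i j, i != j ->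
        exists2 Y, Y \in Eminus i j & qform (X i) (X j) Y = 1].

End Orbits.

Section Generic.
Variables (p : nat) (K : fieldType) (nu : K -> rat) (F : fieldExtType K).
Variables (L : fieldType) (iota : {rmorphism F -> L}) (g : lieAlgType F).
Variable H0 : g.

Definition open_orbit (X : g) : Prop :=
  padic_open_in nu p (Vplus H0) (Gorbit iota H0 X).

Definition generic (X : g) : Prop := X \in Vplus H0 /\ open_orbit X.

End Generic.

(* Main.v *)
Require Import Defs.
From HB Require Import structures.
From mathcomp Require Import all_boot all_order all_algebra all_field.
From mathcomp Require Import boolp classical_sets functions cardinality.
From mathcomp.multinomials Require Import mpoly.
From mathcomp Require Import ring lra zify.

Set Implicit Arguments.
Unset Strict Implicit.
Unset Printing Implicit Defensive.

Import Order.TTheory GRing.Theory Num.Theory passmx.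
Local Open Scope ring_scope.
Local Open Scope classical_set_scope.
Local Open Scope card_scope.

(** Exponentials of elements of g bring each vector of V+ to the form
    [\sum_j a j *: X j]; the rank of (ad Z)^2 on V- counts the nonzero [a j]. It
    remains to find elements of G scaling the X_j by given factors. As the forms
    on E_ij(1,-1) are universal, only the product t of the factors matters. A
    scalar will do for k even; for e = 0, a torus dual to a simple root with odd
    coefficient in the sum of the lambda_j; for e = 4, products of quarter turns,
    defined over an extension and descended to F. *)

(** * Linear identities by reflection *)

(** Membership in G asks for elementarity over [Fbar] only, so a torus may be taken at a parameter
    outside F as long as the resulting map is defined over F; [descent_rational] reduces this to its
    effect on V+. The torus of H_j scales X_j by squares, so only the class of t modulo squares is
    at stake and exponents count through their parity: the scalar t has product t^(k+1). For the
    quarter turn, D is an infinitesimal rotation with D^2 = -t. A torus over [Fbar] acts as (I/om) D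
    with I^2 = -1 and om^2 = -t; the torus of H_i at om/I removes this factor and multiplies X_i by
    t. Such a D is found when -t is not a square, because anisotropic quaternary forms over F have
    square discriminant; the other t are products of two such. This arithmetic of F, like the
    universality of the forms for e = 4, comes from completeness and a residue characteristic other
    than 2. For the character, the relative invariant is shown to be a constant times an n-th power,
    n being its exponent along each X_j; irreducibility forces n = 1. *)

Section LinearReflection.
Variables (F : fieldType) (V : lmodType F).

Inductive lexpr : Type :=
  | LVar of nat
  | LZero
  | LAdd of lexpr & lexpr
  | LOpp of lexpr
  | LScale of F & lexpr
  | LMuln of lexpr & nat.

Fixpoint leval (vs : seq V) (e : lexpr) : V :=
  match e with
  | LVar i => nth 0 vs i
  | LZero => 0
  | LAdd e1 e2 => leval vs e1 + leval vs e2
  | LOpp e1 => - leval vs e1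
  | LScale c e1 => c *: leval vs e1
  | LMuln e1 n => leval vs e1 *+ n
  end.

(** [Nat.eqb] instead of [==]: [cbn] has to reduce the coefficients to the scalars on which [ring]
    and [field] act. *)
Fixpoint lcoef (e : lexpr) (i : nat) : F :=
  match e with
  | LVar j => if Nat.eqb i j then 1 else 0
  | LZero => 0
  | LAdd e1 e2 => lcoef e1 i + lcoef e2 i
  | LOpp e1 => - lcoef e1 i
  | LScale c e1 => c * lcoef e1 i
  | LMuln e1 n => lcoef e1 i *+ n
  end.

Fixpoint lcoef_eq (n : nat) (e1 e2 : lexpr) : Prop :=
  match n with
  | 0%N => True
  | n'.+1 => lcoef e1 n' = lcoef e2 n' /\ lcoef_eq n' e1 e2
  end.

Lemma leval_sum vs e :
  leval vs e = \sum_(i < size vs) lcoef e i *: nth 0 vs i.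
Proof.
elim: e => [j||e1 IH1 e2 IH2|e1 IH1|c e1 IH1|e1 IH1 n] /=.
- have nE i : Nat.eqb i j = (i == j) by elim: i j => [|i IH] [|j] //=; rewrite IH.
  have [lt_j|le_j] := ltnP j (size vs); last first.
    rewrite nth_default // big1 // => i _; rewrite nE.
    by rewrite ltn_eqF ?scale0r // (leq_trans _ le_j).
  rewrite (bigD1 (Ordinal lt_j)) //= nE eqxx scale1r big1 ?addr0 // => i.
  by rewrite nE -val_eqE /= => /negPf->; rewrite scale0r.
- by rewrite big1 // => i _; rewrite scale0r.
- by rewrite IH1 IH2 -big_split; apply: eq_bigr => i _; rewrite scalerDl.
- by rewrite IH1 -sumrN; apply: eq_bigr => i _; rewrite scaleNr.
- by rewrite IH1 scaler_sumr; apply: eq_bigr => i _; rewrite scalerA.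
- by rewrite IH1 -sumrMnl; apply: eq_bigr => i _; rewrite scalerMnl.
Qed.

(** Comparing coefficients is sufficient but not necessary, as the atoms may be linearly dependent:
    relations between them must be rewritten beforehand. *)
Lemma leval_eq vs e1 e2 :
  lcoef_eq (size vs) e1 e2 -> leval vs e1 = leval vs e2.
Proof.
rewrite !leval_sum => h; apply: eq_bigr => i _; congr (_ *: _).
elim: (size vs) h (i : nat) (ltn_ord i) => [//|n IH] /= [hn /IH h] m.
by rewrite ltnS leq_eqVlt => /predU1P[-> //|]; apply: h.
Qed.

End LinearReflection.

Ltac lmod_index a l :=
  lazymatch l with
  | a :: _ => constr:(0%N)
  | _ :: ?t => let n := lmod_index a t in constr:(S n)
  end.

Ltac lmod_add a l :=
  match l with
  | _ => let _ := lmod_index a l in constr:(l)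
  | _ => constr:(a :: l)
  end.

Ltac lmod_atoms l e :=
  lazymatch e with
  | (?x + ?y)%R => let l1 := lmod_atoms l x in lmod_atoms l1 y
  | (- ?x)%R => lmod_atoms l x
  | (_ *: ?x)%R => lmod_atoms l x
  | (?x *+ _)%R => lmod_atoms l x
  | (0)%R => constr:(l)
  | _ => lmod_add e l
  end.

Ltac lmod_quote F l e :=
  lazymatch e with
  | (?x + ?y)%R =>
      let a := lmod_quote F l x in let b := lmod_quote F l y in
      constr:(@LAdd F a b)
  | (- ?x)%R => let a := lmod_quote F l x in constr:(@LOpp F a)
  | (?c *: ?x)%R => let a := lmod_quote F l x in constr:(@LScale F c a)
  | (?x *+ ?n)%R => let a := lmod_quote F l x in constr:(@LMuln F a n)
  | (0)%R => constr:(@LZero F)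
  | _ => let i := lmod_index e l in constr:(@LVar F i)
  end.

Ltac lmod_prepare F :=
  lazymatch goal with
  | |- @eq ?T ?x ?y =>
      let l0 := constr:(@nil T) in
      let l1 := lmod_atoms l0 x in
      let l := lmod_atoms l1 y in
      let a := lmod_quote F l x in
      let b := lmod_quote F l y in
      refine (@leval_eq F _ l a b _);
      cbn [size lcoef_eq lcoef Nat.eqb]
  end.

Tactic Notation "lmod" constr(F) := lmod_prepare F; repeat split; try ring.
Tactic Notation "lmodf" constr(F) := lmod_prepare F; repeat split; try field.

(** * Lie brackets and the Killing form *)

Section LieBasics.
Variables (F : fieldType) (g : lieAlgType F).
Implicit Types (x y z : g) (c : F).

Lemma lieDl x y z : lie (x + y) z = lie x z + lie y z.
Proof. by rewrite -{1}[x]scale1r lie_linearl scale1r. Qed.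

Lemma lieDr x y z : lie z (x + y) = lie z x + lie z y.
Proof. by rewrite linearD. Qed.

Lemma lieC x y : lie x y = - lie y x.
Proof.
apply/eqP; rewrite -addr_eq0; apply/eqP.
by have := liexx (x + y); rewrite lieDl !lieDr !liexx add0r addr0.
Qed.

Lemma lie0r x : lie x 0 = 0. Proof. exact: linear0. Qed.

Lemma lieZl c x y : lie (c *: x) y = c *: lie x y.
Proof. by rewrite -[c *: x]addr0 lie_linearl lie0l addr0. Qed.

Lemma lieZr c x y : lie x (c *: y) = c *: lie x y.
Proof. exact: linearZ. Qed.

Lemma lieNl x y : lie (- x) y = - lie x y.
Proof. by rewrite -scaleN1r lieZl scaleN1r. Qed.

Lemma lieNr x y : lie x (- y) = - lie x y.
Proof. exact: linearN. Qed.

Lemma lieMnl x y n : lie (x *+ n) y = lie x y *+ n.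
Proof. by rewrite -scaler_nat lieZl scaler_nat. Qed.

Lemma lieMnr x y n : lie x (y *+ n) = lie x y *+ n.
Proof. exact: linearMn. Qed.

Definition lieE := (lieDl, lieDr, lieNl, lieNr, lieZl, lieZr, lieMnl, lieMnr,
  lie0l, lie0r).

Lemma lie_suml I (r : seq I) (P : pred I) (E : I -> g) y :
  lie (\sum_(i <- r | P i) E i) y = \sum_(i <- r | P i) lie (E i) y.
Proof. by rewrite lieC raddf_sum -sumrN; apply: eq_bigr => i _; rewrite -lieC. Qed.

Lemma lie_sumr I (r : seq I) (P : pred I) (E : I -> g) y :
  lie y (\sum_(i <- r | P i) E i) = \sum_(i <- r | P i) lie y (E i).
Proof. exact: raddf_sum. Qed.

Lemma lieJ x y z : lie x (lie y z) = lie (lie x y) z + lie y (lie x z).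
Proof.
have := lie_jacobi x y z.
rewrite (lieC z (lie x y)) (lieC z x) lieNr => /eqP.
by rewrite -addrA addr_eq0 opprD !opprK addrC => /eqP.
Qed.

Lemma lie_lie x y z : lie (lie x y) z = lie x (lie y z) - lie y (lie x z).
Proof. by rewrite [lie x (lie y z)]lieJ addrK. Qed.

(** The zero vector has every weight, so that weights add under brackets without side conditions;
    vanishing is then proved by [wt_uniq], from a weight that cannot occur. *)
Definition wt (h : g) (c : F) (z : g) : Prop := lie h z = c *: z.

Lemma wt_lie h c d x y : wt h c x -> wt h d y -> wt h (c + d) (lie x y).
Proof. by move=> hx hy; rewrite /wt lieJ hx hy lieZl lieZr scalerDl. Qed.

Lemma wt_lie0l h c x y : wt h 0 x -> wt h c y -> wt h c (lie x y).
Proof. by rewrite -{2}[c]add0r; exact: wt_lie. Qed.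

Lemma wt_lie0r h c x y : wt h c x -> wt h 0 y -> wt h c (lie x y).
Proof. by rewrite -{2}[c]addr0; exact: wt_lie. Qed.

Lemma wtD h c x y : wt h c x -> wt h c y -> wt h c (x + y).
Proof. by rewrite /wt lieDr scalerDr => -> ->. Qed.

Lemma wtZ h c d x : wt h c x -> wt h c (d *: x).
Proof. by rewrite /wt lieZr => ->; rewrite !scalerA mulrC. Qed.

Lemma wtN h c x : wt h c x -> wt h c (- x).
Proof. by rewrite -scaleN1r; apply: wtZ. Qed.

Lemma wt0 h c : wt h c 0. Proof. by rewrite /wt lie0r scaler0. Qed.

Lemma wt_sum h c I (r : seq I) (P : pred I) (E : I -> g) :
  (forall i, P i -> wt h c (E i)) -> wt h c (\sum_(i <- r | P i) E i).
Proof.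
by move=> hE; elim/big_ind: _ => //; [exact: wt0 | move=> *; exact: wtD].
Qed.

Lemma wt_uniq h c d x : wt h c x -> wt h d x -> c != d -> x = 0.
Proof.
move=> hc; rewrite /wt hc => /eqP; rewrite -subr_eq0 -scalerBl scaler_eq0.
by rewrite subr_eq0 => /orP[-> //|/eqP].
Qed.

Lemma wt_eigen h c x : (x \in leigenspace (ad h) c) <-> wt h c x.
Proof. by rewrite leigenspace_adP; split=> /eqP. Qed.

End LieBasics.

Section Trace.
Variables (F : fieldType) (V : vectType F).

Definition ltrace (f : 'End(V)) : F := \tr (mxof (vbasis {:V}) (vbasis {:V}) f).

Lemma ltraceD f1 f2 : ltrace (f1 + f2) = ltrace f1 + ltrace f2.
Proof. by rewrite /ltrace !linearD. Qed.

Lemma ltraceZ c f : ltrace (c *: f) = c * ltrace f.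
Proof. by rewrite /ltrace !linearZ. Qed.

Lemma ltrace0 : ltrace 0 = 0.
Proof. by rewrite /ltrace !linear0. Qed.

Lemma ltraceC f1 f2 : ltrace (f1 \o f2)%VF = ltrace (f2 \o f1)%VF.
Proof.
by rewrite /ltrace !(mxof_comp _ _ (vbasisP _)) mxtrace_mulC.
Qed.

(** Factor M = C R with C of full column rank and R of full row rank. Then tr (C R) = tr (R C), and
    cancelling C and R in (C R)^(n+1) = C (R C)^n R shows that R C has a smaller nilpotency
    index. *)
Lemma mxtrace_nilpotent n (r : nat) (M : 'M[F]_r) :
  iter n (mulmx M) 1%:M = 0 -> \tr M = 0.
Proof.
elim: n r M => [|n IH] r M /=.
  by move=> h; rewrite -[M]mulmx1 h mulmx0 mxtrace0.
have [q [C [R [-> /row_fullP[C' C'C] /row_freeP[R' RR']]]]] :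
    exists q (C : 'M_(r, q)) (R : 'M_(q, r)),
      [/\ M = C *m R, row_full C & row_free R].
  exists (\rank M), (col_base M), (row_base M).
  by rewrite mulmx_base col_base_full row_base_free.
rewrite mxtrace_mulC => h; apply: IH.
have MC k : iter k (mulmx (C *m R)) C = C *m iter k (mulmx (R *m C)) 1%:M.
  elim: k => [|k /= ->]; first by rewrite mulmx1.
  by rewrite !mulmxA.
have MR k : iter k (mulmx (C *m R)) (C *m R) =
    C *m iter k (mulmx (R *m C)) 1%:M *m R.
  rewrite -MC; elim: k => [//|k /= ->].
  by rewrite !mulmxA.
have h1 : C *m iter n (mulmx (R *m C)) 1%:M *m R = 0 by rewrite -MR -[RHS]h -iterS iterSr mulmx1.
have := congr1 (fun Z => C' *m Z *m R') h1.
by rewrite /= !mulmxA C'C mul1mx -mulmxA RR' mulmx1 mulmx0 mul0mx.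
Qed.

Lemma ltrace_nilpotent n (f : 'End(V)) :
  (forall v, iter n f v = 0) -> ltrace f = 0.
Proof.
move=> hf; apply: (@mxtrace_nilpotent n).
have -> : iter n (mulmx (mxof (vbasis {:V}) (vbasis {:V}) f)) 1%:M =
   mxof (vbasis {:V}) (vbasis {:V}) (iter n (fun h => h \o f)%VF \1%VF).
  elim: n {hf} => [|n /= ->]; first by rewrite mxof1 // (basis_free (vbasisP _)).
  by rewrite (mxof_comp _ _ (vbasisP _)).
have -> : iter n (fun h => h \o f)%VF \1%VF = 0 :> 'End(V).
  apply/lfunP => v; rewrite zero_lfunE -[RHS](hf v) /=.
  elim: n {hf} v => [|n IH] v; first by rewrite id_lfunE.
  by rewrite [RHS]iterSr -IH /= comp_lfunE.
by rewrite linear0.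
Qed.

End Trace.

Section Killing.
Variables (F : fieldType) (g : lieAlgType F).
Implicit Types (x y z : g) (c : F).

Lemma killingE x y : killing x y = ltrace (ad x \o ad y)%VF.
Proof. by []. Qed.

Lemma killingC x y : killing x y = killing y x.
Proof. exact: ltraceC. Qed.

Lemma adD x y : ad (x + y) = ad x + ad y.
Proof. by apply/lfunP => z; rewrite add_lfunE !adE lieDl. Qed.

Lemma adZ c x : ad (c *: x) = c *: ad x.
Proof. by apply/lfunP => z; rewrite scale_lfunE !adE lieZl. Qed.

Lemma killingDr x y z : killing x (y + z) = killing x y + killing x z.
Proof. by rewrite !killingE adD comp_lfunDr ltraceD. Qed.

Lemma killingZr c x y : killing x (c *: y) = c * killing x y.
Proof. by rewrite !killingE adZ -comp_lfunZr ltraceZ. Qed.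

Lemma killingDl x y z : killing (y + z) x = killing y x + killing z x.
Proof. by rewrite killingC killingDr !(killingC x). Qed.

Lemma killingZl c x y : killing (c *: x) y = c * killing x y.
Proof. by rewrite killingC killingZr killingC. Qed.

Lemma killing0r x : killing x 0 = 0.
Proof. by rewrite -(scale0r 0) killingZr mul0r. Qed.

Lemma killing0l x : killing 0 x = 0.
Proof. by rewrite killingC killing0r. Qed.

Lemma killingNr x y : killing x (- y) = - killing x y.
Proof. by rewrite -scaleN1r killingZr mulN1r. Qed.

Lemma killingNl x y : killing (- x) y = - killing x y.
Proof. by rewrite -scaleN1r killingZl mulN1r. Qed.

Lemma ad_lie x y : ad (lie x y) = (ad x \o ad y)%VF - (ad y \o ad x)%VF.
Proof.
by apply/lfunP => z; rewrite add_lfunE opp_lfunE !comp_lfunE !adE lie_lie.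
Qed.

Lemma killing_lie x y z : killing (lie x y) z = killing x (lie y z).
Proof.
rewrite !killingE !ad_lie comp_lfunDl comp_lfunDr comp_lfunNl comp_lfunNr.
rewrite -scaleN1r -[in RHS]scaleN1r !ltraceD !ltraceZ; congr (_ + _).
  by rewrite comp_lfunA.
congr (_ * _).
by rewrite [RHS]ltraceC -[in RHS]comp_lfunA [RHS]ltraceC.
Qed.

Lemma killing_wt h c d x y : wt h c x -> wt h d y -> c + d != 0 ->
  killing x y = 0.
Proof.
move=> hx hy cd; apply: (mulfI cd); rewrite mulr0 mulrDl.
by rewrite -killingZl -killingZr -hx -hy (lieC h x) killingNl killing_lie addNr.
Qed.

Lemma lie_autE (phi : 'End(g)) : lie_automorphism phi ->
  forall x y, phi (lie x y) = lie (phi x) (phi y).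
Proof. by case. Qed.

End Killing.

(** * Exponentials of nilpotent derivations *)

Section NilpotencyIndex.
Variables (F : fieldType) (V : vectType F).

(** The images of the powers of f decrease strictly until they become stationary, hence zero. This
    is why the sum [exp_ad], cut at the dimension, is the full exponential. *)
Lemma nilpotent_dim (f : 'End(V)) n : (forall v, iter n f v = 0) ->
  forall v, iter (\dim {:V}) f v = 0.
Proof.
move=> fn; pose U i := iter i (fun W => (f @: W)%VS) fullv.
have memU i v : iter i f v \in U i by elim: i => [|i IH] /=; [exact: memvf | exact: memv_img].
have Un : U n = 0%VS.
  apply/eqP; rewrite -subv0; apply/subvP => u.
  suff Uiter i : forall u, u \in U i -> exists v, u = iter i f v.
    by case/Uiter => v ->; rewrite fn memv0.
  elim: i => [|i IH] w /=; first by move=> _; exists w.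
  by case/memv_imgP => w' /IH[v ->] ->; exists v.
have leU i : (U i.+1 <= U i)%VS by elim: i => [|i IH]; [exact: subvf | exact: limgS].
have dimU i : U i = 0%VS \/ (\dim (U i) + i <= \dim {:V})%N.
  elim: i => [|i [IH|IH]]; first by right; rewrite addn0 dimvS ?subvf.
    by left; apply/eqP; rewrite -subv0 -IH leU.
  have [eqU|neU] := eqVneq (U i.+1) (U i).
    left; rewrite eqU; have [le_in|lt_ni] := leqP i n; last first.
      apply/eqP; rewrite -subv0 -Un -(subnK (ltnW lt_ni)).
      elim: (i - n)%N => [//|m IHm]; rewrite addSn.
      exact: subv_trans (leU _) IHm.
    rewrite -Un -(subnK le_in); elim: (n - i)%N => [//|m IHm].
    by rewrite addSn [RHS]/= -/(U (m + i)%N) -IHm -{1}eqU.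
  right; rewrite addnS -addSn; apply: leq_trans IH; rewrite leq_add2r.
  rewrite ltn_neqAle dimvS ?leU // andbT.
  by apply: contraNneq neU => eqd; rewrite eqEdim leU eqd leqnn.
move=> v; apply/eqP; rewrite -memv0.
case: (dimU (\dim {:V})) => [<-|]; first exact: memU.
rewrite -[X in (_ <= X)%N]add0n leq_add2r leqn0 dimv_eq0 => /eqP <-.
exact: memU.
Qed.

End NilpotencyIndex.

(** Cauchy product of two sums of M terms: the diagonals n < 2M cover the square, and what they add
    to it vanishes. *)
Lemma convolution_sum (V : nmodType) (B : nat -> nat -> V) M :
  (forall i j, (M <= i)%N || (M <= j)%N -> B i j = 0) ->
  \sum_(n < M + M) \sum_(i < n.+1) B (n - i)%N i =
  \sum_(j < M) \sum_(i < M) B j i.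
Proof.
move=> B0; rewrite exchange_big /=.
transitivity (\sum_(n < M + M) \sum_(i < M + M | (i <= n)%N) B (n - i)%N i).
  apply: eq_bigr => n _.
  rewrite (big_ord_widen_cond (M + M) xpredT (fun i => B (n - i)%N i)) //.
rewrite (exchange_big_dep xpredT) //=.
rewrite big_split_ord /= [X in _ + X]big1 ?addr0; last first.
  by move=> i _; rewrite big1 // => j _; rewrite B0 ?leq_addr ?orbT.
apply: eq_bigr => i _.
transitivity (\sum_(i <= n < M + M) B (n - i)%N i).
  rewrite big_geq_mkord; apply: eq_bigl => n.
  by [].
move: (nat_of_ord i) (ltn_ord i) => m lt_m.
rewrite -{1}[m]add0n big_addn big_mkord.
under [LHS]eq_bigr do rewrite addnK.
have leM : (M <= M + M - m)%N by rewrite -addnBA ?leq_addr // ltnW.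
rewrite -(subnKC leM) big_split_ord /= [X in _ + X]big1 ?addr0 // => j _.
by rewrite B0 ?leq_addr.
Qed.

Section Exponential.
Variables (F : fieldType) (g : lieAlgType F).
Hypothesis char0 : [pchar F] =i pred0.
Implicit Types (x y z : g).

Let fact_neq0 n : (n`!%:R : F) != 0.
Proof. by rewrite -[n`!]prednK ?fact_gt0 ?((pcharf0P F).1 char0). Qed.

Lemma iter_lieD x y z n : iter n (lie x) (y + z) = iter n (lie x) y + iter n (lie x) z.
Proof. by elim: n => [//|n /= ->]; rewrite lieDr. Qed.

Lemma iter_lieZ x c y n : iter n (lie x) (c *: y) = c *: iter n (lie x) y.
Proof. by elim: n => [//|n /= ->]; rewrite lieZr. Qed.

Lemma iter_lie0 x n : iter n (lie x) 0 = 0.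
Proof. by elim: n => [//|n /= ->]; rewrite lie0r. Qed.

Lemma ad_nilpotent_dim x y m : ad_nilpotent x -> (\dim {:g} <= m)%N ->
  iter m (lie x) y = 0.
Proof.
move=> [n xn] le_m; rewrite -(subnK le_m) iterD.
have iterE k v : iter k (lie x) v = iter k (ad x) v by elim: k => [//|k /= ->]; rewrite adE.
rewrite [X in iter _ _ X]iterE (@nilpotent_dim _ _ (ad x) n) ?iter_lie0 //.
by move=> v; rewrite -iterE.
Qed.

Lemma exp_adE x y m : ad_nilpotent x -> iter m (lie x) y = 0 ->
  exp_ad x y = \sum_(i < m) (i`!%:R)^-1 *: iter i (lie x) y.
Proof.
move=> nx ym; have trunc k l : (k <= l)%N -> iter k (lie x) y = 0 ->
    \sum_(i < l) (i`!%:R : F)^-1 *: iter i (lie x) y =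
    \sum_(i < k) (i`!%:R)^-1 *: iter i (lie x) y.
  move=> le_kl yk; rewrite -(subnKC le_kl) big_split_ord /= [X in _ + X]big1.
    by rewrite addr0.
  by move=> i _; rewrite addnC iterD yk iter_lie0 scaler0.
have yd := ad_nilpotent_dim y nx (leqnSn _).
have [le|/ltnW le] := leqP m (\dim {:g}).+1; first exact: trunc.
by rewrite (trunc _ _ le yd).
Qed.

Lemma exp_ad_is_linear x : linear (exp_ad x).
Proof.
move=> c y z; rewrite /exp_ad scaler_sumr -big_split; apply: eq_bigr => i _ /=.
by rewrite iter_lieD iter_lieZ scalerDr !scalerA mulrC.
Qed.

HB.instance Definition _ x := GRing.isLinear.Build F g g *:%R (exp_ad x)
  (exp_ad_is_linear x).

Lemma iter_lie_leibniz x y z n : iter n (lie x) (lie y z) =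
  \sum_(i < n.+1) 'C(n, i)%:R *: lie (iter (n - i) (lie x) y) (iter i (lie x) z).
Proof.
elim: n => [|n IH] /=; first by rewrite big_ord1 scale1r.
rewrite IH lie_sumr.
transitivity (\sum_(i < n.+1) 'C(n, i)%:R *:
   (lie (iter (n - i).+1 (lie x) y) (iter i (lie x) z)) +
   \sum_(i < n.+1) 'C(n, i)%:R *:
   (lie (iter (n - i) (lie x) y) (iter i.+1 (lie x) z))).
  rewrite -big_split; apply: eq_bigr => i _ /=.
  by rewrite lieZr lieJ scalerDr.
rewrite [in RHS]big_ord_recl /= bin0 ?subn0.
rewrite [X in X + _]big_ord_recl /= bin0 ?subn0 -addrA; congr (_ + _).
under [in RHS]eq_bigr => i _.
  rewrite /bump /= add1n binS natrD scalerDl subSS.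
over.
rewrite big_split /=; congr (_ + _).
rewrite [in RHS]big_ord_recr /= bin_small // scale0r addr0.
apply: eq_bigr => i _; rewrite /bump /= add1n -iterS.
by rewrite subnSK.
Qed.

Lemma exp_ad_lie x y z : ad_nilpotent x ->
  exp_ad x (lie y z) = lie (exp_ad x y) (exp_ad x z).
Proof.
move=> nx; set M := \dim {:g}.
have xM w m : (M <= m)%N -> iter m (lie x) w = 0 by exact: ad_nilpotent_dim.
rewrite (@exp_adE x (lie y z) (M + M)) ?xM ?leq_addr //.
rewrite (@exp_adE x y M) ?(@exp_adE x z M) ?xM //.
rewrite lie_suml; under [RHS]eq_bigr do rewrite lie_sumr.
pose B j i := lie ((j`!%:R)^-1 *: iter j (lie x) y) ((i`!%:R)^-1 *: iter i (lie x) z).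
rewrite -(@convolution_sum _ B M); last first.
  by move=> i j /orP[] h; rewrite /B ?(xM y i h) ?(xM z j h) scaler0 (lie0l, lie0r).
apply: eq_bigr => n _; rewrite iter_lie_leibniz scaler_sumr.
apply: eq_bigr => i _; rewrite /B lieZl lieZr !scalerA; congr (_ *: _).
have le_in : (i <= n)%N by rewrite -ltnS.
have b_neq0 : ('C(n, i)%:R : F) != 0 by rewrite -['C(n, i)]prednK ?bin_gt0 ?((pcharf0P F).1 char0).
by rewrite -(bin_fact le_in) !natrM; field; rewrite b_neq0 !fact_neq0.
Qed.

Lemma ad_nilpotentN x : ad_nilpotent x -> ad_nilpotent (- x).
Proof.
move=> [n xn]; exists n => y.
have -> : iter n (lie (- x)) y = (-1) ^+ n *: iter n (lie x) y.
  elim: n {xn} => [|n /= ->]; first by rewrite scale1r.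
  by rewrite lieNl lieZr exprS mulN1r scaleNr.
by rewrite xn scaler0.
Qed.

Lemma exp_adNK x : ad_nilpotent x -> cancel (exp_ad x) (exp_ad (- x)).
Proof.
move=> nx y; set M := \dim {:g}.
have xM w m : (M <= m)%N -> iter m (lie x) w = 0 by exact: ad_nilpotent_dim.
have nxM w m : (M <= m)%N -> iter m (lie (- x)) w = 0.
  exact/ad_nilpotent_dim/ad_nilpotentN.
have iterN n w : iter n (lie (- x)) w = (-1) ^+ n *: iter n (lie x) w.
  elim: n => [|n /= ->]; first by rewrite scale1r.
  by rewrite lieNl lieZr exprS mulN1r scaleNr.
rewrite (@exp_adE (- x) _ M) ?nxM //; last exact: ad_nilpotentN.
rewrite (@exp_adE x y M) ?xM //.
pose B j i := ((j`!%:R : F)^-1 * (i`!%:R)^-1 * (-1) ^+ j) *: iter (j + i) (lie x) y.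
transitivity (\sum_(j < M) \sum_(i < M) B j i).
  apply: eq_bigr => j _; rewrite iterN.
  have -> : iter j (lie x) (\sum_(i < M) (i`!%:R)^-1 *: iter i (lie x) y) =
     \sum_(i < M) (i`!%:R)^-1 *: iter (j + i) (lie x) y.
    elim: (j : nat) => [//|m /= ->]; rewrite lie_sumr.
    by apply: eq_bigr => i _; rewrite lieZr.
  rewrite !scaler_sumr; apply: eq_bigr => i _; rewrite !scalerA; congr (_ *: _).
  by rewrite mulrAC.
have [M0|M_gt0] := posnP M.
  have g0 w : w = 0 :> g.
    by apply/eqP; rewrite -memv0; have := memvf w; rewrite (eqP (_ : {:g}%VS == 0%VS)) // -dimv_eq0 -/M M0.
  by rewrite [LHS]g0 [RHS]g0.
rewrite -(@convolution_sum _ B M); last first.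
  move=> i j /orP[] h; rewrite /B xM ?scaler0 //.
    exact: leq_trans h (leq_addr _ _).
  exact: leq_trans h (leq_addl _ _).
have [M2 ->] : exists m, (M + M)%N = m.+1 by exists (M + M).-1; rewrite prednK ?addn_gt0 ?M_gt0.
rewrite big_ord_recl [X in _ + X]big1 ?addr0; last first.
  move=> n _; rewrite lift0.
  transitivity ((\sum_(i < n.+2) ((n.+1 - i)`!%:R : F)^-1 * (i`!%:R)^-1 * (-1) ^+ (n.+1 - i))
     *: iter n.+1 (lie x) y).
    rewrite scaler_suml; apply: eq_bigr => i _; rewrite /B subnK //.
    by rewrite -ltnS.
  suff -> : (\sum_(i < n.+2) ((n.+1 - i)`!%:R : F)^-1 * (i`!%:R)^-1 * (-1) ^+ (n.+1 - i)) = 0.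
    by rewrite scale0r.
  (* Multiplied by (n+1)!, the coefficient becomes the binomial expansion of (-1 + 1)^(n+1). *)
  apply: (mulfI (fact_neq0 n.+1)); rewrite mulr0 mulr_sumr.
  have := exprDn (-1 : F) 1 n.+1; rewrite addNr exprS mul0r => sum0; rewrite [RHS]sum0.
  apply: eq_bigr => i _; rewrite expr1n mulr1.
  have le_in : (i <= n.+1)%N by rewrite -ltnS.
  by rewrite -(bin_fact le_in) !natrM -mulr_natr; field; rewrite !fact_neq0.
by rewrite big_ord1 /B /= !invr1 !mul1r scale1r.
Qed.

End Exponential.

(** * Automorphisms, base change and elementary maps *)

Section LieAutomorphisms.
Variables (F : fieldType) (g : lieAlgType F).
Hypothesis char0 : [pchar F] =i pred0.
Implicit Types (x y z : g) (phi psi : 'End(g)).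

Definition expE (x : g) : 'End(g) := linfun (exp_ad x).

Lemma expEE x y : expE x y = exp_ad x y. Proof. by rewrite lfunE. Qed.

Lemma lie_automorphism_exp x : ad_nilpotent x -> lie_automorphism (expE x).
Proof.
move=> nx; split; last by move=> y z; rewrite !expEE exp_ad_lie.
apply/eqP/lker0P => y z; rewrite !expEE => eq_yz.
by rewrite -(exp_adNK char0 nx y) eq_yz exp_adNK.
Qed.

Lemma lie_automorphism_id : lie_automorphism (\1%VF : 'End(g)).
Proof.
by split; [apply/eqP/lker0P => x y; rewrite !id_lfunE | move=> x y; rewrite !id_lfunE].
Qed.

Lemma lie_automorphism_comp phi psi : lie_automorphism phi ->
  lie_automorphism psi -> lie_automorphism (phi \o psi)%VF.
Proof.
move=> [/eqP/lker0P phi0 phiL] [/eqP/lker0P psi0 psiL]; split.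
  by apply/eqP/lker0P => x y; rewrite !comp_lfunE => /phi0/psi0.
by move=> x y; rewrite !comp_lfunE psiL phiL.
Qed.

Lemma lie_automorphism_inv phi : lie_automorphism phi ->
  lie_automorphism (phi^-1)%VF.
Proof.
move=> [/eqP ker0 phiL]; split.
  by apply/eqP/lker0P => x y h; rewrite -(lker0_lfunVK ker0 x) h lker0_lfunVK.
move=> x y; apply: (can_inj (lker0_lfunK ker0)).
by rewrite phiL !lker0_lfunVK.
Qed.

Lemma aut_wt phi h c x : lie_automorphism phi -> wt h c x -> wt (phi h) c (phi x).
Proof. by move=> [_ phiL]; rewrite /wt -phiL => ->; rewrite linearZ. Qed.

Lemma aut_ad_nilpotent phi x : lie_automorphism phi -> ad_nilpotent x ->
  ad_nilpotent (phi x).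
Proof.
move=> [/eqP ker0 phiL] [n xn]; exists n => y.
have iterphi w : iter n (lie (phi x)) (phi w) = phi (iter n (lie x) w).
  by elim: n {xn} => [//|n /= ->]; rewrite phiL.
by rewrite -(lker0_lfunVK ker0 y) iterphi xn linear0.
Qed.

End LieAutomorphisms.

Section Elementary.
Variables (L : fieldType) (g : lieAlgType L).
Hypothesis char0 : [pchar L] =i pred0.

Lemma elementary_id : elementary (id : g -> g).
Proof. by exists [::]. Qed.

Lemma elementary_comp (f1 f2 : g -> g) : elementary f1 -> elementary f2 ->
  elementary (fun x => f1 (f2 x)).
Proof.
move=> [s1 h1 e1] [s2 h2 e2]; exists (s1 ++ s2).
  by move=> x; rewrite mem_cat => /orP[/h1|/h2].
by move=> x; rewrite foldr_cat -e2 -e1.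
Qed.

Lemma elementary_exp (x : g) : ad_nilpotent x -> elementary (exp_ad x).
Proof. by move=> nx; exists [:: x] => // y; rewrite inE => /eqP->. Qed.

Lemma elementary_ext (f1 f2 : g -> g) : f1 =1 f2 -> elementary f1 ->
  elementary f2.
Proof. by move=> e [s h1 e1]; exists s => // x; rewrite -e e1. Qed.

Lemma elementary_inv (f : g -> g) : elementary f ->
  exists2 f' : g -> g, elementary f' & cancel f f' /\ cancel f' f.
Proof.
move=> [s hs e]; exists (fun x => foldr (exp_ad (g:=g)) x (rev [seq - z | z <- s])).
  exists (rev [seq - z | z <- s]) => // x; rewrite mem_rev => /mapP[y /hs ny ->].
  exact: ad_nilpotentN.
elim: s f hs e => [|y s IH] f hs e; first by split=> x; rewrite e.
have ny : ad_nilpotent y by apply: hs; rewrite mem_head.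
have nNy := ad_nilpotentN ny.
have [|//|IH1 IH2] := IH (fun x => foldr (exp_ad (g:=g)) x s).
  by move=> z zs; apply: hs; rewrite inE zs orbT.
split=> x; rewrite e /= rev_cons -cats1 foldr_cat /=.
  by rewrite (exp_adNK char0 ny) IH1.
by rewrite IH2 -{1}[y]opprK (exp_adNK char0 nNy).
Qed.

Lemma elementary_linear (f : g -> g) : elementary f -> linear f.
Proof.
move=> [s _ e] c x y; rewrite !e; elim: s {e} => [//|z s /= ->].
by rewrite linearP.
Qed.

Lemma elementary0 (f : g -> g) : elementary f -> f 0 = 0.
Proof.
by move/elementary_linear => fL; have := fL (- 1) 0 0; rewrite !scaleN1r oppr0 addr0 addNr.
Qed.

Lemma elementaryZ (f : g -> g) c x : elementary f -> f (c *: x) = c *: f x.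
Proof. by move=> ef; rewrite -[_ *: x]addr0 elementary_linear // elementary0 // addr0. Qed.

Lemma elementary_lie (f : g -> g) : elementary f ->
  forall x y, f (lie x y) = lie (f x) (f y).
Proof.
move=> [s hs e] x y; rewrite !e; elim: s hs {e} => [//|z s IH] hs /=.
rewrite IH => [|w ws]; last by apply: hs; rewrite inE ws orbT.
by rewrite (exp_ad_lie char0) //; apply: hs; rewrite mem_head.
Qed.

End Elementary.

Section BaseChangeTheory.
Variables (F L : fieldType) (iota : {rmorphism F -> L}) (g : lieAlgType F).
Notation gL := (baseChange iota g).
Notation b := (vbasis {:g}).
Notation tau := (@toBC F L iota g).
Notation eBC := (@endBC F L iota g).
Implicit Types (u v : g) (x y : gL) (phi psi : 'End(g)).

Lemma toBC_linear c u v : tau (c *: u + v) = iota c *: tau u + tau v.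
Proof. by apply/rowP => k; rewrite !mxE linearP rmorphD rmorphM. Qed.

Lemma toBC0 : tau 0 = 0.
Proof. by apply/rowP => k; rewrite !mxE linear0 rmorph0. Qed.

Lemma toBCD u v : tau (u + v) = tau u + tau v.
Proof. by rewrite -{1}[u]scale1r toBC_linear rmorph1 scale1r. Qed.

Lemma toBCZ c u : tau (c *: u) = iota c *: tau u.
Proof. by rewrite -[c *: u]addr0 toBC_linear toBC0 addr0. Qed.

Lemma toBC_sum I (r : seq I) (P : pred I) (E : I -> g) :
  tau (\sum_(i <- r | P i) E i) = \sum_(i <- r | P i) tau (E i).
Proof. by elim/big_rec2: _ => [|i y1 y2 _ <-]; rewrite ?toBC0 ?toBCD. Qed.

Lemma toBC_inj : injective tau.
Proof.
move=> u v /rowP uv; rewrite [u](coord_vbasis (memvf u)) [v](coord_vbasis (memvf v)).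
apply: eq_bigr => i _; congr (_ *: _); apply: (fmorph_inj iota).
by have := uv i; rewrite !mxE.
Qed.

Lemma toBC_lieE u v : lie (tau u) (tau v) = tau (lie u v).
Proof. by rewrite toBC_lie. Qed.

Lemma toBC_wt h c u : wt h c u -> wt (tau h) (iota c) (tau u).
Proof. by rewrite /wt toBC_lieE => ->; rewrite toBCZ. Qed.

Lemma toBC_iter n u v : iter n (lie (tau u)) (tau v) = tau (iter n (lie u) v).
Proof. by elim: n => [//|n /= ->]; rewrite toBC_lieE. Qed.

Lemma gL_ind (P : gL -> Prop) :
  P 0 -> (forall x y, P x -> P y -> P (x + y)) ->
  (forall c u, P (c *: tau u)) -> forall x, P x.
Proof.
by move=> P0 PD Ptau x; rewrite [x]toBC_basis; elim/big_ind: _.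
Qed.

Lemma toBC_ad_nilpotent u : ad_nilpotent u -> ad_nilpotent (tau u).
Proof.
move=> [n un]; exists n; apply: gL_ind => [|x y hx hy|c v].
- exact: iter_lie0.
- by rewrite iter_lieD hx hy addr0.
- by rewrite iter_lieZ toBC_iter un toBC0 scaler0.
Qed.

Lemma dim_gL : \dim {:gL} = \dim {:g}.
Proof. by rewrite dimvf /dim /= mul1n. Qed.

Lemma toBC_exp u v : exp_ad (tau u) (tau v) = tau (exp_ad u v).
Proof.
rewrite /exp_ad toBC_sum dim_gL; apply: eq_bigr => i _.
by rewrite toBC_iter toBCZ fmorphV rmorph_nat.
Qed.

Lemma endBC_is_linear phi : linear (eBC phi).
Proof.
move=> c x y; rewrite /endBC scaler_sumr -big_split; apply: eq_bigr => i _ /=.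
by rewrite scalerA -scalerDl !mxE.
Qed.

HB.instance Definition _ phi :=
  GRing.isLinear.Build L gL gL *:%R (eBC phi) (endBC_is_linear phi).

Lemma endBC_toBC phi u : eBC phi (tau u) = tau (phi u).
Proof.
rewrite [u in RHS](coord_vbasis (memvf u)) linear_sum toBC_sum.
by apply: eq_bigr => i _; rewrite mxE linearZ toBCZ.
Qed.

Lemma linear_ext_BC (f1 f2 : {linear gL -> gL}) :
  (forall u, f1 (tau u) = f2 (tau u)) -> f1 =1 f2.
Proof.
move=> h; apply: gL_ind => [|x y hx hy|c u]; first by rewrite !linear0.
  by rewrite !linearD hx hy.
by rewrite !linearZ /= h.
Qed.

Hypothesis char0 : [pchar L] =i pred0.

Lemma Aut0_exp u : ad_nilpotent u -> Aut0 iota (expE u).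
Proof.
move=> nu; split.
  apply: lie_automorphism_exp => // n; rewrite -char0 !inE; congr (_ && _).
  by rewrite -(fmorph_eq0 iota) rmorph_nat.
apply: elementary_ext (elementary_exp (toBC_ad_nilpotent nu)).
by apply: linear_ext_BC => v /=; rewrite endBC_toBC toBC_exp expEE.
Qed.

Lemma Aut0_id : Aut0 iota (\1%VF : 'End(g)).
Proof.
split; first exact: lie_automorphism_id.
have e : elementary (id : gL -> gL) by exact: elementary_id.
apply: elementary_ext e => x; apply: esym; move: x.
by apply: (@linear_ext_BC _ idfun) => v /=; rewrite endBC_toBC id_lfunE.
Qed.

Lemma endBC_comp phi psi x :
  eBC (phi \o psi)%VF x = eBC phi (eBC psi x).
Proof.
move: x; apply: (@linear_ext_BC _ (eBC phi \o eBC psi)) => v /=.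
by rewrite !endBC_toBC comp_lfunE.
Qed.

Lemma Aut0_comp phi psi : Aut0 iota phi -> Aut0 iota psi ->
  Aut0 iota (phi \o psi)%VF.
Proof.
move=> [a1 e1] [a2 e2]; split; first exact: lie_automorphism_comp.
apply: elementary_ext (elementary_comp e1 e2) => x.
by rewrite endBC_comp.
Qed.

Lemma Aut0_inv phi : Aut0 iota phi -> Aut0 iota (phi^-1)%VF.
Proof.
move=> [a1 e1]; split; first exact: lie_automorphism_inv.
have [f' ef' [fK f'K]] := elementary_inv char0 e1.
apply: elementary_ext ef' => x; rewrite -{1}[x]/(id x).
have -> : x = eBC phi (eBC (phi^-1)%VF x).
  rewrite -endBC_comp lker0_compfV; last by case: a1 => /eqP.
  apply: esym; move: x.
  by apply: (@linear_ext_BC _ idfun) => v /=; rewrite endBC_toBC id_lfunE.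
rewrite fK; congr (eBC _ _); rewrite -endBC_comp lker0_compfV; last by case: a1 => /eqP.
apply: esym; move: x.
by apply: (@linear_ext_BC _ idfun) => v /=; rewrite endBC_toBC id_lfunE.
Qed.

End BaseChangeTheory.

(** * Weight decompositions *)

Section Eigenvectors.
Variables (F : fieldType) (V : vectType F).

Lemma memv_sum_seq (I : eqType) (s : seq I) (U : I -> {vspace V}) (v : V) :
  uniq s -> v \in (\sum_(c <- s) U c)%VS ->
  exists f : I -> V, {in s, forall c, f c \in U c} /\ v = \sum_(c <- s) f c.
Proof.
elim: s v => [|c s IH] v /=; rewrite ?big_nil.
  by rewrite memv0 => _ /eqP->; exists (fun=> 0); rewrite big_nil.
case/andP=> cs us; rewrite big_cons => /memv_addP[u uc [w /(IH _ us)[f [fU ->]] ->]].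
exists (fun d => if d == c then u else f d); split.
  move=> d; rewrite inE; case: eqP => [-> //|_] /= ds; exact: fU.
rewrite big_cons eqxx; congr (_ + _); apply: eq_big_seq => d ds.
by case: eqP ds cs => // -> ->.
Qed.

(** Applying phi - c to the sum removes the component of eigenvalue c and multiplies the others by
    nonzero scalars; induction on the number of eigenvalues. *)
Lemma eigen_stable (phi : 'End(V)) (s : seq F) (W : {vspace V}) (f : F -> V) :
  uniq s -> {in W, forall w, phi w \in W} ->
  {in s, forall c, phi (f c) = c *: f c} -> \sum_(c <- s) f c \in W ->
  {in s, forall c, f c \in W}.
Proof.
move=> us phiW; elim: s f us => [//|c s IH] f /= /andP[cs us] hf sumW.
have fW d : d \in s -> f d \in W.
  move=> ds; have dc : d - c != 0 by rewrite subr_eq0; apply: contraNneq cs => <-.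
  rewrite -[f d](scalerK dc) memvZ //.
  apply: (IH (fun d => (d - c) *: f d)) => //.
    move=> e es; rewrite linearZ /= hf ?inE ?es ?orbT //.
    by rewrite !scalerA mulrC.
  have := memvB (phiW _ sumW) (memvZ c sumW).
  rewrite linear_sum /= scaler_sumr -sumrB big_cons hf ?mem_head // subrr add0r.
  rewrite [X in X \in W -> _](_ : _ = \sum_(e <- s) (e - c) *: f e) //.
  apply: eq_big_seq => e es.
  by rewrite hf ?inE ?es ?orbT // scalerBl.
move=> d; rewrite inE => /orP[/eqP->|]; last exact: fW.
have := sumW; rewrite big_cons => h.
rewrite -[f c](addrK (\sum_(e <- s) f e)) rpredB // big_seq rpred_sum //.
Qed.

Lemma diagonalizable_decomp (phi : 'End(V)) (s : seq F) (v : V) :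
  (\sum_(c <- s) leigenspace phi c)%VS = fullv ->
  exists f : F -> V, (forall c, phi (f c) = c *: f c) /\
    v = \sum_(c <- undup s) f c.
Proof.
move=> sumE; have : v \in (\sum_(c <- undup s) leigenspace phi c)%VS.
  by rewrite big_undup ?sumE ?memvf // => U; exact: addvv.
case/(memv_sum_seq (undup_uniq s)) => f [fE ->].
exists (fun c => if c \in undup s then f c else 0); split.
  move=> c; case: ifP => [cs|_]; last by rewrite linear0 scaler0.
  have := fE c cs; rewrite memv_ker add_lfunE opp_lfunE scale_lfunE id_lfunE.
  by rewrite subr_eq0 => /eqP.
by apply: eq_big_seq => c ->.
Qed.

End Eigenvectors.

Section Weights.
Variables (F : fieldType) (g : lieAlgType F).
Implicit Types (x y h : g) (W : {vspace g}).

(** Simultaneous diagonalization in the form of an induction principle: a subspace stable under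
    commuting diagonalizable operators is spanned by its joint eigenvectors. The operators are
    treated one by one, W being cut down to an eigenspace each time. *)
Lemma weights_span (hs : seq g) W W' :
  {in hs, forall h, lfun_diagonalizable (ad h)} ->
  {in hs &, forall h h', lie h h' = 0} ->
  {in hs, forall h, {in W, forall w, lie h w \in W}} ->
  (forall w, w \in W -> {in hs, forall h, exists c, wt h c w} -> w \in W') ->
  (W <= W')%VS.
Proof.
elim: hs W => [|h hs IH] W diag comm stab sub; apply/subvP => w wW.
  exact: sub.
have [s sE] : lfun_diagonalizable (ad h) by apply: diag; rewrite mem_head.
have [f [fE wE]] := diagonalizable_decomp w sE.
rewrite wE big_seq; apply: rpred_sum => c cs.
have fW : f c \in W.
  apply: (@eigen_stable _ _ (ad h) (undup s) W f) => //.
  - exact: undup_uniq.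
  - by move=> u uW; rewrite adE stab // mem_head.
  - by rewrite -wE.
have wt_fc : wt h c (f c) by rewrite /wt -adE fE.
suff : (W :&: leigenspace (ad h) c <= W')%VS.
  by move/subvP; apply; rewrite memv_cap fW; apply/wt_eigen.
apply: IH.
- by move=> k ks; apply: diag; rewrite inE ks orbT.
- by move=> k k' ks ks'; apply: comm; rewrite inE ?ks ?ks' orbT.
- move=> k ks u; rewrite !memv_cap => /andP[uW /wt_eigen uc].
  rewrite stab ?inE ?ks ?orbT //=; apply/wt_eigen.
  apply: wt_lie0l uc.
  by rewrite /wt scale0r comm ?inE ?eqxx ?ks ?orbT.
- move=> u; rewrite memv_cap => /andP[uW /wt_eigen uc] uhs.
  apply: sub => // k; rewrite inE => /orP[/eqP->|]; last exact: uhs.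
  by exists c.
Qed.

Variable a : {vspace g}.
Implicit Types (mu nu : dual a).

Lemma root_evalD mu nu h : root_eval (mu + nu) h = root_eval mu h + root_eval nu h.
Proof. by rewrite /root_eval add_lfunE. Qed.

Lemma root_evalN mu h : root_eval (- mu) h = - root_eval mu h.
Proof. by rewrite /root_eval opp_lfunE. Qed.

Lemma root_evalZ c mu h : root_eval (c *: mu) h = c * root_eval mu h.
Proof. by rewrite /root_eval scale_lfunE. Qed.

Lemma root_eval0 h : root_eval (0 : dual a) h = 0.
Proof. by rewrite /root_eval zero_lfunE. Qed.

Lemma root_eval_sum I (r : seq I) (P : pred I) (E : I -> dual a) h :
  root_eval (\sum_(i <- r | P i) E i) h = \sum_(i <- r | P i) root_eval (E i) h.
Proof.
by elim/big_rec2: _ => [|i x y _ <-]; rewrite ?root_eval0 ?root_evalD.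
Qed.

Lemma root_evalMn mu n h : root_eval (mu *+ n) h = root_eval mu h *+ n.
Proof. by rewrite -scaler_nat root_evalZ mulr_natl. Qed.

Lemma root_evalZr mu c h : root_eval mu (c *: h) = c * root_eval mu h.
Proof. by rewrite /root_eval !linearZ. Qed.

Lemma root_evalBr mu h h' : root_eval mu (h - h') = root_eval mu h - root_eval mu h'.
Proof. by rewrite /root_eval !linearB. Qed.

Lemma root_eval_sumr mu I (r : seq I) (P : pred I) (E : I -> g) :
  root_eval mu (\sum_(i <- r | P i) E i) = \sum_(i <- r | P i) root_eval mu (E i).
Proof. by rewrite /root_eval !linear_sum. Qed.

Lemma dual_ext mu nu : {in a, forall h, root_eval mu h = root_eval nu h} -> mu = nu.
Proof.
move=> h; apply/lfunP => u; have := h (vsval u) (subvsP u).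
by rewrite /root_eval vsvalK.
Qed.

Lemma root_wt mu x h : x \in root_space mu -> h \in a -> wt h (root_eval mu h) x.
Proof. by move=> /root_spaceP xmu ha; exact: xmu. Qed.

Lemma root_eval_wt mu x h c : x \in root_space mu -> x != 0 -> h \in a ->
  wt h c x -> root_eval mu h = c.
Proof.
move=> xmu x0 ha xc; apply/eqP; apply: contraNT x0 => ne.
by apply/eqP; exact: wt_uniq (root_wt xmu ha) xc ne.
Qed.

Lemma wt_root mu x : {in a, forall h, wt h (root_eval mu h) x} -> x \in root_space mu.
Proof. by move=> xmu; apply/root_spaceP. Qed.

Lemma root_space_lie mu nu x y : x \in root_space mu -> y \in root_space nu ->
  lie x y \in root_space (mu + nu).
Proof.
move=> xmu ynu; apply: wt_root => h ha; rewrite root_evalD.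
by apply: wt_lie; apply: root_wt.
Qed.

Lemma killing_root mu nu x y : x \in root_space mu -> y \in root_space nu ->
  mu + nu != 0 -> killing x y = 0.
Proof.
move=> xmu ynu; apply: contraNeq => kxy; apply/eqP/dual_ext => h ha.
rewrite root_eval0; apply/eqP; apply: contraNT kxy => ne.
by rewrite (killing_wt (root_wt xmu ha) (root_wt ynu ha)) // -root_evalD.
Qed.

Definition dual_fun (c : 'I_(\dim a) -> F) (u : subvs_of a) : F^o :=
  \sum_i coord (vbasis a) i (vsval u) * c i.

Lemma dual_fun_linear c : linear (dual_fun c).
Proof.
move=> d u v; rewrite /dual_fun scaler_sumr -big_split; apply: eq_bigr => i _ /=.
by rewrite !linearP /= mulrDl /GRing.scale /= mulrA.
Qed.

HB.instance Definition _ c :=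
  GRing.isLinear.Build F (subvs_of a) F^o *:%R (dual_fun c) (dual_fun_linear c).

Definition dual_of (c : 'I_(\dim a) -> F) : dual a := linfun (dual_fun c).

Lemma dual_ofE c (i : 'I_(\dim a)) : root_eval (dual_of c) (vbasis a)`_i = c i.
Proof.
rewrite /root_eval /dual_of lfunE /= /dual_fun vsprojK; last first.
  by apply: vbasis_mem; rewrite mem_nth ?size_tuple.
rewrite (bigD1 i) //= coord_free ?(basis_free (vbasisP _)) // eqxx mul1r.
rewrite big1 ?addr0 // => j ji; rewrite coord_free ?(basis_free (vbasisP _)) //.
by rewrite eq_sym (negPf ji) mul0r.
Qed.

Lemma vbasis_root_ext mu x :
  (forall i : 'I_(\dim a), wt (vbasis a)`_i (root_eval mu (vbasis a)`_i) x) ->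
  x \in root_space mu.
Proof.
move=> h; rewrite memvE; apply/subv_bigcapP => i _; rewrite -memvE.
exact/wt_eigen.
Qed.

Lemma root_ind W W' : split_abelian a ->
  {in a, forall h, {in W, forall w, lie h w \in W}} ->
  (forall mu w, w \in W -> w \in root_space mu -> w \in W') -> (W <= W')%VS.
Proof.
move=> [comm diag] stab sub.
have ba (h : g) : h \in (vbasis a : seq g) -> h \in a by exact: vbasis_mem.
apply: (@weights_span (vbasis a)).
- by move=> h /ba; apply: diag.
- by move=> h h' /ba ha /ba; apply: comm.
- by move=> h /ba; apply: stab.
move=> w wW weig.
have {}weig (i : 'I_(\dim a)) : exists c, wt (vbasis a)`_i c w.
  by apply: weig; rewrite mem_nth ?size_tuple.
have [c hc] := choice weig.
by apply: (sub (dual_of c)) => //; apply: vbasis_root_ext => i; rewrite dual_ofE.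
Qed.

Lemma dual_ext_basis mu nu :
  (forall i : 'I_(\dim a), root_eval mu (vbasis a)`_i = root_eval nu (vbasis a)`_i) ->
  mu = nu.
Proof.
move=> h; apply: dual_ext => x xa; rewrite (coord_vbasis xa).
by rewrite !root_eval_sumr; apply: eq_bigr => i _; rewrite !root_evalZr h.
Qed.

Lemma diagonalizable_eigenvalue (phi : 'End(g)) (s : seq F) c w :
  (\sum_(d <- s) leigenspace phi d)%VS = fullv -> phi w = c *: w -> w != 0 ->
  c \in s.
Proof.
move=> sE phiw; apply: contraNT => cs.
have [f [fE wE]] := diagonalizable_decomp w sE.
(* If c were missing from the list, -w joined to the decomposition of w would be a vanishing sum of
   eigenvectors with distinct eigenvalues. *)
pose f' d := if d == c then - w else f d.
suff : f' c \in 0%VS by rewrite memv0 /f' eqxx oppr_eq0.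
apply: (@eigen_stable _ _ phi (c :: undup s)); last exact: mem_head.
- by rewrite /= undup_uniq mem_undup cs.
- by move=> u; rewrite memv0 => /eqP->; rewrite linear0 mem0v.
- move=> d _; rewrite /f'; case: eqP => [->|//].
  by rewrite linearN /= phiw scalerN.
- rewrite big_cons {1}/f' eqxx memv0 addrC subr_eq0 [X in _ == X]wE; apply/eqP.
  apply: eq_big_seq => d; rewrite mem_undup /f' => ds.
  by case: eqP ds cs => // -> ->.
Qed.

(** A root is determined by its values on a basis of [a], and these are eigenvalues taken from
    finite lists. *)
Lemma finite_roots : split_abelian a ->
  exists rs : seq (dual a), forall mu, root_space mu != 0%VS -> mu \in rs.
Proof.
move=> [_ diag].
have ba (i : 'I_(\dim a)) : (vbasis a)`_i \in a by apply: vbasis_mem; rewrite mem_nth ?size_tuple.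
have diagb (i : 'I_(\dim a)) : exists s,
    (\sum_(c <- s) leigenspace (ad (vbasis a)`_i) c)%VS = fullv.
  exact: diag.
have [s sE] := choice diagb.
pose S := flatten [seq s i | i <- enum 'I_(\dim a)].
exists [seq dual_of (fun i => nth 0 S (f i)) | f : {ffun 'I_(\dim a) -> 'I_(size S)}].
move=> mu; rewrite -vpick0; set w := vpick _ => w0.
have wmu : w \in root_space mu by exact: memv_pick.
have muS (i : 'I_(\dim a)) : root_eval mu (vbasis a)`_i \in S.
  apply/flattenP; exists (s i); first by apply: map_f; rewrite mem_enum.
  apply: diagonalizable_eigenvalue (sE i) _ w0.
  by rewrite adE; apply: root_wt.
have lt_i (i : 'I_(\dim a)) : (index (root_eval mu ((vbasis a)`_i)%R) S < size S)%N.
  by rewrite index_mem.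
apply/mapP; exists [ffun i => Ordinal (lt_i i)]; first by rewrite mem_enum.
by apply: dual_ext_basis => i; rewrite dual_ofE ffunE /= nth_index.
Qed.

End Weights.

(** * sl2-triples in a 3-graded Lie algebra *)

Section SL2Graded.
Variables (F : fieldType) (g : lieAlgType F).
Hypothesis char0 : [pchar F] =i pred0.
Variables (H0 Y h X : g).
Hypothesis wt4 : forall v, wt H0 4 v -> v = 0.
Hypothesis wtN4 : forall v, wt H0 (- 4) v -> v = 0.
Hypothesis sl2 : sl2_triple Y h X.
Hypothesis wtX : wt H0 2 X.
Hypothesis wtY : wt H0 (- 2) Y.
Implicit Types (v w z : g).

Lemma char0_natr n : (n.+1%:R : F) != 0.
Proof. by rewrite ((pcharf0P F).1 char0). Qed.

Lemma lie_hX w : lie h (lie X w) = lie X (lie h w) + 2 *: lie X w.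
Proof. by case: sl2 => hX _ _; rewrite lieJ hX lieZl addrC. Qed.

Lemma lie_hY w : lie h (lie Y w) = lie Y (lie h w) - 2 *: lie Y w.
Proof. by case: sl2 => _ hY _; rewrite lieJ hY lieZl scaleNr addrC. Qed.

Lemma lie_XY w : lie X (lie Y w) = lie Y (lie X w) - lie h w.
Proof. by case: sl2 => _ _ <-; rewrite lie_lie opprB addrC subrK. Qed.

Lemma wt_h0 : wt H0 0 h.
Proof. by case: sl2 => _ _ <-; rewrite -(addNr 2); exact: wt_lie. Qed.

Lemma wt_hv c v : wt H0 c v -> wt H0 c (lie h v).
Proof. by move=> vc; apply: wt_lie0l wt_h0 vc. Qed.

Lemma plus_X v : wt H0 2 v -> lie X v = 0.
Proof. by move=> v2; apply: wt4; rewrite (_ : 4 = 2 + 2) ?natrD; [exact: wt_lie | ring]. Qed.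

Lemma plus_XY v : wt H0 2 v -> lie X (lie Y v) = - lie h v.
Proof. by move=> v2; rewrite lie_XY plus_X // lie0r sub0r. Qed.

Lemma plus_XYY v : wt H0 2 v ->
  lie X (lie Y (lie Y v)) = (- 2) *: lie Y (lie h v) + 2 *: lie Y v.
Proof.
move=> v2; rewrite lie_XY plus_XY // lie_hY lieNr.
lmod F.
Qed.

Lemma minus_Y3 v : wt H0 2 v -> lie Y (lie Y (lie Y v)) = 0.
Proof.
move=> v2; apply: wtN4; rewrite (_ : - 4 = - 2 + (- 2 + (- 2 + 2))); last by ring.
by do 3!apply: wt_lie => //.
Qed.

(** Y^3 v has degree -4 and vanishes. Moving X across this relation gives Y^2 (h - 2) v = 0, and
    across the latter Y (h - 1)(h - 2) v = 0. One more X yields [plus_h_poly]: the only eigenvalues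
    of h on V+ are 0, 1 and 2. *)
Lemma plus_Y_poly v : wt H0 2 v ->
  lie Y (lie h (lie h v)) = 3 *: lie Y (lie h v) - 2 *: lie Y v.
Proof.
move=> v2; have := lie_XY (lie Y (lie Y v)).
rewrite minus_Y3 // lie0r plus_XYY // !lie_hY !lieE => /eqP.
pose w := lie h v - 2 *: v; have w2 : wt H0 2 w.
  by apply: wtD; [exact: wt_hv | apply: wtN; exact: wtZ].
have wE : lie Y (lie Y w) = lie Y (lie Y (lie h v)) - 2 *: lie Y (lie Y v) by rewrite /w !lieE.
rewrite (_ : _ - _ = (- 3) *: lie Y (lie Y w)); last first.
  by rewrite wE; lmod F.
rewrite eq_sym scaler_eq0 oppr_eq0 (negPf (char0_natr 2)) /= => /eqP YYw.
have := plus_XYY w2; rewrite YYw lie0r.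
pose u := lie h w - w; have u2 : wt H0 2 u.
  by apply: wtD; [exact: wt_hv | apply: wtN].
rewrite (_ : _ + _ = (- 2) *: lie Y u); last by rewrite /u !lieE; lmod F.
move/eqP; rewrite eq_sym scaler_eq0 oppr_eq0 (negPf (char0_natr 1)) /= => /eqP Yu.
apply: subr0_eq.
by rewrite -[RHS]Yu /u /w !lieE; lmod F.
Qed.

Lemma plus_h_poly v : wt H0 2 v ->
  lie h (lie h (lie h v)) = 3 *: lie h (lie h v) - 2 *: lie h v.
Proof.
move=> v2; pose u := lie h (lie h v) - 3 *: lie h v + 2 *: v.
have u2 : wt H0 2 u.
  apply: wtD; last exact: wtZ.
  by apply: wtD; [do 2!apply: wt_hv | apply: wtN; apply: wtZ; exact: wt_hv].
have := plus_XY u2; rewrite /u !(lieE, plus_Y_poly v2).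
rewrite (_ : _ + _ = 0); last by lmod F.
move=> /eqP; rewrite eq_sym oppr_eq0 => /eqP hu.
by apply: subr0_eq; rewrite -[RHS]hu; lmod F.
Qed.

End SL2Graded.

Lemma sl2_swap (F : fieldType) (g : lieAlgType F) (Y h X : g) :
  sl2_triple Y h X -> sl2_triple X (- h) Y.
Proof.
move=> [hX hY YX]; split; first by rewrite lieNl hY scaleNr opprK.
  by rewrite lieNl hX scaleNr.
by rewrite lieC YX.
Qed.

Lemma wt_opp (F : fieldType) (g : lieAlgType F) (h v : g) c :
  wt h c v -> wt (- h) (- c) v.
Proof. by rewrite /wt lieNl scaleNr => ->. Qed.

(** The descent that proves [plus_h_poly], for a bracket h = [y, x] which commutes with x and y: the
    shifts by 1 and 2 disappear and h is nilpotent on V+. *)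
Lemma commuting_cube (F : fieldType) (g : lieAlgType F) (char0 : [pchar F] =i pred0)
    (H0 x y h : g) : (forall v, wt H0 4 v -> v = 0) -> (forall v, wt H0 (- 4) v -> v = 0) ->
  wt H0 2 x -> wt H0 (- 2) y -> lie y x = h -> lie h x = 0 -> lie h y = 0 ->
  forall w, wt H0 2 w -> lie h (lie h (lie h w)) = 0.
Proof.
move=> wt4 wtN4 x2 y2 yx hx hy; have nat0 := char0_natr char0.
have hY' w : lie h (lie y w) = lie y (lie h w) by rewrite lieJ hy lie0l add0r.
have XY w : lie x (lie y w) = lie y (lie x w) - lie h w by rewrite -yx lie_lie opprB addrC subrK.
have h0 : wt H0 0 h by rewrite -yx -(addNr 2); apply: wt_lie.
have hw c w : wt H0 c w -> wt H0 c (lie h w) by move=> wc; apply: wt_lie0l.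
have xu u : wt H0 2 u -> lie x u = 0.
  by move=> u2; apply: wt4; rewrite (_ : 4 = 2 + 2); [exact: wt_lie | ring].
have XYY u : wt H0 2 u -> lie x (lie y (lie y u)) = (- 2) *: lie y (lie h u).
  by move=> u2; rewrite XY XY xu // lie0r hY' !lieE; lmod F.
move=> w w2; have YYY : lie y (lie y (lie y w)) = 0.
  apply: wtN4; rewrite (_ : - 4 = - 2 + (- 2 + (- 2 + 2))); last by ring.
  by do 3!apply: wt_lie => //.
have YYh : lie y (lie y (lie h w)) = 0.
  have := XY (lie y (lie y w)); rewrite YYY lie0r XYY // !hY' !lieE => /eqP.
  rewrite (_ : _ - _ = (- 3) *: lie y (lie y (lie h w))); last by lmod F.
  by rewrite eq_sym scaler_eq0 oppr_eq0 (negPf (nat0 2)) => /eqP.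
have Yhh : lie y (lie h (lie h w)) = 0.
  have := XYY _ (hw _ _ w2); rewrite YYh lie0r => /eqP.
  by rewrite eq_sym scaler_eq0 oppr_eq0 (negPf (nat0 1)) => /eqP.
have := XY (lie h (lie h w)); rewrite Yhh lie0r (xu _ (hw _ _ (hw _ _ w2))).
by rewrite lie0r sub0r => /eqP; rewrite eq_sym oppr_eq0 => /eqP.
Qed.

Section SL2GradedZero.
Variables (F : fieldType) (g : lieAlgType F).
Hypothesis char0 : [pchar F] =i pred0.
Variables (H0 Y h X : g).
Hypothesis wt4 : forall v, wt H0 4 v -> v = 0.
Hypothesis wtN4 : forall v, wt H0 (- 4) v -> v = 0.
Hypothesis sl2 : sl2_triple Y h X.
Hypothesis wtX : wt H0 2 X.
Hypothesis wtY : wt H0 (- 2) Y.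
Implicit Types (v w z : g).

Let wt4' v : wt (- H0) 4 v -> v = 0.
Proof. by move/wt_opp; rewrite opprK; apply: wtN4. Qed.
Let wtN4' v : wt (- H0) (- 4) v -> v = 0.
Proof. by move/wt_opp; rewrite !opprK; apply: wt4. Qed.
Let wtY' : wt (- H0) 2 Y.
Proof. by rewrite -[2]opprK; apply: wt_opp. Qed.
Let wtX' : wt (- H0) (- 2) X.
Proof. exact: wt_opp. Qed.
Let wtv' v : wt H0 (- 2) v -> wt (- H0) 2 v.
Proof. by move/wt_opp; rewrite opprK. Qed.

Lemma minus_YX v : wt H0 (- 2) v -> lie Y (lie X v) = lie h v.
Proof.
by move/wtv' => v2; rewrite (plus_XY wt4' (sl2_swap sl2) wtY' v2) lieNl opprK.
Qed.

Lemma minus_YXX v : wt H0 (- 2) v ->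
  lie Y (lie X (lie X v)) = 2 *: lie X (lie h v) + 2 *: lie X v.
Proof.
move/wtv' => v2; rewrite (plus_XYY wt4' (sl2_swap sl2) wtY' v2) lieNl lieNr.
by rewrite scaleNr scalerN opprK.
Qed.

Lemma minus_h_poly v : wt H0 (- 2) v ->
  lie h (lie h (lie h v)) = (- 3) *: lie h (lie h v) - 2 *: lie h v.
Proof.
move/wtv' => v2.
have := plus_h_poly char0 wt4' wtN4' (sl2_swap sl2) wtY' wtX' v2.
rewrite !lieE => e; rewrite -[LHS]opprK; rewrite -[- lie h _]/(- _) .
apply: subr0_eq.
have /eqP := e; rewrite -subr_eq0 => /eqP e0; rewrite -[RHS]oppr0 -e0; lmod F.
Qed.

Lemma minus_X_poly v : wt H0 (- 2) v ->
  lie X (lie h (lie h v)) = (- 3) *: lie X (lie h v) - 2 *: lie X v.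
Proof.
move/wtv' => v2.
have := plus_Y_poly char0 wt4' wtN4' (sl2_swap sl2) wtY' wtX' v2.
by rewrite !lieE opprK scalerN scaleNr.
Qed.

(** Writing h v = [Y, [X, v]] - [X, [Y, v]], the relations on V+ and V- give the eigenvalues -1, 0
    on the first term and 0, 1 on the second, whence only h^2 (h^2 - 1) v = 0. To exclude a Jordan
    block at 0, r = h (h^2 - 1) v is shown to be killed by X and Y, and then to vanish. *)
Lemma zero_h_poly v : wt H0 0 v -> lie h (lie h (lie h v)) = lie h v.
Proof.
move=> v0.
have wtXz w : wt H0 0 w -> wt H0 2 (lie X w) by move=> w0; apply: wt_lie0r.
have wtYz w : wt H0 0 w -> wt H0 (- 2) (lie Y w) by move=> w0; apply: wt_lie0r.
have hz w : wt H0 0 w -> wt H0 0 (lie h w) by move=> w0; exact: (wt_hv sl2 wtX wtY w0).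
have hE w : lie h w = lie Y (lie X w) - lie X (lie Y w) by case: sl2 => _ _ <-; rewrite lie_lie.
pose a := lie Y (lie X v); pose b := lie X (lie Y v).
have ha : lie h (lie h a) = - lie h a.
  rewrite /a !(lie_hY sl2) !lieE !(lie_hY sl2).
  rewrite (plus_Y_poly char0 wt4 wtN4 sl2 wtX wtY (wtXz _ v0)); lmod F.
have hb : lie h (lie h b) = lie h b.
  rewrite /b !(lie_hX sl2) !lieE !(lie_hX sl2) (minus_X_poly (wtYz _ v0)); lmod F.
have hv : lie h v = a - b by exact: hE.
pose v' := lie h (lie h v) - v.
have v'0 : wt H0 0 v' by apply: wtD; [exact: (hz _ (hz _ v0)) | exact: wtN].
have hhv' : lie h (lie h v') = 0 by rewrite /v' !lieE hv !lieE ha hb !lieE ha hb; lmod F.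
pose r := lie h v'; have r0 : wt H0 0 r by exact: hz.
pose W := lie X v'; pose Z := lie Y v'.
have hW : lie h W = 2 *: W.
  pose s := lie h W - 2 *: W; have sE : s = lie X r.
    by rewrite /s /W (lie_hX sl2) addrK.
  have hs : lie h s = 2 *: s by rewrite sE (lie_hX sl2) hhv' lie0r add0r.
  have := plus_h_poly char0 wt4 wtN4 sl2 wtX wtY (wtXz _ v'0); rewrite -/W => hW3.
  have : lie h (lie h s) = lie h s by rewrite /s !lieE hW3; lmod F.
  rewrite hs lieE hs scalerA => /eqP; rewrite -subr_eq0 -scalerBl scaler_eq0.
  rewrite (_ : 2 * 2 - 2 = 2); last by ring.
  by rewrite (negPf (char0_natr char0 1)) subr_eq0 => /eqP.
have hZ : lie h Z = (- 2) *: Z.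
  pose s := lie h Z + 2 *: Z; have sE : s = lie Y r.
    by rewrite /s /Z (lie_hY sl2) subrK.
  have hs : lie h s = (- 2) *: s by rewrite sE (lie_hY sl2) hhv' lie0r add0r scaleNr.
  have := minus_h_poly (wtYz _ v'0); rewrite -/Z => hZ3.
  have : lie h (lie h s) = - lie h s by rewrite /s !lieE hZ3; lmod F.
  rewrite hs lieE hs scalerA -scaleNr => /eqP; rewrite -subr_eq0 -scalerBl scaler_eq0.
  rewrite (_ : - 2 * - 2 - - - 2 = 2); last by ring.
  rewrite (negPf (char0_natr char0 1)) /= addr_eq0 => /eqP ->.
  by rewrite scaleNr.
have Xr : lie X r = 0 by rewrite /r -[lie X _](addrK (2 *: W)) -(lie_hX sl2) hW subrr.
have Yr : lie Y r = 0 by rewrite /r -[lie Y _](subrK (2 *: Z)) -(lie_hY sl2) hZ scaleNr addNr.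
have rE : r = lie Y W - lie X Z by exact: hE.
have YYW : lie Y (lie Y W) = (- 2) *: Z.
  have := Yr; rewrite rE !lieE (minus_YX (wtYz _ v'0)) -/Z hZ => /eqP.
  by rewrite subr_eq0 => /eqP.
have := plus_XYY wt4 sl2 wtX (wtXz _ v'0); rewrite -/W YYW hW !lieE => e.
have : r = 0.
  apply: (scalerI (char0_natr char0 1)); rewrite scaler0 rE.
  by rewrite scalerBr -[2 *: lie X Z]opprK -scaleNr e; lmod F.
by rewrite /r /v' !lieE => /eqP; rewrite subr_eq0 => /eqP.
Qed.

End SL2GradedZero.

Section Integers.
Variable F : fieldType.
Hypothesis char0 : [pchar F] =i pred0.

Lemma natr_inj0 m n : (m%:R : F) = n%:R -> m = n.
Proof.
wlog le : m n / (m <= n)%N => [hw|].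
  by case/orP: (leq_total m n) => le e; [apply: hw | symmetry; apply: hw].
move/esym/eqP; rewrite -subr_eq0 -natrB // ((pcharf0P F).1 char0) subn_eq0.
by move=> le'; apply/eqP; rewrite eqn_leq le.
Qed.

Lemma natr_oppr_eq0 m n : (m%:R : F) = - n%:R -> m = 0%N /\ n = 0%N.
Proof.
move/eqP; rewrite -addr_eq0 -natrD ((pcharf0P F).1 char0) addn_eq0.
by case/andP => /eqP-> /eqP->.
Qed.

Lemma neq_natr (x y : F) n : x - y = n.+1%:R -> x != y.
Proof. by rewrite -subr_eq0 => ->; rewrite ((pcharf0P F).1 char0). Qed.

Lemma neq_natrN (x y : F) n : y - x = n.+1%:R -> x != y.
Proof. by rewrite eq_sym; exact: neq_natr. Qed.

End Integers.

Section WeightVectors.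
Variables (F : fieldType) (g : lieAlgType F).
Hypothesis char0 : [pchar F] =i pred0.

(** ad x shifts the eigenvalues of ad h by c; in characteristic 0 the numbers d + n c are distinct,
    and only finitely many of them are eigenvalues. *)
Lemma ad_nilpotent_wt (h x : g) (c : F) :
  lfun_diagonalizable (ad h) -> wt h c x -> c != 0 -> ad_nilpotent x.
Proof.
move=> [s sE] xc c0.
have iterw d v n : wt h d v -> wt h (d + c *+ n) (iter n (lie x) v).
  move=> vd; elim: n => [|n IH] /=; first by rewrite mulr0n addr0.
  by rewrite mulrS addrCA; apply: wt_lie.
have iter0 d v : wt h d v -> iter (size s).+1 (lie x) v = 0.
  move=> vd; apply/eqP; apply/negPn/negP => ne0.
  have ne n : (n <= (size s).+1)%N -> iter n (lie x) v != 0.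
    move=> le_n; apply: contraNneq ne0 => e.
    by rewrite -(subnK le_n) iterD e iter_lie0.
  pose t := [seq d + c *+ n | n <- iota 0 (size s).+1].
  have ut : uniq t.
    rewrite map_inj_uniq ?iota_uniq // => m n /addrI.
    by rewrite -(mulr_natl c n) -(mulr_natl c) => /(mulIf c0); exact: natr_inj0.
  have sub : {subset t <= s}.
    move=> e /mapP[n]; rewrite mem_iota add0n => /andP[_ lt_n] ->.
    apply: diagonalizable_eigenvalue sE _ (ne n (ltnW lt_n)).
    by rewrite adE; apply: iterw.
  by have := uniq_leq_size ut sub; rewrite size_map size_iota ltnn.
exists (size s).+1 => v; have [f [fE ->]] := diagonalizable_decomp v sE.
elim/big_rec: _ => [|d w _ IH]; first exact: iter_lie0.
by rewrite iter_lieD IH addr0; apply: (iter0 d); rewrite /wt -adE fE.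
Qed.

(** The trace of a projection is its rank, which is nonzero in characteristic 0. *)
Lemma ltrace_idempotent (V : vectType F) (f : 'End(V)) :
  (forall v, f (f v) = f v) -> f != 0 -> ltrace f != 0.
Proof.
move=> ff f0; rewrite /ltrace; set M := mxof _ _ f.
have M0 : M != 0 by rewrite mxof_eq0 ?vbasisP.
have MM : M *m M = M.
  by rewrite -(mxof_comp _ _ (vbasisP _)); congr mxof; apply/lfunP => v; rewrite comp_lfunE ff.
have [q [C [R [MCR /row_fullP[C' C'C] /row_freeP[R' RR'] qE]]]] :
    exists q (C : 'M_(_, q)) (R : 'M_(q, _)),
      [/\ M = C *m R, row_full C, row_free R & q = \rank M].
  exists (\rank M), (col_base M), (row_base M).
  by rewrite mulmx_base col_base_full row_base_free.
have RC : R *m C = 1%:M.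
  have := congr1 (fun Z => C' *m Z *m R') MM; rewrite MCR /=.
  by rewrite !mulmxA C'C !mul1mx -!mulmxA RR' mulmx1.
by rewrite MCR mxtrace_mulC RC mxtrace1 ((pcharf0P F).1 char0) qE mxrank_eq0.
Qed.

Lemma killing_is_linear (x : g) : linear (killing x : g -> F^o).
Proof. by move=> c y z; rewrite killingDr killingZr. Qed.

HB.instance Definition _ (x : g) :=
  GRing.isLinear.Build F g F^o *:%R (killing x) (killing_is_linear x).

Lemma killing_sumr I (r : seq I) (P : pred I) (E : I -> g) x :
  killing x (\sum_(i <- r | P i) E i) = \sum_(i <- r | P i) killing x (E i).
Proof. by elim/big_rec2: _ => [|i y z _ <-]; rewrite ?killing0r ?killingDr. Qed.

Lemma exp_adD (x v w : g) : exp_ad x (v + w) = exp_ad x v + exp_ad x w.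
Proof. exact: linearD. Qed.

Lemma exp_adZ (x : g) c v : exp_ad x (c *: v) = c *: exp_ad x v.
Proof. exact: linearZ. Qed.

Lemma exp_ad1 (x v : g) : ad_nilpotent x -> lie x v = 0 -> exp_ad x v = v.
Proof.
move=> nx xv; rewrite (exp_adE (m := 1) nx) //.
by rewrite big_ord1 fact0 invr1 scale1r.
Qed.

Lemma exp_ad2 (x v : g) : ad_nilpotent x -> lie x (lie x v) = 0 ->
  exp_ad x v = v + lie x v.
Proof.
move=> nx xv; rewrite (exp_adE (m := 2) nx) //.
by rewrite !big_ord_recl big_ord0 !factS !fact0 !invr1 !scale1r addr0.
Qed.

Lemma exp_ad3 (x v : g) : ad_nilpotent x -> lie x (lie x (lie x v)) = 0 ->
  exp_ad x v = v + lie x v + 2^-1 *: lie x (lie x v).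
Proof.
move=> nx xv; rewrite (exp_adE (m := 3) nx) //.
by rewrite !big_ord_recl big_ord0 !factS !fact0 !invr1 !scale1r addr0 addrA.
Qed.

Lemma lie_sq_lie (A x y : g) : lie A (lie A (lie y x)) =
  lie (lie A (lie A y)) x + 2 *: lie (lie A y) (lie A x) + lie y (lie A (lie A x)).
Proof. by rewrite (lieJ A y) lieDr !(lieJ A _ (lie A _)) (lieJ A _ x); lmod F. Qed.

Lemma lie_cube_lie (A x y : g) : lie A (lie A (lie A (lie y x))) =
  lie (lie A (lie A (lie A y))) x + 3 *: lie (lie A (lie A y)) (lie A x) +
  3 *: lie (lie A y) (lie A (lie A x)) + lie y (lie A (lie A (lie A x))).
Proof.
rewrite (lie_sq_lie A x y) !lieDr lieZr (lieJ A (lie A (lie A y))) (lieJ A (lie A y)).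
by rewrite (lieJ A y (lie A (lie A x))); lmod F.
Qed.

Lemma ad_nilpotentZ c (A : g) : ad_nilpotent A -> ad_nilpotent (c *: A).
Proof.
case=> n hn; exists n => y.
have e m z : iter m (lie (c *: A)) z = c ^+ m *: iter m (lie A) z.
  elim: m => [|m IH]; first by rewrite expr0 scale1r.
  by rewrite !iterS IH lieZl lieZr scalerA exprS.
by rewrite e hn scaler0.
Qed.

Lemma wt_components (h : g) (e : nat -> F) (w : nat -> g) N c : injective e ->
  (forall n, wt h (e n) (w n)) -> wt h c (\sum_(n < N) w n) ->
  forall n, (n < N)%N -> e n != c -> w n = 0.
Proof.
move=> inj_e hw hsum n lt_n ne.
pose f c := \sum_(i < N | e i == c) w i.
pose s := undup (c :: [seq e i | i <- seq.iota 0 N]).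
have fe i : (i < N)%N -> f (e i) = w i.
  move=> lt_i; rewrite /f (big_pred1 (Ordinal lt_i)) // => i'.
  by apply/eqP/eqP => [/inj_e h1|->//]; exact: val_inj.
have wf d : wt h d (f d) by apply: wt_sum => i /eqP<-; exact: hw.
have emem i : (i < N)%N -> e i \in s.
  move=> lt_i; rewrite mem_undup inE; apply/orP; right.
  by apply: map_f; rewrite mem_iota.
have cs : c \in s by rewrite mem_undup inE eqxx.
pose f' d := if d == c then f d - \sum_(n < N) w n else f d.
have f'0 : \sum_(d <- s) f' d \in 0%VS.
  rewrite (bigD1_seq c) ?undup_uniq //= {1}/f' eqxx.
  have -> : \sum_(d <- s | d != c) f' d = \sum_(d <- s | d != c) f d.
    by apply: eq_bigr => d /negPf dc; rewrite /f' dc.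
  rewrite addrAC -(bigD1_seq c) ?undup_uniq //=.
  have -> : \sum_(d <- s) f d = \sum_(n < N) w n.
    rewrite /f; under eq_bigr => d _ do rewrite big_mkcond.
    rewrite exchange_big /=; apply: eq_bigr => i _.
    rewrite (bigD1_seq (e i)) ?undup_uniq ?emem //= eqxx big1 ?addr0 // => d.
    by rewrite eq_sym => /negPf->.
  by rewrite subrr mem0v.
have : f' (e n) \in 0%VS.
  apply: (@eigen_stable _ _ (ad h) s 0%VS f') => //; first exact: undup_uniq.
  - by move=> v; rewrite memv0 => /eqP->; rewrite linear0 mem0v.
  - move=> d _; rewrite adE /f'; case: eqP => [->|_]; last exact: wf.
    by apply: wtD; [exact: wf | exact: wtN].
  - exact: emem.
by rewrite /f' (negPf ne) memv0 fe // => /eqP.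
Qed.

End WeightVectors.

Ltac nat_neq :=
  match goal with char0 : _ =i pred0 |- _ =>
    let go n := first [by apply: (neq_natr char0 (n := n)); ring
                     | by apply: (neq_natrN char0 (n := n)); ring] in
    first [go 0%N | go 1%N | go 2%N | go 3%N]
  end.

Record orthogonal_triples (F : fieldType) (g : lieAlgType F) (H0 : g) (k : nat)
    (H X Y : 'I_k.+1 -> g) : Prop := OrthogonalTriples {
  fam_sl2 : forall j, sl2_triple (Y j) (H j) (X j);
  fam_X2 : forall j, wt H0 2 (X j);
  fam_Y2 : forall j, wt H0 (- 2) (Y j);
  lie_YX : forall i j, i != j -> lie (Y i) (X j) = 0 }.

(** What the descent contributes to the study of orbits, freed of roots: a complete system of
    orthogonal primitive idempotents, in the language of Jordan pairs. The hypothesis l = 1 enters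
    through [frame_wt2], the end of the descent through [frame_stop]. Roots return only to treat e =
    0 and e = 4. *)
Record jordan_frame (F : fieldType) (g : lieAlgType F) (H0 : g) (k : nat)
    (H X Y : 'I_k.+1 -> g) : Prop := JordanFrame {
  frame_triples : orthogonal_triples H0 H X Y;
  frame_X0 : forall j, X j != 0;
  frame_wt2 : forall j v, wt H0 2 v -> wt (H j) 2 v -> exists c, v = c *: X j;
  frame_stop : forall v, wt H0 2 v -> (forall j, wt (H j) 0 v) -> v = 0 }.

Lemma intr0_eq0 (F : fieldType) (char0 : [pchar F] =i pred0) (z : int) :
  (z%:~R : F) = 0 -> z = 0.
Proof.
case: z => n /eqP; first by rewrite -pmulrn ((pcharf0P F).1 char0) => /eqP->.
by rewrite NegzE rmorphN oppr_eq0 /= (negPf (char0_natr char0 n)).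
Qed.

(** * The torus of an sl2-triple as an elementary map *)

Section Torus.
Variables (L : fieldType) (g : lieAlgType L).
Hypothesis char0 : [pchar L] =i pred0.
Variables (y h x : g).
Hypothesis sl2 : sl2_triple y h x.
Hypotheses (nx : ad_nilpotent x) (ny : ad_nilpotent y).
Let nat0 := char0_natr char0.
Let two0 := char0_natr char0 1.

(** The element n(t) of SL2 representing the reflection; the middle exponent has a plus sign because
    of the convention [y, x] = h. The quotient n(t) n(1)^-1 is the torus element acting by t^n on
    weight n, which is thereby a product of exponentials of nilpotents. *)
Definition weyl (t : L) : g -> g :=
  fun v => exp_ad (t *: x) (exp_ad (t^-1 *: y) (exp_ad (t *: x) v)).

Lemma weyl_elementary t : elementary (weyl t).
Proof.
have ex s z : ad_nilpotent z -> elementary (exp_ad (s *: z)).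
  by move=> nz; apply: elementary_exp => //; exact: ad_nilpotentZ.
by apply: elementary_comp; [|apply: elementary_comp]; exact: ex.
Qed.

Lemma wt_iterx c n v : wt h c v -> wt h (c + 2 * n%:R) (iter n (lie x) v).
Proof.
move=> vc; elim: n => [|n IH]; first by rewrite mulr0 addr0.
rewrite iterS -natr1 (_ : c + _ = 2 + (c + 2 * n%:R)); last by ring.
by apply: wt_lie IH; case: sl2.
Qed.

Lemma wt_itery c n v : wt h c v -> wt h (c - 2 * n%:R) (iter n (lie y) v).
Proof.
move=> vc; elim: n => [|n IH]; first by rewrite mulr0 subr0.
rewrite iterS -natr1 (_ : c - _ = - 2 + (c - 2 * n%:R)); last by ring.
by apply: wt_lie IH; case: sl2.
Qed.

Lemma weyl_lie t v w : t != 0 -> weyl t (lie v w) = lie (weyl t v) (weyl t w).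
Proof.
move=> t0; rewrite /weyl; have nZ s z : ad_nilpotent z -> ad_nilpotent (s *: z).
  exact: ad_nilpotentZ.
by rewrite !exp_ad_lie //; apply: nZ.
Qed.

Lemma weyl_h : weyl 1 h = - h.
Proof.
have [hx hy hyx] := sl2; rewrite /weyl invr1 !scale1r.
have xh : lie x h = - 2 *: x by rewrite lieC hx scaleNr.
have yh : lie y h = 2 *: y by rewrite lieC hy scaleNr opprK.
have xx : lie x x = 0 := liexx x.
have xy : lie x y = - h by rewrite lieC hyx.
have ex : exp_ad x h = h - 2 *: x by rewrite exp_ad2 // xh ?lieZr ?xx ?scaler0 // scaleNr.
have eh : exp_ad y h = h + 2 *: y by rewrite exp_ad2 // yh ?lieZr ?liexx ?scaler0.
have eyx : exp_ad y x = x + h + y.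
  by rewrite exp_ad3 // hyx yh ?lieZr ?liexx ?scaler0 // scalerA mulVf // scale1r.
have exx : exp_ad x x = x by rewrite exp_ad1.
have exy : exp_ad x y = y - h + x.
  rewrite exp_ad3 // xy !lieNr xh ?lieNr ?lieZr ?xx ?scaler0 ?oppr0 //.
  by lmodf L.
rewrite ex exp_adD -scaleNr exp_adZ eh eyx.
have -> : h + 2 *: y + -2 *: (x + h + y) = - h + -2 *: x by lmod L.
by rewrite exp_adD exp_adZ exx -scaleN1r exp_adZ ex; lmod L.
Qed.

(* On a vector of weight n, the operator [weyl t] is a sum of components of weights
   n + 2m with coefficients t^m; since [weyl 1] maps it to weight -n, only m = -n
   survives. *)
Lemma weyl_weight t (n : int) v : t != 0 -> wt h n%:~R v ->
  weyl t v = t ^ (- n) *: weyl 1 v.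
Proof.
move=> t0 vn; pose d := (\dim {:g}).+1.
pose term (i j l : nat) := (i`!%:R)^-1 *: iter i (lie x) ((j`!%:R)^-1 *:
  iter j (lie y) ((l`!%:R)^-1 *: iter l (lie x) v)).
have itZl z c m u : iter m (lie (c *: z)) u = c ^+ m *: iter m (lie z) u.
  elim: m => [|m IH]; first by rewrite expr0 scale1r.
  by rewrite !iterS IH lieZl lieZr scalerA exprS.
have it_sum z m I (r : seq I) (P : pred I) (K : I -> g) :
    iter m (lie z) (\sum_(i <- r | P i) K i) = \sum_(i <- r | P i) iter m (lie z) (K i).
  by elim: m => //= m ->; rewrite lie_sumr.
have weylE s : s != 0 -> weyl s v =
    \sum_(i < d) \sum_(j < d) \sum_(l < d) (s ^+ i * s^-1 ^+ j * s ^+ l) *: term i j l.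
  move=> s0; rewrite /weyl /exp_ad; apply: eq_bigr => i _; rewrite it_sum scaler_sumr.
  apply: eq_bigr => j _; rewrite !it_sum !scaler_sumr !it_sum scaler_sumr.
  apply: eq_bigr => l _; rewrite /term !(itZl, iter_lieZ) !scalerA; congr (_ *: _); ring.
have wterm i j l : wt h (n%:~R + 2 * (i%:R - j%:R + l%:R)) (term i j l).
  rewrite (_ : _ + _ = n%:~R + 2 * l%:R - 2 * j%:R + 2 * i%:R); last by ring.
  by apply: wtZ; apply: wt_iterx; apply: wtZ; apply: wt_itery; apply: wtZ; exact: wt_iterx.
(* component m of the grading i + l - j + d *)
pose comp m := \sum_(i < d) \sum_(j < d) \sum_(l < d | (i + l + d == m + j)%N) term i j l.
pose M := (3 * d)%N.
have weylC s : s != 0 -> weyl s v = \sum_(m < M) (s ^+ m / s ^+ d) *: comp m.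
  move=> s0; rewrite weylE // /comp.
  under [RHS]eq_bigr => m _ do rewrite scaler_sumr.
  rewrite [RHS]exchange_big /=; apply: eq_bigr => i _.
  under [RHS]eq_bigr => m _ do rewrite scaler_sumr.
  rewrite [RHS]exchange_big /=; apply: eq_bigr => j _.
  under [RHS]eq_bigr => m _ do rewrite big_mkcond scaler_sumr.
  rewrite [RHS]exchange_big /=; apply: eq_bigr => l _.
  have lt_m : (i + l + d - j < M)%N by have := ltn_ord i; have := ltn_ord l; rewrite /M; lia.
  have le_j : (j <= i + l + d)%N by have := ltn_ord j; lia.
  rewrite (bigD1 (Ordinal lt_m)) //= subnK // eqxx big1 ?addr0 => [|m ne].
    congr (_ *: _); apply: (mulIf (expf_neq0 d s0)); rewrite divfK ?expf_neq0 //.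
    apply: (mulIf (expf_neq0 j s0)); rewrite -[RHS]exprD subnK // !exprD exprVn.
    by field; rewrite expf_neq0.
  case: eqP => [e|_]; last by rewrite scaler0.
  by case/eqP: ne; apply: val_inj; rewrite /= e addnK.
have wcomp m : wt h (n%:~R + 2 * (m%:R - d%:R)) (comp m).
  apply: wt_sum => i _; apply: wt_sum => j _; apply: wt_sum => l /eqP e.
  have -> : (m%:R - d%:R : L) = i%:R - j%:R + l%:R.
    have := congr1 (fun a => a%:R : L) e; rewrite !natrD => e'.
    apply: subr0_eq; transitivity (m%:R + j%:R - (i%:R + l%:R + d%:R) : L).
      by ring.
    by rewrite -e' subrr.
  exact: wterm.
have w1 : wt h (- n%:~R) (weyl 1 v).
  have := congr1 (weyl 1) vn; rewrite weyl_lie ?oner_neq0 // weyl_h lieNl.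
  rewrite (_ : weyl 1 (n%:~R *: v) = n%:~R *: weyl 1 v); last by rewrite /weyl !exp_adZ.
  by move/(congr1 -%R); rewrite opprK -scaleNr.
have w1E : weyl 1 v = \sum_(m < M) comp m.
  rewrite weylC ?oner_neq0 //; apply: eq_bigr => m _.
  by rewrite !expr1n divr1 scale1r.
pose ev (m : nat) : L := n%:~R + 2 * (m%:R - d%:R).
have ev_inj : injective ev.
  move=> m m' /addrI /(mulfI two0) /addIr; exact: natr_inj0.
have comp0 m : (m < M)%N -> ev m != - n%:~R -> comp m = 0.
  by apply: (wt_components (h := h) (e := ev)) => //; rewrite -w1E.
have evE m : ev m = - n%:~R -> m%:Z = d%:Z - n.
  move=> em; have : ((m%:Z - d%:Z + n)%:~R : L) = 0.
    apply: (mulfI two0); rewrite mulr0 !rmorphD rmorphN /=.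
    transitivity (ev m + n%:~R); last by rewrite em addNr.
    by rewrite /ev -!pmulrn; ring.
  by move/(intr0_eq0 char0); lia.
rewrite weylC // w1E scaler_sumr; apply: eq_bigr => m _.
have [/evE em|ne] := eqVneq (ev m) (- n%:~R); last by rewrite comp0 ?scaler0.
have -> : t ^+ m = t ^ (- n) * t ^+ d by rewrite exprnP em addrC expfzDr.
by rewrite mulfK // expf_neq0.
Qed.

Lemma torus_elementary t : t != 0 -> exists2 T : g -> g, elementary T &
  forall (n : int) v, wt h n%:~R v -> T v = t ^ n *: v.
Proof.
move=> t0; have [W eW [WK KW]] := elementary_inv char0 (weyl_elementary 1).
exists (fun v => weyl t (W v)); first exact: elementary_comp (weyl_elementary t) eW.
move=> n v vn; have lW := elementary_lie char0 eW.
have W0 : W 0 = 0.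
  by have := elementary_linear eW (-1) 0 0; rewrite scaler0 addr0 scaleN1r addNr.
have WZ c u : W (c *: u) = c *: W u.
  by have := elementary_linear eW c u 0; rewrite W0 !addr0.
have hN : W h = - h.
  by rewrite -[RHS]scaleN1r -[h in RHS]WK weyl_h -[- h]scaleN1r WZ scaleN1r scaleNr scale1r opprK.
have Wn : wt h (- n)%:~R (W v).
  have := congr1 W vn; rewrite lW hN lieNl => /(congr1 -%R); rewrite opprK.
  by rewrite /wt => ->; rewrite WZ rmorphN scaleNr.
by rewrite (weyl_weight t0 Wn) opprK KW.
Qed.

End Torus.

(** A subspace of maximal dimension among those contained in P must contain every vector of P. Used
    to apply spanning arguments to linear properties. *)
Lemma pred_vspace (F : fieldType) (V : vectType F) (P : V -> Prop) : P 0 ->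
  (forall c x y, P x -> P y -> P (c *: x + y)) ->
  exists W : {vspace V}, forall x, x \in W <-> P x.
Proof.
move=> P0 PZ; pose Q n := `[< exists W : {vspace V}, (forall x, x \in W -> P x) /\ \dim W = n >].
have exQ : exists n, Q n.
  by exists 0%N; apply/asboolP; exists 0%VS; split=> [x|]; rewrite ?dimv0 // memv0 => /eqP->.
have maxQ n : Q n -> (n <= \dim {:V})%N by move=> /asboolP[W [_ <-]]; exact: dimvS (subvf W).
case: (ex_maxnP exQ maxQ) => n /asboolP[W [WP dW]] max_n; exists W => x; split; first exact: WP.
move=> Px; have /max_n : Q (\dim (W + <[x]>)).
  apply/asboolP; exists (W + <[x]>)%VS; split=> // z /memv_addP[w wW [u /vlineP[c ->] ->]].
  by rewrite addrC; apply: PZ => //; exact: WP.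
rewrite -dW => le; have /eqP -> : W == (W + <[x]>)%VS by rewrite eqEdim addvSl.
exact: (subvP (addvSr W <[x]>%VS)) (memv_line x).
Qed.

Lemma closed_root (L : closedFieldType) n (a : L) : (0 < n)%N -> exists x, x ^+ n = a.
Proof.
move=> n0; have [x ex] := solve_monicpoly (fun i => if i == 0%N then a else 0) n0.
exists x; rewrite ex; case: n n0 {ex} => // n _.
by rewrite big_ord_recl expr0 mulr1 big1 ?addr0 // => i _; rewrite mul0r.
Qed.

Lemma closed_sqrt (L : closedFieldType) (a : L) : exists x, x * x = a.
Proof. by have [x <-] := closed_root a (isT : (0 < 2)%N); exists x; rewrite expr2. Qed.

(** If x killed u, the relation x y^n u = n (n + m) y^(n-1) u would keep all the vectors y^n u
    nonzero, against the nilpotency of y. *)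
Lemma sl2_string (F : fieldType) (g : lieAlgType F) (char0 : [pchar F] =i pred0)
    (y h x u : g) m : sl2_triple y h x -> ad_nilpotent y ->
  wt h (- m.+1%:R) u -> u != 0 -> lie x u != 0.
Proof.
move=> s ny hu u0; apply/eqP => xu.
have xy n : lie x (iter n (lie y) u) = (n * (n + m))%:R *: iter n.-1 (lie y) u.
  elim: n => [|n IH]; first by rewrite xu scale0r.
  rewrite iterS lieJ; have [_ _ yx] := s; rewrite (lieC x y) yx lieNl.
  rewrite (wt_itery s n hu) IH lieZr /=.
  case: n {IH} => [|n]; first by rewrite mul0n scale0r mul1n add1n; lmod F.
  rewrite -iterS /= -scaleNr -scalerDl; congr (_ *: _).
  by rewrite !natrM !natrD -!natr1; ring.
have [n hn] := ny.
have nz i : iter i (lie y) u != 0.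
  elim: i => [//|i IH]; apply: contraNneq IH => e; have := xy i.+1.
  rewrite e lie0r => /esym/eqP; rewrite scaler_eq0 mulSn addSn => /orP[|//].
  by rewrite (negPf (char0_natr char0 _)).
by have := nz n; rewrite hn eqxx.
Qed.

(** * Nilpotency tested on generators *)

Section LocallyNilpotent.
Variables (L : fieldType) (g : lieAlgType L).
Hypothesis char0 : [pchar L] =i pred0.
Variable z : g.

(** The vectors with this property form a Lie subalgebra, so that nilpotency of ad z may be tested
    on generators. *)
Definition locally_nilpotent u := exists n, iter n (lie z) u = 0.

Lemma iter_lie_le n m u : (n <= m)%N -> iter n (lie z) u = 0 -> iter m (lie z) u = 0.
Proof.
by move=> /subnK<- e; rewrite iterD e; exact: iter_lie0.
Qed.

Lemma locally_nilpotent_lie u v : locally_nilpotent u -> locally_nilpotent v ->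
  locally_nilpotent (lie u v).
Proof.
move=> [n en] [m em]; exists (n + m)%N; rewrite iter_lie_leibniz big1 // => i _.
have [le|lt] := leqP m i; first by rewrite (iter_lie_le le em) lie0r scaler0.
rewrite (iter_lie_le _ en) ?lie0l ?scaler0 //; move: lt; clear; lia.
Qed.

Lemma locally_nilpotent_lin c u v : locally_nilpotent u -> locally_nilpotent v ->
  locally_nilpotent (c *: u + v).
Proof.
move=> [n en] [m em]; exists (n + m)%N; rewrite iter_lieD iter_lieZ.
by rewrite (iter_lie_le (leq_addr m n) en) (iter_lie_le (leq_addl n m) em) scaler0 addr0.
Qed.

Lemma locally_nilpotent_ad : (forall u, locally_nilpotent u) -> ad_nilpotent z.
Proof.
move=> h; have [n hn] := choice (fun i : 'I_(\dim {:g}) => h (vbasis {:g})`_i).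
pose N := (\sum_i n i)%N; have leN i : (n i <= N)%N by rewrite /N (bigD1 i) //= leq_addr.
exists N => y; rewrite (coord_vbasis (memvf y)); clearbody N.
elim/big_rec: _ => [|i u _ IH]; first exact: iter_lie0.
by rewrite iter_lieD iter_lieZ IH addr0 (iter_lie_le (leN i) (hn i)) scaler0.
Qed.

End LocallyNilpotent.

(** * Anisotropic quadratic spaces *)

Section Quadratic.
Variable F : fieldType.

(** The u-invariant of F is at most 4. *)
Definition five_isotropic := forall a : 'I_5 -> F,
  exists2 x : 'I_5 -> F, exists i, x i != 0 & \sum_i a i * x i ^+ 2 = 0.

(** Over a p-adic field the anisotropic quaternary forms are the multiples of the norm form of the
    quaternion division algebra; the trait used here is their square discriminant. *)
Definition four_square := forall a : 'I_4 -> F,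
  (forall x : 'I_4 -> F, \sum_i a i * x i ^+ 2 = 0 -> forall i, x i = 0) ->
  exists s, \prod_i a i = s ^+ 2.

Variables (V : vectType F) (b : V -> V -> F) (W : {vspace V}).
Hypothesis bDl : forall A B C, b (A + B) C = b A C + b B C.
Hypothesis bZl : forall c A B, b (c *: A) B = c * b A B.
Hypothesis bC : {in W &, forall A B, b A B = b B A}.
Hypothesis bDr : forall A B C, b C (A + B) = b C A + b C B.
Hypothesis bZr : forall c A B, b A (c *: B) = c * b A B.
Hypothesis aniso : {in W, forall A, A != 0 -> b A A != 0}.
Hypothesis two0 : (2 : F) != 0.

Definition orthogonal n (B : 'I_n -> V) (W' : {vspace V}) :=
  [/\ forall i, B i \in W', forall i, B i != 0 & forall i j, i != j -> b (B i) (B j) = 0].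

Lemma b_linear A : linear (b A : V -> F^o).
Proof. by move=> c x y; rewrite bDr bZr. Qed.

Lemma dim_orthogonal (W' : {vspace V}) A : exists W'' : {vspace V},
  [/\ (W'' <= W')%VS, {in W'', forall B, b A B = 0} & (\dim W' <= (\dim W'').+1)%N].
Proof.
pose f : 'Hom(V, F^o) := linfun (HB.pack_for {linear V -> F^o} (b A : V -> F^o)
  (GRing.isLinear.Build _ _ _ _ _ (@b_linear A))).
exists (W' :&: lker f)%VS; split; first exact: capvSl.
  by move=> B /memv_capP[_]; rewrite memv_ker lfunE /= => /eqP.
have := limg_ker_dim f W'; have : (\dim (f @: W') <= 1)%N.
  by apply: leq_trans (dimvS (subvf _)) _; rewrite dimvf.
by move=> h <-; rewrite -addn1 leq_add2l.
Qed.

Lemma orthogonal_cons n (B : 'I_n -> V) W' W'' A : (W' <= W)%VS -> A \in W' -> A != 0 ->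
  (W'' <= W')%VS -> {in W'', forall C, b A C = 0} -> orthogonal B W'' ->
  orthogonal (fun i => oapp B A (unlift ord0 i)) W'.
Proof.
move=> sW AW A0 sW'' oW'' [BW B0 Bo]; split=> [i|i|i j].
- by case: unliftP => [l _|_] //=; exact: (subvP sW'').
- by case: unliftP => [l _|_] /=.
case: unliftP => [l ->|->]; case: unliftP => [l' ->|->] ne //=.
- by apply: Bo; apply: contraNneq ne => ->.
- rewrite bC ?oW'' //; [exact/(subvP sW)/(subvP sW'') | exact: (subvP sW)].
- exact: oW''.
Qed.

Lemma orthogonal_family n (W' : {vspace V}) : (W' <= W)%VS -> (n <= \dim W')%N ->
  exists B : 'I_n -> V, orthogonal B W'.
Proof.
elim: n W' => [|n IH] W' sW le_n.
  by exists (fun=> 0); split=> [[]|[]|[]].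
have W0 : W' != 0%VS by rewrite -dimv_eq0 -lt0n; apply: leq_trans le_n.
have [W'' [sW'' oW'' dW'']] := dim_orthogonal W' (vpick W').
have [||B oB] := IH W''; first exact: subv_trans sW.
  by rewrite -ltnS; apply: leq_trans dW''.
eexists; apply: orthogonal_cons sW'' oW'' oB => //; first exact: memv_pick.
by rewrite vpick0.
Qed.

Let b0 C : b C 0 = 0. Proof. by have := bZr 0 C 0; rewrite scale0r mul0r. Qed.
Let b0' C : b 0 C = 0. Proof. by have := bZl 0 0 C; rewrite scale0r mul0r. Qed.
Let bsum C I (r : seq I) (K : I -> V) : b C (\sum_(i <- r) K i) = \sum_(i <- r) b C (K i).
Proof. by elim/big_rec2: _ => [|i u v _ <-]; rewrite ?b0 ?bDr. Qed.

Lemma orthogonal_norm n (B : 'I_n -> V) W' x : orthogonal B W' ->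
  b (\sum_i x i *: B i) (\sum_i x i *: B i) = \sum_i b (B i) (B i) * x i ^+ 2.
Proof.
case=> _ _ Bo; set S := \sum_i _ *: _.
have -> : b S S = \sum_i b (x i *: B i) S.
  by rewrite {1}/S; elim/big_rec2: _ => [|i u v _ <-]; rewrite ?b0' ?bDl.
apply: eq_bigr => i _; rewrite bsum (bigD1 i) //= big1 ?addr0 => [|j ne].
  by rewrite bZl bZr expr2; ring.
by rewrite bZl bZr Bo 1?eq_sym // !mulr0.
Qed.

Lemma orthogonal_free n (B : 'I_n -> V) W' x : (W' <= W)%VS -> orthogonal B W' ->
  \sum_i x i *: B i = 0 -> forall i, x i = 0.
Proof.
move=> sW [BW B0 Bo] e i.
have := b0 (B i); rewrite -e bsum (bigD1 i) //= big1 ?addr0 => [|j ne]; last first.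
  by rewrite bZr Bo 1?eq_sym // mulr0.
rewrite bZr => /eqP; rewrite mulf_eq0 => /orP[/eqP //|h].
by case/negP: (aniso (subvP sW _ (BW i)) (B0 i)).
Qed.

Lemma orthogonal_span n (B : 'I_n -> V) W' A : (W' <= W)%VS -> orthogonal B W' ->
  \dim W' = n -> A \in W' -> exists x, A = \sum_i x i *: B i.
Proof.
move=> sW oB dW AW; pose X := [tuple B i | i < n].
have XE (i : 'I_n) : X`_i = B i by rewrite -tnth_nth tnth_mktuple.
have fX : free X.
  apply/vector.freeP => c e; apply: (orthogonal_free sW oB); rewrite -[RHS]e.
  by apply: eq_bigr => i _; rewrite XE.
have /eqP eX : (<<X>> == W')%VS.
  rewrite eqEdim dW (eqP fX) size_tuple leqnn andbT.
  by apply/span_subvP => _ /mapP[i _ ->]; case: oB.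
exists (fun i => coord X i A); rewrite {1}(@coord_span _ _ _ X A) ?eX //.
by apply: eq_bigr => i _; rewrite XE.
Qed.

(** The coordinate of an isotropic vector along the added line of norm -t is nonzero, since the form
    is anisotropic on W'; dividing by it gives a vector of norm t. *)
Lemma represents n (B : 'I_n -> V) W' t x : (W' <= W)%VS -> orthogonal B W' ->
  \sum_(i < n.+1) oapp (fun j => b (B j) (B j)) (- t) (unlift ord0 i) * x i ^+ 2 = 0 ->
  (exists i, x i != 0) -> exists2 A, A \in W' & b A A = t.
Proof.
move=> sW oB; rewrite big_ord_recl unlift_none /= => e [i0 xi0].
pose S := \sum_i x (lift ord0 i) *: B i.
have eS : b S S = t * x ord0 ^+ 2.
  rewrite (orthogonal_norm _ oB); apply/eqP; rewrite -subr_eq0 -mulNr addrC -[X in _ == X]e.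
  by apply/eqP; congr (_ + _); apply: eq_bigr => i _; rewrite liftK.
have SW : S \in W' by case: oB => BW _ _; apply: memv_suml => i _; exact: memvZ.
have [xm|xm] := eqVneq (x ord0) 0; last first.
  exists ((x ord0)^-1 *: S); first exact: memvZ.
  by rewrite bZl bZr eS; field.
rewrite xm expr0n mulr0 in eS.
have S0 : S = 0 by apply/eqP; apply: contraT => /(aniso (subvP sW _ SW)); rewrite eS eqxx.
have yi := orthogonal_free sW oB S0.
by case/negP: xi0; case: (unliftP ord0 i0) => [j ->|->]; rewrite ?xm ?yi.
Qed.

Lemma aniso_represents : five_isotropic -> (4 <= \dim W)%N -> forall t,
  exists2 A, A \in W & b A A = t.
Proof.
move=> h5 d4 t; have [B oB] := orthogonal_family (subvv W) d4.
have [x x0 xE] := h5 (fun i => oapp (fun j => b (B j) (B j)) (- t) (unlift ord0 i)).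
exact: represents (subvv W) oB xE x0.
Qed.

(** Let c1 be the norm of A1. If its orthogonal did not represent t c1, adding to it a line of norm
    -t c1 would give an anisotropic quaternary form; its discriminant and that of W would both be
    squares, and so would their ratio -t. The norm of A4 is then fixed up to squares by the
    discriminant of W. *)
Lemma adapted_basis t : four_square -> \dim W = 4%N -> t != 0 ->
  (forall s, - t != s ^+ 2) -> exists A1 A2 A3 A4,
  [/\ [/\ A1 \in W, A2 \in W, A3 \in W & A4 \in W],
      [/\ b A1 A2 = 0, b A1 A3 = 0, b A1 A4 = 0, b A2 A3 = 0 & b A2 A4 = 0],
      b A3 A4 = 0 /\ (b A1 A1 != 0 /\ b A3 A3 != 0),
      b A2 A2 = t * b A1 A1 /\ b A4 A4 = t * b A3 A3 &
      forall B, B \in W -> exists x1 x2 x3 x4,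
        B = x1 *: A1 + (x2 *: A2 + (x3 *: A3 + (x4 *: A4 + 0)))].
Proof.
move=> h4 dW t0 nt; have d4 : (4 <= \dim W)%N by rewrite dW.
have prod4 (B : 'I_4 -> V) : orthogonal B W -> exists s, \prod_i b (B i) (B i) = s ^+ 2.
  move=> oB; apply: h4 => x; rewrite -(orthogonal_norm _ oB) => e.
  apply: (orthogonal_free (subvv W) oB); apply/eqP; apply: contraT => n0.
  have sW : \sum_i x i *: B i \in W by case: oB => BW _ _; apply: memv_suml => i _; exact: memvZ.
  by case/eqP: (aniso sW n0).
have W0 : W != 0%VS by rewrite -dimv_eq0 -lt0n; apply: leq_trans d4.
pose A1 := vpick W; have A1W : A1 \in W := memv_pick W.
have A10 : A1 != 0 by rewrite vpick0.
have c10 := aniso A1W A10.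
have [W1 [sW1 oW1 dW1]] := dim_orthogonal W A1.
have d3 : (3 <= \dim W1)%N by rewrite -ltnS; apply: leq_trans dW1.
have [B oB] := orthogonal_family sW1 d3; have [BW B0 Bo] := oB.
have cB i : b (B i) (B i) != 0 by apply: aniso (B0 i); exact: (subvP sW1).
have [A2 A2W1 c2] : exists2 A2, A2 \in W1 & b A2 A2 = t * b A1 A1.
  apply: contrapT => no.
  have [|s] := h4 (fun i => oapp (fun j => b (B j) (B j)) (- (t * b A1 A1)) (unlift ord0 i)).
    move=> x xE i; apply/eqP; apply: contraT => xi; case: no.
    by apply: represents sW1 oB xE _; exists i.
  have [s'] := prod4 _ (orthogonal_cons (subvv W) A1W A10 sW1 oW1 oB).
  rewrite !big_ord_recl !big_ord0 !unlift_none !liftK /= => es' es.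
  have s'0 : s' != 0 by rewrite -sqrf_eq0 -es' !mulf_neq0 ?oner_neq0.
  case/eqP: (nt (s / s')); rewrite expr_div_n -es -es'; field.
  by rewrite !cB c10.
have A2W := subvP sW1 _ A2W1.
have [W2 [sW2 oW2 dW2]] := dim_orthogonal W1 A2.
have d2 : (2 <= \dim W2)%N by rewrite -ltnS; apply: leq_trans dW2.
have sW2W := subv_trans sW2 sW1.
have [C oC] := orthogonal_family sW2W d2; have [CW C0 Co] := oC.
pose A3 := C ord0; pose B4 := C (lift ord0 ord0).
have c3 : b A3 A3 != 0 by apply: aniso (C0 _); exact: (subvP sW2W).
have c4 : b B4 B4 != 0 by apply: aniso (C0 _); exact: (subvP sW2W).
have A20 : A2 != 0.
  by apply: contraTneq c10 => e; move/esym/eqP: c2; rewrite e b0 mulf_eq0 (negPf t0) negbK.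
have o1 i : b A1 (C i) = 0 by apply: oW1; exact: (subvP sW2).
have oA := orthogonal_cons (subvv W) A1W A10 sW1 oW1
  (orthogonal_cons sW1 A2W1 A20 sW2 oW2 oC).
have [s] := prod4 _ oA; rewrite !big_ord_recl !big_ord0 !(unlift_none, liftK) /= !(unlift_none, liftK) /= c2 mulr1 -/A3 -/B4 => es.
have s0 : s != 0 by rewrite -sqrf_eq0 -es !mulf_neq0.
(* As s^2 is the product of the four norms, the norm of c B4 is t times that of A3. *)
pose c := t * b A1 A1 * b A3 A3 / s; have n0 : c != 0 by rewrite !mulf_neq0 ?invr_eq0.
exists A1, A2, A3, (c *: B4); split=> [||||A].
- by split=> //; try apply: memvZ; exact: (subvP sW2W _ (CW _)).
- by split; rewrite /A3 /B4 ?bZr ?o1 ?(oW1 _ A2W1) ?(oW2 _ (CW _)) ?mulr0.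
- by rewrite bZr (Co ord0 (lift ord0 ord0)) ?mulr0.
- split=> //; rewrite bZl bZr; apply: (mulIf (expf_neq0 2 s0)); rewrite -{2}es /c; field.
  by rewrite s0.
move=> /(orthogonal_span (subvv W) oA dW)[x ->].
exists (x ord0), (x (lift ord0 ord0)), (x (lift ord0 (lift ord0 ord0))),
  (x (lift ord0 (lift ord0 (lift ord0 ord0))) / c).
rewrite !big_ord_recl big_ord0 !(unlift_none, liftK) /= !(unlift_none, liftK) /=.
by rewrite scalerA divfK.
Qed.

End Quadratic.

Lemma dim_injective (F : fieldType) (V V' : vectType F) (f : 'Hom(V, V')) (W : {vspace V})
  (W' : {vspace V'}) : {in W, forall w, f w \in W'} ->
  {in W, forall w, f w = 0 -> w = 0} -> (\dim W <= \dim W')%N.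
Proof.
move=> fW f0; rewrite -(limg_dim_eq (f := f)) ?dimvS //.
  by apply/subvP => _ /memv_imgP[w wW ->]; exact: fW.
apply/eqP; rewrite -subv0; apply/subvP => w /memv_capP[wW].
by rewrite memv_ker memv0 => /eqP /(f0 w wW) ->.
Qed.

Lemma avoid_two (T : eqType) (i j r p q : T) : i != j -> r != i -> r != j ->
  exists u, u != p /\ u != q.
Proof.
move=> ij ri rj; have [ip|ip] := eqVneq i p; first have [jq|jq] := eqVneq j q.
- by exists r; rewrite -ip -jq.
- by exists j; rewrite -ip eq_sym.
have [iq|iq] := eqVneq i q; last by exists i.
have [jp|jp] := eqVneq j p; first by exists r; rewrite -iq -jp.
by exists j; rewrite -iq jp eq_sym.
Qed.

(** * Polynomial functions *)

Lemma digits_inj N n (f h : 'I_n -> nat) : (forall i, (f i < N)%N) -> (forall i, (h i < N)%N) ->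
  (\sum_i f i * N ^ i)%N = (\sum_i h i * N ^ i)%N -> f =1 h.
Proof.
elim: n f h => [|n IH] f h hf hh; first by move=> _ [].
rewrite !big_ord_recl !expn0 !muln1 => e.
have shift (f' : 'I_n.+1 -> nat) : (\sum_(i < n) f' (lift ord0 i) * N ^ lift ord0 i =
    (\sum_(i < n) f' (lift ord0 i) * N ^ i) * N)%N.
  by rewrite big_distrl; apply: eq_bigr => i _ /=; rewrite /bump /= add1n expnSr mulnA.
rewrite !shift in e.
have N0 : (0 < N)%N by exact: leq_ltn_trans (hf ord0).
have e0 : f ord0 = h ord0.
  have := congr1 (modn^~ N) e; rewrite !(addnC _ (_ * N)%N) !modnMDl.
  by rewrite !modn_small.
move: e; rewrite e0 => /addnI/eqP; rewrite eqn_pmul2r // => /eqP e i.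
case: (unliftP ord0 i) => [i'|] ->; last exact: e0.
exact: (IH (fun i => f (lift ord0 i)) (fun i => h (lift ord0 i)) _ _ e i').
Qed.

Section InfiniteField.
Variable F : fieldType.
Hypothesis char0 : [pchar F] =i pred0.

Lemma poly_eq_on (p q : {poly F}) (u : nat -> F) : injective u ->
  (forall n, p.[u n] = q.[u n]) -> p = q.
Proof.
move=> iu e; apply/eqP; rewrite -subr_eq0; apply: contraT => n0.
have /(_ (map u (seq.iota 0 (size (p - q))))) := max_poly_roots n0.
rewrite size_map size_iota ltnn map_inj_uniq ?iota_uniq // => h.
suff: false by []; apply: h => //; apply/allP => _ /mapP[n _ ->].
by rewrite /root hornerD hornerN e subrr.
Qed.

Let natS_inj : injective (fun n => n.+1%:R : F).
Proof. by move=> m n /(natr_inj0 char0)[]. Qed.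

Lemma poly_eq_natS (p q : {poly F}) : (forall n, p.[n.+1%:R] = q.[n.+1%:R]) -> p = q.
Proof. exact: poly_eq_on natS_inj. Qed.

Lemma poly_eq_sqr (p q : {poly F}) : (forall s : F, s != 0 -> p.[s ^+ 2] = q.[s ^+ 2]) -> p = q.
Proof.
move=> e; apply: (poly_eq_on (u := fun n => (n.+1%:R) ^+ 2)) => [m n|n].
  by rewrite -!natrX => /(natr_inj0 char0)/eqP; rewrite eqn_exp2r // => /eqP[].
by apply: e; exact: char0_natr.
Qed.

(* Kronecker substitution X_i -> X^(N^i). *)
Lemma mpoly_eq0 n (p : {mpoly F[n]}) : (forall v : 'I_n -> F, p.@[v] = 0) -> p = 0.
Proof.
move=> p0; pose N := msize p; pose e (m : 'X_{1..n}) := (\sum_i m i * N ^ i)%N.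
pose q : {poly F} := \sum_(m <- msupp p) p@_m *: 'X^(e m).
have q0 : q = 0.
  apply: poly_eq_natS => r; rewrite horner0 -(p0 (fun i => r.+1%:R ^+ (N ^ i))) mevalE horner_sum.
  apply: eq_bigr => m _; rewrite hornerZ hornerXn; congr (_ * _).
  by rewrite /e expr_sum; apply: eq_bigr => i _; rewrite -exprM mulnC.
have bnd m : m \in msupp p -> forall i, (m i < N)%N.
  move=> hm i; apply: leq_ltn_trans (msize_mdeg_lt hm).
  by rewrite mdegE (bigD1 i) //= leq_addr.
apply/eqP; rewrite -msupp_eq0; case E: (msupp p) => [//|m0 s].
have m0p : m0 \in msupp p by rewrite E mem_head.
have := congr1 (fun r : {poly F} => r`_(e m0)) q0; rewrite coef0 /q coef_sum.
rewrite (bigD1_seq m0) ?msupp_uniq //= coefZ coefXn eqxx mulr1 big_seq_cond big1 ?addr0.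
  by move=> z; move: m0p; rewrite mcoeff_msupp z eqxx.
move=> m /andP[hm nm]; rewrite coefZ coefXn; case: eqVneq => [em|]; last by rewrite mulr0.
case/eqP: nm; apply/mnmP => i; apply: esym.
exact: digits_inj (bnd _ m0p) (bnd _ hm) em i.
Qed.

(** After removal of the power of X, the remaining factor r satisfies r(0) != 0 and r(z X) = r(z)
    r(X); the value at 0 gives r(z) = 1. *)
Lemma multiplicative_monomial (p : {poly F}) : (forall z, z != 0 -> p.[z] != 0) ->
  (forall z z', z != 0 -> z' != 0 -> p.[z * z'] = p.[z] * p.[z']) -> exists n, p = 'X^n.
Proof.
move=> nz hm; have p0 : p != 0 by apply: contra_neq (nz 1 (oner_neq0 _)) => ->; rewrite horner0.
have [n [r r0 pE]] := multiplicity_XsubC p 0.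
rewrite subr0 in pE; rewrite p0 /= in r0; exists n.
have rz : r.[0] != 0 by [].
have rE z : z != 0 -> p.[z] = r.[z] * z ^+ n by rewrite pE hornerM hornerXn.
have rm z z' : z != 0 -> z' != 0 -> r.[z * z'] = r.[z] * r.[z'].
  move=> z0 z0'; have := hm _ _ z0 z0'; rewrite !rE ?mulf_neq0 // exprMn => e.
  apply: (mulIf (_ : z ^+ n * z' ^+ n != 0)); first by rewrite mulf_neq0 ?expf_neq0.
  by rewrite e; ring.
have r1 : r = 1.
  apply: poly_eq_natS => m; rewrite hornerC; set z := m.+1%:R.
  have z0 : z != 0 := char0_natr char0 m.
  have /(congr1 (horner^~ 0)) : r \Po (z *: 'X) = r.[z] *: r.
    apply: poly_eq_natS => l; rewrite horner_comp !hornerZ hornerX rm //.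
    exact: char0_natr.
  rewrite horner_comp !hornerZ hornerX mulr0 => e.
  by apply: (mulIf rz); rewrite -e mul1r.
by rewrite pE r1 mul1r.
Qed.

End InfiniteField.

Section PolynomialFunctions.
Variables (F : fieldType) (V : vectType F).

(** Polynomial functions as a predicate, because projections, brackets and exponentials are
    substituted into them; [polyfun_mpoly] returns to polynomials in the coordinates of a subspace,
    where irreducibility is available. *)
Inductive polyfun : (V -> F) -> Prop :=
| polyfun_const c : polyfun (fun=> c)
| polyfun_linear (f : {linear V -> F^o}) : polyfun f
| polyfun_add P Q : polyfun P -> polyfun Q -> polyfun (fun v => P v + Q v)
| polyfun_mul P Q : polyfun P -> polyfun Q -> polyfun (fun v => P v * Q v)
| polyfun_ext P Q : P =1 Q -> polyfun P -> polyfun Q.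

Definition polymap (A : V -> V) := forall f : {linear V -> F^o}, polyfun (fun v => f (A v)).

Lemma polyfun_if (b : bool) P : polyfun P -> polyfun (fun v => if b then P v else 0).
Proof. by move=> hP; case: b => //; exact: polyfun_const. Qed.

Lemma polyfun_sum I (r : seq I) (P : I -> V -> F) : (forall i, polyfun (P i)) ->
  polyfun (fun v => \sum_(i <- r) P i v).
Proof.
move=> hP; elim: r => [|i r IH].
  by apply: polyfun_ext (polyfun_const 0) => v; rewrite big_nil.
by apply: polyfun_ext (polyfun_add (hP i) IH) => v; rewrite big_cons.
Qed.

Lemma polyfun_exp P n : polyfun P -> polyfun (fun v => P v ^+ n).
Proof.
move=> hP; elim: n => [|n IH]; first exact: polyfun_const.
by apply: polyfun_ext (polyfun_mul hP IH) => v; rewrite exprS.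
Qed.

Lemma polyfun_prod I (r : seq I) (P : I -> V -> F) : (forall i, polyfun (P i)) ->
  polyfun (fun v => \prod_(i <- r) P i v).
Proof.
move=> hP; elim: r => [|i r IH].
  by apply: polyfun_ext (polyfun_const 1) => v; rewrite big_nil.
by apply: polyfun_ext (polyfun_mul (hP i) IH) => v; rewrite big_cons.
Qed.

Lemma polymap_linear (A : {linear V -> V}) : polymap A.
Proof. by move=> f; exact: (polyfun_linear (f \o A)). Qed.

Lemma polymap_const v0 : polymap (fun=> v0).
Proof. by move=> f; exact: polyfun_const. Qed.

Lemma polymap_scale P B : polyfun P -> polymap B -> polymap (fun v => P v *: B v).
Proof.
by move=> hP hB f; apply: polyfun_ext (polyfun_mul hP (hB f)) => v; rewrite linearZ.
Qed.

(** The coefficients of the powers of w are polynomial functions of v, not merely scalars for each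
    v: [invariant_root_step] assembles its new polynomial from them. *)
Lemma polyfun_line P A B : polyfun P -> polymap A -> polymap B ->
  exists n, exists2 c : nat -> V -> F, forall i, polyfun (c i) &
  forall v w, P (A v + w *: B v) = (\poly_(i < n) c i v).[w].
Proof.
move=> hP hA hB; elim: hP => {P} [c|f|P Q _ [n [c hc cE]] _ [m [d hd dE]]|
    P Q _ [n [c hc cE]] _ [m [d hd dE]]|P Q e _ [n [c hc cE]]].
- exists 1%N, (fun=> fun=> c) => [_|v w]; first exact: polyfun_const.
  by rewrite horner_poly big_ord_recl big_ord0 mulr1 addr0.
- exists 2%N, (fun i v => if i == 0%N then f (A v) else f (B v)) => [[|i]|v w] //=.
  by rewrite horner_poly !big_ord_recl big_ord0 /= addr0 mulr1 linearD linearZ /= mulrC.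
- exists (maxn n m), (fun i v => (if (i < n)%N then c i v else 0) + (if (i < m)%N then d i v else 0)).
    by move=> i; apply: polyfun_add; exact: polyfun_if.
  move=> v w; rewrite cE dE -hornerD; congr (_.[w]); apply/polyP => i.
  rewrite coefD !coef_poly leq_max; case: (ltnP i n) (ltnP i m) => _ [] //= _.
  by rewrite addr0.
- exists (n + m)%N, (fun i v => \sum_(j < i.+1) (if (j < n)%N then c j v else 0) *
      (if (i - j < m)%N then d (i - j)%N v else 0)).
    move=> i; apply: polyfun_sum => j.
    by apply: polyfun_mul; exact: polyfun_if.
  move=> v w; rewrite cE dE -hornerM; congr (_.[w]); apply/polyP => i.
  rewrite coefM coef_poly; case: ltnP => hi.
    by apply: eq_bigr => j _; rewrite !coef_poly.
  apply: big1 => j _; rewrite !coef_poly; case: ltnP => hj; last by rewrite mul0r.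
  case: ltnP => hij; last by rewrite mulr0.
  by have := leq_trans (leq_add (ltnW hj) (ltnW hij)) hi; lia.
by exists n, c => // v w; rewrite -e.
Qed.

Lemma polyfun_eval (U : {vspace V}) (P : {mpoly F[\dim U]}) : polyfun (eval_on P).
Proof.
have h : polyfun (fun x => \sum_(m <- msupp P) P@_m * \prod_i coord (vbasis U) i x ^+ m i).
  apply: polyfun_sum => m; apply: polyfun_mul; first exact: polyfun_const.
  apply: polyfun_prod => i; apply: polyfun_exp.
  exact: (polyfun_linear (coord (vbasis U) i)).
by apply: polyfun_ext h => x; rewrite /eval_on mevalE.
Qed.

Lemma polyfun_mpoly (U : {vspace V}) P : polyfun P ->
  exists Q : {mpoly F[\dim U]}, {in U, forall x, eval_on Q x = P x}.
Proof.
elim=> {P} [c|f|P1 P2 _ [Q1 h1] _ [Q2 h2]|P1 P2 _ [Q1 h1] _ [Q2 h2]|P1 P2 e _ [Q h]].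
- by exists c%:MP => x _; rewrite /eval_on mevalC.
- exists (\sum_(i < \dim U) (f (vbasis U)`_i : F) *: 'X_i) => x xU; rewrite /eval_on raddf_sum /=.
  rewrite {2}(coord_vbasis xU) linear_sum; apply: eq_bigr => i _.
  by rewrite mevalZ mevalXU linearZ /= mulrC.
- by exists (Q1 + Q2) => x xU; rewrite /eval_on mevalD -!/(eval_on _ x) h1 ?h2.
- by exists (Q1 * Q2) => x xU; rewrite /eval_on mevalM -!/(eval_on _ x) h1 ?h2.
by exists Q => x xU; rewrite -e h.
Qed.

Hypothesis char0 : [pchar F] =i pred0.

Lemma eval_on_eq0 (U : {vspace V}) (P : {mpoly F[\dim U]}) :
  {in U, forall x, eval_on P x = 0} -> P = 0.
Proof.
move=> h; apply: (mpoly_eq0 char0) => v.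
have fr := basis_free (vbasisP U); pose x := \sum_i v i *: (vbasis U)`_i.
have xU : x \in U.
  by apply: memv_suml => i _; apply: memvZ; apply: vbasis_mem; apply: mem_nth; rewrite size_tuple.
rewrite -(h x xU) /eval_on; apply: meval_eq => i; rewrite /x linear_sum /= (bigD1 i) //=.
rewrite linearZ /= coord_free // eqxx mulr1 big1 ?addr0 // => j nj.
by rewrite linearZ /= coord_free // (negPf nj) mulr0.
Qed.

Lemma polyfun_curve P n (u : nat -> V) : polyfun P ->
  exists p : {poly F}, forall w, P (\sum_(i < n) w ^+ i *: u i) = p.[w].
Proof.
elim=> {P} [c|f|P1 P2 _ [p1 h1] _ [p2 h2]|P1 P2 _ [p1 h1] _ [p2 h2]|P1 P2 e _ [p h]].
- by exists c%:P => w; rewrite hornerC.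
- exists (\poly_(i < n) (f (u i) : F)) => w; rewrite horner_poly linear_sum.
  by apply: eq_bigr => i _; rewrite linearZ /= mulrC.
- by exists (p1 + p2) => w; rewrite hornerD h1 h2.
- by exists (p1 * p2) => w; rewrite hornerM h1 h2.
by exists p => w; rewrite -e h.
Qed.

Lemma polyfun_const_line P u v : polyfun P -> exists p : {poly F}, forall w, P (u + w *: v) = p.[w].
Proof.
move=> /(polyfun_curve 2 (fun i => if i == 0%N then u else v))[p h]; exists p => w.
by rewrite -h !big_ord_recl big_ord0 /= addr0 scale1r.
Qed.

End PolynomialFunctions.

(** * The graded Lie algebra and its Killing form *)

Section Regular.
Variables (F : fieldType) (L : closedFieldType) (iota : {rmorphism F -> L}).
Variables (g : lieAlgType F) (H0 : g).
Hypothesis char0 : [pchar F] =i pred0.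
Hypothesis hgraded : regular_graded iota H0.
Hypothesis hsimple : lie_simple g.
Notation gL := (baseChange iota g).
Notation tau := (@toBC F L iota g).
Notation G := (Ggrp iota H0).
Let nat0 := char0_natr char0.

Section RegularGraded.
Implicit Types (x y v w h : g) (W : {vspace g}).

Lemma two_neq0 : (2 : F) != 0. Proof. exact: (nat0 1). Qed.

Lemma grade_decomp v : exists u z w,
  [/\ v = u + z + w, wt H0 (- 2) u, wt H0 0 z & wt H0 2 w].
Proof.
have : v \in (Vminus H0 + g0 H0 + Vplus H0)%VS by rewrite (graded_sum hgraded) memvf.
case/memv_addP => x /memv_addP[u /wt_eigen hu [z /wt_eigen hz ->]] [w /wt_eigen hw ->].
by exists u, z, w.
Qed.

Lemma diag_H0 : lfun_diagonalizable (ad H0).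
Proof.
exists [:: - 2; 0; 2]; rewrite !big_cons big_nil addv0 addvA.
exact: (graded_sum hgraded).
Qed.

Lemma nilp2 x : wt H0 2 x -> ad_nilpotent x.
Proof. by move=> h; apply: (ad_nilpotent_wt char0 diag_H0 h); exact: nat0. Qed.

Lemma nilpN2 x : wt H0 (- 2) x -> ad_nilpotent x.
Proof. by move=> h; apply: (ad_nilpotent_wt char0 diag_H0 h); rewrite oppr_eq0 nat0. Qed.

Lemma wt_H0_eig c v : wt H0 c v -> v != 0 -> [\/ c = - 2, c = 0 | c = 2].
Proof.
move=> vc v0; pose s : seq F := [:: - 2; 0; 2].
have sE : (\sum_(d <- s) leigenspace (ad H0) d)%VS = fullv.
  rewrite !big_cons big_nil addv0 addvA; exact: (graded_sum hgraded).
have := @diagonalizable_eigenvalue _ _ _ _ c v sE; rewrite adE => /(_ vc v0).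
rewrite !inE => /or3P[] /eqP->; [exact: Or31 | exact: Or32 | exact: Or33].
Qed.

Lemma wt_H0_0 c v : wt H0 c v -> c + 2 != 0 -> c != 0 -> c - 2 != 0 -> v = 0.
Proof.
move=> vc c1 c2 c3; apply/eqP; apply/negPn/negP => /(wt_H0_eig vc)[] e.
- by rewrite e addNr eqxx in c1.
- by rewrite e eqxx in c2.
- by rewrite e subrr eqxx in c3.
Qed.

Lemma wt_H0_4 v : wt H0 4 v -> v = 0.
Proof.
move=> h; apply: (wt_H0_0 h); [| exact: (nat0 3) |].
  by rewrite -natrD; exact: (nat0 5).
by rewrite -natrB //; exact: (nat0 1).
Qed.

Lemma wt_H0_N4 v : wt H0 (- 4) v -> v = 0.
Proof.
move=> h; apply: (wt_H0_0 h).
- by rewrite addrC -opprB oppr_eq0 -natrB //; exact: (nat0 1).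
- by rewrite oppr_eq0; exact: (nat0 3).
- by rewrite -opprD oppr_eq0 -natrD; exact: (nat0 5).
Qed.

Lemma plus_lie u v : wt H0 2 u -> wt H0 2 v -> lie u v = 0.
Proof.
by move=> u2 v2; apply: wt_H0_4; rewrite (_ : 4 = 2 + 2); [exact: wt_lie | ring].
Qed.

Lemma minus_lie u v : wt H0 (- 2) u -> wt H0 (- 2) v -> lie u v = 0.
Proof.
by move=> u2 v2; apply: wt_H0_N4; rewrite (_ : - 4 = - 2 + - 2); [exact: wt_lie | ring].
Qed.

(** (ad H0)^2 is 4 times the projection onto V- + V+, and V+ is nonzero. *)
Lemma killing_H0 : killing H0 H0 != 0.
Proof.
pose f := 4^-1 *: (ad H0 \o ad H0)%VF.
have four : (4 : F) != 0 by exact: (nat0 3).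
have fE v : f v = 4^-1 *: lie H0 (lie H0 v) by rewrite scale_lfunE comp_lfunE !adE.
have ff v : f (f v) = f v.
  have [u [z [w [-> hu hz hw]]]] := grade_decomp v.
  rewrite !fE !lieE hu hz hw !lieE hu hz hw !lieE hu hz hw !lieE hu hw hz.
  by lmodf F; rewrite // four.
have f0 : f != 0.
  have [w wV w0] : exists2 w, w \in Vplus H0 & w != 0.
    by exists (vpick (Vplus H0)); rewrite ?memv_pick // vpick0 (graded_Vplus_neq0 hgraded).
  apply: contraNneq w0 => e; move/wt_eigen in wV.
  have : f w = w by rewrite fE wV lieZr wV !scalerA -natrM mulVf ?scale1r.
  by rewrite e zero_lfunE => <-.
have := ltrace_idempotent char0 ff f0; rewrite ltraceZ mulf_eq0 negb_or.
by rewrite -killingE => /andP[].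
Qed.

(** The radical of the Killing form is an ideal which does not contain H0. *)
Lemma killing_nondeg x : (forall y, killing x y = 0) -> x = 0.
Proof.
pose K : {vspace g} := (\bigcap_(i < \dim {:g})
  lker (linfun (killing (vbasis {:g})`_i : g -> F^o)))%VS.
have KP z : z \in K <-> forall y, killing z y = 0.
  split=> [zK y|zK]; last first.
    rewrite memvE; apply/subv_bigcapP => i _; rewrite -memvE memv_ker lfunE /=.
    by rewrite killingC zK.
  rewrite [y](coord_vbasis (memvf y)) killing_sumr big1 // => i _ /=.
  move: zK; rewrite memvE => /subv_bigcapP/(_ i isT).
  by rewrite -memvE memv_ker lfunE /= killingZr killingC => /eqP->; rewrite mulr0.
have idK : lie_ideal K.
  move=> y z /KP zK; apply/KP => w.
  by rewrite lieC killingNl killing_lie zK oppr0.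
move=> hx; have xK : x \in K by apply/KP.
case: (hsimple.2 K idK) => KE; first by move: xK; rewrite KE memv0 => /eqP.
have : H0 \in K by rewrite KE memvf.
by move/KP/(_ H0)/eqP; rewrite (negPf killing_H0).
Qed.

Lemma minus_ext v : wt H0 (- 2) v -> (forall w, wt H0 2 w -> killing v w = 0) -> v = 0.
Proof.
move=> v2 h; apply: killing_nondeg => y; have [u [z [w [-> hu hz hw]]]] := grade_decomp y.
rewrite !killingDr (h w hw) (killing_wt v2 hu) ?(killing_wt v2 hz) ?addr0 //.
  by rewrite oppr_eq0.
by rewrite -opprD oppr_eq0 -natrD nat0.
Qed.

Lemma central0 x : (forall y, lie x y = 0) -> x = 0.
Proof.
move=> hx; apply: killing_nondeg => y; rewrite killingE.
have -> : ad x = 0 by apply/lfunP => z; rewrite adE hx zero_lfunE.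
by rewrite comp_lfun0l ltrace0.
Qed.

(** The span of V-, V+ and [V-, V+] is an ideal, hence everything by simplicity. It is obtained as
    the set of vectors lying in all the subspaces with [gen]. *)
Lemma generated_Vpm W : (Vminus H0 <= W)%VS -> (Vplus H0 <= W)%VS ->
  {in W &, forall x y, lie x y \in W} -> W = fullv.
Proof.
move=> Wm Wp Wlie; pose gen (U : {vspace g}) := [/\ (Vminus H0 <= U)%VS, (Vplus H0 <= U)%VS &
  forall u w, wt H0 (- 2) u -> wt H0 2 w -> lie u w \in U].
have [I IE] : exists I : {vspace g}, forall x, x \in I <-> forall U, gen U -> x \in U.
  apply: pred_vspace => [U _|c x y hx hy U hU]; first exact: mem0v.
  by rewrite rpredD ?rpredZ ?hx ?hy.
have inI2 w : w \in Vplus H0 -> w \in I by move=> hw; apply/IE => U [_ /subvP Up _]; exact: Up.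
have idI : lie_ideal I.
  move=> x y /IE hy; apply/IE => U hU; have [/subvP Um /subvP Up Ul] := hU.
  have Vm u : wt H0 (- 2) u -> u \in U by move/wt_eigen; exact: Um.
  have Vp w : wt H0 2 w -> w \in U by move/wt_eigen; exact: Up.
  suff /hy : gen (ad x @^-1: U)%VS by rewrite -memv_preim adE.
  have [u0 [z0 [w0 [-> hu hz hw]]]] := grade_decomp x.
  split=> [||u w u2 w2]; [apply/subvP => u /wt_eigen u2 | apply/subvP => w /wt_eigen w2 |];
    rewrite -memv_preim adE !lieDl.
  - rewrite (minus_lie hu u2) add0r rpredD ?(Vm _ (wt_lie0l hz u2)) //.
    by rewrite lieC rpredN Ul.
  - by rewrite (plus_lie hw w2) addr0 rpredD ?(Ul _ _ hu w2) ?(Vp _ (wt_lie0l hz w2)).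
  have uw : wt H0 0 (lie u w) by rewrite -(addNr 2); exact: wt_lie.
  rewrite 2?rpredD ?(Vm _ (wt_lie0r hu uw)) ?(Vp _ (wt_lie0r hw uw)) // lieJ rpredD // Ul //;
    exact: wt_lie0l.
have IW : (I <= W)%VS.
  apply/subvP => x /IE; apply; split=> // u w /wt_eigen hu /wt_eigen hw.
  by apply: Wlie; [exact: (subvP Wm) | exact: (subvP Wp)].
case: (hsimple.2 I idI) => IE'; last by apply/eqP; rewrite eqEsubv subvf -IE'.
have := graded_Vplus_neq0 hgraded.
by rewrite -subv0 -IE' (_ : _ <= _)%VS //; apply/subvP => w; exact: inI2.
Qed.

Lemma centralizes_Vpm h : {in Vminus H0, forall v, lie h v = 0} ->
  {in Vplus H0, forall v, lie h v = 0} -> h = 0.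
Proof.
move=> hm hp; apply: central0 => y.
have : lker (ad h) = fullv.
  apply: generated_Vpm; first by apply/subvP => v; rewrite memv_ker adE => /hm->.
    by apply/subvP => v; rewrite memv_ker adE => /hp->.
  move=> x z; rewrite !memv_ker !adE lieJ => /eqP-> /eqP->.
  by rewrite lie0l lie0r addr0.
by move=> e; have := memvf y; rewrite -e memv_ker adE => /eqP.
Qed.

(** V- is dual to V+ for the Killing form, so h kills it too, and then centralizes the algebra they
    generate. *)
Lemma g0_faithful h : wt H0 0 h -> (forall w, wt H0 2 w -> lie h w = 0) -> h = 0.
Proof.
move=> h0 hp; apply: centralizes_Vpm => v /wt_eigen v2; last exact: hp.
apply: minus_ext => [|w w2]; first exact: wt_lie0l.
by rewrite lieC killingNl killing_lie hp // killing0r oppr0.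
Qed.

(** The sum of [a] and the line of h is again split abelian. This places in [a] the neutral elements
    of the sl2-triples built from root vectors. *)
Lemma max_split (a : {vspace g}) h : maximal_split_abelian_in (g0 H0) a ->
  wt H0 0 h -> {in a, forall x, lie x h = 0} -> lfun_diagonalizable (ad h) ->
  h \in a.
Proof.
move=> [ag0 [comm diag] maxa] h0 ah [s2 s2E].
suff <- : (a + <[h]>)%VS = a by rewrite memvE addvSr.
apply: maxa; first exact: addvSl.
  rewrite subv_add ag0 -memvE; exact/wt_eigen.
have ha x : x \in a -> lie h x = 0 by move=> /ah e; rewrite lieC e oppr0.
split.
  move=> x y /memv_addP[x' x'a [_ /vlineP[c ->] ->]].
  move=> /memv_addP[y' y'a [_ /vlineP[d ->] ->]].
  by rewrite !lieE comm // liexx ah // ha // !scaler0 !addr0.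
move=> x /memv_addP[x' x'a [_ /vlineP[c ->] ->]].
have [s1 s1E] := diag _ x'a.
exists [seq c1 + c * c2 | c1 <- s1, c2 <- s2]; apply/eqP.
rewrite eqEsubv subvf /=.
apply: (@weights_span _ _ [:: x'; h]).
- by move=> y; rewrite !inE => /orP[] /eqP->; [exists s1 | exists s2].
- by move=> y z; rewrite !inE => /orP[] /eqP-> /orP[] /eqP->; rewrite ?liexx ?ah ?ha.
- by move=> y _ w _; exact: memvf.
move=> w _ hw; have [->|w0] := eqVneq w 0; first exact: mem0v.
have [c1 wc1] := hw x' (mem_head _ _).
have [c2 wc2] : exists c2, wt h c2 w by apply: hw; rewrite !inE eqxx orbT.
have c1s : c1 \in s1 by apply: diagonalizable_eigenvalue s1E _ w0; rewrite adE.
have c2s : c2 \in s2 by apply: diagonalizable_eigenvalue s2E _ w0; rewrite adE.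
have cs : c1 + c * c2 \in [seq c1 + c * c2 | c1 <- s1, c2 <- s2].
  by apply/allpairsP; exists (c1, c2).
rewrite (big_rem _ cs) /= -[w]addr0 memv_add ?mem0v //; apply/wt_eigen.
by rewrite /wt lieDl lieZl wc1 wc2 scalerA -scalerDl.
Qed.

(** Projections on the eigenspaces 2, 1, 0 of an element acting on V+ with
    these eigenvalues. *)
Definition pr2 h v := 2^-1 *: (lie h (lie h v) - lie h v).
Definition pr1 h v := 2 *: lie h v - lie h (lie h v).
Definition pr0 h v := v - pr1 h v - pr2 h v.

Lemma pr_sum h v : v = pr0 h v + pr1 h v + pr2 h v.
Proof. by rewrite /pr0; lmod F. Qed.

End RegularGraded.
Let two0 := two_neq0.
Let wt4 := wt_H0_4.
Let wtN4 := wt_H0_N4.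

Section SL2Weights.
Variables (Y h X : g).
Hypothesis sl2 : sl2_triple Y h X.
Hypothesis wtX : wt H0 2 X.
Hypothesis wtY : wt H0 (- 2) Y.
Let plus_poly := plus_h_poly char0 wt4 wtN4 sl2 wtX wtY.

Lemma wt_pr2 v : wt H0 2 v -> wt h 2 (pr2 h v).
Proof.
move=> v2; rewrite /wt /pr2 !lieE plus_poly //.
by lmodf F; rewrite // two0.
Qed.

Lemma wt_pr1 v : wt H0 2 v -> wt h 1 (pr1 h v).
Proof. by move=> v2; rewrite /wt /pr1 !lieE plus_poly //; lmod F. Qed.

Lemma wt_pr0 v : wt H0 2 v -> wt h 0 (pr0 h v).
Proof.
move=> v2; rewrite /wt /pr0 /pr1 /pr2 !lieE plus_poly //.
by lmodf F; rewrite // two0.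
Qed.

Lemma sl2_diagonalizable : lfun_diagonalizable (ad h).
Proof.
pose s : seq F := [:: 0; 1; - 1; 2; - 2].
exists s; apply/eqP; rewrite eqEsubv subvf /=.
have memS c v : c \in s -> wt h c v ->
    v \in (\sum_(c <- s) leigenspace (ad h) c)%VS.
  move=> cs vc; rewrite (big_rem _ cs) /= -[v]addr0 memv_add ?mem0v //.
  exact/wt_eigen.
apply/subvP => v _; have [u [z [w [-> hu hz hw]]]] := grade_decomp v.
apply: rpredD; [apply: rpredD|].
- pose u2 := 2^-1 *: (lie h (lie h u) + lie h u).
  pose u1 := (- 2) *: lie h u - lie h (lie h u).
  have uE : u = (u - u1 - u2) + u1 + u2 by lmod F.
  have up := minus_h_poly char0 wt4 wtN4 sl2 wtX wtY hu.
  rewrite uE; apply: rpredD; [apply: rpredD|].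
  + apply: (memS 0); rewrite ?inE ?eqxx ?orbT // /wt /u1 /u2 !lieE up.
    by lmodf F; rewrite // two0.
  + by apply: (memS (- 1)); rewrite ?inE ?eqxx ?orbT // /wt /u1 !lieE up; lmod F.
  + apply: (memS (- 2)); rewrite ?inE ?eqxx ?orbT // /wt /u2 !lieE up.
    by lmodf F; rewrite // two0.
- pose z1 := 2^-1 *: (lie h (lie h z) + lie h z).
  pose z2 := 2^-1 *: (lie h (lie h z) - lie h z).
  have zE : z = (z - z1 - z2) + z1 + z2 by lmod F.
  have zp := zero_h_poly char0 wt4 wtN4 sl2 wtX wtY hz.
  rewrite zE; apply: rpredD; [apply: rpredD|].
  + apply: (memS 0); rewrite ?inE ?eqxx ?orbT // /wt /z1 /z2 !lieE zp.
    by lmodf F; rewrite // two0.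
  + by apply: (memS 1); rewrite ?inE ?eqxx ?orbT // /wt /z1 !lieE zp; lmodf F; rewrite // two0.
  + by apply: (memS (- 1)); rewrite ?inE ?eqxx ?orbT // /wt /z2 !lieE zp; lmodf F; rewrite // two0.
- rewrite (pr_sum h w); apply: rpredD; [apply: rpredD|].
  + by apply: (memS 0); rewrite ?inE ?eqxx ?orbT //; exact: wt_pr0.
  + by apply: (memS 1); rewrite ?inE ?eqxx ?orbT //; exact: wt_pr1.
  + by apply: (memS 2); rewrite ?inE ?eqxx ?orbT //; exact: wt_pr2.
Qed.

Lemma plus_wt c v : wt H0 2 v -> v != 0 -> wt h c v -> [\/ c = 0, c = 1 | c = 2].
Proof.
move=> v2 v0 vc; have := plus_poly v2.
rewrite !(vc, lieZr, scalerA) => /eqP; rewrite -subr_eq0 -scalerBl -scalerBl scaler_eq0.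
rewrite (negPf v0) orbF (_ : _ - _ = c * (c - 1) * (c - 2)); last by ring.
rewrite !mulf_eq0 !subr_eq0 => /orP[/orP[]|] /eqP; [exact: Or31 | exact: Or32 | exact: Or33].
Qed.

Lemma minus_wt c v : wt H0 (- 2) v -> v != 0 -> wt h c v -> [\/ c = 0, c = - 1 | c = - 2].
Proof.
move=> v2 v0 vc; have := minus_h_poly char0 wt4 wtN4 sl2 wtX wtY v2.
rewrite !(vc, lieZr, scalerA) => /eqP; rewrite -subr_eq0 -scalerBl -scalerBl scaler_eq0.
rewrite (negPf v0) orbF (_ : _ - _ = c * (c + 1) * (c + 2)); last by ring.
rewrite !mulf_eq0 !addr_eq0 => /orP[/orP[]|] /eqP; [exact: Or31 | exact: Or32 | exact: Or33].
Qed.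

Lemma zero_wt c v : wt H0 0 v -> v != 0 -> wt h c v -> [\/ c = 0, c = 1 | c = - 1].
Proof.
move=> v2 v0 vc; have := zero_h_poly char0 wt4 wtN4 sl2 wtX wtY v2.
rewrite !(vc, lieZr, scalerA) => /eqP; rewrite -subr_eq0 -scalerBl scaler_eq0.
rewrite (negPf v0) orbF (_ : _ - _ = c * (c - 1) * (c + 1)); last by ring.
rewrite !mulf_eq0 subr_eq0 addr_eq0 => /orP[/orP[]|] /eqP; [exact: Or31 | exact: Or32 | exact: Or33].
Qed.

Lemma lower1 v : wt H0 2 v -> wt h 1 v -> lie X (lie Y v) = - v.
Proof. by move=> v2 v1; rewrite (plus_XY wt4 sl2 wtX v2) v1 scale1r. Qed.

Lemma lower2 v : wt H0 2 v -> wt h 2 v -> lie X (lie Y v) = (- 2) *: v.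
Proof. by move=> v2 vh; rewrite (plus_XY wt4 sl2 wtX v2) vh scaleNr. Qed.

Lemma lower22 v : wt H0 2 v -> wt h 2 v ->
  lie X (lie X (lie Y (lie Y v))) = 4 *: v.
Proof.
move=> v2 vh; rewrite (plus_XYY wt4 sl2 wtX v2) vh !lieE lower2 //.
by lmod F.
Qed.

Lemma lower0 v : wt H0 2 v -> wt h 0 v -> lie Y v = 0.
Proof.
move=> v2 vh; have := plus_Y_poly char0 wt4 wtN4 sl2 wtX wtY v2.
rewrite !(vh, scale0r, lie0r, scaler0, sub0r) => /eqP.
by rewrite eq_sym oppr_eq0 scaler_eq0 (negPf two0) => /eqP.
Qed.

End SL2Weights.
Section OrthogonalTriples.
Variables (k : nat) (H X Y : 'I_k.+1 -> g).
Hypothesis fam : orthogonal_triples H0 H X Y.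
Implicit Types (i j : 'I_k.+1) (v w z : g).

Let sl2 := fam_sl2 fam.
Let X2 := fam_X2 fam.
Let Y2 := fam_Y2 fam.
Let lie_YX' := lie_YX fam.

Lemma lie_XX i j : lie (X i) (X j) = 0.
Proof. exact: plus_lie. Qed.

Lemma lie_YY i j : lie (Y i) (Y j) = 0.
Proof. exact: minus_lie. Qed.

Lemma lie_HX i j : i != j -> lie (H i) (X j) = 0.
Proof.
by move=> ne; case: (sl2 i) => _ _ <-; rewrite lie_lie lie_XX lie_YX' // !lie0r subrr.
Qed.

Lemma lie_HY i j : i != j -> lie (H i) (Y j) = 0.
Proof.
move=> ne; case: (sl2 i) => _ _ <-; rewrite lie_lie lie_YY lie0r subr0.
by rewrite (lieC (X i)) lie_YX' 1?eq_sym // oppr0 lie0r.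
Qed.

(** The nonzero vector Y_j^2 v lies in V- and has the same weight for H_i as v; the weights of H_i
    lie in {0, 1, 2} on V+ and in {0, -1, -2} on V-. *)
Lemma wt2_excl i j v : i != j -> wt H0 2 v -> v != 0 -> wt (H j) 2 v ->
  forall c, wt (H i) c v -> c = 0.
Proof.
move=> ne v2 v0 vj c vi.
pose u := lie (Y j) (lie (Y j) v).
have u0 : u != 0.
  apply: contraNneq v0 => e; have := lower22 (sl2 j) (X2 j) v2 vj.
  by rewrite -/u e !lie0r => /esym/eqP; rewrite scaler_eq0 (negPf (nat0 3)) => /eqP ->.
have HiY w d : wt (H i) d w -> wt (H i) d (lie (Y j) w).
  by move=> wd; apply: wt_lie0l wd; rewrite /wt lie_HY // scale0r.
have u2 : wt H0 (- 2) u.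
  rewrite (_ : - 2 = - 2 + (- 2 + 2)); last by ring.
  by do 2?apply: wt_lie.
have ui : wt (H i) c u by apply HiY; apply HiY.
have [n cn] : exists n : nat, c = n%:R.
  have [] := plus_wt (sl2 i) (X2 i) (Y2 i) v2 v0 vi => ->.
  - by exists 0%N.
  - by exists 1%N.
  - by exists 2%N.
have [m cm] : exists m : nat, c = - m%:R.
  have [] := minus_wt (sl2 i) (X2 i) (Y2 i) u2 u0 ui => ->.
  - by exists 0%N; rewrite oppr0.
  - by exists 1%N.
  - by exists 2%N.
by move: cm; rewrite cn => /(natr_oppr_eq0 char0)[-> _].
Qed.

Lemma no_wt2_g0 j z : wt H0 0 z -> wt (H j) 2 z -> z = 0.
Proof.
move=> z0 z2; apply/eqP; apply: contraT => zn0.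
have [] := zero_wt (sl2 j) (X2 j) (Y2 j) z0 zn0 z2.
- by move/eqP; rewrite (negPf two0).
- by move/(@natr_inj0 _ char0 2 1).
- by move/(@natr_oppr_eq0 _ char0 2 1) => [].
Qed.

End OrthogonalTriples.

(** * Roots and the descent *)

Section RootPairing.
Variable a : {vspace g}.
Hypothesis ha : maximal_split_abelian_in (g0 H0) a.
Hypothesis haH0 : H0 \in a.
Implicit Types (x y v w h : g) (W : {vspace g}) (mu nu : dual a).

Lemma a_split : split_abelian a. Proof. by case: ha. Qed.

Lemma a_comm x y : x \in a -> y \in a -> lie x y = 0.
Proof. by case: a_split => h _; exact: h. Qed.

Lemma a_wt x y : x \in a -> y \in a -> wt x 0 y.
Proof. by move=> xa ya; rewrite /wt scale0r a_comm. Qed.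

Lemma root_ind_all (Q : g -> Prop) : Q 0 -> (forall x y, Q x -> Q y -> Q (x + y)) ->
  (forall c x, Q x -> Q (c *: x)) ->
  (forall mu w, w \in root_space mu -> Q w) -> forall v, Q v.
Proof.
move=> Q0 QD QZ Qroot v.
have [rs rsP] := finite_roots a_split.
have sub : (fullv <= \sum_(mu <- rs) root_space mu)%VS.
  apply: (root_ind a_split) => [h _ w _|mu w _ wmu]; first exact: memvf.
  have [->|w0] := eqVneq w 0; first exact: mem0v.
  have mrs : mu \in rs by apply: rsP; apply: contraNneq w0 => e; rewrite e memv0 in wmu.
  by rewrite (big_rem _ mrs) /= -[w]addr0 memv_add ?mem0v.
have := subvP sub v (memvf v); elim: rs v {rsP sub} => [|mu rs IH] v.
  by rewrite big_nil memv0 => /eqP->.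
by rewrite big_cons => /memv_addP[x /Qroot Qx [y /IH Qy ->]]; exact: QD.
Qed.

Lemma killing_root_nondeg mu x : x \in root_space mu ->
  {in root_space (- mu), forall y, killing x y = 0} -> x = 0.
Proof.
move=> xmu h; apply: killing_nondeg.
apply: root_ind_all => [|y z hy hz|c y hy|nu y ynu]; first exact: killing0r.
- by rewrite killingDr hy hz addr0.
- by rewrite killingZr hy mulr0.
have [e|ne] := eqVneq (mu + nu) 0; last exact: killing_root ne.
by apply: h; move: e => /eqP; rewrite addrC addr_eq0 => /eqP <-.
Qed.

Lemma killing_root_dual mu x : x \in root_space mu -> x != 0 ->
  exists2 y, y \in root_space (- mu) & killing x y != 0.
Proof.
move=> xmu; apply: contra_neqP => no; apply: (killing_root_nondeg xmu) => y ymu.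
by apply/eqP/negPn/negP => ne; apply: no; exists y.
Qed.

Lemma root_spaceN mu : root_space mu != 0%VS -> root_space (- mu) != 0%VS.
Proof.
rewrite -vpick0; set x := vpick _ => x0; apply: contraNneq x0 => e.
rewrite (@killing_root_nondeg mu x) ?memv_pick // => y.
by rewrite e memv0 => /eqP->; rewrite killing0r.
Qed.

Lemma root_space_neq0 mu x : x \in root_space mu -> x != 0 -> root_space mu != 0%VS.
Proof. by move=> xmu; apply: contraNneq => e; rewrite e memv0 in xmu. Qed.

Lemma root_space_eq mu nu x : x \in root_space mu -> x \in root_space nu ->
  x != 0 -> mu = nu.
Proof.
move=> xmu xnu x0; apply: dual_ext => h hh; apply/eqP; apply: contraNT x0 => ne.
by rewrite (wt_uniq (root_wt xmu hh) (root_wt xnu hh)).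
Qed.

(** * The reflection of an sl2-triple on [a] and on the roots *)

Section Reflection.
Variables (mu : dual a) (y h x : g).
Hypothesis sl2 : sl2_triple y h x.
Hypothesis xmu : x \in root_space mu.
Hypothesis ymu : y \in root_space (- mu).
Hypothesis hha : h \in a.
Hypothesis xn0 : x != 0.
Hypotheses (nx : ad_nilpotent x) (ny : ad_nilpotent y).

Definition sl2_theta : 'End(g) := (expE x \o expE y \o expE x)%VF.

Lemma sl2_theta_aut : lie_automorphism sl2_theta.
Proof.
exact: lie_automorphism_comp (lie_automorphism_comp (lie_automorphism_exp char0 nx)
  (lie_automorphism_exp char0 ny)) (lie_automorphism_exp char0 nx).
Qed.

Lemma sl2_theta_a h' : h' \in a -> sl2_theta h' = h' - root_eval mu h' *: h.
Proof.
move=> h'a; set c := root_eval mu h'.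
have [hx hy yx] := sl2.
have e1 : lie x h' = - c *: x by rewrite lieC (root_wt xmu h'a) scaleNr.
have e2 : lie y h' = c *: y by rewrite lieC (root_wt ymu h'a) root_evalN scaleNr opprK.
have e3 : lie x h = (- 2) *: x by rewrite lieC hx scaleNr.
have e4 : lie y h = 2 *: y by rewrite lieC hy scaleNr opprK.
rewrite /sl2_theta !comp_lfunE !expEE.
rewrite (@exp_ad2 _ _ x h') // ?e1 ?lieE ?liexx ?scaler0 //.
rewrite exp_adD exp_adZ (@exp_ad2 _ _ y h') // ?e2 ?lieE ?liexx ?scaler0 //.
rewrite (@exp_ad3 _ _ y x) // ?yx ?e4 ?lieE ?liexx ?scaler0 //.
rewrite !(exp_adD, exp_adZ) (@exp_ad2 _ _ x h') // ?e1 ?lieE ?liexx ?scaler0 //.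
rewrite (@exp_ad2 _ _ x x) ?liexx ?lie0r // addr0.
rewrite (@exp_ad2 _ _ x h) ?e3 ?lieE ?liexx ?scaler0 //.
by lmodf F.
Qed.

Lemma sl2_theta_root nu v : v \in root_space nu ->
  sl2_theta v \in root_space (nu - root_eval nu h *: mu).
Proof.
move=> vnu; apply: wt_root => h' h'a.
have muh : root_eval mu h = 2.
  have [hx _ yx] := sl2; apply/eqP; apply: contraT => ne.
  by case/eqP: xn0; apply: wt_uniq (root_wt xmu hha) hx ne.
pose h'' := h' - root_eval mu h' *: h.
have h''a : h'' \in a by rewrite memvB ?memvZ.
have -> : h' = sl2_theta h''.
  rewrite sl2_theta_a // /h'' root_evalBr root_evalZr muh.
  by lmod F.
rewrite root_evalD root_evalN root_evalZ -{1}/h''.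
have := aut_wt sl2_theta_aut (root_wt vnu h''a); rewrite /wt => ->.
congr (_ *: _); rewrite sl2_theta_a // !root_evalBr !root_evalZr muh /h''.
ring.
Qed.

End Reflection.

(* Reflections preserving the finite set of roots are unique: the product of
   two of them with the same root is unipotent. *)
Lemma coroot_uniq (lam0 : dual a) h1 h2 : lam0 != 0 ->
  is_coroot lam0 h1 -> is_coroot lam0 h2 -> h1 = h2.
Proof.
move=> lam00 [h1a e1 r1] [h2a e2 r2].
apply: subr0_eq.
apply: central0; apply: root_ind_all.
- by rewrite lie0r.
- by move=> v w hv hw; rewrite lieDr hv hw addr0.
- by move=> c v hv; rewrite lieZr hv scaler0.
move=> mu w wmu; have h12 : h1 - h2 \in a by rewrite memvB.
rewrite (root_wt wmu h12) root_evalBr.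
have [->|mu0] := eqVneq mu 0; first by rewrite !root_eval0 subrr scale0r.
have [->|w0] := eqVneq w 0; first by rewrite scaler0.
have mur : is_root mu by rewrite /is_root inE mu0 (root_space_neq0 wmu).
set d := _ - _; suff -> : d = 0 by rewrite scale0r.
have iterr n : is_root (mu + (d *+ n) *: lam0).
  elim: n => [|n IH]; first by rewrite mulr0n scale0r addr0.
  have := r2 _ (r1 _ IH); rewrite [is_root _](_ : _ = is_root (mu + (d *+ n.+1) *: lam0)) //.
  congr is_root; rewrite !(root_evalD, root_evalN, root_evalZ) e1 e2 [d *+ n.+1]mulrS.
  by move: (d *+ n) => m; rewrite /d; lmod F.
have [rs rsP] := finite_roots a_split.
apply/eqP; apply: contraT => d0.
pose t := [seq mu + (d *+ n) *: lam0 | n <- seq.iota 0 (size rs).+1].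
have ut : uniq t.
  rewrite map_inj_uniq ?iota_uniq // => m n /addrI/eqP.
  rewrite -subr_eq0 -scalerBl scaler_eq0 (negPf lam00) orbF subr_eq0.
  rewrite -![d *+ _]mulr_natl (inj_eq (mulIf d0)) -subr_eq0.
  have [le|/ltnW le] := leqP m n.
    rewrite -oppr_eq0 opprB -natrB // ((pcharf0P F).1 char0) subn_eq0 => le'.
    by apply/eqP; rewrite eqn_leq le.
  rewrite -natrB // ((pcharf0P F).1 char0) subn_eq0 => le'.
  by apply/eqP; rewrite eqn_leq le le'.
have sub : {subset t <= rs} by move=> e /mapP[n _ ->]; apply: rsP; have /andP[] := iterr n.
by have := uniq_leq_size ut sub; rewrite size_map size_iota ltnn.
Qed.

Section DescentRoots.
Variables (Pi : seq (dual a)).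
Hypothesis hPi : root_basis Pi.
Hypothesis hPiH0 :
  {in Pi, forall alpha, root_eval alpha H0 = 0 \/ root_eval alpha H0 = 2}.
Variables (k : nat) (lam : 'I_k.+1 -> dual a).
Hypothesis hlam : descent H0 Pi lam.
Variable H : 'I_k.+1 -> g.
Hypothesis hH : forall j, is_coroot (lam j) (H j).
Variable X : 'I_k.+1 -> g.
Hypothesis hX : forall j, X j \in root_space (lam j) /\ X j != 0.
Hypothesis hdim : forall j, \dim (root_space (lam j)) = 1%N.
Implicit Types (i j : 'I_k.+1).

Lemma lam_X j x : x \in root_space (lam j) -> exists c, x = c *: X j.
Proof.
have [Xj Xj0] := hX j.
have -> : root_space (lam j) = <[X j]>%VS.
  by apply/esym/eqP; rewrite eqEdim -memvE Xj hdim dim_vline Xj0.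
by move/vlineP.
Qed.

Lemma Ha j : H j \in a. Proof. by case: (hH j). Qed.

Lemma lam_H j : root_eval (lam j) (H j) = 2. Proof. by case: (hH j). Qed.

Lemma lam_H0 j : root_eval (lam j) H0 = 2. Proof. exact: descent_H0 hlam j. Qed.

Lemma wt_X j : wt H0 2 (X j).
Proof. by rewrite -(lam_H0 j); apply: root_wt; [case: (hX j) |]. Qed.

Lemma wt_lamN j y : y \in root_space (- lam j) -> wt H0 (- 2) y.
Proof. by move=> h; rewrite -(lam_H0 j) -root_evalN; apply: root_wt. Qed.

(* If [Y, X] centralized X and Y, it would be nilpotent on V+ and V-. *)
Lemma commuting_triple_killing y x h : wt H0 2 x -> wt H0 (- 2) y ->
  lie y x = h -> lie h x = 0 -> lie h y = 0 -> killing y x = 0.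
Proof.
move=> x2 y2 yx hx hy.
have h0 : wt H0 0 h by rewrite -yx -(addNr 2); apply: wt_lie.
have plus := commuting_cube char0 wt4 wtN4 x2 y2 yx hx hy.
have minus w : wt H0 (- 2) w -> lie h (lie h (lie h w)) = 0.
  move=> w2; have hN c v : wt (- H0) c v <-> wt H0 (- c) v.
    by split=> /wt_opp; rewrite ?opprK.
  have := @commuting_cube _ _ char0 (- H0) y x (- h) (fun v hv => wtN4 ((hN _ v).1 hv)) _
    ((hN 2 y).2 y2) _ _ _ _ w ((hN 2 w).2 w2).
  rewrite !(lieNl, lieNr) opprK hx hy oppr0 -yx (lieC x) => e.
  apply: oppr_inj; rewrite oppr0; apply: e => // [v /hN|]; last by apply/hN; rewrite opprK.
  by rewrite opprK; exact: wt4.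
have kh : killing h H0 = 0.
  rewrite killingE; apply: (@ltrace_nilpotent _ _ 3) => v /=.
  rewrite !comp_lfunE !adE.
  have [u [z [w [-> hu hz hw']]]] := grade_decomp v.
  have hc e : lie H0 (lie h e) = lie h (lie H0 e) by rewrite lieJ h0 scale0r lie0l add0r.
  rewrite !hc !(lieDr, hu, hz, hw', lieZr, scale0r, lie0r).
  by rewrite minus // plus // !(scaler0, addr0).
move: kh; rewrite -yx killing_lie lieC x2 killingNr killingZr => /eqP.
by rewrite oppr_eq0 mulf_eq0 (negPf two0) => /eqP.
Qed.

Lemma lamN_eq0 j y : y \in root_space (- lam j) -> killing (X j) y = 0 -> y = 0.
Proof.
move=> yl ky; apply: (@killing_root_nondeg (- lam j)) => // x; rewrite opprK.
by move/lam_X => [c ->]; rewrite killingZr killingC ky mulr0.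
Qed.

Lemma lam_neq0 j : lam j != 0.
Proof.
by apply: contraTneq two0 => e; rewrite -(lam_H0 j) e root_eval0 eqxx.
Qed.

(** As root spaces of lam_j and -lam_j are lines, h = [y, X_j] acts on X_j and y by opposite
    scalars, nonzero by [commuting_triple_killing]. After rescaling, h lies in [a] by maximality,
    and the reflection of the triple preserves the roots, so h is the coroot H_j by uniqueness. *)
Lemma descent_sl2 j : exists2 y, y \in root_space (- lam j) &
  sl2_triple y (H j) (X j).
Proof.
have [Xj Xj0] := hX j; have X2 := wt_X j.
have [y yl ky] := killing_root_dual Xj Xj0.
have y2 := wt_lamN yl.
pose h := lie y (X j).
have hroot : h \in root_space (0 : dual a) by have := root_space_lie yl Xj; rewrite addNr.
have [xi hXj] : exists xi, lie h (X j) = xi *: X j.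
  by apply: lam_X; have := root_space_lie hroot Xj; rewrite add0r.
have hy : lie h y = - xi *: y.
  apply: subr0_eq; apply/(@lamN_eq0 j).
    by rewrite rpredB ?rpredZ //; have := root_space_lie hroot yl; rewrite add0r.
  rewrite killingDr killingNr killingZr -killing_lie lieC hXj killingNl killingZl.
  by rewrite mulNr opprK addNr.
have xi0 : xi != 0.
  apply: contraNneq ky => xi0; rewrite killingC.
  apply/eqP; apply: (@commuting_triple_killing y (X j) h) => //.
    by rewrite hXj xi0 scale0r.
  by rewrite hy xi0 oppr0 scale0r.
pose y' := (2 / xi) *: y; pose h' := (2 / xi) *: h.
have y'l : y' \in root_space (- lam j) by rewrite rpredZ.
have sl2 : sl2_triple y' h' (X j).
  split; rewrite /y' /h' ?lieE ?hXj ?hy ?scalerA //.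
    by rewrite divfK.
  by congr (_ *: _); field.
have h'0 : wt H0 0 h' by apply: wtZ; have := root_wt hroot haH0; rewrite root_eval0.
have h'a : h' \in a.
  apply: (max_split ha h'0) => [x xa|].
    by rewrite lieZr (root_wt hroot xa) root_eval0 scale0r scaler0.
  exact: (sl2_diagonalizable sl2 X2 (wt_lamN y'l)).
exists y' => //; have -> // : H j = h'.
apply: (coroot_uniq (lam_neq0 j)) => //.
have lh : root_eval (lam j) h' = 2 by case: sl2 => hx _ _; exact: root_eval_wt Xj Xj0 h'a hx.
split=> // mu /andP[mu0 rmu].
have nx := nilp2 X2; have ny := nilpN2 (wt_lamN y'l).
set nu := mu - _; have nu0 : nu != 0.
  apply: contraNneq mu0 => e; have e1 : root_eval mu h' = 0.
    have := congr1 (fun r => root_eval r h') e.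
    rewrite root_evalD root_evalN root_evalZ lh root_eval0 => e2.
    by apply/eqP; rewrite -oppr_eq0 -[X in _ == X]e2; apply/eqP; ring.
  by move: e; rewrite /nu e1 scale0r subr0 => ->.
rewrite /is_root inE nu0 /=; set w := vpick (root_space mu).
have w0 : w != 0 by rewrite vpick0.
have wmu : w \in root_space mu by exact: memv_pick.
have /lker0P injt : lker (sl2_theta y' (X j)) == 0%VS by case: (sl2_theta_aut nx ny) => /eqP.
apply: (root_space_neq0 (sl2_theta_root sl2 Xj y'l h'a Xj0 nx ny wmu)).
by apply: contraNneq w0 => e; apply/eqP/injt; rewrite e linear0.
Qed.

Section DescentFrame.
Variable Y : 'I_k.+1 -> g.
Hypothesis hY : forall j, Y j \in root_space (- lam j) /\ sl2_triple (Y j) (H j) (X j).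

Let HaE := Ha.
Let sl2 j := (hY j).2.
Let X2 j := wt_X j.
Let Y2 j := wt_lamN (hY j).1.

Lemma lam_strong i j : i != j -> root_space (lam i - lam j) = 0%VS.
Proof.
have lt_case i' j' : (i' < j')%N -> root_space (lam i' - lam j') = 0%VS.
  move=> lt_ij; have [[_ so] _] := descent_lam hlam j'.
  have [_ nr _ /eqP ne] := so _ lt_ij.
  by apply/eqP; move: nr; rewrite /is_root inE ne /= negbK.
rewrite -val_eqE /= neq_ltn => /orP[|lt_ji]; first exact: lt_case.
apply/eqP; apply: contraT; move/(root_spaceN).
by rewrite opprB lt_case // eqxx.
Qed.

Lemma descent_YX i j : i != j -> lie (Y i) (X j) = 0.
Proof.
move=> ne; have := root_space_lie (hY i).1 (hX j).1.
by rewrite addrC lam_strong 1?eq_sym // memv0 => /eqP.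
Qed.

Let fam : orthogonal_triples H0 H X Y.
Proof. split; [exact: sl2 | exact: X2 | exact: Y2 | exact: descent_YX]. Qed.

Lemma lam_H_ij i j : i != j -> root_eval (lam j) (H i) = 0.
Proof.
move=> ne; have [Xj Xj0] := hX j; have := root_wt Xj (HaE i).
rewrite /wt (lie_HX fam) // => /esym/eqP; rewrite scaler_eq0 (negPf Xj0) orbF.
by move/eqP.
Qed.

Lemma root_value mu : root_eval mu H0 = 2 -> ~ nonneg_comb Pi (- mu).
Proof.
move=> mu2 [n e]; have := congr1 (fun r => root_eval r H0) e.
rewrite root_evalN mu2 root_eval_sum.
suff [m ->] : exists m : nat, \sum_(i < size Pi) root_eval (Pi`_i *+ n i) H0 = m%:R.
  by move/esym/(@natr_oppr_eq0 _ char0) => [_].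
elim/big_ind: _ => [|x y [m1 ->] [m2 ->]|i _]; first by exists 0%N.
  by exists (m1 + m2)%N; rewrite natrD.
rewrite root_evalMn; have : Pi`_i \in Pi by exact: mem_nth.
by case/hPiH0 => ->; [exists 0%N; rewrite mul0rn | exists (2 * n i)%N; rewrite natrM mulr_natr].
Qed.

Lemma value2_positive mu : is_root mu -> root_eval mu H0 = 2 -> positive_root Pi mu.
Proof.
move=> rmu mu2; split=> //; have [_ _ posneg] := hPi.
by case: (posneg _ rmu) => // /(root_value mu2).
Qed.

Lemma value_neq0 mu : root_eval mu H0 != 0 -> mu <> 0.
Proof. by move=> h e; rewrite e root_eval0 eqxx in h. Qed.

(** The sum of the two roots would have degree 4; the difference would have degree 0 and weight 2
    for H_i, which [no_wt2_g0] excludes. *)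
Lemma value2_strong i mu : root_eval mu H0 = 2 -> root_eval mu (H i) = 0 ->
  strongly_orthogonal (lam i) mu.
Proof.
move=> mu2 mui; have l2 := lam_H0 i; have four : (4 : F) != 0 := nat0 3.
split.
- apply/negP => /andP[_]; rewrite -vpick0; set z := vpick _ => /negP[]; apply/eqP.
  apply: wt4; have := root_wt (memv_pick (root_space (lam i + mu))) haH0.
  by rewrite root_evalD l2 mu2 -natrD.
- apply/negP => /andP[_]; rewrite -vpick0; set z := vpick _ => /negP[]; apply/eqP.
  have zr := memv_pick (root_space (lam i - mu)).
  apply: (no_wt2_g0 fam (j := i)).
    by have := root_wt zr haH0; rewrite root_evalD root_evalN l2 mu2 subrr.
  by have := root_wt zr (HaE i); rewrite root_evalD root_evalN mui subr0 lam_H.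
- by apply: value_neq0; rewrite root_evalD l2 mu2 -natrD.
- move=> e; have := congr1 (fun r => root_eval r (H i)) e.
  rewrite root_evalD root_evalN mui subr0 lam_H root_eval0 => /eqP.
  by rewrite (negPf two0).
Qed.

(** Let v have a root mu other than lam_j and put nu = mu - lam_j. Lowering v once and twice by Y_j
    shows that nu and lam_j - nu are roots. Whichever of nu and -nu is positive, lam_j = (lam_j -
    nu) + nu or lam_j = mu + (-nu) contradicts the simplicity of lam_j in the descended system. *)
Lemma wt2_lam j v : wt H0 2 v -> wt (H j) 2 v -> v \in root_space (lam j).
Proof.
have [n le_jn] := ubnP (nat_of_ord j); elim: n j v le_jn => // n IH j v /ltnSE le_jn.
move=> v2 vj; have: (Vplus H0 :&: leigenspace (ad (H j)) 2 <= root_space (lam j))%VS.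
  apply: (root_ind a_split) => [h hh w|mu w].
    rewrite !memv_cap => /andP[/wt_eigen w2 /wt_eigen wj].
    by apply/andP; split; apply/wt_eigen; apply: wt_lie0l => //; exact: a_wt.
  rewrite memv_cap => /andP[/wt_eigen w2 /wt_eigen wj] wmu.
  have [->|w0] := eqVneq w 0; first exact: mem0v.
  have [<- //|ne] := eqVneq mu (lam j); exfalso.
  have mu2 := root_eval_wt wmu w0 haH0 w2; have muj := root_eval_wt wmu w0 (HaE j) wj.
  have mui i : i != j -> root_eval mu (H i) = 0.
    by move=> neij; apply: (wt2_excl fam neij w2 w0 wj); exact: root_wt.
  pose nu := mu - lam j; have nu0 : nu != 0 by rewrite subr_eq0.
  pose y1 := lie (Y j) w; pose y2 := lie (Y j) y1.
  have y20 : y2 != 0.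
    apply: contraNneq w0 => e; have := lower22 (sl2 j) (X2 j) w2 wj.
    by rewrite -/y1 -/y2 e !lie0r => /esym/eqP; rewrite scaler_eq0 (negPf (nat0 3)) => /eqP ->.
  have y10 : y1 != 0 by apply: contraNneq y20 => e; rewrite /y2 e lie0r.
  have y1r : y1 \in root_space nu by rewrite /nu addrC; apply: root_space_lie (hY j).1 wmu.
  have y2r : y2 \in root_space (nu - lam j) by rewrite addrC; apply: root_space_lie (hY j).1 y1r.
  have rN := root_spaceN.
  have rnu := root_space_neq0 y1r y10.
  have rmu' : root_space (lam j - nu) != 0%VS.
    by rewrite -opprB; apply: rN; exact: root_space_neq0 y2r y20.
  have l2 := lam_H0 j.
  have nuH0 : root_eval nu H0 = 0 by rewrite root_evalD root_evalN mu2 l2 subrr.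
  have nui i : i != j -> root_eval nu (H i) = 0.
    by move=> neij; rewrite root_evalD root_evalN mui // lam_H_ij // subrr.
  pose mu' := lam j - nu.
  have mu'2 : root_eval mu' H0 = 2 by rewrite root_evalD root_evalN nuH0 l2 subr0.
  have mu'i i : i != j -> root_eval mu' (H i) = 0.
    by move=> neij; rewrite root_evalD root_evalN nui // lam_H_ij // subrr.
  have is_root2 (rho : dual a) : root_space rho != 0%VS -> root_eval rho H0 = 2 -> is_root rho.
    move=> rr r2; rewrite /is_root inE rr andbT; apply/eqP/value_neq0.
    by rewrite r2.
  have neq_lt i : (i < j)%N -> i != j by rewrite -val_eqE /= => /ltn_eqF ->.
  have pos2 (rho : dual a) : root_space rho != 0%VS -> root_eval rho H0 = 2 ->
      (forall i, i != j -> root_eval rho (H i) = 0) -> descent_positive Pi lam j rho.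
    move=> rr r2 ri; split; first by apply: value2_positive => //; exact: is_root2.
    by move=> i /neq_lt neij; apply: value2_strong => //; exact: ri.
  (* A root lam_i + rho or lam_i - rho would have degree 2 and weight 2 for H_i, so it would be
     lam_i by the induction hypothesis. *)
  have posnu (rho : dual a) : root_space rho != 0%VS -> rho != 0 -> root_eval rho H0 = 0 ->
      (forall i, i != j -> root_eval rho (H i) = 0) -> nonneg_comb Pi rho ->
      descent_positive Pi lam j rho.
    move=> rr r0 rH0 ri pr; split; first by split=> //; rewrite /is_root inE r0.
    move=> i lt_ij; have neij := neq_lt _ lt_ij; have li2 := lam_H0 i.
    have notr (sg : dual a) : root_eval sg H0 = 0 -> root_eval sg (H i) = 0 -> sg != 0 ->
        ~~ is_root (lam i + sg).
      move=> s0 si sn0; apply/negP => /andP[_]; rewrite -vpick0.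
      set z := vpick _ => z0; have zr : z \in root_space (lam i + sg) by exact: memv_pick.
      have zl : z \in root_space (lam i).
        apply: IH; first exact: leq_trans lt_ij le_jn.
          by have := root_wt zr haH0; rewrite root_evalD li2 s0 addr0.
        by have := root_wt zr (HaE i); rewrite root_evalD lam_H si addr0.
      have /eqP := root_space_eq zr zl z0.
      by rewrite -subr_eq0 addrAC subrr add0r (negPf sn0).
    split.
    - by apply: notr => //; exact: ri.
    - by apply: notr; rewrite ?root_evalN ?rH0 ?ri ?oppr0 ?oppr_eq0.
    - by apply: value_neq0; rewrite root_evalD rH0 li2 addr0.
    - by apply: value_neq0; rewrite root_evalD root_evalN rH0 li2 subr0.
  have [_ simple] := descent_lam hlam j.
  have [_ _ posneg] := hPi.
  have rnu' : is_root nu by rewrite /is_root inE nu0.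
  case: (posneg _ rnu') => pn.
    apply: (simple mu' nu); last by rewrite /mu' subrK.
      by apply: pos2.
    by apply: posnu.
  apply: (simple mu (- nu)); last by rewrite /nu opprB addrCA subrr addr0.
    by apply: pos2 => //; exact: root_space_neq0 wmu w0.
  apply: posnu => //; rewrite ?oppr_eq0 ?root_evalN ?nuH0 ?oppr0 //; first exact: rN.
  by move=> i neij; rewrite root_evalN nui // oppr0.
move/subvP; apply; rewrite memv_cap; apply/andP; split; exact/wt_eigen.
Qed.

Lemma wt0_all v : wt H0 2 v -> (forall j, wt (H j) 0 v) -> v = 0.
Proof.
move=> v2 vj; pose W := (Vplus H0 :&: \bigcap_(j < k.+1) leigenspace (ad (H j)) 0)%VS.
have WP w : w \in W <-> wt H0 2 w /\ forall j, wt (H j) 0 w.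
  rewrite memv_cap; split=> [/andP[/wt_eigen w2]|[w2 wj]].
    by rewrite memvE => /subv_bigcapP h; split=> // j; apply/wt_eigen; rewrite memvE h.
  apply/andP; split; first exact/wt_eigen.
  by rewrite memvE; apply/subv_bigcapP => j _; rewrite -memvE; apply/wt_eigen.
suff /subvP/(_ v) : (W <= 0)%VS by rewrite memv0 => h; apply/eqP/h/WP.
apply: (root_ind a_split) => [h hh w /WP[w2 wj]|mu w /WP[w2 wj] wmu].
  by apply/WP; split=> [|j]; apply: wt_lie0l => //; exact: a_wt.
rewrite memv0; apply/negPn/negP => w0.
have mu2 := root_eval_wt wmu w0 haH0 w2.
have rmu : is_root mu.
  rewrite /is_root inE (root_space_neq0 wmu w0) andbT; apply/eqP/value_neq0.
  by rewrite mu2.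
apply: (descent_stop hlam rmu mu2) => i; apply: value2_strong => //.
exact: root_eval_wt wmu w0 (HaE i) (wj i).
Qed.

End DescentFrame.

Lemma descent_frame :
  exists2 Y, jordan_frame H0 H X Y & forall j, Y j \in root_space (- lam j).
Proof.
have ex j : exists y, y \in root_space (- lam j) /\ sl2_triple y (H j) (X j).
  by have [y] := descent_sl2 j; exists y.
have [Y hY] := choice ex; exists Y => [|j]; last by case: (hY j).
split; [|by move=> j; case: (hX j)| |exact: wt0_all hY].
  split=> [j|j|j|]; [by case: (hY j) | exact: wt_X | exact: wt_lamN (hY j).1 |].
  exact: descent_YX hY.
by move=> j v v2 vj; apply: lam_X; exact: (wt2_lam hY).
Qed.

End DescentRoots.
End RootPairing.

(** * The group G and its orbits *)

Section FixedGroup.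
Implicit Types phi psi : 'End(g).

Lemma char0_ext : [pchar L] =i pred0.
Proof.
by move=> n; rewrite -char0 !inE; congr (_ && _); rewrite -(fmorph_eq0 iota) rmorph_nat.
Qed.

Lemma Ggrp_id : Ggrp iota H0 \1%VF.
Proof. by split; [exact: Aut0_id | rewrite id_lfunE]. Qed.

Lemma Ggrp_comp phi psi : Ggrp iota H0 phi -> Ggrp iota H0 psi ->
  Ggrp iota H0 (phi \o psi)%VF.
Proof.
move=> [p1 p2] [q1 q2]; split; last by rewrite comp_lfunE q2.
by apply: Aut0_comp => //; exact: char0_ext.
Qed.

Lemma Ggrp_aut phi : Ggrp iota H0 phi -> lie_automorphism phi.
Proof. by case=> [] []. Qed.

Lemma Ggrp_lker phi : Ggrp iota H0 phi -> lker phi == 0%VS.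
Proof. by case/Ggrp_aut => /eqP. Qed.

Lemma Ggrp_inv phi : Ggrp iota H0 phi -> Ggrp iota H0 (phi^-1)%VF.
Proof.
move=> G; have ker0 := Ggrp_lker G; case: G => [p1 p2]; split.
  by apply: Aut0_inv => //; exact: char0_ext.
by rewrite -{1}p2 lker0_lfunK.
Qed.

Lemma Ggrp_exp x : wt H0 0 x -> ad_nilpotent x -> Ggrp iota H0 (expE x).
Proof.
move=> x0 nx; split; first by apply: Aut0_exp => //; exact: char0_ext.
by rewrite expEE exp_ad1 // lieC x0 scale0r oppr0.
Qed.

Lemma Ggrp_lie phi x y : Ggrp iota H0 phi -> phi (lie x y) = lie (phi x) (phi y).
Proof. by case/Ggrp_aut. Qed.

Lemma Ggrp_wt phi c x : Ggrp iota H0 phi -> wt H0 c x -> wt H0 c (phi x).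
Proof. by move=> G xc; case: (G) => _ <-; apply: aut_wt (Ggrp_aut G) xc. Qed.

Lemma Gorbit_refl Z : Gorbit iota H0 Z Z.
Proof. by exists \1%VF; [exact: Ggrp_id | rewrite id_lfunE]. Qed.

Lemma Gorbit_sym Z Z' : Gorbit iota H0 Z Z' -> Gorbit iota H0 Z' Z.
Proof.
move=> [phi G <-]; exists (phi^-1)%VF; first exact: Ggrp_inv.
by rewrite lker0_lfunK // (Ggrp_lker G).
Qed.

Lemma Gorbit_trans Z Z' Z'' : Gorbit iota H0 Z Z' -> Gorbit iota H0 Z' Z'' ->
  Gorbit iota H0 Z Z''.
Proof.
move=> [phi G <-] [psi G' <-]; exists (psi \o phi)%VF; first exact: Ggrp_comp.
by rewrite comp_lfunE.
Qed.

Lemma Gorbit_eq Z Z' : Gorbit iota H0 Z = Gorbit iota H0 Z' <-> Gorbit iota H0 Z Z'.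
Proof.
split=> [->|h]; first exact: Gorbit_refl.
rewrite predeqE => W; split=> hW; first exact: Gorbit_trans (Gorbit_sym h) hW.
exact: Gorbit_trans h hW.
Qed.

End FixedGroup.
Let char0L := char0_ext.

(** * Jordan frames *)

Section Frame.
Variables (k : nat) (H X Y : 'I_k.+1 -> g).
Hypothesis frame : jordan_frame H0 H X Y.
Let fam := frame_triples frame.
Let sl2 := fam_sl2 fam.
Let X2 := fam_X2 fam.
Let Y2 := fam_Y2 fam.

Section FrameWeights.
Implicit Types (i j : 'I_k.+1) (u v w z A B Z : g) (phi : 'End(g)).

Lemma wt_H0_H j : wt H0 0 (H j).
Proof. by case: (sl2 j) => _ _ <-; rewrite -(addNr 2); exact: wt_lie. Qed.

Lemma HH i j : lie (H i) (H j) = 0.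
Proof.
have [->|ne] := eqVneq i j; first exact: liexx.
case: (sl2 j) => _ _ <-; rewrite lieJ (lie_HY fam ne) lie0l add0r.
by rewrite (lie_HX fam ne) lie0r.
Qed.

Lemma H_diag j : lfun_diagonalizable (ad (H j)).
Proof. exact: (sl2_diagonalizable (sl2 j) (X2 j) (Y2 j)). Qed.

Lemma wt_HX i j : wt (H i) (if i == j then 2 else 0) (X j).
Proof.
case: eqP => [<-|/eqP ne]; first by case: (sl2 i).
by rewrite /wt scale0r (lie_HX fam ne).
Qed.

Lemma wt_HXii j : wt (H j) 2 (X j). Proof. by case: (sl2 j). Qed.

Lemma wt_HXij i j : i != j -> wt (H i) 0 (X j).
Proof. by move=> ne; have := wt_HX i j; rewrite (negPf ne). Qed.

Lemma wt_HYij i j : i != j -> wt (H i) 0 (Y j).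
Proof. by move=> ne; rewrite /wt scale0r (lie_HY fam ne). Qed.

Lemma wt_HYii j : wt (H j) (- 2) (Y j). Proof. by case: (sl2 j). Qed.

Definition joint v := (exists c, wt H0 c v) /\ forall j, exists c, wt (H j) c v.

Lemma joint_ind (W W' : {vspace g}) :
  {in W, forall w, lie H0 w \in W} -> (forall j, {in W, forall w, lie (H j) w \in W}) ->
  (forall w, w \in W -> joint w -> w \in W') -> (W <= W')%VS.
Proof.
move=> s0 sj sub; apply: (@weights_span _ _ (H0 :: [seq H j | j <- enum 'I_k.+1])).
- move=> h; rewrite inE => /orP[/eqP->|/mapP[j _ ->]]; last exact: H_diag.
  exact: diag_H0.
- have H0H j : lie H0 (H j) = 0 by rewrite wt_H0_H scale0r.
  move=> h h'; rewrite !inE => /orP[/eqP->|/mapP[j _ ->]] /orP[/eqP->|/mapP[j' _ ->]] //.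
  + exact: liexx.
  + by rewrite lieC H0H oppr0.
  + exact: HH.
- by move=> h; rewrite inE => /orP[/eqP->|/mapP[j _ ->]]; [exact: s0 | exact: sj].
move=> w wW hw; apply: sub => //; split; first by apply: hw; rewrite mem_head.
by move=> j; apply: hw; rewrite inE; apply/orP; right; apply: map_f; rewrite mem_enum.
Qed.

(** The joint eigenvectors span, so one of them pairs with B; a nonzero pairing forces opposite
    weights. *)
Lemma dual_eigenvector B : B != 0 -> exists A, [/\ killing A B != 0, joint A,
  forall c, wt H0 c B -> wt H0 (- c) A & forall j c, wt (H j) c B -> wt (H j) (- c) A].
Proof.
move=> B0; have [A [kA jA]] : exists A, killing A B != 0 /\ joint A.
  apply: contrapT => no; case/eqP: B0; apply: killing_nondeg => y.
  pose W' := lker (linfun (killing B : g -> F^o)).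
  suff /subvP/(_ y (memvf y)) : (fullv <= W')%VS by rewrite memv_ker lfunE => /eqP.
  apply: joint_ind => [w _|j w _|w _ jw]; [exact: memvf | exact: memvf |].
  rewrite memv_ker lfunE /= killingC; apply/negPn/negP => kw.
  by apply: no; exists w.
have opp h c d : wt h c B -> wt h d A -> wt h (- c) A.
  move=> hB hA; have [<- //|ne] := eqVneq d (- c); case/eqP: kA.
  by apply: killing_wt hA hB _; rewrite addr_eq0.
by exists A; split=> // [c hB|j c hB]; [case: jA => [[d hd] _] | case: jA => [_ /(_ j)[d hd]]];
  exact: opp hB hd.
Qed.

Lemma plus_wtP j c v : wt H0 2 v -> v != 0 -> wt (H j) c v -> [\/ c = 0, c = 1 | c = 2].
Proof. exact: (plus_wt (sl2 j) (X2 j) (Y2 j)). Qed.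

Lemma plus_wt0 j c v : wt H0 2 v -> wt (H j) c v -> c != 0 -> c != 1 -> c != 2 -> v = 0.
Proof.
move=> v2 vj c0 c1 c2; apply/eqP; apply: contraT => v0.
by case: (plus_wtP v2 v0 vj) => e; rewrite e eqxx in c0 c1 c2.
Qed.

Lemma plus_wtN1 j v : wt H0 2 v -> wt (H j) (- 1) v -> v = 0.
Proof.
move=> v2 vj; apply: (plus_wt0 v2 vj); first by rewrite oppr_eq0 oner_neq0.
  by nat_neq.
by nat_neq.
Qed.

Lemma plus_wt3 j v : wt H0 2 v -> wt (H j) 3 v -> v = 0.
Proof.
move=> v2 vj; apply: (plus_wt0 v2 vj); first exact: nat0 2.
  by nat_neq.
by nat_neq.
Qed.

Lemma plus_g0 h v : wt H0 0 h -> wt H0 2 v -> wt H0 2 (lie h v).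
Proof. by move=> h0 v2; apply: wt_lie0l. Qed.

Lemma wt_H_lie h c v j : wt (H j) 0 h -> wt (H j) c v -> wt (H j) c (lie h v).
Proof. by move=> h0 vc; apply: wt_lie0l. Qed.

Lemma wt_pr_stable j (h : g) (h' : g) c v : lie h' h = 0 -> wt h' c v ->
  [/\ wt h' c (pr0 h v), wt h' c (pr1 h v) & wt h' c (pr2 h v)].
Proof.
move=> hh vc; have h0 u : wt h' c u -> wt h' c (lie h u).
  by move=> uc; apply: wt_lie0l => //; rewrite /wt scale0r.
have v1 := h0 _ vc; have v2 := h0 _ v1.
have p1 : wt h' c (pr1 h v) by apply: wtD; [exact: wtZ | exact: wtN].
have p2 : wt h' c (pr2 h v) by apply: wtZ; apply: wtD => //; exact: wtN.
by split=> //; do 2?[apply: wtD; last exact: wtN].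
Qed.

(** A is dual to [Y_j, v], which is nonzero because [X_j, [Y_j, v]] = -v; invariance of the Killing
    form turns the nonzero pairing of A with [Y_j, v] into [A, v] != 0. *)
Lemma exists_partner j v : wt H0 2 v -> wt (H j) 1 v -> v != 0 ->
  exists A, [/\ wt H0 0 A, wt (H j) 1 A, lie A v != 0 &
    forall i, wt (H i) 0 v -> wt (H i) 0 A].
Proof.
move=> v2 vj v0; pose B := lie (Y j) v.
have B0 : B != 0.
  apply: contraNneq v0 => e; have := lower1 (sl2 j) (X2 j) v2 vj.
  by rewrite -/B e lie0r => /esym/eqP; rewrite oppr_eq0.
have [A [kA _ A0 Aj]] := dual_eigenvector B0.
exists A; split.
- by rewrite -[0]oppr0; apply: A0; rewrite -(addNr 2); apply: wt_lie.
- rewrite -[1]opprK; apply: Aj; rewrite (_ : - 1 = - 2 + 1); last by ring.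
  exact: wt_lie (wt_HYii j) vj.
- apply: contraNneq kA => e; rewrite -killing_lie.
  by rewrite (lieC A) killingNl killing_lie e killing0r oppr0.
- move=> i vi; have [eij|ne] := eqVneq i j.
    by rewrite eij in vi; case/eqP: v0; apply: (wt_uniq vi vj); rewrite eq_sym oner_neq0.
  rewrite -[0]oppr0; apply: Aj; apply: wt_lie0l vi.
  exact: wt_HYij.
Qed.

Lemma nilp_H j c A : wt (H j) c A -> c != 0 -> ad_nilpotent A.
Proof. exact: ad_nilpotent_wt (H_diag j). Qed.

(** Gaussian elimination with pivot c X_j: B is chosen with [B, c X_j] = -Z1, and the weight-0 part
    becomes the Schur complement. *)
Lemma eliminate j c Z1 Z0 : c != 0 -> wt H0 2 Z1 -> wt H0 2 Z0 ->
  wt (H j) 1 Z1 -> wt (H j) 0 Z0 -> exists B, [/\ wt H0 0 B, ad_nilpotent B,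
  expE B (c *: X j + Z1 + Z0) = c *: X j + (Z0 - (2 * c)^-1 *: lie (lie (Y j) Z1) Z1) &
  forall i, i != j -> expE B (X i) = X i].
Proof.
move=> c0 Z12 Z02 Z1j Z0j; pose B := - c^-1 *: lie (Y j) Z1.
have B0 : wt H0 0 B by apply: wtZ; rewrite -(addNr 2); apply: wt_lie.
have Bj : wt (H j) (- 1) B.
  apply: wtZ; rewrite (_ : - 1 = - 2 + 1); last by ring.
  exact: wt_lie (wt_HYii j) Z1j.
have BXj : lie B (c *: X j) = - Z1.
  rewrite lieZr /B lieZl scalerA mulrN divff // scaleN1r lie_lie (plus_lie Z12 (X2 j)) lie0r.
  by case: (sl2 j) => _ _ ->; rewrite sub0r -lieC Z1j scale1r.
have BZ0 : lie B Z0 = 0 by apply: (@plus_wtN1 j); [exact: plus_g0 | exact: wt_lie0r].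
have BBZ1 : lie B (lie B Z1) = 0.
  apply: (@plus_wtN1 j); first by do 2!apply: plus_g0 => //.
  by rewrite (_ : - 1 = - 1 + (- 1 + 1)); [do 2!apply: wt_lie => // | ring].
have nB : ad_nilpotent B by apply: (nilp_H Bj); rewrite oppr_eq0 oner_neq0.
exists B; split=> // [|i nij].
  rewrite expEE 2!exp_adD (exp_ad1 nB BZ0) (exp_ad2 nB BBZ1).
  rewrite exp_ad3 // BXj ?lieNr ?BBZ1 ?oppr0 // /B lieZl.
  by lmodf F; rewrite // two0 c0.
rewrite expEE exp_ad1 // /B lieZl lie_lie (plus_lie Z12 (X2 i)) lie0r.
by rewrite (lie_YX fam (_ : j != i)) 1?eq_sym // lie0r subrr scaler0.
Qed.

Lemma pr_split j Z : wt H0 2 Z -> exists Z0 Z1, [/\ Z = pr2 (H j) Z + Z1 + Z0,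
  wt H0 2 Z0 /\ wt H0 2 Z1, wt (H j) 0 Z0 /\ wt (H j) 1 Z1, wt H0 2 (pr2 (H j) Z) &
  forall i, wt (H i) 0 Z -> wt (H i) 0 Z0 /\ wt (H i) 0 Z1].
Proof.
move=> Z2; exists (pr0 (H j) Z), (pr1 (H j) Z).
have [] : [/\ wt H0 2 (pr0 (H j) Z), wt H0 2 (pr1 (H j) Z) & wt H0 2 (pr2 (H j) Z)].
  by apply: wt_pr_stable => //; rewrite wt_H0_H scale0r.
split=> //; first by rewrite {1}(pr_sum (H j) Z); lmod F.
  by split; [exact: (wt_pr0 (sl2 j)) | exact: (wt_pr1 (sl2 j))].
by move=> i /(@wt_pr_stable j _ _ _ _ (HH i j))[].
Qed.

(** S is the set of pivots already cleared, and Z is the remainder. A further index j acts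
    nontrivially on Z as long as Z is nonzero, by completeness of the frame; if the X_j-component
    vanishes, a pivot is first created by the exponential of a partner which commutes with the X_i
    for i in S. *)
Lemma diagonalize_step (S : {set 'I_k.+1}) (a : 'I_k.+1 -> F) Z :
  wt H0 2 Z -> (forall i, i \in S -> wt (H i) 0 Z) ->
  exists phi, G phi /\ exists b, phi (\sum_(i in S) a i *: X i + Z) = \sum_i b i *: X i.
Proof.
have [n le_n] := ubnP #|~: S|; elim: n S a Z le_n => // n IH S a Z /ltnSE le_n Z2 ZS.
have [Z0|Zn0] := eqVneq Z 0.
  exists \1%VF; split; first exact: Ggrp_id.
  exists (fun i => if i \in S then a i else 0); rewrite id_lfunE Z0 addr0.
  by rewrite big_mkcond; apply: eq_bigr => i _; case: ifP; rewrite ?scale0r.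
have [j jZ] : exists j, ~ wt (H j) 0 Z.
  apply: contrapT => no; case/eqP: Zn0; apply: (frame_stop frame) => // j.
  by apply: contrapT => h; apply: no; exists j.
have jS : j \notin S by apply/negP => /ZS.
have ne_S i : i \in S -> i != j by move=> iS; apply: contraNneq jS => <-.
pose fixS phi := forall i, i \in S -> phi (X i) = X i.
have fixsum (phi : 'End(g)) Z' : fixS phi ->
    phi (\sum_(i in S) a i *: X i + Z') = \sum_(i in S) a i *: X i + phi Z'.
  move=> fx; rewrite linearD linear_sum; congr (_ + _); apply: eq_bigr => i iS.
  by rewrite linearZ /= fx.
have [phi [Gphi fphi [Z'S p2]]] : exists phi : 'End(g), [/\ G phi, fixS phi &
    (forall i, i \in S -> wt (H i) 0 (phi Z)) /\ pr2 (H j) (phi Z) != 0].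
  have [p2|p2] := eqVneq (pr2 (H j) Z) 0; last first.
    by exists \1%VF; split=> [|i _|]; rewrite ?id_lfunE //; exact: Ggrp_id.
  have [Z0 [Z1 [ZE [Z02 Z12] [Z0j Z1j] _ Zi]]] := pr_split j Z2.
  rewrite p2 add0r in ZE.
  have Z1n0 : Z1 != 0 by apply/eqP => e; apply: jZ; rewrite ZE e add0r.
  have [A [A0 Aj AZ1 AS]] := exists_partner Z12 Z1j Z1n0.
  have AiS i : i \in S -> wt (H i) 0 A by move=> /ZS/Zi[_]; exact: AS.
  have AX i : i \in S -> lie A (X i) = 0.
    move=> iS; apply/eqP; apply: contraT => n0.
    have jni : j != i by rewrite eq_sym ne_S.
    have := wt2_excl fam jni (plus_g0 A0 (X2 i)) n0 (wt_H_lie (AiS i iS) (wt_HXii i))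
      (wt_lie0r Aj (wt_HXij jni)).
    by move/eqP; rewrite oner_eq0.
  have AAZ1 : lie A (lie A Z1) = 0.
    apply: (@plus_wt3 j); first by do 2!apply: plus_g0 => //.
    by rewrite (_ : 3 = 1 + (1 + 1)); [do 2!apply: wt_lie => // | ring].
  have AAAZ0 : lie A (lie A (lie A Z0)) = 0.
    apply: (@plus_wt3 j); first by do 3!apply: plus_g0 => //.
    by rewrite (_ : 3 = 1 + (1 + (1 + 0))); [do 3!apply: wt_lie => // | ring].
  (* The new X_j-component is the displayed sum. If it vanished for both signs, subtraction would
     give 2 [A, Z1] = 0. *)
  have [s [ss n0]] : exists s, s * s = 1 /\ s *: lie A Z1 + 2^-1 *: lie A (lie A Z0) != 0.
    have [e1|n1] := eqVneq (1 *: lie A Z1 + 2^-1 *: lie A (lie A Z0)) 0; last first.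
      by exists 1; rewrite mulr1.
    exists (- 1); split; first by rewrite mulrNN mulr1.
    apply: contraNneq AZ1 => e2; apply/eqP/(scalerI two0).
    by rewrite scaler0 -[RHS]subr0 -{1}e1 -e2; lmod F.
  have nsA : ad_nilpotent (s *: A) by apply: (@nilp_H j 1); [exact: wtZ | exact: oner_neq0].
  exists (expE (s *: A)); split; first by apply: Ggrp_exp => //; exact: wtZ.
    by move=> i iS; rewrite expEE exp_ad1 // lieZl AX // scaler0.
  have -> : expE (s *: A) Z =
      Z0 + (Z1 + s *: lie A Z0) + (s *: lie A Z1 + 2^-1 *: lie A (lie A Z0)).
    rewrite expEE ZE addrC exp_adD exp_ad3 // ?lieE ?AAAZ0 ?scaler0 //.
    rewrite exp_ad2 // ?lieE ?AAZ1 ?scaler0 // [s *: (s *: _)]scalerA ss scale1r.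
    by lmod F.
  split=> [i iS|].
    have [z0 z1] := Zi i (ZS i iS); have Ai := AiS i iS.
    by do !apply: wtD => //; apply: wtZ; do ?apply: wt_H_lie.
  set T2 := _ + 2^-1 *: _ in n0 *; set T1 := _ + s *: _.
  have T1j : wt (H j) 1 T1 by apply: wtD => //; apply: wtZ; exact: wt_lie0r.
  have T2j : wt (H j) 2 T2.
    apply: wtD; apply: wtZ; rewrite (_ : 2 = 1 + 1) ?natrD //; try exact: wt_lie.
    by apply: wt_lie => //; apply: wt_lie0r.
  clearbody T1 T2.
  suff -> : pr2 (H j) (Z0 + T1 + T2) = T2 by [].
  rewrite /pr2 !lieDr T1j T2j Z0j !lieZr T1j T2j Z0j.
  by lmodf F; rewrite // two0.
have Z'2 : wt H0 2 (phi Z) by exact: (Ggrp_wt Gphi Z2).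
have [Z0 [Z1 [Z'E [Z02 Z12] [Z0j Z1j] Z22 Zi]]] := pr_split j Z'2.
have [c cE] := frame_wt2 frame Z22 (wt_pr2 (sl2 j) (X2 j) (Y2 j) Z'2).
have c0 : c != 0 by apply: contraNneq p2 => e; rewrite cE e scale0r.
have [B [B0 nB BE BX]] := eliminate c0 Z12 Z02 Z1j Z0j.
set Z'' := Z0 - _ in BE; pose b i := if i == j then c else a i.
have YZ0 : wt H0 0 (lie (Y j) Z1) by rewrite -(addNr 2); apply: wt_lie.
have Z''2 : wt H0 2 Z'' by apply: wtD => //; apply/wtN/wtZ/plus_g0.
have Z''S i : i \in j |: S -> wt (H i) 0 Z''.
  rewrite !inE => /orP[/eqP->|iS]; apply: wtD => //; [|by have [] := Zi i (Z'S i iS)|]; apply/wtN/wtZ.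
    rewrite (_ : 0 = - 2 + 1 + 1); last by ring.
    exact: wt_lie (wt_lie (wt_HYii j) Z1j) Z1j.
  have [_ z1] := Zi i (Z'S i iS); do 2!apply: wt_H_lie => //; apply: wt_HYij; exact: ne_S.
have [|psi [Gpsi [b' psiE]]] := IH (j |: S) b Z'' _ Z''2 Z''S.
  rewrite (leq_trans _ le_n) //; apply: proper_card; rewrite properE; apply/andP; split.
    by apply/fintype.subsetP => i; rewrite !inE negb_or => /andP[].
  by apply/fintype.subsetPn; exists j; rewrite !inE // eqxx.
exists (psi \o (expE B \o phi))%VF; split.
  apply: Ggrp_comp => //; apply: Ggrp_comp => //; exact: Ggrp_exp.
exists b'; rewrite -psiE !comp_lfunE fixsum // fixsum => [|i /ne_S]; last exact: BX.
rewrite Z'E cE BE; congr (psi _).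
rewrite big_setU1 //= {1}/b eqxx addrA [X in X + Z'']addrC; congr (_ + _ + _).
by apply: eq_bigr => i iS; rewrite /b (negPf (ne_S i iS)).
Qed.

Lemma diagonalize Z : wt H0 2 Z -> exists phi, G phi /\
  exists b, phi Z = \sum_i b i *: X i.
Proof.
move=> Z2; have [|phi [Gphi [b e]]] := @diagonalize_step finset.set0 (fun=> 0) Z Z2.
  by move=> i; rewrite inE.
by exists phi; split=> //; exists b; rewrite -e finset.big_set0 add0r.
Qed.

End FrameWeights.
Let HXij := wt_HXij.
Let HYij := wt_HYij.
Let wtH0H := wt_H0_H.

Section FrameStructure.
Implicit Types (i j : 'I_k.+1) (u v w z A B Z : g) (phi : 'End(g)).

(** Lowering by Y_i and Y_j leads to a nonzero vector of V- on which H_l still has weight 1, while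
    its weights on V- are not positive. *)
Lemma three_ones i j l v : i != j -> i != l -> j != l -> wt H0 2 v ->
  wt (H i) 1 v -> wt (H j) 1 v -> wt (H l) 1 v -> v = 0.
Proof.
move=> nij nil njl v2 vi vj vl; apply/eqP; apply: contraT => v0.
pose y1 := lie (Y i) v; pose y2 := lie (Y j) y1.
have y1n0 : y1 != 0.
  apply: contraNneq v0 => e; have := lower1 (sl2 i) (X2 i) v2 vi.
  by rewrite -/y1 e lie0r => /esym/eqP; rewrite oppr_eq0.
have Xjy1 : lie (X j) y1 = 0.
  rewrite lieJ (plus_lie (X2 j) v2) lie0r addr0.
  by rewrite (lieC (X j)) (lie_YX fam nij) oppr0 lie0l.
have y1j : wt (H j) 1 y1 by apply: wt_lie0l vj; apply: HYij; rewrite eq_sym.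
have y1l : wt (H l) 1 y1 by apply: wt_lie0l vl; apply: HYij; rewrite eq_sym.
have y2n0 : y2 != 0.
  apply: contraNneq y1n0 => e; have := lie_XY (sl2 j) y1.
  by rewrite -/y2 e lie0r Xjy1 lie0r y1j scale1r sub0r => /esym/eqP; rewrite oppr_eq0.
have y2l : wt (H l) 1 y2 by apply: wt_lie0l y1l; apply: HYij; rewrite eq_sym.
have y22 : wt H0 (- 2) y2.
  rewrite (_ : - 2 = - 2 + (- 2 + 2)); last by ring.
  by apply: wt_lie => //; apply: wt_lie.
have [] := minus_wt (sl2 l) (X2 l) (Y2 l) y22 y2n0 y2l.
- by move/eqP; rewrite oner_eq0.
- by move/eqP; rewrite (negPf (neq_natr char0 (n := 1) _)) //; ring.
- by move/eqP; rewrite (negPf (neq_natr char0 (n := 2) _)) //; ring.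
Qed.

Lemma weights_cases (n : 'I_k.+1 -> F) v : wt H0 2 v -> v != 0 ->
  (forall j, wt (H j) (n j) v) ->
  [\/ exists2 j, n j = 2 & forall i, i != j -> n i = 0,
      exists2 j, n j = 1 & forall i, i != j -> n i = 0 |
      exists i j, [/\ i != j, n i = 1, n j = 1 & forall l, l != i -> l != j -> n l = 0]].
Proof.
move=> v2 v0 nv.
have case_n j : [\/ n j = 0, n j = 1 | n j = 2].
  exact: (plus_wtP v2 v0 (nv j)).
have [[j nj]|no2] := pselect (exists j, n j = 2).
  apply: Or31; exists j => // i ne.
  apply: (wt2_excl fam ne v2 v0) (nv i).
  by rewrite -nj.
have case01 j : n j = 0 \/ n j = 1 by case: (case_n j) => e; [left | right | case: no2; exists j].
have [i ni] : exists i, n i = 1.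
  apply: contrapT => no1; case/eqP: v0; apply: (frame_stop frame) => // j.
  by have [<-|e] := case01 j; [exact: nv | case: no1; exists j].
have ni' := nv i; rewrite ni in ni'.
have [[j [nij nj]]|no] := pselect (exists j, i != j /\ n j = 1); last first.
  apply: Or32; exists i => // j ne; have [//|e] := case01 j.
  by case: no; exists j; rewrite eq_sym.
apply: Or33; exists i, j; split=> // l nli nlj.
have [//|e] := case01 l; case/eqP: v0.
have nj' := nv j; rewrite nj in nj'; have nl' := nv l; rewrite e in nl'.
by apply: (@three_ones i j l) => //; rewrite eq_sym.
Qed.

Lemma g0_stable_Vplus h : wt H0 0 h -> {in Vplus H0, forall w, lie h w \in Vplus H0}.
Proof.
by move=> h0 w /wt_eigen w2; apply/wt_eigen; exact: wt_lie0l.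
Qed.

Lemma g0_stable_Vminus h : wt H0 0 h -> {in Vminus H0, forall w, lie h w \in Vminus H0}.
Proof.
by move=> h0 w /wt_eigen w2; apply/wt_eigen; exact: wt_lie0l.
Qed.

Lemma wt_H0_H0 : wt H0 0 H0. Proof. by rewrite /wt liexx scale0r. Qed.

(** By [weights_cases], h = H0 - sum H_j has eigenvalues 0 and 1 on V+, hence 0 and -1 on V- by
    duality. A diagonal conjugate Z of I+ commutes with h, and (ad Z)^2 maps V- onto V+, so the
    eigenvalue 1 cannot occur; then h kills V+ and vanishes. *)
Lemma H0_sum : H0 = \sum_j H j.
Proof.
pose h := H0 - \sum_j H j; apply/eqP; rewrite -subr_eq0 -/h; apply/eqP.
have h0 : wt H0 0 h by apply: wtD; [exact: wt_H0_H0 | apply/wtN/wt_sum].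
have wth c n v : wt H0 c v -> (forall j, wt (H j) (n j) v) -> wt h (c - \sum_j n j) v.
  move=> vc nv; rewrite /wt /h lieDl lieNl vc scalerBl lie_suml scaler_suml.
  by congr (_ - _); apply: eq_bigr => j _; exact: nv.
have joint_h v : joint v -> wt H0 2 v -> v != 0 ->
    exists2 c, wt h c v & c = 0 \/ c = 1.
  move=> [_ jv] v2 v0; have [n nv] := choice jv.
  exists (2 - \sum_j n j); first exact: wth.
  case: (weights_cases v2 v0 nv) => [[j nj no]|[j nj no]|[i [j [ne ni nj no]]]].
  - by left; rewrite (bigD1 j) //= nj big1 ?addr0 ?subrr.
  - by right; rewrite (bigD1 j) //= nj big1 ?addr0 //; ring.
  - left; rewrite (bigD1 i) //= ni (bigD1 j) /= 1?eq_sym // nj big1; first by ring.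
    by move=> l /andP[nli nlj]; exact: no.
have minus_h u : wt H0 (- 2) u -> lie h (lie h u) = - lie h u.
  have sub : (Vminus H0 <= lker ((ad h \o ad h)%VF + ad h)%R)%VS.
    apply: joint_ind.
    - exact: g0_stable_Vminus wt_H0_H0.
    - by move=> j; exact: g0_stable_Vminus.
    move=> w /wt_eigen w2 jw; rewrite memv_ker add_lfunE comp_lfunE !adE.
    have [->|w0] := eqVneq w 0; first by rewrite !lie0r addr0.
    have [A [kA jA A0 Aj]] := dual_eigenvector w0.
    have A2 : wt H0 2 A by rewrite -[2]opprK; exact: A0.
    have An0 : A != 0 by apply: contraNneq kA => ->; rewrite killing0l.
    have [c hA c01] := joint_h A jA A2 An0.
    have hw : wt h (- c) w.
      have [n nw] := choice jw.2; have hw := wth _ _ _ w2 nw.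
      have [<- //|ne] := eqVneq (- 2 - \sum_j n j) (- c); case/eqP: kA.
      by apply: killing_wt hA hw _; rewrite addrC addr_eq0.
    by rewrite hw lieZr hw scalerA -scalerDl; case: c01 => ->;
      rewrite ?oppr0 ?mul0r ?addr0 ?scale0r ?mulrNN ?mulr1 ?subrr ?scale0r.
  move/wt_eigen/(subvP sub); rewrite memv_ker add_lfunE comp_lfunE !adE addr_eq0.
  by move/eqP.
have [Im [Ip [/wt_eigen Im2 /wt_eigen Ip2 slI]]] := graded_sl2 hgraded.
have [phi [Gphi [b phiE]]] := diagonalize Ip2.
pose Z := phi Ip; have Z2 : wt H0 2 Z by exact: (Ggrp_wt Gphi Ip2).
have hZ : lie h Z = 0.
  rewrite /Z phiE lie_sumr big1 // => j _; rewrite lieZr /h lieDl lieNl X2.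
  rewrite lie_suml (bigD1 j) //= wt_HXii big1 ?addr0 ?subrr ?scaler0 //.
  by move=> i ne; rewrite HXij // scale0r.
have slZ : sl2_triple (phi Im) H0 Z.
  have [h1 h2 h3] := slI; have [_ pH] := Gphi; split.
  - by rewrite -{1}pH -(Ggrp_lie _ _ Gphi) h1 linearZ.
  - by rewrite -{1}pH -(Ggrp_lie _ _ Gphi) h2 linearZ.
  - by rewrite -(Ggrp_lie _ _ Gphi) h3.
(* All of V+ has weight 2 for the neutral element H0 of the triple of Z, so [lower22] inverts (ad
   Z)^2. *)
have ZZ v : wt H0 2 v -> exists2 u, wt H0 (- 2) u & v = lie Z (lie Z u).
  move=> v2; have Im2' := Ggrp_wt Gphi Im2.
  exists (4^-1 *: lie (phi Im) (lie (phi Im) v)).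
    apply: wtZ; rewrite (_ : - 2 = - 2 + (- 2 + 2)); last by ring.
    by apply: wt_lie => //; apply: wt_lie.
  by rewrite !lieZr (lower22 slZ Z2 v2 v2) scalerA mulVf ?scale1r ?(nat0 3).
have plus_h v : wt H0 2 v -> lie h v = 0.
  have sub : (Vplus H0 <= lker (ad h))%VS.
    apply: joint_ind.
    - exact: g0_stable_Vplus wt_H0_H0.
    - by move=> j; exact: g0_stable_Vplus.
    move=> w /wt_eigen w2 jw; rewrite memv_ker adE.
    have [->|w0] := eqVneq w 0; first by rewrite !lie0r.
    have [c hw [] c01] := joint_h w jw w2 w0; first by rewrite hw c01 scale0r.
    have [u u2 wE] := ZZ w w2.
    have hZc z : lie h (lie Z z) = lie Z (lie h z) by rewrite lieJ hZ lie0l add0r.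
    have : lie h (lie h w) = - lie h w by rewrite wE !hZc minus_h // !lieNr.
    rewrite hw c01 !scale1r hw c01 scale1r => /eqP.
    by rewrite -subr_eq0 opprK -mulr2n -scaler_nat scaler_eq0 (negPf two0).
  by move/wt_eigen/(subvP sub); rewrite memv_ker adE => /eqP.
exact: g0_faithful h0 plus_h.
Qed.

Lemma wt_H0_joint (n : 'I_k.+1 -> F) v : (forall j, wt (H j) (n j) v) ->
  wt H0 (\sum_j n j) v.
Proof.
move=> nv; rewrite /wt {1}H0_sum lie_suml scaler_suml.
by apply: eq_bigr => j _; exact: nv.
Qed.

Definition Eij i j (c d : F) v : Prop :=
  [/\ wt (H i) c v, wt (H j) d v & forall s, s != i -> s != j -> wt (H s) 0 v].

Lemma Eij_sym i j c d v : Eij i j c d v -> Eij j i d c v.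
Proof. by case=> vi vj vs; split=> // s sj si; exact: vs. Qed.

Lemma Eij_H0 i j c d v : i != j -> Eij i j c d v -> wt H0 (c + d) v.
Proof.
move=> ne [vi vj vs].
pose n s := if s == i then c else if s == j then d else 0.
have -> : c + d = \sum_s n s.
  rewrite (bigD1 i) //= {1}/n eqxx (bigD1 j) /= 1?eq_sym // {1}/n eqxx.
  rewrite eq_sym (negPf ne) big1 ?addr0 // => s /andP[si sj].
  by rewrite /n (negPf si) (negPf sj).
apply: wt_H0_joint => s; rewrite /n; case: eqP => [->//|/eqP si].
by case: eqP => [->//|/eqP sj]; exact: vs.
Qed.

Lemma Eij_V i j v : i != j -> Eij i j 1 1 v -> wt H0 2 v.
Proof. exact: Eij_H0. Qed.

Lemma Eij_g0 i j v : i != j -> Eij i j 1 (- 1) v -> wt H0 0 v.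
Proof. by rewrite -(subrr 1); exact: Eij_H0. Qed.

Lemma EijD i j c d v w : Eij i j c d v -> Eij i j c d w -> Eij i j c d (v + w).
Proof.
by move=> [vi vj vs] [wi wj ws]; split; [exact: wtD | exact: wtD |] => s si sj;
  apply: wtD; [exact: vs | exact: ws].
Qed.

Lemma EijZ i j c d e v : Eij i j c d v -> Eij i j c d (e *: v).
Proof. by move=> [vi vj vs]; split=> [||s si sj]; apply: wtZ => //; exact: vs. Qed.

Lemma Eij_lie i j c d c' d' v w : Eij i j c d v -> Eij i j c' d' w ->
  Eij i j (c + c') (d + d') (lie v w).
Proof.
move=> [vi vj vs] [wi wj ws]; split; [exact: wt_lie | exact: wt_lie |] => s si sj.
by apply: wt_lie0r; [exact: vs | exact: ws].
Qed.

Lemma Eij_X i j : i != j -> Eij i j 0 2 (X j).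
Proof.
move=> ne; split; [exact: HXij | exact: wt_HXii j |] => s si sj; exact: HXij.
Qed.

Lemma Eij_Y i j : i != j -> Eij i j 0 (- 2) (Y j).
Proof.
move=> ne; split; [exact: HYij | exact: wt_HYii j |] => s si sj; exact: HYij.
Qed.

Lemma Eij_X' i j : i != j -> Eij i j 2 0 (X i).
Proof. by move=> ne; apply/Eij_sym/Eij_X; rewrite eq_sym. Qed.

Lemma Eij_Y' i j : i != j -> Eij i j (- 2) 0 (Y i).
Proof. by move=> ne; apply/Eij_sym/Eij_Y; rewrite eq_sym. Qed.

Lemma Eij_cast i j c d c' d' v : Eij i j c d v -> c = c' -> d = d' -> Eij i j c' d' v.
Proof. by move=> + <- <-. Qed.

(** Peirce decomposition of V+. A vector with a single nonzero weight, equal to 1, would have degree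
    1 by [H0_sum]. *)
Lemma frame_span (W : {vspace g}) : (forall j, X j \in W) ->
  (forall i j v, i != j -> Eij i j 1 1 v -> v \in W) -> (Vplus H0 <= W)%VS.
Proof.
move=> XW EW; apply: joint_ind.
- exact: g0_stable_Vplus wt_H0_H0.
- by move=> j; exact: g0_stable_Vplus.
move=> v /wt_eigen v2 [_ jv]; have [->|v0] := eqVneq v 0; first exact: mem0v.
have [n nv] := choice jv.
case: (weights_cases v2 v0 nv) => [[j nj no]|[j nj no]|[i [j [ne ni nj no]]]].
- have [|c ->] := frame_wt2 frame v2 (j := j); last exact: memvZ.
  by rewrite -nj.
- have := wt_H0_joint nv; rewrite (bigD1 j) //= nj big1 // addr0 => v1.
  case/eqP: v0; apply: (wt_uniq v1 v2).
  by nat_neq.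
- apply: (EW i j v ne); split; [by rewrite -ni | by rewrite -nj |] => s si sj.
  by rewrite -(no s si sj).
Qed.

(** The sl2-triple of a diagonal element; [b^-1 = 0] for [b = 0]. *)
Definition diagX (b : 'I_k.+1 -> F) := \sum_i b i *: X i.
Definition diagY (b : 'I_k.+1 -> F) := \sum_i (b i)^-1 *: Y i.
Definition diagH (b : 'I_k.+1 -> F) := \sum_i ((b i)^-1 * b i) *: H i.

Lemma wt_diagX b : wt H0 2 (diagX b).
Proof. by apply: wt_sum => i _; exact: wtZ. Qed.

Lemma wt_diagY b : wt H0 (- 2) (diagY b).
Proof. by apply: wt_sum => i _; exact: wtZ. Qed.

Lemma lie_diagY b j : lie (diagY b) (X j) = (b j)^-1 *: H j.
Proof.
rewrite lie_suml (bigD1 j) //= lieZl; have [_ _ ->] := sl2 j.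
by rewrite big1 ?addr0 // => i ne; rewrite lieZl (lie_YX fam ne) scaler0.
Qed.

Lemma lie_HdiagX b j : lie (H j) (diagX b) = (2 * b j) *: X j.
Proof.
rewrite lie_sumr (bigD1 j) //= lieZr wt_HXii scalerA mulrC.
by rewrite big1 ?addr0 // => i ne; rewrite lieZr HXij 1?eq_sym // scale0r scaler0.
Qed.

Lemma lie_HdiagY b j : lie (H j) (diagY b) = (- 2 * (b j)^-1) *: Y j.
Proof.
rewrite lie_sumr (bigD1 j) //= lieZr wt_HYii scalerA mulrC.
by rewrite big1 ?addr0 // => i ne; rewrite lieZr HYij 1?eq_sym // scale0r scaler0.
Qed.

Lemma diag_sl2 b : sl2_triple (diagY b) (diagH b) (diagX b).
Proof.
have bb (c : F) : c^-1 * c * c = c by have [->|c0] := eqVneq c 0; rewrite ?mulr0 // mulVf ?mul1r.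
have bb' (c : F) : c^-1 * c * c^-1 = c^-1.
  by have [->|c0] := eqVneq c 0; rewrite ?invr0 ?mulr0 // mulVf ?mul1r.
split.
- rewrite /diagH lie_suml /diagX scaler_sumr; apply: eq_bigr => i _.
  by rewrite lieZl -/(diagX b) lie_HdiagX !scalerA mulrCA bb.
- rewrite /diagH lie_suml /diagY scaler_sumr; apply: eq_bigr => i _.
  by rewrite lieZl -/(diagY b) lie_HdiagY !scalerA mulrCA bb'.
- rewrite /diagX lie_sumr; apply: eq_bigr => i _.
  by rewrite lieZr lie_diagY scalerA mulrC.
Qed.

Lemma diagH_full b : (forall i, b i != 0) -> diagH b = H0.
Proof.
by move=> b0; rewrite H0_sum; apply: eq_bigr => i _; rewrite mulVf ?scale1r.
Qed.

Lemma diagX_inj_minus b y : (forall i, b i != 0) -> wt H0 (- 2) y ->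
  lie y (diagX b) = 0 -> y = 0.
Proof.
move=> b0 y2 e; have := diag_sl2 b; rewrite diagH_full // => s.
have := minus_YX wtN4 s (wt_diagY b) y2.
rewrite (lieC (diagX b)) e oppr0 lie0r y2 => /esym/eqP.
by rewrite scaler_eq0 oppr_eq0 (negPf two0) => /eqP.
Qed.

(** An element of V- is determined by its bracket with [diagX a], and both sides give H0.
    Consequently phi fixes each H_j, the bracket of the sum of the Y_i with X_j: this puts it in
    L. *)
Lemma diag_fix_Y phi (a : 'I_k.+1 -> F) : G phi -> (forall i, a i != 0) ->
  (forall i, phi (X i) = a i *: X i) -> phi (diagY (fun=> 1)) = diagY a.
Proof.
move=> Gphi a0 phiX; apply: subr0_eq.
have [_ pH] := Gphi; apply: (diagX_inj_minus a0).
  by apply: wtD; [exact: (Ggrp_wt Gphi (wt_diagY _)) | apply/wtN/wt_diagY].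
have -> : diagX a = phi (diagX (fun=> 1)).
  by rewrite linear_sum; apply: eq_bigr => i _; rewrite linearZ /= scale1r phiX.
rewrite lieDl lieNl -(Ggrp_lie _ _ Gphi).
have -> : phi (diagX (fun=> 1)) = diagX a.
  by rewrite linear_sum; apply: eq_bigr => i _; rewrite linearZ /= scale1r phiX.
have [_ _ ->] := diag_sl2 (fun=> 1); have [_ _ ->] := diag_sl2 a.
by rewrite !diagH_full ?pH ?subrr // => i; exact: oner_neq0.
Qed.

Lemma diag_Lgrp phi (a : 'I_k.+1 -> F) : G phi -> (forall i, a i != 0) ->
  (forall i, phi (X i) = a i *: X i) -> Lgrp iota H0 H phi.
Proof.
move=> Gphi a0 phiX; split=> // h.
have phiH j : phi (H j) = H j.
  have e : lie (diagY (fun=> 1)) (X j) = H j by rewrite lie_diagY invr1 scale1r.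
  rewrite -{1}e (Ggrp_lie _ _ Gphi) (diag_fix_Y Gphi a0 phiX) phiX lieZr lie_diagY.
  by rewrite scalerA mulfV ?scale1r.
case/memv_sumP => f fE ->; rewrite linear_sum; apply: eq_bigr => j _.
by have /vlineP[c ->] := fE j isT; rewrite linearZ /= phiH.
Qed.

(** Image of the quadratic operator of the Jordan pair (V+, V-); its dimension is constant on orbits
    and separates the ranks. *)
Definition imsq Z : {vspace g} := ((ad Z \o ad Z)%VF @: Vminus H0)%VS.

Lemma imsqP Z v : reflect (exists2 u, wt H0 (- 2) u & v = lie Z (lie Z u)) (v \in imsq Z).
Proof.
apply: (iffP memv_imgP) => [[u /wt_eigen u2 ->]|[u u2 ->]].
  by exists u; rewrite // comp_lfunE !adE.
by exists u; rewrite ?comp_lfunE ?adE //; apply/wt_eigen.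
Qed.

Lemma wt_diagXX b u : wt H0 (- 2) u -> wt H0 2 (lie (diagX b) (lie (diagX b) u)).
Proof.
move=> u2; rewrite (_ : 2 = 2 + (2 + - 2)); last by ring.
exact: wt_lie (wt_diagX b) (wt_lie (wt_diagX b) u2).
Qed.

(** If b j = 0, H_j commutes with [diagX b]; its weights are not positive on V- and not negative on
    V+, so only weight 0 passes from one to the other. Conversely the triple [diag_sl2] inverts (ad
    X)^2 on its weight-2 space. *)
Lemma imsq_diag b v : v \in imsq (diagX b) <->
  wt H0 2 v /\ forall j, b j = 0 -> wt (H j) 0 v.
Proof.
split=> [/imsqP[u u2 ->]|[v2 vj]].
  split=> [|j bj]; first exact: wt_diagXX.
  pose T := (ad (H j) \o (ad (diagX b) \o ad (diagX b)))%VF.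
  suff /subvP/(_ u) : (Vminus H0 <= lker T)%VS.
    rewrite memv_ker !comp_lfunE !adE => h; rewrite /wt scale0r; apply/eqP/h.
    exact/wt_eigen.
  apply: joint_ind.
  - exact: g0_stable_Vminus wt_H0_H0.
  - by move=> i; exact: g0_stable_Vminus.
  move=> w /wt_eigen w2 [_ /(_ j)[c wc]]; rewrite memv_ker !comp_lfunE !adE.
  have [->|w0] := eqVneq w 0; first by rewrite !lie0r.
  have Hd : wt (H j) 0 (diagX b) by rewrite /wt lie_HdiagX bj mulr0 !scale0r.
  have T2 : wt H0 2 (lie (diagX b) (lie (diagX b) w)).
    exact: wt_diagXX.
  have Tc : wt (H j) c (lie (diagX b) (lie (diagX b) w)) by apply: wt_lie0l => //; apply: wt_lie0l.
  rewrite Tc; case: (minus_wt (sl2 j) (X2 j) (Y2 j) w2 w0 wc) => e.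
  - by rewrite e scale0r.
  - by rewrite e in Tc *; rewrite (plus_wtN1 T2 Tc) scaler0.
  - rewrite e in Tc *; rewrite (plus_wt0 T2 Tc) ?scaler0 ?oppr_eq0 //.
      by nat_neq.
    by nat_neq.
apply/imsqP; exists (4^-1 *: lie (diagY b) (lie (diagY b) v)).
  apply: wtZ; rewrite (_ : - 2 = - 2 + (- 2 + 2)); last by ring.
  by apply: wt_lie; [exact: wt_diagY | apply: wt_lie => //; exact: wt_diagY].
have vh : wt (diagH b) 2 v.
  rewrite /wt -v2 H0_sum /diagH !lie_suml; apply: eq_bigr => j _.
  have [bj|bj] := eqVneq (b j) 0; last by rewrite mulVf ?scale1r.
  by rewrite bj mulr0 scale0r lie0l (vj j bj) scale0r.
rewrite !lieZr (lower22 (diag_sl2 b) (wt_diagX b) v2 vh).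
by rewrite scalerA mulVf ?scale1r ?(nat0 3).
Qed.

Lemma imsq_G phi Z : G phi -> imsq (phi Z) = (phi @: imsq Z)%VS.
Proof.
move=> Gphi; apply/vspaceP => v; apply/imsqP/memv_imgP => [[u u2 ->]|[w /imsqP[u u2 ->] ->]].
  have ker0 := Ggrp_lker Gphi.
  exists (lie Z (lie Z ((phi^-1)%VF u))).
    by apply/imsqP; exists ((phi^-1)%VF u) => //; exact: (Ggrp_wt (Ggrp_inv Gphi) u2).
  by rewrite !(Ggrp_lie _ _ Gphi) lker0_lfunVK.
exists (phi u); first exact: (Ggrp_wt Gphi u2).
by rewrite !(Ggrp_lie _ _ Gphi).
Qed.

Lemma dim_imsq_G phi Z : G phi -> \dim (imsq (phi Z)) = \dim (imsq Z).
Proof.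
move=> Gphi; rewrite imsq_G // limg_dim_eq //.
by rewrite (eqP (Ggrp_lker Gphi)) capv0.
Qed.

Definition initX (m : nat) (b : 'I_k.+1 -> F) := diagX (fun i => if (i < m)%N then b i else 0).

Lemma imsq_init_lt m m' b b' : (m < m')%N -> (m' <= k.+1)%N -> (forall i, b i != 0) ->
  (forall i, b' i != 0) -> (\dim (imsq (initX m b)) < \dim (imsq (initX m' b')))%N.
Proof.
move=> lt_m le_m' b0 b'0.
have sub : (imsq (initX m b) <= imsq (initX m' b'))%VS.
  apply/subvP => v /imsq_diag[v2 vj]; apply/imsq_diag; split=> // j.
  case: ifP => [_ /eqP|/negbT]; first by rewrite (negPf (b'0 j)).
  rewrite -leqNgt => le_j _; apply: vj; case: ifP => // lt_j.
  by exfalso; move: le_j lt_j lt_m; clear; lia.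
rewrite ltn_neqAle (dimvS sub) andbT; apply/negP => /eqP e.
have lt_mk : (m < k.+1)%N := leq_trans lt_m le_m'.
pose j : 'I_k.+1 := Ordinal lt_mk.
have : X j \in imsq (initX m' b').
  apply/imsq_diag; split=> [|i]; first exact: X2.
  case: ifP => [_ /eqP|/negbT]; first by rewrite (negPf (b'0 i)).
  rewrite -leqNgt => le_i _; apply: HXij.
  by rewrite -val_eqE /= gtn_eqF // (leq_trans lt_m).
have -> : imsq (initX m' b') = imsq (initX m b) by apply/esym/eqP; rewrite eqEdim sub e leqnn.
case/imsq_diag => _ /(_ j); rewrite ltnn => /(_ erefl) h.
case/eqP: (frame_X0 frame j); apply: (wt_uniq h (wt_HXii j)).
by rewrite eq_sym.
Qed.

Lemma imsq_full b : (imsq (diagX b) == Vplus H0) = [forall i, b i != 0].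
Proof.
apply/eqP/forallP => [e j|b0].
  apply/eqP => bj; have : X j \in imsq (diagX b) by rewrite e; apply/wt_eigen.
  case/imsq_diag => _ /(_ j bj) h; case/eqP: (frame_X0 frame j).
  by apply: (wt_uniq h (wt_HXii j)); rewrite eq_sym.
apply/vspaceP => v; apply/idP/idP => [/imsq_diag[v2 _]|/wt_eigen v2]; first exact/wt_eigen.
by apply/imsq_diag; split=> // j /eqP; rewrite (negPf (b0 j)).
Qed.

Definition Espace i j (c d : F) : {vspace g} :=
  (leigenspace (ad (H i)) c :&: leigenspace (ad (H j)) d :&:
   \bigcap_(s < k.+1 | (s != i) && (s != j)) leigenspace (ad (H s)) 0)%VS.

Lemma EspaceP i j c d v : v \in Espace i j c d <-> Eij i j c d v.
Proof.
split=> [/memv_capP[/memv_capP[/wt_eigen vi /wt_eigen vj] vs]|[vi vj vs]].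
  split=> // s si sj; apply/wt_eigen; move: vs; rewrite memvE => /subv_bigcapP/(_ s).
  by rewrite si sj -memvE => /(_ isT).
apply/memv_capP; split; first by apply/memv_capP; split; apply/wt_eigen.
by rewrite memvE; apply/subv_bigcapP => s /andP[si sj]; rewrite -memvE; apply/wt_eigen/vs.
Qed.

End FrameStructure.
Notation E := Eij.
Notation dX := diagX.
Notation dY := diagY.

(** * The quadratic form on E_ij(1,-1) *)

Section QuadraticForm.
Implicit Types (i j s : 'I_k.+1) (u v w z A B C Z : g) (phi : 'End(g)).

Let EH0 := Eij_H0.

Lemma zero_wt0 s c z : wt H0 0 z -> wt (H s) c z -> c != 0 -> c != 1 -> c != - 1 -> z = 0.
Proof.
move=> z0 zs c0 c1 c2; apply/eqP; apply: contraT => n0.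
by case: (zero_wt (sl2 s) (X2 s) (Y2 s) z0 n0 zs) => e; rewrite e eqxx in c0 c1 c2.
Qed.

Lemma zero_wtN2 s z : wt H0 0 z -> wt (H s) (- 2) z -> z = 0.
Proof.
move=> z0 zs; apply: (zero_wt0 z0 zs); first by rewrite oppr_eq0.
  by nat_neq.
by nat_neq.
Qed.

Lemma minus_wt0 s c v : wt H0 (- 2) v -> wt (H s) c v -> c != 0 -> c != - 1 ->
  c != - 2 -> v = 0.
Proof.
move=> z0 zs c0 c1 c2; apply/eqP; apply: contraT => n0.
by case: (minus_wt (sl2 s) (X2 s) (Y2 s) z0 n0 zs) => e; rewrite e eqxx in c0 c1 c2.
Qed.

Lemma minus_wtN3 s v : wt H0 (- 2) v -> wt (H s) (- 3) v -> v = 0.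
Proof.
move=> v2 vs; apply: (minus_wt0 v2 vs); first by rewrite oppr_eq0 (nat0 2).
  by nat_neq.
by nat_neq.
Qed.

Lemma minus_span j y : wt H0 (- 2) y -> wt (H j) (- 2) y -> exists c, y = c *: Y j.
Proof.
move=> y2 yj; have [c e] : exists c, lie (X j) (lie (X j) y) = c *: X j.
  apply: (frame_wt2 frame).
    rewrite (_ : 2 = 2 + (2 + - 2)); last by ring.
    exact: wt_lie (X2 j) (wt_lie (X2 j) y2).
  rewrite (_ : 2 = 2 + (2 + - 2)); last by ring.
  exact: wt_lie (wt_HXii j) (wt_lie (wt_HXii j) yj).
exists (c / 2).
have y2' : wt (- H0) 2 y by rewrite -[2]opprK; exact: wt_opp.
have yj' : wt (- H j) 2 y by rewrite -[2]opprK; exact: wt_opp.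
have YX := minus_YXX wtN4 (sl2 j) (Y2 j) y2.
have Yy := minus_YX wtN4 (sl2 j) (Y2 j) y2.
have e4 : lie (Y j) (lie (Y j) (lie (X j) (lie (X j) y))) = 4 *: y.
  rewrite YX yj !lieE Yy yj; lmod F.
have [_ hY hX] := sl2 j.
have := e4; rewrite e !lieE hX (lieC (Y j)) hY => /(congr1 (fun z => 4^-1 *: z)).
rewrite !scalerA mulVf ?(nat0 3) // scale1r => <-; lmodf F.
by rewrite // two0 (nat0 3).
Qed.

Lemma killing_YX j : killing (Y j) (X j) != 0.
Proof.
have X0 := frame_X0 frame j.
have [A [kA _ A2 Aj]] := dual_eigenvector X0.
have [c e] := minus_span (A2 _ (X2 j)) (Aj j _ (wt_HXii j)).
by apply: contraNneq kA => k0; rewrite e killingZl k0 mulr0.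
Qed.

(** The form with [A, [B, X_j]] = 2 b(A, B) X_i on E_ij(1,-1), see [bq_lie]. The coefficient is read
    off by pairing with Y_i, which defines it on the whole algebra. *)
Definition bq i j A B : F :=
  killing (Y i) (lie A (lie B (X j))) / (2 * killing (Y i) (X i)).

(** The transpose of A in E_ij(-1,1): up to the factor b(A, A) it completes A to an sl2-triple with
    neutral element H_i - H_j. *)
Definition flat i j A : g := - lie (Y i) (lie A (X j)).

Lemma bqDl i j A B C : bq i j (A + B) C = bq i j A C + bq i j B C.
Proof. by rewrite /bq lieDl killingDr mulrDl. Qed.
Lemma bqZl i j c A B : bq i j (c *: A) B = c * bq i j A B.
Proof. by rewrite /bq lieZl killingZr mulrA. Qed.

Lemma flat_is_linear i j : linear (flat i j).
Proof. by move=> c A B; rewrite /flat lieDl lieZl lieDr lieZr; lmod F. Qed.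

HB.instance Definition _ i j := GRing.isLinear.Build F g g *:%R (flat i j)
  (flat_is_linear i j).

Section Pair.
Variables i j : 'I_k.+1.
Hypothesis nij : i != j.
Let nji : j != i. Proof. by rewrite eq_sym. Qed.
Notation U := (E i j 1 (- 1)).
Notation b := (bq i j).
Notation fl := (flat i j).

Lemma U_H0 A : U A -> wt H0 0 A.
Proof. exact: Eij_g0. Qed.

Lemma U_X A : U A -> E i j 1 1 (lie A (X j)).
Proof. by move=> UA; apply: Eij_cast (Eij_lie UA (Eij_X nij)) _ _; ring. Qed.

Lemma flat_E A : U A -> E i j (- 1) 1 (fl A).
Proof.
move=> /U_X UA; rewrite /flat -scaleN1r; apply: EijZ.
by apply: Eij_cast (Eij_lie (Eij_Y' nij) UA) _ _; ring.
Qed.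

Lemma flat_H0 A : U A -> wt H0 0 (fl A).
Proof. by move=> UA; have := EH0 nij (flat_E UA); rewrite addNr. Qed.

Lemma U_comm A B : U A -> U B -> lie A B = 0.
Proof.
move=> UA UB; apply: (no_wt2_g0 fam (j := i)).
  by apply: wt_lie0r (U_H0 UA) (U_H0 UB).
by case: UA UB => Ai _ _ [Bi _ _]; rewrite (_ : 2 = 1 + 1); [exact: wt_lie | ring].
Qed.

Lemma bq_lie A B : U A -> U B -> lie A (lie B (X j)) = (2 * b A B) *: X i.
Proof.
move=> UA UB; have := Eij_lie UA (U_X UB) => Ev.
have [c e] : exists c, lie A (lie B (X j)) = c *: X i.
  have [vi _ _] := Ev; apply: (frame_wt2 frame) vi.
  have := EH0 nij Ev; rewrite (_ : 1 + 1 + _ = 2) //; by ring.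
rewrite /bq e killingZr; congr (_ *: _); field.
by rewrite two0 killing_YX.
Qed.

Lemma bqC A B : U A -> U B -> b A B = b B A.
Proof.
move=> UA UB; have e : lie A (lie B (X j)) = lie B (lie A (X j)).
  by rewrite lieJ (U_comm UA UB) lie0l add0r.
by rewrite /bq e.
Qed.

Lemma U_Yj_X A : U A -> lie (Y j) (lie A (X j)) = A.
Proof.
move=> UA; have [_ Aj _] := UA; rewrite lieJ (_ : lie (Y j) A = 0); last first.
  apply: (minus_wtN3 (s := j)).
    by apply: wt_lie0r (Y2 j) (U_H0 UA).
  rewrite (_ : - 3 = - 2 + - 1); last by ring.
  exact: wt_lie (wt_HYii j) Aj.
have [_ _ ->] := sl2 j.
by rewrite lie0l add0r lieC Aj scaleN1r opprK.
Qed.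

Lemma U_Xi A : U A -> lie A (X i) = 0.
Proof.
move=> UA; have [Ai _ _] := UA; apply: (plus_wt3 (j := i)).
  exact: plus_g0 (U_H0 UA) (X2 i).
by rewrite (_ : 3 = 1 + 2); [exact: wt_lie Ai (wt_HXii i) | ring].
Qed.

Lemma U_Xs A s : U A -> s != i -> s != j -> lie A (X s) = 0.
Proof.
move=> UA si sj; have [_ Aj _] := UA; apply: (plus_wtN1 (j := j)).
  exact: plus_g0 (U_H0 UA) (X2 s).
apply: wt_lie0r Aj _; apply: wt_HXij.
by rewrite eq_sym.
Qed.

Lemma flat_Xs A s : U A -> s != i -> lie (fl A) (X s) = 0.
Proof.
move=> UA si; have [Ai _ _] := flat_E UA; apply: (plus_wtN1 (j := i)).
  exact: plus_g0 (flat_H0 UA) (X2 s).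
apply: wt_lie0r Ai _; apply: wt_HXij.
by rewrite eq_sym.
Qed.

Lemma flat_Xi A : U A -> lie (fl A) (X i) = - lie A (X j).
Proof.
move=> UA; have [wi _ _] := U_X UA; have [_ _ hX] := sl2 i.
have W2 : wt H0 2 (lie A (X j)) by exact: plus_g0 (U_H0 UA) (X2 j).
rewrite /flat lieNl lie_lie (plus_lie W2 (X2 i)) lie0r sub0r opprK hX.
by rewrite lieC wi scale1r.
Qed.

Lemma U_Yi A : U A -> lie (lie A (Y i)) (X i) = - A.
Proof.
move=> UA; have [Ai _ _] := UA; have [_ _ hX] := sl2 i.
by rewrite lie_lie hX (U_Xi UA) lie0r subr0 lieC Ai scale1r.
Qed.

(** Let c be the coefficient on the left. Applying (ad A)^3 to [Y_i, X_j] = 0 leaves 3 (c - 2 b(A,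
    A)) A = 0. The relation with (ad A)^2 gives [flat_lie_self]. *)
Lemma bq_lie_Y A : U A -> lie A (lie A (Y i)) = (2 * b A A) *: Y j.
Proof.
move=> UA; have Ev := Eij_lie UA (Eij_lie UA (Eij_Y' nij)).
have [c e] : exists c, lie A (lie A (Y i)) = c *: Y j.
  have [_ vj _] := Ev; apply: minus_span.
    have := EH0 nij Ev; rewrite (_ : _ + _ = - 2) //; by ring.
  by move: vj; rewrite (_ : _ + _ = - 2) //; ring.
have [A0|An0] := eqVneq A 0; first by rewrite A0 /bq !lie0l killing0r mul0r mulr0 scale0r.
have YX0 : lie (Y i) (X j) = 0 := lie_YX fam nij.
have AAA : lie A (lie A (lie A (X j))) = 0 by rewrite (bq_lie UA UA) lieZr (U_Xi UA) scaler0.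
have AAAY : lie A (lie A (lie A (Y i))) = 0.
  rewrite e lieZr (_ : lie A (Y j) = 0) ?scaler0 // lieC (_ : lie (Y j) A = 0) ?oppr0 //.
  have [_ Aj _] := UA; apply: (minus_wtN3 (s := j)).
    by apply: wt_lie0r (Y2 j) (U_H0 UA).
  rewrite (_ : - 3 = - 2 + - 1); last by ring.
  exact: wt_lie (wt_HYii j) Aj.
have e1 : lie (lie A (lie A (Y i))) (lie A (X j)) = c *: A by rewrite e lieZl (U_Yj_X UA).
have e2 : lie (lie A (Y i)) (lie A (lie A (X j))) = - (2 * b A A) *: A.
  by rewrite (bq_lie UA UA) lieZr (U_Yi UA) scalerN scaleNr.
have := lie_cube_lie A (X j) (Y i); rewrite YX0 !lie0r AAAY AAA lie0l lie0r e1 e2.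
move=> h; rewrite e; congr (_ *: _); apply/eqP; rewrite -subr_eq0.
have : (3 * (c - 2 * b A A)) *: A = 0 by rewrite {1}h; lmod F.
by move/eqP; rewrite scaler_eq0 (negPf An0) orbF mulf_eq0 (negPf (nat0 2)).
Qed.

Lemma flat_lie_self A : U A -> lie (fl A) A = b A A *: (H i - H j).
Proof.
move=> UA; have [_ _ hi] := sl2 i; have [_ _ hj] := sl2 j.
have YX0 : lie (Y i) (X j) = 0 := lie_YX fam nij.
have := lie_sq_lie A (X j) (Y i); rewrite YX0 !lie0r.
rewrite (bq_lie_Y UA) (bq_lie UA UA) lieZl lieZr hi hj => h.
rewrite /flat lieNl lieC opprK (lieJ A (Y i)) (bq_lie UA UA) lieZr hi.
apply: (scalerI two0); rewrite -[LHS]addr0 -[X in _ = X]add0r {2}h; lmod F.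
Qed.

Lemma flat_lie_sym A B : U A -> U B ->
  lie (fl A) B + lie (fl B) A = (2 * b A B) *: (H i - H j).
Proof.
move=> UA UB; have := flat_lie_self (EijD UA UB).
rewrite (linearD fl) !lieDl !lieDr (flat_lie_self UA) (flat_lie_self UB).
have -> : b (A + B) (A + B) = b A A + b B B + 2 * b A B.
  rewrite bqDl (bqC UA) ?(bqC UB); [|exact: EijD..].
  by rewrite !bqDl (bqC UB UA); ring.
move=> h; transitivity (b A A *: (H i - H j) + lie (fl A) B +
    (lie (fl B) A + b B B *: (H i - H j)) - b A A *: (H i - H j) - b B B *: (H i - H j)).
  by lmod F.
by rewrite h; lmod F.
Qed.

Lemma HiHj_U A : U A -> lie (H i - H j) A = 2 *: A.
Proof. by move=> [Ai Aj _]; rewrite lieDl lieNl Ai Aj; lmod F. Qed.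

Lemma HiHj_flat A : U A -> lie (H i - H j) (fl A) = - 2 *: fl A.
Proof. by move=> /flat_E[Ai Aj _]; rewrite lieDl lieNl Ai Aj; lmod F. Qed.

Lemma U_nilp A : U A -> ad_nilpotent A.
Proof. by case=> Ai _ _; apply: (nilp_H Ai); exact: oner_neq0. Qed.

Lemma flat_nilp A : U A -> ad_nilpotent (fl A).
Proof.
by move=> /flat_E[_ Aj _]; apply: (nilp_H Aj); exact: oner_neq0.
Qed.

Lemma bq_nondeg A : U A -> A != 0 -> exists2 B, U B & b A B != 0.
Proof.
move=> UA A0; pose v := lie A (X j); have Ev := U_X UA.
have v2 : wt H0 2 v by exact: plus_g0 (U_H0 UA) (X2 j).
have [vi vj vs] := Ev.
have v0 : v != 0 by apply: contraNneq A0 => e; rewrite -(U_Yj_X UA) -/v e lie0r.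
pose w := lie (Y i) v.
have Ew : E i j (- 1) 1 w by apply: Eij_cast (Eij_lie (Eij_Y' nij) Ev) _ _; ring.
have w0 : w != 0.
  apply: contraNneq v0 => e; have := lower1 (sl2 i) (X2 i) v2 vi.
  by rewrite -/w e lie0r => /esym/eqP; rewrite oppr_eq0.
have [B [kB _ _ Bj]] := dual_eigenvector w0.
have UB : U B.
  have [wi wj ws] := Ew; split; [by rewrite -[1]opprK; exact: Bj | exact: Bj |].
  by move=> s si sj; rewrite -[0]oppr0; apply: Bj; exact: ws.
exists B => //; rewrite (bqC UA UB); apply: contraNneq kB => b0.
rewrite -killing_lie lieC killingNl killing_lie (bq_lie UB UA) b0.
by rewrite mulr0 scale0r killing0r oppr0.
Qed.

Section Exchange.
Variable A : g.
Hypothesis UA : U A.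
Hypothesis c0 : b A A != 0.

Lemma U_sl2 : sl2_triple ((b A A)^-1 *: fl A) (H i - H j) A.
Proof.
split; [exact: HiHj_U | by rewrite lieZr HiHj_flat // !scalerA mulrC |].
by rewrite lieZl flat_lie_self // scalerA mulVf // scale1r.
Qed.

(** The reflection element of the triple on A. The vectors X_j, [A, X_j], X_i span a
    three-dimensional module of weights -2, 0, 2, so that X_j and X_i are exchanged up to the factor
    b(A, A). *)
Definition exch : 'End(g) := sl2_theta ((b A A)^-1 *: fl A) A.

Lemma exch_G : G exch.
Proof.
have GA := Ggrp_exp (U_H0 UA) (U_nilp UA).
apply: Ggrp_comp => //; first apply: Ggrp_comp => //.
apply: Ggrp_exp => //; first exact: wtZ (flat_H0 UA).
exact: ad_nilpotentZ (flat_nilp UA).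
Qed.

Lemma exch_X : [/\ exch (X j) = b A A *: X i, exch (X i) = (b A A)^-1 *: X j &
  forall s, s != i -> s != j -> exch (X s) = X s].
Proof.
have nA := U_nilp UA; have nB := ad_nilpotentZ (b A A)^-1 (flat_nilp UA).
have c0' := c0; set B := _ *: _ in nB; pose W := lie A (X j).
have AXj : lie A (X j) = W by [].
have AXi := U_Xi UA.
have AW : lie A W = (2 * b A A) *: X i := bq_lie UA UA.
have BXj : lie B (X j) = 0 by rewrite lieZl flat_Xs ?scaler0.
have BXi : lie B (X i) = - (b A A)^-1 *: W by rewrite lieZl flat_Xi // scalerN scaleNr.
have BW : lie B W = - 2 *: X j.
  rewrite lieJ BXj lie0r addr0; have [_ _ ->] := U_sl2.
  by rewrite lieDl lieNl (wt_HXij nij) wt_HXii scale0r sub0r scaleNr.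
rewrite /exch /sl2_theta -/B; set c := b A A in AW BXi c0' *; clearbody W c.
have eAXi : exp_ad A (X i) = X i by rewrite exp_ad1.
have eAW : exp_ad A W = W + (2 * c) *: X i by rewrite exp_ad2 // AW // lieZr AXi scaler0.
have eAXj : exp_ad A (X j) = X j + W + c *: X i.
  by rewrite exp_ad3 // ?AXj ?AW ?lieZr ?AXi ?scaler0 //; lmodf F.
have eBXj : exp_ad B (X j) = X j by rewrite exp_ad1.
have eBW : exp_ad B W = W - 2 *: X j by rewrite exp_ad2 // BW ?lieZr ?BXj ?scaler0 // scaleNr.
have eBXi : exp_ad B (X i) = X i - c^-1 *: W + c^-1 *: X j.
  rewrite exp_ad3 // BXi !lieZr BW ?lieZr ?BXj ?scaler0 //.
  by lmodf F; rewrite // ?c0' ?two0.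
split=> [||s si sj]; rewrite !comp_lfunE !expEE.
- rewrite eAXj; have -> : exp_ad B (X j + W + c *: X i) = c *: X i.
    by rewrite !exp_adD exp_adZ eBXj eBW eBXi; lmodf F; rewrite // ?c0'.
  by rewrite exp_adZ eAXi.
- rewrite eAXi eBXi !exp_adD -scaleNr !exp_adZ eAXi eAW eAXj; lmodf F; by rewrite // ?c0'.
have As : lie A (X s) = 0 by exact: U_Xs.
have Bs : lie B (X s) = 0 by rewrite /B lieZl flat_Xs // scaler0.
by rewrite (exp_ad1 nA As) (exp_ad1 nB Bs) (exp_ad1 nA As).
Qed.

End Exchange.

Lemma universal_of_isotropic A : U A -> A != 0 -> b A A = 0 ->
  forall t, exists2 B, U B & b B B = t.
Proof.
move=> UA A0 b0 t; have [B UB bAB] := bq_nondeg UA A0.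
pose c := (t - b B B) / (2 * b A B).
exists (B + c *: A); first by apply: EijD => //; exact: EijZ.
have UcA : U (c *: A) by exact: EijZ.
rewrite bqDl !(bqC _ (EijD UB UcA)) // !bqDl !bqZl (bqC UB UcA) bqZl (bqC UA UcA) bqZl b0 /c.
by field; rewrite two0 bAB.
Qed.

(* A' exchanges back with the factor [b A' A'], whence the scaling. *)
Lemma scale_exchange A A' : U A -> U A' -> b A A != 0 -> b A' A' != 0 ->
  exists phi, [/\ G phi, phi (X i) = (b A A / b A' A') *: X i,
    phi (X j) = (b A' A' / b A A) *: X j &
    forall s, s != i -> s != j -> phi (X s) = X s].
Proof.
move=> UA UA' c0 c0'; exists (exch A \o exch A')%VF.
have [e1 e2 e3] := exch_X UA c0; have [e1' e2' e3'] := exch_X UA' c0'.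
split; first by apply: Ggrp_comp => //; exact: exch_G.
- by rewrite comp_lfunE e2' linearZ /= e1 scalerA mulrC.
- by rewrite comp_lfunE e1' linearZ /= e2 scalerA.
- by move=> s si sj; rewrite comp_lfunE e3' // e3.
Qed.

End Pair.

(** Here the normalization of the X_j enters: with A = [X_i, Z], the Killing product of [X_i, Z] and
    [X_j, Z] is a multiple of b(A, A), so q(Z) = 1 yields an anisotropic A. *)
Lemma anisotropic_of_normalized i j Z : i != j -> Z \in Eminus H i j ->
  qform H0 k (X i) (X j) Z = 1 -> exists2 A, E i j 1 (- 1) A & bq i j A A != 0.
Proof.
move=> nij /memv_capP[/memv_capP[/wt_eigen Zi /wt_eigen Zj] Zs] q1.
have {}Zs s : s != i -> s != j -> wt (H s) 0 Z.
  move=> si sj; apply/wt_eigen; move: Zs; rewrite memvE => /subv_bigcapP/(_ s).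
  by rewrite si sj -memvE => /(_ isT).
have EZ : E i j (- 1) (- 1) Z by [].
pose A := lie (X i) Z.
have UA : E i j 1 (- 1) A by apply: Eij_cast (Eij_lie (Eij_X' nij) EZ) _ _; ring.
exists A => //; apply/eqP => b0.
have Z2 : wt H0 (- 2) Z.
  have := EH0 nij EZ; rewrite (_ : - 1 + - 1 = - 2) //; by ring.
have ZE : Z = - lie (Y i) A by rewrite (minus_YX wtN4 (sl2 i) (Y2 i) Z2) Zi scaleN1r opprK.
have XjE : lie (X j) Z = - lie (Y i) (lie (X j) A).
  by rewrite ZE lieNr lieJ (lieC (X j) (Y i)) (lie_YX fam nij) oppr0 lie0l add0r.
have e : killing A (lie (X j) Z) = 0.
  rewrite XjE (lieC (X j)) lieNr opprK -killing_lie (lieC A) killingNl killing_lie.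
  by rewrite (bq_lie nij UA UA) b0 mulr0 scale0r killing0r oppr0.
by move/eqP: q1; rewrite /qform /bform -/A e !mulr0 eq_sym oner_eq0.
Qed.

End QuadraticForm.

(** * Normal forms of the orbits *)

Section NormalForm.
Implicit Types (i j s : 'I_k.+1) (u v w z A B C Z : g) (phi : 'End(g)).
Implicit Types b d : 'I_k.+1 -> F.

Definition universal := forall i j, i != j -> forall t, t != 0 ->
  exists2 A, E i j 1 (- 1) A & bq i j A A = t.

(** The t realized in this way are closed under multiplication and include the squares ([dop_mul],
    [dop_sqr]). *)
Definition diagonal_of_product t := exists2 phi, G phi &
  exists2 d, forall j, phi (X j) = d j *: X j & \prod_j d j = t.

Definition torus_surjective := forall d, (forall j, d j != 0) ->
  exists2 phi, G phi & forall j, phi (X j) = d j *: X j.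

Lemma diagX_act phi b d : (forall j, phi (X j) = d j *: X j) ->
  phi (dX b) = dX (fun j => b j * d j).
Proof.
move=> phiX; rewrite linear_sum; apply: eq_bigr => j _.
by rewrite linearZ /= phiX scalerA.
Qed.

Lemma scale_two i j t : universal -> i != j -> t != 0 ->
  exists2 phi, G phi & forall s, phi (X s) =
    (if s == i then t else if s == j then t^-1 else 1) *: X s.
Proof.
move=> univ nij t0.
have [A UA cA] := univ i j nij t t0.
have [B UB cB] := univ i j nij 1 (oner_neq0 _).
have [||phi [Gphi pi pj ps]] := scale_exchange nij UA UB.
- by rewrite cA.
- by rewrite cB oner_neq0.
exists phi => // s; case: eqP => [->|/eqP si]; first by rewrite pi cA cB divr1.
case: eqP => [->|/eqP sj]; first by rewrite pj cA cB div1r.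
by rewrite ps // scale1r.
Qed.

(** The factors are adjusted one index at a time, the inverse being charged to index 0; there the
    value is forced by the product. *)
Lemma scale_product_one d : universal -> (forall j, d j != 0) -> \prod_j d j = 1 ->
  exists2 phi, G phi & forall j, phi (X j) = d j *: X j.
Proof.
move=> univ d0 d1; pose r : 'I_k.+1 := ord0.
have step (l : seq 'I_k.+1) : uniq l -> r \notin l -> exists2 phi, G phi &
    exists2 d', forall j, phi (X j) = d' j *: X j & \prod_j d' j = 1 /\
      forall j, j != r -> d' j = if j \in l then d j else 1.
  elim: l => [|i l IH]; first move=> _ _.
    exists \1%VF; first exact: Ggrp_id.
    exists (fun=> 1) => [j|]; first by rewrite id_lfunE scale1r.
    by split=> //; rewrite big1.
  rewrite /= inE negb_or => /andP[il ul] /andP[ri rl].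
  have [phi Gphi [d' phiX [d'1 d'l]]] := IH ul rl.
  have nir : i != r by rewrite eq_sym.
  have [psi Gpsi psiX] := scale_two univ nir (d0 i).
  exists (psi \o phi)%VF; first exact: Ggrp_comp.
  exists (fun s => d' s * (if s == i then d i else if s == r then (d i)^-1 else 1)).
    by move=> j; rewrite comp_lfunE phiX linearZ /= psiX scalerA.
  split=> [|j jr].
    rewrite big_split /= d'1 mul1r (bigD1 i) //= (bigD1 r) 1?eq_sym //= !eqxx (negPf ri).
    rewrite big1 ?mulr1 ?mulfV // => s /andP[si sr].
    by rewrite (negPf si) (negPf sr).
  rewrite (d'l j jr) inE (negPf jr); case: eqP => [->|_]; last by rewrite mulr1.
  by rewrite (negPf il) mul1r.
have [|phi Gphi [d' phiX [d'1 d'l]]] := step (rem r (enum 'I_k.+1)) (rem_uniq _ (enum_uniq _)).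
  by rewrite mem_rem_uniq ?enum_uniq // !inE eqxx.
have dd' j : j != r -> d' j = d j.
  by move=> jr; rewrite (d'l j jr) mem_rem_uniq ?enum_uniq // !inE jr mem_enum.
exists phi => // j; rewrite phiX; congr (_ *: _).
have [->|jr] := eqVneq j r; last exact: dd'.
have P0 : \prod_(i < k.+1 | i != r) d i != 0 by apply/prodf_neq0 => i _; exact: d0.
apply: (mulIf P0); transitivity (\prod_j d j); last by rewrite (bigD1 r).
rewrite d1; transitivity (\prod_j d' j); last by rewrite d'1.
rewrite [RHS](bigD1 r) //=; congr (_ * _).
by apply: eq_bigr => i ir; rewrite dd'.
Qed.

Lemma torus_of_products : universal -> (forall t, t != 0 -> diagonal_of_product t) ->
  torus_surjective.
Proof.
move=> univ prods d d0; have D0 : \prod_j d j != 0 by apply/prodf_neq0 => j _.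
have [phi Gphi [a phiX a1]] := prods _ D0.
have a0 j : a j != 0 by apply: contraNneq D0 => e; rewrite -a1 (bigD1 j) //= e mul0r.
have da0 j : d j / a j != 0 by rewrite mulf_neq0 ?invr_eq0.
have da1 : \prod_j (d j / a j) = 1 by rewrite big_split /= prodfV a1 mulfV.
have [psi Gpsi psiX] := scale_product_one univ da0 da1.
exists (psi \o phi)%VF => [|j]; first exact: Ggrp_comp.
by rewrite comp_lfunE phiX linearZ /= psiX scalerA mulrC divfK.
Qed.

Hypothesis aniso : forall i j, i != j ->
  exists2 A, E i j 1 (- 1) A & bq i j A A != 0.

Lemma exchange_diagX i j b : i != j -> b i = 0 -> b j != 0 -> exists2 phi, G phi &
  exists2 b', phi (dX b) = dX b' & [/\ b' j = 0, b' i != 0 &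
    forall s, s != i -> s != j -> b' s = b s].
Proof.
move=> nij bi bj; have [A UA c0] := aniso nij.
have [ej ei es] := exch_X nij UA c0.
exists (exch i j A).
  exact: (exch_G nij UA).
pose c := bq i j A A.
exists (fun s => if s == i then c * b j else if s == j then 0 else b s).
  rewrite /diagX linear_sum (bigD1 j) // (bigD1 i) //= [RHS](bigD1 i) //=.
  rewrite (bigD1 j (P := fun s => s != i)) 1?eq_sym //= !eqxx (eq_sym j i) (negPf nij).
  rewrite !linearZ /= ej ei bi !scale0r !add0r scalerA mulrC; congr (_ + _).
  rewrite [RHS](eq_bigl (fun s => (s != j) && (s != i))) => [|s]; last by rewrite andbC.
  apply: eq_bigr => s /andP[sj si].
  by rewrite linearZ /= es // (negPf si) (negPf sj).
split=> [||s si sj]; rewrite ?eqxx ?(negPf si) ?(negPf sj) //.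
  by rewrite eq_sym (negPf nij).
by rewrite mulf_neq0.
Qed.

Lemma sort_diagX b : exists2 phi, G phi & exists m b', [/\ (m <= k.+1)%N,
  forall i, b' i != 0 & phi (dX b) = initX m b'].
Proof.
(* An exchange moves a nonzero coefficient to a smaller index, which lowers this sum. *)
pose w (b : 'I_k.+1 -> F) := (\sum_(s < k.+1 | b s != 0%R) s)%N.
have [n le_n] := ubnP (w b); elim: n b le_n => // n IH b /ltnSE le_n.
have [[i [j [lt_ij bi bj]]]|no] :=
    pselect (exists i j : 'I_k.+1, [/\ (i < j)%N, b i = 0 & b j != 0]).
  have nij : i != j by rewrite -val_eqE neq_ltn lt_ij.
  have [phi Gphi [b' phiE [b'j b'i b's]]] := exchange_diagX nij bi bj.
  have [|psi Gpsi [m [b'' [le_m b''0 psiE]]]] := IH b'.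
    apply: leq_trans le_n; rewrite /w (bigD1 i) //= [X in (_ < X)%N](bigD1 j) //= -addSn.
    apply: leq_add => //; apply/eq_leq/eq_bigl => s.
    have [->|si] := eqVneq s i; first by rewrite bi eqxx andbF.
    by have [->|sj] := eqVneq s j; rewrite ?b'j ?eqxx ?andbF //= b's.
  exists (psi \o phi)%VF; first exact: Ggrp_comp.
  by exists m, b''; split=> //; rewrite comp_lfunE phiE.
exists \1%VF; first exact: Ggrp_id.
have [m [le_m mP]] : exists m, (m <= k.+1)%N /\ forall i : 'I_k.+1, (i < m)%N = (b i != 0).
  have [i0 b0|nz] := pickP (fun i => b i == 0); last first.
    by exists k.+1; split=> // i; rewrite ltn_ord; move: (nz i) => /= ->.
  case: (@arg_minnP _ i0 (fun i => b i == 0) (fun i : 'I_k.+1 => i : nat) b0) => i /eqP bi mi.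
  exists i; split=> [|s]; first exact: ltnW.
  rewrite ltnNge; congr negb; apply/idP/idP => [le|/mi //].
  apply: contraT => bs; case: no; exists i, s; split=> //.
  by rewrite ltn_neqAle le andbT; apply: contraNneq bs => /val_inj <-; rewrite bi.
exists m, (fun i => if b i == 0 then 1 else b i); split=> // [i|].
  by case: (eqVneq (b i) 0) => [_|//]; exact: oner_neq0.
rewrite id_lfunE; apply: eq_bigr => i _; congr (_ *: _).
by rewrite mP; case: (eqVneq (b i) 0).
Qed.

Lemma normal_form Z : wt H0 2 Z -> exists2 phi, G phi &
  exists m b, [/\ (m <= k.+1)%N, forall i, b i != 0 & phi Z = initX m b].
Proof.
move=> /(diagonalize)[phi [Gphi [b phiE]]].
have [psi Gpsi [m [b' [le_m b'0 psiE]]]] := sort_diagX b.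
exists (psi \o phi)%VF; first exact: Ggrp_comp.
by exists m, b'; split=> //; rewrite comp_lfunE phiE.
Qed.

Lemma initX_lt_orbit m m' b b' : (m <= k.+1)%N -> (m' <= k.+1)%N ->
  (forall i, b i != 0) -> (forall i, b' i != 0) ->
  Gorbit iota H0 (initX m b) (initX m' b') -> m = m'.
Proof.
move=> le_m le_m' b0 b'0 [phi Gphi e].
have := dim_imsq_G (initX m b) Gphi; rewrite e => ed.
have lt := imsq_init_lt.
case: (ltngtP m m') => // lt_m.
- by have := lt _ _ b b' lt_m le_m' b0 b'0; rewrite ed ltnn.
- by have := lt _ _ b' b lt_m le_m b'0 b0; rewrite ed ltnn.
Qed.

Hypothesis torus : torus_surjective.

Lemma initX_orbit m b b' : (forall i, b i != 0) -> (forall i, b' i != 0) ->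
  Gorbit iota H0 (initX m b) (initX m b').
Proof.
move=> b0 b'0; have [|phi Gphi phiX] := torus (d := fun j => b' j / b j).
  by move=> j; rewrite mulf_neq0 ?invr_eq0.
exists phi => //; rewrite /initX (diagX_act _ phiX); apply: eq_bigr => i _.
by congr (_ *: _); case: ifP => _; rewrite ?mul0r // mulrC divfK.
Qed.

Definition initial m := initX m (fun=> 1).

Lemma initial_orbit Z : wt H0 2 Z ->
  exists2 m, (m <= k.+1)%N & Gorbit iota H0 Z (initial m).
Proof.
case/normal_form => phi Gphi [m [b [le_m b0 phiE]]]; exists m => //.
have h : Gorbit iota H0 Z (initX m b) by exists phi.
apply: Gorbit_trans h _; apply: initX_orbit => // i; exact: oner_neq0.
Qed.

Lemma initial_inj m m' : (m <= k.+1)%N -> (m' <= k.+1)%N ->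
  Gorbit iota H0 (initial m) (initial m') -> m = m'.
Proof. by move=> le_m le_m'; apply: initX_lt_orbit => // i; exact: oner_neq0. Qed.

Lemma wt_initial m : wt H0 2 (initial m).
Proof. exact: wt_diagX. Qed.

Lemma initial0 : initial 0 = 0.
Proof. by apply: big1 => i _; rewrite scale0r. Qed.

Lemma initial_full : initial k.+1 = \sum_j X j.
Proof. by apply: eq_bigr => i _; rewrite ltn_ord scale1r. Qed.

Lemma initial_neq0 m : (0 < m)%N -> (m <= k.+1)%N -> initial m != 0.
Proof.
move=> m0 le_m; apply/eqP => e; have := @initial_inj 0 m isT le_m.
rewrite initial0 -e => h; have /h e0 : Gorbit iota H0 (initial m) (initial m).
  exact: Gorbit_refl.
by rewrite -e0 in m0.
Qed.

Lemma Gorbit0 Z : Gorbit iota H0 0 Z -> Z = 0.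
Proof. by case=> phi _ <-; rewrite linear0. Qed.

Lemma nonzero_orbits :
  [set Gorbit iota H0 Z | Z in [set Z | Z \in Vplus H0 /\ Z != 0]] #= `I_k.+1.
Proof.
rewrite card_eq_sym; apply/card_set_bijP.
exists (fun m => Gorbit iota H0 (initial m.+1)); split.
- move=> m /= lt_m; exists (initial m.+1) => //; split.
    exact/wt_eigen/wt_initial.
  exact: initial_neq0.
- move=> m m' /set_mem /= lt_m /set_mem /= lt_m' /Gorbit_eq e.
  by apply/eq_add_S/initial_inj => //; exact: e.
move=> O /= [Z [/wt_eigen Z2 Z0] <-].
have [m le_m OZ] := initial_orbit Z2.
case: m => [|m] in le_m OZ *.
  case/eqP: Z0; apply: Gorbit0; rewrite -initial0; exact: Gorbit_sym.
by exists m => //; apply/Gorbit_eq => //; exact: Gorbit_sym.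
Qed.

End NormalForm.

(** * Diagonal elements of G *)

Section Descent.

Lemma generated_ind (P : g -> Prop) : P 0 ->
  (forall c x y, P x -> P y -> P (c *: x + y)) ->
  (forall x y, P x -> P y -> P (lie x y)) ->
  (forall v, wt H0 2 v -> P v) -> (forall v, wt H0 (- 2) v -> P v) -> forall v, P v.
Proof.
move=> P0 PZ Pl Pp Pm; have [W WP] := pred_vspace P0 PZ.
have e : W = fullv.
  apply: generated_Vpm.
  - by apply/subvP => v /wt_eigen /Pm /WP.
  - by apply/subvP => v /wt_eigen /Pp /WP.
  - by move=> x y /WP Px /WP Py; apply/WP/Pl.
by move=> v; apply/WP; rewrite e memvf.
Qed.

Lemma H0_cube v : lie H0 (lie H0 (lie H0 v)) = 4 *: lie H0 v.
Proof.
have [a [b [c [-> wa wb wc]]]] := grade_decomp v.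
rewrite !lieDr wa wb wc !scale0r !lieZr wa wc !lieZr ?lie0r wa wc !scalerA.
lmod F.
Qed.

(** The identity (ad H0)^3 = 4 ad H0 extends linearly to the new scalars and fails for the
    eigenvalue -4. *)
Lemma wtN4_BC (u : gL) : wt (tau H0) (- 4) u -> u = 0.
Proof.
move=> u4.
have e : lie (tau H0) (lie (tau H0) (lie (tau H0) u)) = iota 4 *: lie (tau H0) u.
  clear u4; move: u; apply: gL_ind => [|x y ex ey|c v].
  - by rewrite !lie0r scaler0.
  - by rewrite !lieDr ex ey scalerDr.
  - by rewrite !lieZr !toBC_lieE H0_cube toBCZ scalerA mulrC -scalerA.
move: e; rewrite !(u4, lieZr, scalerA) rmorph_nat => /eqP.
rewrite -subr_eq0 -scalerBl scaler_eq0 => /orP[|/eqP //].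
have -> : -4 * -4 * -4 - 4 * -4 = - (48%:R) :> L by ring.
by rewrite oppr_eq0 (negPf (char0_natr char0L 47)).
Qed.

(** Rationality on V+ is enough. The element [dY b1] goes to [dY a], which is determined by [dX a]
    and H0; V- is the image of V+ under (ad [dY b1])^2; and V+, V- generate the algebra. So Phi
    preserves the rational vectors and is the extension of an element of G. *)
Lemma descent_rational (Phi : gL -> gL) (a : 'I_k.+1 -> F) : elementary Phi ->
  Phi (tau H0) = tau H0 -> (forall j, a j != 0) ->
  (forall j, Phi (tau (X j)) = tau (a j *: X j)) ->
  (forall v, wt H0 2 v -> exists w, Phi (tau v) = tau w) ->
  exists2 phi, Ggrp iota H0 phi & forall v, Phi (tau v) = tau (phi v).
Proof.
move=> ePhi PH0 a0 PX Pp; have lP := elementary_linear ePhi.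
have cP := elementary_lie char0L ePhi.
pose b1 : 'I_k.+1 -> F := fun=> 1; have b10 j : b1 j != 0 by exact: oner_neq0.
have PD u v : Phi (u + v) = Phi u + Phi v by have := lP 1 u v; rewrite !scale1r.
have P0 := elementary0 ePhi; have PZ c u := elementaryZ c u ePhi.
have PdX : Phi (tau (dX b1)) = tau (dX a).
  rewrite !toBC_sum (big_morph Phi PD P0); apply: eq_bigr => j _.
  by rewrite toBCZ PZ rmorph1 scale1r PX.
have PdY : Phi (tau (dY b1)) = tau (dY a).
  pose u := Phi (tau (dY b1)) - tau (dY a).
  have wtm z : wt H0 (- 2) z -> wt (tau H0) (- 2) (tau z).
    by move/(toBC_wt iota); rewrite rmorphN rmorph_nat.
  have u2 : wt (tau H0) (- 2) u.
    apply: wtD; last by apply/wtN/wtm; exact: wt_diagY a.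
    by rewrite /wt -{1}PH0 -cP (wtm _ (wt_diagY b1)) PZ.
  have u0 : lie u (tau (dX a)) = 0.
    rewrite /u lieDl lieNl -{1}PdX -cP !toBC_lieE.
    have [_ _ ->] := diag_sl2 b1; have [_ _ ->] := diag_sl2 a.
    by rewrite !(diagH_full) // PH0 subrr.
  have Yu : lie (tau (dY a)) u = 0.
    apply: wtN4_BC; rewrite (_ : - 4 = - 2 + - 2); last by ring.
    by apply: wt_lie => //; apply/wtm; exact: wt_diagY a.
  have : lie (tau H0) u = 0.
    have [_ _ e] := diag_sl2 a; rewrite diagH_full // in e.
    by rewrite -e -toBC_lieE lie_lie Yu lie0r subr0 (lieC _ u) u0 oppr0 lie0r.
  rewrite u2 => /eqP; rewrite scaler_eq0 oppr_eq0 (negPf (char0_natr char0L 1)) /=.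
  by rewrite subr_eq0 => /eqP.
have rat v : exists w, Phi (tau v) = tau w.
  apply: (generated_ind (P := fun v => exists w, Phi (tau v) = tau w)) => //.
  - by exists 0; rewrite toBC0.
  - by move=> c x y [wx ex] [wy ey]; exists (c *: wx + wy); rewrite toBC_linear lP ex ey toBC_linear.
  - by move=> x y [wx ex] [wy ey]; exists (lie wx wy); rewrite -toBC_lieE cP ex ey toBC_lieE.
  move=> {}v v2; pose z := 4^-1 *: lie (dX b1) (lie (dX b1) v).
  have z2 : wt H0 2 z by apply: wtZ; exact: wt_diagXX.
  have vE : v = lie (dY b1) (lie (dY b1) z).
    have s := diag_sl2 b1; rewrite diagH_full // in s.
    have YXX := minus_YXX wt_H0_N4 s (wt_diagY b1) v2.
    have YX := minus_YX wt_H0_N4 s (wt_diagY b1) v2.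
    rewrite /z !lieZr YXX v2 !lieE YX v2; lmodf F.
    by rewrite // ?(nat0 3).
  have [w ew] := Pp z z2; exists (lie (dY a) (lie (dY a) w)).
  by rewrite vE -!toBC_lieE !cP PdY ew.
have [phi phiE] := choice rat.
have phi_lin : linear phi.
  by move=> c x y; apply: (@toBC_inj _ _ iota); rewrite -phiE !toBC_linear lP -!phiE.
pose lphi := linfun (HB.pack_for {linear g -> g} phi (GRing.isLinear.Build _ _ _ _ phi phi_lin)).
have lphiE v : lphi v = phi v by rewrite lfunE.
have inj_phi : injective phi.
  have [W _ [WK _]] := elementary_inv char0L ePhi.
  move=> x y e; apply: (@toBC_inj _ _ iota); apply: (can_inj WK).
  by rewrite !phiE e.
exists lphi => [|v]; last by rewrite lphiE.
split; [split; [split|]|].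
- apply/eqP/lker0P => x y; rewrite !lphiE; exact: inj_phi.
- by move=> x y; rewrite !lphiE; apply: (@toBC_inj _ _ iota); rewrite -phiE -!toBC_lieE cP !phiE.
- apply: elementary_ext ePhi => u; have EL := @endBC_is_linear _ _ iota _ lphi.
  move: u; apply: gL_ind => [|x y ex ey|c v].
  + by have := EL (-1) 0 0; rewrite P0 scaler0 addr0 scaleN1r addNr.
  + by rewrite PD ex ey; have := EL 1 x y; rewrite !scale1r.
  + have := EL c (tau v) 0; rewrite !addr0 PZ phiE endBC_toBC lphiE => ->.
    by have := EL (-1) 0 0; rewrite scaler0 addr0 scaleN1r addNr => ->; rewrite addr0.
- by rewrite lphiE; apply: (@toBC_inj _ _ iota); rewrite -phiE.
Qed.

End Descent.
Notation dop := diagonal_of_product.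

Section DiagonalElements.

Lemma dop_mul t t' : dop t -> dop t' -> dop (t * t').
Proof.
move=> [phi Gphi [d phiX <-]] [psi Gpsi [d' psiX <-]].
exists (phi \o psi)%VF; first exact: Ggrp_comp.
exists (fun j => d j * d' j); last by rewrite big_split.
by move=> j; rewrite comp_lfunE psiX linearZ /= phiX scalerA mulrC.
Qed.

Lemma toBC_sl2 y h x : sl2_triple y h x -> sl2_triple (tau y : gL) (tau h) (tau x).
Proof.
move=> [hx hy hyx]; split; last by rewrite toBC_lieE hyx.
- by rewrite toBC_lieE hx toBCZ rmorph_nat.
- by rewrite toBC_lieE hy toBCZ rmorphN rmorph_nat.
Qed.

Lemma torus_rational y h x t : sl2_triple y h x -> ad_nilpotent x -> ad_nilpotent y ->
  t != 0 -> exists2 T : gL -> gL, elementary T &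
  forall (n : int) v, wt h n%:~R v -> T (tau v) = t ^ n *: tau v.
Proof.
move=> s nx ny t0; have nxL := toBC_ad_nilpotent iota nx; have nyL := toBC_ad_nilpotent iota ny.
have [T eT TE] := torus_elementary char0L (toBC_sl2 s) nxL nyL t0.
exists T => // n v vn; apply: TE; rewrite /wt toBC_lieE vn toBCZ.
by case: n {vn} => n; rewrite ?NegzE ?rmorphN /= rmorph_nat.
Qed.

Lemma torus_V y h x t : sl2_triple y h x -> wt H0 2 x -> wt H0 (- 2) y ->
  t != 0 -> exists2 T : gL -> gL, elementary T &
  forall (n : int) v, wt h n%:~R v -> T (tau v) = t ^ n *: tau v.
Proof. by move=> s /nilp2 nx /nilpN2 ny t0; exact: torus_rational s nx ny t0. Qed.

Lemma torus_H j s : s != 0 -> exists2 phi, G phi &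
  [/\ phi (X j) = s ^+ 2 *: X j, forall i, i != j -> phi (X i) = X i &
      forall v, wt H0 2 v -> wt (H j) 0 v -> phi v = v].
Proof.
move=> s0; have is0 : iota s != 0 by rewrite fmorph_eq0.
have [T eT TE] := torus_V (sl2 j) (X2 j) (Y2 j) is0.
have T0 v : wt (H j) 0 v -> T (tau v) = tau v by move=> v0; rewrite (TE 0) ?expr0z ?scale1r.
have T1 v : wt (H j) 1 v -> T (tau v) = tau (s *: v) by move=> v1; rewrite (TE 1) // expr1z toBCZ.
have T2 v : wt (H j) 2 v -> T (tau v) = tau (s ^+ 2 *: v).
  by move=> v1; rewrite (TE 2%:Z) // toBCZ rmorphXn.
pose a i := if i == j then s ^+ 2 else 1.
have [||||phi Gphi phiE] := descent_rational (a := a) eT.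
- apply: T0; have := wt_H0_H j; rewrite /wt !scale0r => e.
  by rewrite lieC e oppr0.
- by move=> i; rewrite /a; case: ifP => _; rewrite ?expf_neq0 ?oner_neq0.
- move=> i; rewrite /a; case: eqP => [->|/eqP ne]; first exact: T2 (wt_HXii j).
  by rewrite scale1r; apply/T0/(wt_HXij); rewrite eq_sym.
- move=> v v2; have lT := elementary_linear eT.
  have TD u w : T (u + w) = T u + T w by have := lT 1 u w; rewrite !scale1r.
  exists (pr0 (H j) v + s *: pr1 (H j) v + s ^+ 2 *: pr2 (H j) v).
  rewrite {1}(pr_sum (H j) v) 2!toBCD 2!TD [RHS]toBCD (toBCD _ (pr0 _ _)).
  have w0 := wt_pr0 (sl2 j) (X2 j) (Y2 j) v2.
  have w1 := wt_pr1 (sl2 j) (X2 j) (Y2 j) v2.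
  have w2 := wt_pr2 (sl2 j) (X2 j) (Y2 j) v2.
  by rewrite (T0 _ w0) (T1 _ w1) (T2 _ w2).
have inj := @toBC_inj _ _ iota g.
exists phi => //; split=> [|i ne|v v2 v0]; apply: inj; rewrite -phiE.
- exact: T2 (wt_HXii j).
- by apply/T0/(wt_HXij); rewrite eq_sym.
- exact: T0.
Qed.

Lemma dop_sqr s : s != 0 -> dop (s ^+ 2).
Proof.
move=> s0; have [phi Gphi [phi0 phij _]] := torus_H ord0 s0.
exists phi => //; exists (fun j => if j == ord0 then s ^+ 2 else 1).
  by move=> j; case: eqP => [->|/eqP ne]; rewrite ?phi0 // phij // scale1r.
by rewrite (bigD1 ord0) //= big1 ?mulr1 // => j /negPf->.
Qed.

(** The torus with neutral element H0, taken at a square root s of t in the algebraic closure, acts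
    on V+ by s^2 = t. *)
Lemma scalars t : t != 0 -> exists2 phi, G phi & forall v, wt H0 2 v -> phi v = t *: v.
Proof.
move=> t0; have [s es] := closed_root (iota t) (isT : (0 < 2)%N).
have s0 : s != 0 by apply: contraNneq t0 => e; rewrite -(fmorph_eq0 iota) -es e expr0n.
pose b1 : 'I_k.+1 -> F := fun=> 1; have b10 j : b1 j != 0 by exact: oner_neq0.
have sl := diag_sl2 b1.
rewrite diagH_full // in sl.
have [T eT TE] := torus_V sl (wt_diagX b1) (wt_diagY b1) s0.
have T2 v : wt H0 2 v -> T (tau v) = tau (t *: v) by move=> v2; rewrite (TE 2%:Z) // toBCZ -es.
have [||||phi Gphi phiE] := descent_rational (a := fun=> t) eT.
- by rewrite (TE 0) ?expr0z ?scale1r // /wt liexx scale0r.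
- by [].
- by move=> j; exact: T2.
- by move=> v v2; rewrite T2 //; eexists.
exists phi => // v v2; apply: (@toBC_inj _ _ iota g); by rewrite -phiE T2.
Qed.

Lemma dop_even t : ~~ odd k -> t != 0 -> dop t.
Proof.
move=> ek t0; have := odd_double_half k; rewrite (negPf ek) add0n => ek2.
have -> : t = t ^+ k.+1 * (t^-1 ^+ k./2) ^+ 2.
  by rewrite -exprM muln2 ek2 exprVn exprS mulfK // expf_neq0.
apply: dop_mul; last by apply: dop_sqr; rewrite expf_neq0 ?invr_eq0.
have [phi Gphi phiE] := scalars t0; exists phi => //.
by exists (fun=> t) => [j|]; [exact: phiE | rewrite prodr_const card_ord].
Qed.

End DiagonalElements.

(** * Extremal elements and long roots *)

Section Extremal.
Implicit Types (i j s : 'I_k.+1) (u v w y z A B : g) (phi : 'End(g)).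

(** Extremal elements replace long root vectors, without classifying root systems: they are produced
    by conjugating X_j and Y_j, and they complete to triples with one-dimensional weight-2 spaces in
    V+. *)
Definition extremal v := forall u, exists c, lie v (lie v u) = c *: v.

Lemma extremal_aut phi v : lie_automorphism phi -> extremal (phi v) -> extremal v.
Proof.
move=> aphi ev u; have [c e] := ev (phi u); exists c.
by apply: (lker0P (introT eqP aphi.1)); rewrite !(lie_autE aphi) e linearZ.
Qed.

Lemma extremal_X j : extremal (X j).
Proof.
move=> u; have [um [u0 [up [-> wm w0 wp]]]] := grade_decomp u.
have e0 : lie (X j) (lie (X j) u0) = 0.
  apply: (plus_lie (X2 j)).
  by exact: wt_lie0r (X2 j) w0.
have ep : lie (X j) up = 0 := plus_lie (X2 j) wp.
rewrite !lieDr ep e0 lie0r !addr0; pose b i : F := if i == j then 1 else 0.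
have bX : X j = diagX b.
  rewrite /diagX (bigD1 j) //= /b eqxx scale1r big1 ?addr0 // => i /negPf->.
  by rewrite scale0r.
have : lie (X j) (lie (X j) um) \in imsq (diagX b) by rewrite -bX; apply/imsqP; exists um.
case/(imsq_diag) => v2 vi.
apply: (frame_wt2 frame) => //; rewrite /wt -v2 H0_sum.
rewrite lie_suml (bigD1 j) //= big1 ?addr0 // => i ne.
by rewrite vi ?scale0r // /b (negPf ne).
Qed.

Lemma extremal_Y j : extremal (Y j).
Proof.
move=> u; have [um [u0 [up [-> wm w0 wp]]]] := grade_decomp u.
have e0 : lie (Y j) (lie (Y j) u0) = 0.
  apply: (minus_lie (Y2 j)).
  by exact: wt_lie0r (Y2 j) w0.
have em : lie (Y j) um = 0 := minus_lie (Y2 j) wm.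
rewrite !lieDr em e0 lie0r !add0r (pr_sum (H j) up) 2!lieDr 2!lieDr.
have p0 := wt_pr0 (sl2 j) (X2 j) (Y2 j) wp.
have p1 := wt_pr1 (sl2 j) (X2 j) (Y2 j) wp.
have p2 := wt_pr2 (sl2 j) (X2 j) (Y2 j) wp.
have HH0 : lie (H j) H0 = 0 by rewrite lieC wt_H0_H scale0r oppr0.
have H0w : wt H0 2 up -> [/\ wt H0 2 (pr0 (H j) up), wt H0 2 (pr1 (H j) up) &
    wt H0 2 (pr2 (H j) up)].
  move=> q; have e : lie H0 (H j) = 0 by rewrite wt_H0_H scale0r.
  exact: (wt_pr_stable j e q).
have [q0 q1 q2] := H0w wp.
have [c ->] := frame_wt2 frame q2 p2.
rewrite (lower0 (sl2 j) (X2 j) (Y2 j) q0 p0) lie0r add0r.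
rewrite (minus_wtN3 (s := j) (v := lie (Y j) (lie (Y j) (pr1 (H j) up)))).
- rewrite add0r !lieZr; have [_ hy ->] := sl2 j; rewrite lieC hy.
  by exists (c * 2); rewrite scaleNr opprK scalerA.
- rewrite (_ : - 2 = - 2 + (- 2 + 2)); last by ring.
  exact: wt_lie (Y2 j) (wt_lie (Y2 j) q1).
rewrite (_ : - 3 = - 2 + (- 2 + 1)); last by ring.
exact: wt_lie (wt_HYii j) (wt_lie (wt_HYii j) p1).
Qed.

Section Isotropic.
Variables (i j : 'I_k.+1) (A : g).
Hypothesis nij : i != j.
Hypothesis UA : E i j 1 (- 1) A.
Hypothesis A0 : A != 0.
Hypothesis qA : bq i j A A = 0.
Notation fl := (flat i j A).

Lemma isotropic_partner : exists2 B, E i j 1 (- 1) B & 2 * bq i j B A = 1.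
Proof.
have [B UB bAB] := bq_nondeg nij UA A0.
exists ((2 * bq i j A B)^-1 *: B); first exact: EijZ.
by rewrite bqZl (bqC nij UB UA) mulrCA mulVf // mulf_neq0.
Qed.

Lemma flat_nilpG : ad_nilpotent fl.
Proof. exact: (flat_nilp nij UA). Qed.

Lemma flat_lie0 : lie fl A = 0.
Proof. by rewrite (flat_lie_self nij UA) qA scale0r. Qed.

(** With 2 b(B, A) = 1, exp B adds X_i to v = [A, X_j], and the exponential of the transpose of A
    fixes v and sends X_i to X_i - v: the composite carries v to the extremal X_i. *)
Lemma extremal_plus : extremal (lie A (X j)).
Proof.
have [B UB bB] := isotropic_partner; set v := lie A (X j).
have nB := U_nilp UB; have nf := flat_nilpG.
have Bv : lie B v = X i by rewrite (bq_lie nij UB UA) bB scale1r.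
have BX : lie B (X i) = 0 := U_Xi nij UB.
have fX : lie fl (X i) = - v := flat_Xi nij UA.
have fv : lie fl v = 0.
  rewrite /v lieJ flat_lie0 lie0l add0r.
  rewrite (flat_Xs nij UA) ?lie0r // eq_sym; exact: nij.
apply: (extremal_aut (phi := (expE fl \o expE B)%VF)).
  by apply: lie_automorphism_comp; exact: lie_automorphism_exp.
rewrite comp_lfunE !expEE (exp_ad2 nB) ?Bv // exp_adD (exp_ad1 nf fv).
rewrite exp_ad2 // fX ?lieNr ?fv ?oppr0 // addrC subrK.
exact: extremal_X.
Qed.

Lemma bq_lie_Y2 B : E i j 1 (- 1) B -> lie B (lie A (Y i)) = (2 * bq i j B A) *: Y j.
Proof.
move=> UB; have UAB := EijD UB UA.
have := bq_lie_Y nij UAB.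
rewrite lieDl (lieDl B A (Y i)) !lieDr (bq_lie_Y nij UA) (bq_lie_Y nij UB).
have -> : lie A (lie B (Y i)) = lie B (lie A (Y i)) by rewrite lieJ (U_comm nij UA UB) lie0l add0r.
have -> : bq i j (B + A) (B + A) = bq i j B B + bq i j A A + 2 * bq i j B A.
  have C := bqC nij.
  by rewrite bqDl (C _ _ UB) ?(C _ _ UA) // !bqDl (C _ _ UA UB); ring.
move=> h; apply: (scalerI two0); apply: (addrI (2 * bq i j B B *: Y j + 2 * bq i j A A *: Y j)).
transitivity (2 * bq i j B B *: Y j + lie B (lie A (Y i)) +
  (lie B (lie A (Y i)) + 2 * bq i j A A *: Y j)); first by lmod F.
by rewrite h; lmod F.
Qed.

Lemma flat_Yj : lie fl (Y j) = - lie A (Y i).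
Proof.
by rewrite /flat lieNl lieC opprK lieJ (lie_YY fam) lie0l add0r (U_Yj_X nij UA) lieC.
Qed.

Lemma extremal_minus : extremal (lie A (Y i)).
Proof.
have [B UB bB] := isotropic_partner; set v := lie A (Y i).
have nB := U_nilp UB; have nf := flat_nilpG.
have Bv : lie B v = Y j by rewrite /v bq_lie_Y2 // bB scale1r.
have BY : lie B (Y j) = 0.
  have [_ Bj _] := UB; apply: (minus_wtN3 (s := j)).
    by apply: wt_lie0l (U_H0 nij UB) (Y2 j).
  rewrite (_ : - 3 = - 1 + - 2); last by ring.
  exact: wt_lie Bj (wt_HYii j).
have fv : lie fl v = 0.
  rewrite /v lieJ flat_lie0 lie0l add0r (_ : lie fl (Y i) = 0) ?lie0r //.
  have UE := flat_E nij UA; have [fi _ _] := UE.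
  apply: (minus_wtN3 (s := i)).
    by apply: wt_lie0l (flat_H0 nij UA) (Y2 i).
  rewrite (_ : - 3 = - 1 + - 2); last by ring.
  exact: wt_lie fi (wt_HYii i).
apply: (extremal_aut (phi := (expE fl \o expE B)%VF)).
  by apply: lie_automorphism_comp; exact: lie_automorphism_exp.
rewrite comp_lfunE !expEE (exp_ad2 nB) ?Bv // exp_adD (exp_ad1 nf fv).
rewrite exp_ad2 // flat_Yj ?lieNr ?fv ?oppr0 // addrC subrK.
exact: extremal_Y.
Qed.

End Isotropic.

(** By extremality [y, v] multiplies v and y by scalars, opposite to each other by invariance of the
    Killing form and nonzero by [commuting_triple_killing]. *)
Lemma extremal_triple v y : wt H0 2 v -> wt H0 (- 2) y -> extremal v -> extremal y ->
  killing y v != 0 -> exists c, sl2_triple (c *: y) (lie (c *: y) v) v.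
Proof.
move=> v2 y2 ev ey kyv; pose h := lie y v.
have [c1 e1] := ev y; have [c2 e2] := ey v.
have hv : lie h v = c1 *: v by rewrite -e1 (lieC v y) lieNr lieC.
have hy : lie h y = - c2 *: y by rewrite lieC -/h e2 scaleNr.
have e12 : c2 = c1.
  apply: (mulIf kyv); have := killing_lie y h v; rewrite lieC hy -scaleNr opprK hv.
  by rewrite killingZl killingZr.
have c10 : c1 != 0.
  apply: contraNneq kyv => c0; apply/eqP.
  apply: (commuting_triple_killing v2 y2 (erefl h)).
    by rewrite hv c0 scale0r.
  by rewrite hy e12 c0 oppr0 scale0r.
exists (2 / c1); rewrite !lieZl -/h; split; rewrite ?lieZl //.
- by rewrite hv scalerA divfK.
- by rewrite lieZr hy e12 !scalerA; congr (_ *: _); field.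
Qed.

(** The coefficient of (ad y)^2 w along y is found by pairing with v, and equals a multiple of the
    pairing of y and w; so (ad y)^2 w = 0, and (ad v)^2 (ad y)^2 w = 4 w. Hence the weight-2 space
    of h in V+ is the line of v. *)
Lemma extremal_weight2 y h v w : sl2_triple y h v -> wt H0 2 v -> wt H0 (- 2) y ->
  extremal y -> wt H0 2 w -> wt h 2 w -> killing y v != 0 -> killing y w = 0 -> w = 0.
Proof.
move=> s v2 y2 ey w2 hw kyv kyw; have [c e] := ey w; have [_ hy hyv] := s.
have c0 : c = 0.
  have : killing (lie y (lie y w)) v = 0.
    rewrite lieC killingNl killing_lie hyv killing_lie.
    by rewrite (lieC w) hw killingNr killingZr kyw mulr0 !oppr0.
  by rewrite e killingZl => /eqP; rewrite mulf_eq0 (negPf kyv) orbF => /eqP.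
have := lower22 s v2 w2 hw; rewrite e c0 scale0r !lie0r => /esym/eqP.
by rewrite scaler_eq0 (negPf (nat0 3)) => /eqP.
Qed.

Lemma plus_U i j v : i != j -> E i j 1 1 v ->
  E i j 1 (- 1) (lie (Y j) v) /\ lie (lie (Y j) v) (X j) = v.
Proof.
move=> nij Ev; split.
  by apply: Eij_cast (Eij_lie (Eij_Y nij) Ev) _ _; ring.
have v2 := Eij_V nij Ev.
have [_ vj _] := Ev.
by rewrite lieC (lower1 (sl2 j) (X2 j) v2 vj) opprK.
Qed.

Lemma minus_U i j y : i != j -> E i j (- 1) (- 1) y ->
  E i j 1 (- 1) (lie (X i) y) /\ lie (lie (X i) y) (Y i) = y.
Proof.
move=> nij Ey; split.
  by apply: Eij_cast (Eij_lie (Eij_X' nij) Ey) _ _; ring.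
have y2 : wt H0 (- 2) y by rewrite opprD; exact: Eij_H0 Ey.
have [yi _ _] := Ey.
by rewrite lieC (minus_YX wt_H0_N4 (sl2 i) (Y2 i) y2) yi scaleN1r opprK.
Qed.

End Extremal.

(** * The quarter turn *)

Section Inner.
Implicit Types (u v w z A B C Z : g).

(** The Lie algebra of the stabilizer of the frame; it acts on E_ij(1,-1) by infinitesimal
    rotations. *)
Definition inner Z := [/\ wt H0 0 Z, forall s, lie Z (X s) = 0 & forall s, lie Z (Y s) = 0].

Lemma innerD Z Z' : inner Z -> inner Z' -> inner (Z + Z').
Proof.
move=> [z zX zY] [z' zX' zY']; split=> [|s|s]; first exact: wtD.
  by rewrite lieDl zX zX' addr0.
by rewrite lieDl zY zY' addr0.
Qed.

Lemma innerZ c Z : inner Z -> inner (c *: Z).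
Proof.
move=> [z zX zY]; split=> [|s|s]; first exact: wtZ.
  by rewrite lieZl zX scaler0.
by rewrite lieZl zY scaler0.
Qed.

Lemma inner_H Z s : inner Z -> wt (H s) 0 Z.
Proof.
move=> [_ zX zY]; rewrite /wt scale0r lieC; have [_ _ <-] := sl2 s.
by rewrite lieJ zX zY lie0l lie0r addr0 oppr0.
Qed.

Lemma inner_E Z i j c d v : inner Z -> E i j c d v -> E i j c d (lie Z v).
Proof.
move=> iZ [vi vj vs]; split=> [||s si sj].
- by apply: wt_lie0l vi; exact: inner_H.
- by apply: wt_lie0l vj; exact: inner_H.
- by apply: wt_lie0l (vs s si sj); exact: inner_H.
Qed.

(* Commuting with [X s] suffices, by invariance of the Killing form. *)
Lemma inner_X Z : (forall s, wt (H s) 0 Z) -> (forall s, lie Z (X s) = 0) -> inner Z.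
Proof.
move=> zH zX; have z0 : wt H0 0 Z.
  have := wt_H0_joint (n := fun=> 0) zH.
  by rewrite big1.
split=> // s; have [c e] : exists c, lie Z (Y s) = c *: Y s.
  apply: minus_span.
    by exact: wt_lie0l.
  by apply: wt_lie0l (wt_HYii s).
have : killing (lie Z (Y s)) (X s) = 0 by rewrite lieC killingNl killing_lie zX killing0r oppr0.
rewrite e killingZl => /eqP; rewrite mulf_eq0 (negPf (killing_YX s)).
by rewrite orbF => /eqP->; rewrite scale0r.
Qed.

Section Pair.
Variables i j : 'I_k.+1.
Hypothesis nij : i != j.
Notation U := (E i j 1 (- 1)).
Notation b := (bq i j).
Notation fl := (flat i j).

Lemma inner_flat Z A : inner Z -> lie Z (fl A) = fl (lie Z A).
Proof.
move=> [_ zX zY]; by rewrite /flat lieNr (lieJ Z (Y i)) zY lie0l add0r (lieJ Z A) zX lie0r addr0.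
Qed.

(** Two symmetries determine the product: it is symmetric in B and C because E_ij(1,-1) is abelian,
    and exchanging A with B changes its sign up to 4 b(A, B) C. Running through the six permutations
    returns to the start with the opposite sign and yields twice the product. *)
Lemma triple_product A B C : U A -> U B -> U C ->
  lie (lie (fl A) B) C = (2 * b A B) *: C + (2 * b A C) *: B - (2 * b B C) *: A.
Proof.
have sym A' B' C' : U A' -> U B' -> U C' ->
    lie (lie (fl A') B') C' = lie (lie (fl A') C') B'.
  move=> UA UB UC; rewrite lie_lie (U_comm nij UB UC).
  by rewrite lie0r sub0r lieC opprK.
have swap A' B' C' : U A' -> U B' -> U C' ->
    lie (lie (fl A') B') C' = (4 * b A' B') *: C' - lie (lie (fl B') A') C'.
  move=> UA UB UC; have e := flat_lie_sym nij UA UB.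
  rewrite -[lie (fl A') B'](addrK (lie (fl B') A')) e lieDl lieNl lieZl.
  by rewrite (HiHj_U UC) scalerA mulrAC -natrM.
move=> UA UB UC; apply: (scalerI two0).
have e1 := swap _ _ _ UA UB UC; have e2 := sym _ _ _ UB UA UC.
have e3 := swap _ _ _ UB UC UA; have e4 := sym _ _ _ UC UB UA.
have e5 := swap _ _ _ UC UA UB; have e6 := sym _ _ _ UA UC UB.
have C' := bqC nij.
rewrite scaler_nat mulr2n {1}e1 e2 e3 e4 e5 e6 (C' _ _ UC UA); lmod F.
Qed.

(** For orthogonal A and B this bracket is the infinitesimal rotation in their plane, see
    [orth_act]. *)
Lemma orth_inner A B : U A -> U B -> b A B = 0 -> inner (lie (fl A) B).
Proof.
move=> UA UB bAB.
have bBA : b B A = 0 by rewrite (bqC nij).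
have Uf := flat_E nij UA.
have zH s : wt (H s) 0 (lie (fl A) B).
  have [fi fj fs] := Uf; have [Bi Bj Bs] := UB.
  have [->|si] := eqVneq s i; first by rewrite -(addNr 1); exact: wt_lie.
  have [->|sj] := eqVneq s j; first by rewrite -(addrN 1); exact: wt_lie.
  by apply: wt_lie0r; [exact: fs | exact: Bs].
apply: inner_X => // s.
have [->|si] := eqVneq s i.
  rewrite lie_lie (U_Xi nij UB) lie0r sub0r (flat_Xi nij UA) lieNr opprK.
  by rewrite (bq_lie nij UB UA) bBA mulr0 scale0r.
have [->|sj] := eqVneq s j; last first.
  by rewrite lie_lie (U_Xs nij UB si sj) (flat_Xs nij UA si) !lie0r subrr.
have z0 : wt H0 0 (lie (fl A) B).
  apply: wt_lie0r (U_H0 nij UB).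
  exact: (flat_H0 nij UA).
have [c e] : exists c, lie (lie (fl A) B) (X j) = c *: X j.
  apply: (frame_wt2 frame); apply: wt_lie0l => //.
  exact: wt_HXii j.
have k0 : killing (lie (lie (fl A) B) (X j)) (Y j) = 0.
  have [_ _ hj] := sl2 j; have [_ Bj _] := UB.
  rewrite killing_lie (lieC (X j)) hj killingNr killing_lie (lieC B) Bj scaleN1r opprK.
  rewrite /flat killingNl killing_lie (lieC _ B) killingNr.
  by rewrite (bq_lie nij UB UA) bBA mulr0 scale0r killing0r !oppr0.
move: k0; rewrite e killingZl killingC => /eqP; rewrite mulf_eq0.
by rewrite (negPf (killing_YX j)) orbF => /eqP->; rewrite scale0r.
Qed.

Lemma orth_anti A B : U A -> U B -> b A B = 0 -> lie (fl B) A = - lie (fl A) B.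
Proof.
move=> UA UB bAB; have := flat_lie_sym nij UA UB.
by rewrite bAB mulr0 scale0r => /eqP; rewrite addrC addr_eq0 => /eqP.
Qed.

Lemma orth_act A B C : U A -> U B -> U C -> b A B = 0 ->
  lie (lie (fl A) B) C = (2 * b A C) *: B - (2 * b B C) *: A.
Proof. by move=> UA UB UC e; rewrite triple_product // e mulr0 scale0r add0r. Qed.

Lemma bracket_R Z A B : inner Z -> lie Z (lie (fl A) B) = lie (fl (lie Z A)) B + lie (fl A) (lie Z B).
Proof. by move=> iZ; rewrite lieJ inner_flat. Qed.

End Pair.
End Inner.

(** * A torus acting as a quarter turn over the algebraic closure *)

Section QuarterTorus.
Let two0L : (2 : L) != 0 := char0_natr char0L 1.

Lemma wt_BC c v : wt H0 c v -> wt (tau H0 : gL) (iota c) (tau v).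
Proof. exact: toBC_wt. Qed.

(** The operator (ad H0)^2 + e ad H0 maps every rational vector into the weight space of e and acts
    there by 2 e^2 = 8. Identities known on that space thus pass to the scalar extension. *)
Lemma extend_grade (e : F) (f : 'End(g)) (fL : 'End(gL)) : e = 2 \/ e = - 2 ->
  (forall v, fL (tau v) = tau (f v)) -> (forall v, wt H0 e v -> f v = 0) ->
  forall u : gL, wt (tau H0) (iota e) u -> fL u = 0.
Proof.
move=> he fE f0 u hu.
have e4 : e * e = 4 by case: he => ->; ring.
have p0 v : f (lie H0 (lie H0 v) + e *: lie H0 v) = 0.
  apply: f0; rewrite /wt lieDr lieZr H0_cube -e4 scalerDr scalerA.
  by rewrite addrC.
pose q (x : gL) : gL := lie (tau H0) (lie (tau H0) x) + iota e *: lie (tau H0) x.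
have qD x y : q (x + y) = q x + q y by rewrite /q !lieDr; lmod L.
have qZ c x : q (c *: x) = c *: q x by rewrite /q !lieZr; lmod L.
have pL (x : gL) : fL (q x) = 0.
  move: x; apply: gL_ind => [|x y ex ey|c v].
  - by rewrite /q !lie0r scaler0 addr0 linear0.
  - by rewrite qD linearD /= ex ey addr0.
  - by rewrite qZ linearZ /= /q !toBC_lieE -toBCZ -toBCD fE p0 toBC0 scaler0.
have := pL u; rewrite /q hu lieZr hu !scalerA -rmorphM e4 -scalerDl -rmorphD.
rewrite linearZ /= => /eqP; rewrite scaler_eq0 fmorph_eq0 -natrD (negPf (nat0 7)).
by move/eqP.
Qed.

Variables (D : g).
Hypothesis D0 : wt H0 0 D.
Variable t : F.
Hypothesis t0 : t != 0.
Hypothesis D3 : forall v, wt H0 2 v -> lie D (lie D (lie D v)) = - t *: lie D v.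

Lemma D3_minus v : wt H0 (- 2) v -> lie D (lie D (lie D v)) = - t *: lie D v.
Proof.
move=> v2; apply/eqP; rewrite -subr_eq0 scaleNr opprK; apply/eqP.
have Dc c u : wt H0 c u -> wt H0 c (lie D u) by move=> uc; exact: wt_lie0l.
have w2 : wt H0 (- 2) (lie D (lie D (lie D v)) + t *: lie D v).
  by apply: wtD; [exact: (Dc _ _ (Dc _ _ (Dc _ _ v2))) | exact: wtZ (Dc _ _ v2)].
apply: (minus_ext w2) => w hw; rewrite killingDl killingZl.
have sk x y : killing (lie D x) y = - killing x (lie D y) by rewrite lieC killingNl killing_lie.
by rewrite !sk D3 // killingZr; ring.
Qed.

Variable om : L.
Hypothesis omE : om * om = - iota t.
Let om0 : om != 0.
Proof.
apply/eqP => e; move/eqP: omE; rewrite e mul0r eq_sym oppr_eq0 fmorph_eq0.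
by rewrite (negPf t0).
Qed.

(** D^3 = -t D on V+ and V- becomes [unitD]^3 = [unitD], so that the eigenvalues are 0, 1 and -1. *)
Definition unitD : gL := om^-1 *: tau D.

Lemma unitD3 (c : F) (u : gL) : c = 2 \/ c = - 2 -> wt (tau H0) (iota c) u ->
  lie unitD (lie unitD (lie unitD u)) = lie unitD u.
Proof.
move=> hc hu; pose fL : 'End(gL) := (ad (tau D) \o (ad (tau D) \o ad (tau D)))%VF + iota t *: ad (tau D).
pose f : 'End(g) := (ad D \o (ad D \o ad D))%VF + t *: ad D.
have e := @extend_grade c f fL hc.
have := e _ _ u hu; rewrite /fL !(add_lfunE, comp_lfunE, scale_lfunE, adE) => h.
have {}h : lie (tau D) (lie (tau D) (lie (tau D) u)) = - iota t *: lie (tau D) u.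
  apply/eqP; rewrite scaleNr -addr_eq0; apply/eqP; apply: h.
    move=> v; rewrite /f !(add_lfunE, comp_lfunE, scale_lfunE, adE).
    by rewrite !toBC_lieE -toBCZ -toBCD.
  move=> v vc; rewrite /f !(add_lfunE, comp_lfunE, scale_lfunE, adE).
  by case: hc => ce; rewrite ce in vc; rewrite ?(D3 vc) ?(D3_minus vc) scaleNr addNr.
rewrite /unitD !(lieZl, lieZr) h !scalerA -omE; congr (_ *: _).
by field.
Qed.

(** z raises the weights of h by 2, and these are -1, 0, 1 on V+ and V-; hence (ad z)^2 = 0 there,
    and V+, V- generate the algebra. *)
Lemma unitD_nilpotent (h z : gL) : h = unitD \/ h = - unitD -> lie h z = 2 *: z ->
  lie (tau H0) z = 0 -> ad_nilpotent z.
Proof.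
move=> hE hz Hz; apply: locally_nilpotent_ad.
have h3 c u : c = 2 \/ c = - 2 -> wt (tau H0) (iota c) u -> lie h (lie h (lie h u)) = lie h u.
  by move=> hc hu; case: hE => ->; rewrite ?lieNl ?lieNr ?lieNl ?lieNr ?opprK (unitD3 hc hu).
have hH : lie (tau H0) h = 0.
  have e : lie (tau H0) unitD = 0 by rewrite lieZr toBC_lieE D0 scale0r toBC0 scaler0.
  by case: hE => ->; rewrite ?lieNr e ?oppr0.
have grade c : c = 2 \/ c = - 2 -> forall u : gL, wt (tau H0) (iota c) u -> lie z (lie z u) = 0.
  move=> hc u hu.
  have gz w : wt (tau H0) (iota c) w -> wt (tau H0) (iota c) (lie z w).
    by move=> wc; apply: wt_lie0l => //; rewrite /wt Hz scale0r.
  have gh w : wt (tau H0) (iota c) w -> wt (tau H0) (iota c) (lie h w).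
    by move=> wc; apply: wt_lie0l => //; rewrite /wt hH scale0r.
  have vanish d w : wt (tau H0) (iota c) w -> wt h d w -> d * d * d - d != 0 -> w = 0.
    move=> wc wd dn; have := h3 c w hc wc; rewrite !(wd, lieZr, scalerA) => /eqP.
    by rewrite -subr_eq0 -scalerBl scaler_eq0 (negPf dn) => /eqP.
  pose u0 := u - lie h (lie h u); pose up := 2^-1 *: (lie h (lie h u) + lie h u).
  pose um := 2^-1 *: (lie h (lie h u) - lie h u).
  have uE : u = u0 + up + um by rewrite /u0 /up /um; lmodf L; rewrite // two0L.
  have w0 : wt h 0 u0 by rewrite /wt /u0 lieDr lieNr (h3 c) // subrr scale0r.
  have wp : wt h 1 up by rewrite /wt /up lieZr lieDr (h3 c) // scale1r addrC.
  have wm : wt h (- 1) um by rewrite /wt /um lieZr lieDr lieNr (h3 c) //; lmod L.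
  have c0 : wt (tau H0) (iota c) u0 by apply: wtD => //; apply/wtN/gh/gh.
  have cp : wt (tau H0) (iota c) up by apply/wtZ/wtD; [exact/gh/gh | exact: gh].
  have cm : wt (tau H0) (iota c) um by apply/wtZ/wtD; [exact/gh/gh | exact/wtN/gh].
  have nz (n : nat) (d : L) : d = n.+1%:R -> d != 0 by move=> ->; exact: char0_natr.
  clearbody u0 up um; rewrite uE !lieDr (vanish _ _ (gz _ c0) (wt_lie hz w0)) ?lie0r ?add0r; last first.
    by apply: (nz 5); ring.
  rewrite (vanish _ _ (gz _ cp) (wt_lie hz wp)) ?lie0r ?add0r; last first.
    by apply: (nz 23); ring.
  apply: (vanish _ _ (gz _ (gz _ cm)) (wt_lie hz (wt_lie hz wm))).
  by apply: (nz 23); ring.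
move=> u; apply: (gL_ind (P := locally_nilpotent z)) u => [|x y nx ny|c v].
- by exists 0%N.
- by rewrite -[x]scale1r; exact: locally_nilpotent_lin.
suff nv : locally_nilpotent z (tau v).
  rewrite -[_ *: _]addr0; apply: locally_nilpotent_lin => //; by exists 0%N.
move: v; apply: (generated_ind (P := fun v => locally_nilpotent z (tau v))).
- by exists 0%N; rewrite toBC0.
- by move=> d x y nx ny; rewrite toBC_linear; exact: locally_nilpotent_lin.
- by move=> x y nx ny; rewrite -toBC_lieE; exact: locally_nilpotent_lie.
- by move=> v v2; exists 2%N; apply: (grade 2) => //; [left | exact: wt_BC].
- by move=> v v2; exists 2%N; apply: (grade (- 2)) => //; [right | exact: wt_BC].
Qed.

Variables (J K : g) (s m : F) (I : L).
Hypothesis s2 : s * s = 1.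
Hypotheses (J0 : wt H0 0 J) (K0 : wt H0 0 K).
Hypothesis DJ : lie D J = (2 * s * t) *: K.
Hypothesis DK : lie D K = (- 2 * s) *: J.
Hypothesis JK : lie J K = (8 * s * m * t) *: D.
Hypothesis m0 : m != 0.
Hypothesis I2 : I * I = - 1.

(** J and K combine to eigenvectors x, y of [unitD] forming an sl2-triple with it; T is the torus of
    this triple at I. On the plane of v and D v with D^2 = -t, the eigenvalues 1, -1 become I and
    I^-1 = -I, so T = I [unitD] = (I/om) D. *)
Lemma quarter_torus : exists2 T : gL -> gL, elementary T &
  [/\ T (tau H0) = tau H0, forall v, lie D v = 0 -> T (tau v) = tau v &
      forall v, lie D (lie D v) = - t *: v -> T (tau v) = (I / om) *: tau (lie D v)].
Proof.
pose x : gL := tau J - (iota s * om) *: tau K.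
(* The scalar makes [y, x] = [unitD]: before scaling the bracket is -2 s om [J, K] = -16 om m t D,
   and t = -om^2. *)
pose y : gL := (16 * iota m * iota t ^+ 2)^-1 *: (tau J + (iota s * om) *: tau K).
have is2 : iota s * iota s = 1 by rewrite -rmorphM s2 rmorph1.
have it0 : iota t != 0 by rewrite fmorph_eq0.
have im0 : iota m != 0 by rewrite fmorph_eq0.
have LDJ : lie (tau D) (tau J) = (2 * iota s * iota t) *: (tau K : gL).
  by rewrite toBC_lieE DJ toBCZ !rmorphM rmorph_nat.
have LDK : lie (tau D) (tau K) = (- 2 * iota s) *: (tau J : gL).
  by rewrite toBC_lieE DK toBCZ !rmorphM rmorphN rmorph_nat.
have LJK : lie (tau J) (tau K) = (8 * iota s * iota m * iota t) *: (tau D : gL).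
  by rewrite toBC_lieE JK toBCZ !rmorphM rmorph_nat.
have tE : iota t = - (om * om) by rewrite omE opprK.
have hx : lie unitD x = 2 *: x.
  rewrite /x /unitD lieZl lieDr lieNr lieZr LDJ LDK tE.
  transitivity ((2 * (iota s * iota s)) *: (tau J : gL) - (2 * iota s * om) *: tau K).
    by lmodf L; rewrite // om0.
  by rewrite is2; lmod L.
have hy : lie unitD y = - 2 *: y.
  rewrite /y /unitD lieZl lieZr lieDr lieZr LDJ LDK.
  transitivity ((16 * iota m * iota t ^+ 2)^-1 *: ((- 2 * (iota s * iota s)) *: (tau J : gL) - (2 * iota s * om) *: tau K)).
    by rewrite tE; lmodf L; rewrite ?oppr_eq0 ?mulf_neq0 ?om0 ?im0 ?(char0_natr char0L 15).
  by rewrite is2; lmod L.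
have hyx : lie y x = unitD.
  rewrite /x /y /unitD lieZl lieDl !lieDr !lieNr !lieZl !lieZr !liexx !scaler0 ?subr0 ?addr0 ?oppr0.
  rewrite (lieC (tau K) (tau J)) LJK.
  transitivity ((- (16 * iota m * iota t ^+ 2)^-1 * (16 * (iota s * iota s) * om * iota m * iota t)) *: (tau D : gL)).
    by lmodf L; rewrite // ?it0 ?im0 ?(char0_natr char0L 15).
  rewrite is2 tE; congr (_ *: _); field.
  by rewrite oppr_eq0 mulf_eq0 (negPf om0) im0 (char0_natr char0L 15).
have gJ : lie (tau H0) (tau J) = 0 :> gL by rewrite toBC_lieE J0 scale0r toBC0.
have gK : lie (tau H0) (tau K) = 0 :> gL by rewrite toBC_lieE K0 scale0r toBC0.
have nx : ad_nilpotent x.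
  apply: (unitD_nilpotent (or_introl erefl) hx).
  by rewrite /x lieDr lieNr lieZr gJ gK scaler0 subr0.
have ny : ad_nilpotent y.
  apply: (unitD_nilpotent (or_intror erefl)).
    by rewrite lieNl hy scaleNr opprK.
  by rewrite /y lieZr lieDr lieZr gJ gK scaler0 addr0 scaler0.
have I0 : I != 0 by apply/eqP => e; move/eqP: I2; rewrite e mul0r eq_sym oppr_eq0 oner_eq0.
have tri : sl2_triple y unitD x by split.
have [T eT TE] := torus_elementary char0L tri nx ny I0.
have lT := elementary_linear eT.
have Tid v : lie D v = 0 -> T (tau v) = tau v.
  move=> Dv; rewrite (TE 0) ?expr0z ?scale1r //.
  by rewrite /wt /unitD lieZl toBC_lieE Dv toBC0 scaler0 scale0r.
exists T => //; split=> // [|v DDv].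
  by apply: Tid; rewrite lieC D0 scale0r oppr0.
pose w : gL := om^-1 *: tau (lie D v).
have Dw : lie unitD w = tau v.
  rewrite /w /unitD lieZl lieZr toBC_lieE DDv toBCZ rmorphN tE opprK !scalerA.
  by rewrite -[RHS]scale1r; congr (_ *: _); field.
have Dv : lie unitD (tau v) = w by rewrite /unitD lieZl toBC_lieE.
have vp : wt unitD 1%:~R (2^-1 *: (tau v + w)) by rewrite /wt lieZr lieDr Dw Dv scale1r addrC.
have vm : wt unitD (-1)%:~R (2^-1 *: (tau v - w)) by rewrite /wt lieZr lieDr lieNr Dw Dv; lmod L.
have vE : tau v = 1 *: (2^-1 *: (tau v + w)) + 2^-1 *: (tau v - w) by lmodf L; rewrite // two0L.
rewrite vE lT (TE _ _ vp) (TE _ _ vm) expr1z exprN1 scale1r.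
have -> : I^-1 = - I by apply: (mulfI I0); rewrite mulfV // mulrN I2 opprK.
by rewrite /w; lmodf L; rewrite // ?two0L ?om0.
Qed.

End QuarterTorus.
Section QuarterProduct.
Variables (i : 'I_k.+1) (D J K : g) (t s m : F) (om I : L).
Hypothesis iD : inner D.
Hypotheses (t0 : t != 0) (m0 : m != 0) (s2 : s * s = 1).
Hypothesis omE : om * om = - iota t.
Hypothesis I2 : I * I = - 1.
Hypotheses (J0 : wt H0 0 J) (K0 : wt H0 0 K).
Hypothesis DJ : lie D J = (2 * s * t) *: K.
Hypothesis DK : lie D K = (- 2 * s) *: J.
Hypothesis JK : lie J K = (8 * s * m * t) *: D.
Variable Psi : gL -> gL.
Hypothesis ePsi : elementary Psi.
Hypothesis Psi0 : Psi (tau H0) = tau H0.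
Hypothesis PsiX : forall j, Psi (tau (X j)) = tau (X j).

(** The two kinds of vectors on which the composite of the quarter turn, the torus of H_i at om/I
    and [Psi] is rational. [Psi] repairs the vectors that D kills but on which the torus of H_i is
    not rational; it is the identity when a third index exists. *)
Definition turned v :=
  [/\ lie D (lie D v) = - t *: v, wt (H i) 1 v & Psi (tau (lie D v)) = tau (lie D v)].
Definition torused v := lie D v = 0 /\
  exists2 n : int, wt (H i) n%:~R v & exists w, Psi ((om / I) ^ n *: tau v) = tau w.

Hypothesis spanning : forall W : {vspace g}, (forall v, turned v -> v \in W) ->
  (forall v, torused v -> v \in W) -> forall p q v, p != q -> E p q 1 1 v -> v \in W.

Let om0 : om != 0.
Proof. by apply: contra_eq_neq omE => ->; rewrite mul0r eq_sym oppr_eq0 fmorph_eq0. Qed.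
Let I0 : I != 0.
Proof. by apply: contra_eq_neq I2 => ->; rewrite mul0r eq_sym oppr_eq0 oner_eq0. Qed.
Let c0 : om / I != 0. Proof. by rewrite mulf_neq0 ?invr_eq0. Qed.

Lemma dop_quarter : diagonal_of_product t.
Proof.
have [D0 DX _] := iD.
have spanV (W : {vspace g}) : (forall v, turned v -> v \in W) ->
    (forall v, torused v -> v \in W) -> (forall j, X j \in W) ->
    forall v, wt H0 2 v -> v \in W.
  move=> h1 h2 h3 v /wt_eigen; apply/subvP.
  exact: (frame_span h3 (spanning h1 h2)).
have D3 v : wt H0 2 v -> lie D (lie D (lie D v)) = - t *: lie D v.
  have [W WE] : exists W : {vspace g}, forall v, v \in W <->
      lie D (lie D (lie D v)) = - t *: lie D v.
    apply: pred_vspace => [|c x y ex ey]; first by rewrite !lie0r scaler0.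
    by rewrite !(lieDr, lieZr) ex ey scalerDr !scalerA mulrC.
  move=> hv; apply/WE; apply: spanV hv => [u [e _ _]|u [e _]|j]; apply/WE.
  - by rewrite e lieZr.
  - by rewrite e !lie0r scaler0.
  - by rewrite DX !lie0r scaler0.
have [T eT [T0 Tfix Tturn]] :=
  quarter_torus D0 t0 D3 omE s2 J0 K0 DJ DK JK m0 I2.
have [Ti eTi TiZ] := torus_V (fam_sl2 fam i) (fam_X2 fam i) (fam_Y2 fam i) c0.
have PsiL c u v := elementary_linear ePsi c u v.
have TiL c u v := elementary_linear eTi c u v.
have TL c u v := elementary_linear eT c u v.
(* On turned vectors the factor I/om of T cancels the factor om/I of Ti; on X_i, of weight 2, Ti
   produces (om/I)^2 = t. *)
pose Phi u := Psi (Ti (T u)).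
have ePhi : elementary Phi by apply: elementary_comp ePsi _; exact: elementary_comp eTi eT.
pose a j : F := if j == i then t else 1.
have a0 j : a j != 0 by rewrite /a; case: ifP => _; rewrite ?oner_eq0.
have PhiX j : Phi (tau (X j)) = tau (a j *: X j).
  rewrite /Phi Tfix // (TiZ (if j == i then 2 else 0)); last first.
    by have := wt_HX i j; rewrite eq_sym; case: ifP.
  rewrite elementaryZ // PsiX toBCZ /a; case: ifP => _; last by rewrite rmorph1.
  congr (_ *: _); rewrite -[_ ^ 2]/((om / I) ^+ 2) expr2 mulf_div omE I2.
  by rewrite invrN1 mulrN1 opprK.
have rat v : wt H0 2 v -> exists w, Phi (tau v) = tau w.
  have [W WE] : exists W : {vspace g}, forall v, v \in W <-> exists w, Phi (tau v) = tau w.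
    apply: pred_vspace => [|c x y [x' ex] [y' ey]].
      by exists 0; rewrite toBC0 -[0]toBC0 /Phi Tfix ?lie0r // toBC0 !elementary0.
    by exists (c *: x' + y'); rewrite !toBC_linear /Phi TL TiL PsiL -ex -ey.
  move=> hv; apply/WE; apply: spanV hv => [u [e e1 eP]|u [e [n en [w ew]]]|j]; apply/WE.
  - exists (lie D u); rewrite /Phi Tturn // (elementaryZ _ _ eTi) (TiZ 1); last first.
      rewrite /wt lieJ (_ : lie (H i) D = 0) ?lie0l ?add0r ?e1 ?lieZr //.
      by have := inner_H i iD; rewrite /wt scale0r.
    have -> : I / om *: ((om / I) ^ 1 *: tau (lie D u)) = tau (lie D u) => //.
    by rewrite scalerA expr1z (_ : _ * _ = 1) ?scale1r //; field; rewrite om0 I0.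
  - by exists w; rewrite /Phi Tfix // (TiZ n).
  - by eexists; exact: PhiX.
have Phi0 : Phi (tau H0) = tau H0.
  rewrite /Phi T0 (TiZ 0) ?scale1r //; rewrite /wt scale0r.
  by have := wt_H0_H i; rewrite /wt scale0r => e; rewrite lieC e oppr0.
have [phi Gphi ephi] := descent_rational ePhi Phi0 a0 PhiX rat.
exists phi => //; exists a => [j|]; first by apply: (@toBC_inj _ _ iota); rewrite -ephi PhiX.
by rewrite (bigD1 i) //= /a eqxx big1 ?mulr1 // => j /negPf->.
Qed.
End QuarterProduct.
Lemma zero_of_X j z : wt H0 0 z -> wt (H j) (- 1) z -> lie z (X j) = 0 -> z = 0.
Proof.
move=> z0 zj e; have Yz : lie (Y j) z = 0.
  apply: (minus_wtN3 (s := j)).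
    by exact: wt_lie0r (Y2 j) z0.
  by rewrite (_ : - 3 = - 2 + - 1); [exact: wt_lie (wt_HYii j) zj | ring].
have := congr1 (lie (Y j)) e; rewrite lie0r lieJ Yz lie0l add0r.
by have [_ _ ->] := sl2 j; rewrite lieC zj scaleN1r opprK.
Qed.

Lemma zero_three i j r z : i != j -> r != i -> r != j -> wt H0 0 z ->
  wt (H i) 1 z -> wt (H j) (- 1) z -> wt (H r) 1 z -> z = 0.
Proof.
move=> nij nri nrj z0 zi zj zr; apply: (zero_of_X z0 zj).
apply: (three_ones nij (l := r)); rewrite 1?eq_sym //.
- exact: plus_g0 z0 (X2 j).
- by apply: wt_lie0r zi _; exact: wt_HXij.
- by rewrite (_ : 1 = - 1 + 2); [exact: wt_lie zj (wt_HXii j) | ring].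
- apply: wt_lie0r zr _; apply: wt_HXij => //.
Qed.

Section QuarterTurn.
Variables i j : 'I_k.+1.
Hypothesis nij : i != j.
Notation U := (E i j 1 (- 1)).
Notation b := (bq i j).
Notation fl := (flat i j).
Variables (A1 A2 A3 A4 : g) (t : F).
Hypotheses (U1 : U A1) (U2 : U A2) (U3 : U A3) (U4 : U A4).
Hypotheses (b12 : b A1 A2 = 0) (b13 : b A1 A3 = 0) (b14 : b A1 A4 = 0)
  (b23 : b A2 A3 = 0) (b24 : b A2 A4 = 0) (b34 : b A3 A4 = 0).
Notation c1 := (b A1 A1).
Notation c3 := (b A3 A3).
Hypotheses (c10 : c1 != 0) (c30 : c3 != 0).
Hypotheses (c2E : b A2 A2 = t * c1) (c4E : b A4 A4 = t * c3).
Hypothesis t0 : t != 0.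

Notation R A B := (lie (fl A) B).

Let C {A B} UA UB := @bqC _ _ nij A B UA UB.
Let b21 : b A2 A1 = 0. Proof. by rewrite (C U2 U1). Qed.
Let b31 : b A3 A1 = 0. Proof. by rewrite (C U3 U1). Qed.
Let b41 : b A4 A1 = 0. Proof. by rewrite (C U4 U1). Qed.
Let b32 : b A3 A2 = 0. Proof. by rewrite (C U3 U2). Qed.
Let b42 : b A4 A2 = 0. Proof. by rewrite (C U4 U2). Qed.
Let b43 : b A4 A3 = 0. Proof. by rewrite (C U4 U3). Qed.

Let actE {A B C'} UA UB UC e :=
  @orth_act _ _ nij A B C' UA UB UC e.
Let antiE {A B} UA UB e :=
  @orth_anti _ _ nij A B UA UB e.
Let inn {A B} UA UB e :=
  @orth_inner _ _ nij A B UA UB e.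

Section Turn.
Variable s : F.
Hypothesis s2 : s * s = 1.

(** Rotations in the planes (A1, A2) and (A3, A4), scaled so that D^2 = -t on the whole span. The
    sign s is their relative orientation and selects one of the two simple factors of so(4), inside
    which [turnJ] and [turnK] complete D to a form of sl2. *)
Definition turnD := (2 * c1)^-1 *: R A1 A2 + (s * (2 * c3)^-1) *: R A3 A4.
Definition turnJ := (s * t) *: R A1 A3 - R A2 A4.
Definition turnK := R A2 A3 + s *: R A1 A4.

Lemma turnD_inner : inner turnD.
Proof. by apply: innerD; apply: innerZ; exact: inn. Qed.

Lemma turnJ_inner : inner turnJ.
Proof.
apply: innerD; first by apply: innerZ; exact: inn.
by rewrite -scaleN1r; apply: innerZ; exact: inn.
Qed.

Lemma turnD1 : lie turnD A1 = A2.
Proof.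
rewrite /turnD lieDl !lieZl (actE U1 U2 U1 b12) (actE U3 U4 U1 b34) b21 b31 b41.
rewrite !mulr0 !scale0r !subr0 scaler0 addr0 scalerA -[RHS]scale1r.
by congr (_ *: _); field; rewrite two0 c10.
Qed.

Lemma turnD2 : lie turnD A2 = - t *: A1.
Proof.
rewrite /turnD lieDl !lieZl (actE U1 U2 U2 b12) (actE U3 U4 U2 b34) b12 b32 b42 c2E.
rewrite !mulr0 !scale0r !subr0 scaler0 addr0 sub0r scalerN scalerA -scaleNr.
by congr (_ *: _); field; rewrite two0 c10.
Qed.

Lemma turnD3 : lie turnD A3 = s *: A4.
Proof.
rewrite /turnD lieDl !lieZl (actE U1 U2 U3 b12) (actE U3 U4 U3 b34) b13 b23 b43.
rewrite !mulr0 !scale0r !subr0 scaler0 add0r scalerA.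
by congr (_ *: _); field; rewrite two0 c30.
Qed.

Lemma turnD4 : lie turnD A4 = (- s * t) *: A3.
Proof.
rewrite /turnD lieDl !lieZl (actE U1 U2 U4 b12) (actE U3 U4 U4 b34) b14 b24 b34 c4E.
rewrite !mulr0 !scale0r !subr0 scaler0 add0r sub0r scalerN scalerA -scaleNr.
by congr (_ *: _); field; rewrite two0 c30.
Qed.

Let DR A B := bracket_R i j A B turnD_inner.

Lemma turnDJ : lie turnD turnJ = (2 * s * t) *: turnK.
Proof.
rewrite /turnJ /turnK lieDr lieNr lieZr !DR turnD1 turnD2 turnD3 turnD4.
rewrite !linearZ /= !lieZl.
transitivity ((2 * s * t) *: R A2 A3 + (s * s * t + t) *: R A1 A4); first by lmod F.
rewrite s2 scalerDr scalerA (_ : 2 * s * t * s = 2 * (s * s) * t); last by ring.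
by rewrite s2; lmod F.
Qed.

Lemma turnDK : lie turnD turnK = (- 2 * s) *: turnJ.
Proof.
rewrite /turnJ /turnK lieDr lieZr !DR turnD1 turnD2 turnD3 turnD4.
rewrite !linearZ /= !lieZl.
transitivity ((- (t + s * s * t)) *: R A1 A3 + (s + s) *: R A2 A4); first by lmod F.
rewrite s2 scalerBr scalerA (_ : - 2 * s * (s * t) = - 2 * (s * s) * t); last by ring.
by rewrite s2; lmod F.
Qed.

Lemma turnJK : lie turnJ turnK = (8 * s * t * c1 * c3) *: turnD.
Proof.
have i13 := inn U1 U3 b13; have i24 := inn U2 U4 b24.
have B13 A B := bracket_R i j A B i13.
have B24 A B := bracket_R i j A B i24.
have act0 (A B C' : g) c d : c = 0 -> d = 0 -> (2 * c) *: A - (2 * d) *: B = 0 :> g.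
  by move=> -> ->; rewrite !mulr0 !scale0r subr0.
have e132 : lie (R A1 A3) A2 = 0 by rewrite (actE U1 U3 U2 b13) act0.
have e134 : lie (R A1 A3) A4 = 0 by rewrite (actE U1 U3 U4 b13) act0.
have e241 : lie (R A2 A4) A1 = 0 by rewrite (actE U2 U4 U1 b24) act0.
have e243 : lie (R A2 A4) A3 = 0 by rewrite (actE U2 U4 U3 b24) act0.
have e131 : lie (R A1 A3) A1 = (2 * c1) *: A3.
  by rewrite (actE U1 U3 U1 b13) b31 mulr0 scale0r subr0.
have e133 : lie (R A1 A3) A3 = - (2 * c3) *: A1.
  by rewrite (actE U1 U3 U3 b13) b13 mulr0 scale0r sub0r scaleNr.
have e242 : lie (R A2 A4) A2 = (2 * (t * c1)) *: A4.
  by rewrite (actE U2 U4 U2 b24) c2E b42 mulr0 scale0r subr0.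
have e244 : lie (R A2 A4) A4 = - (2 * (t * c3)) *: A2.
  by rewrite (actE U2 U4 U4 b24) c4E b24 mulr0 scale0r sub0r scaleNr.
have R21 := antiE U1 U2 b12; have R43 := antiE U3 U4 b34.
rewrite /turnJ /turnK lieDl lieNl !lieZl !lieDr !lieZr !B13 !B24.
rewrite e132 e134 e241 e243 e131 e133 e242 e244 /turnD.
rewrite !linear0 !lie0l !linearZ /= !lieZl R21 R43.
set P := R A1 A2; set Q := R A3 A4.
transitivity ((2 * s * t * c3 * (1 + 1)) *: P + ((s * s) * 2 * t * c1 + 2 * t * c1) *: Q).
  by lmod F.
rewrite s2 scalerDr !scalerA; congr (_ *: _ + _ *: _); first by field; rewrite two0 c10.
rewrite (_ : 8 * s * t * c1 * c3 * _ = (s * s) * 4 * t * c1); last by field; rewrite two0 c30.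
by rewrite s2; ring.
Qed.

End Turn.

(** * A third index: Clifford module and choice of the orientation *)

Section ThreeIndices.
Variable r : 'I_k.+1.
Hypotheses (nri : r != i) (nrj : r != j).
Let nir : i != r. Proof. by rewrite eq_sym. Qed.
Let njr : j != r. Proof. by rewrite eq_sym. Qed.
Notation M := (E j r 1 (- 1)).
Notation N := (E i r 1 (- 1)).

Let g0_2 s z : wt H0 0 z -> wt (H s) 2 z -> z = 0.
Proof. exact: (no_wt2_g0 fam). Qed.

Lemma cl_UM A v : U A -> M v -> N (lie A v).
Proof.
move=> [Ai Aj As] [vj vr vs]; split.
- by apply: wt_lie0r Ai (vs i nij nir).
- by apply: wt_lie0l vr; exact: As.
move=> s si sr; have [->|sj] := eqVneq s j; first by rewrite -(addNr 1); exact: wt_lie.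
by apply: wt_lie0r; [exact: As | exact: vs].
Qed.

Lemma cl_fN A n : U A -> N n -> M (lie (fl A) n).
Proof.
move=> UA [ni nr ns]; have [fi fj fs] := flat_E nij UA; split.
- by apply: wt_lie0r fj (ns j _ njr); rewrite eq_sym.
- by apply: wt_lie0l nr; exact: fs.
move=> s sj sr; have [->|si] := eqVneq s i; first by rewrite -(addNr 1); exact: wt_lie.
by apply: wt_lie0r; [exact: fs | exact: ns].
Qed.

Lemma cl_fM A v : U A -> M v -> lie (fl A) v = 0.
Proof.
move=> UA Mv; have [fi fj fs] := flat_E nij UA; have [vj _ _] := Mv.
apply: (g0_2 (s := j)).
  by exact: wt_lie0r (flat_H0 nij UA) (Eij_g0 njr Mv).
by rewrite (_ : 2 = 1 + 1); [exact: wt_lie | ring].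
Qed.

Lemma cl_UN A n : U A -> N n -> lie A n = 0.
Proof.
move=> UA Nn; have [Ai _ _] := UA; have [ni _ _] := Nn; apply: (g0_2 (s := i)).
  by exact: wt_lie0r (Eij_g0 nij UA) (Eij_g0 nir Nn).
by rewrite (_ : 2 = 1 + 1); [exact: wt_lie | ring].
Qed.

Lemma cl_R A B v : U A -> U B -> M v -> lie (lie (fl A) B) v = lie (fl A) (lie B v).
Proof. by move=> UA UB Mv; rewrite lie_lie (cl_fM UA Mv) lie0r subr0. Qed.

(* The Clifford module E(j,-r) + E(i,-r). *)
Definition clm w := exists v n, [/\ M v, N n & w = v + n].
Definition cl A w := lie (A + fl A) w.

Lemma clm_M v : M v -> clm v.
Proof.
by move=> Mv; exists v, 0; split; [| split=> *; exact: wt0 | rewrite addr0].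
Qed.

Lemma clmZ c w : clm w -> clm (c *: w).
Proof.
move=> [v [n [Mv Nn ->]]]; exists (c *: v), (c *: n).
by split; [exact: EijZ | exact: EijZ | rewrite scalerDr].
Qed.

Lemma clmN w : clm w -> clm (- w).
Proof. by rewrite -scaleN1r; exact: clmZ. Qed.

Lemma cl_stable A w : U A -> clm w -> clm (cl A w).
Proof.
move=> UA [v [n [Mv Nn ->]]]; exists (lie (fl A) n), (lie A v); split.
- exact: cl_fN.
- exact: cl_UM.
by rewrite /cl lieDl !lieDr (cl_UN UA Nn) (cl_fM UA Mv) addr0 add0r addrC.
Qed.

Lemma clME A v : U A -> M v -> cl A v = lie A v.
Proof. by move=> UA Mv; rewrite /cl lieDl (cl_fM UA Mv) addr0. Qed.

Lemma clNE A n : U A -> N n -> cl A n = lie (fl A) n.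
Proof. by move=> UA Nn; rewrite /cl lieDl (cl_UN UA Nn) add0r. Qed.

Lemma clZ A c w : cl A (c *: w) = c *: cl A w. Proof. exact: lieZr. Qed.
Lemma clN A w : cl A (- w) = - cl A w. Proof. exact: lieNr. Qed.

Lemma cl_rel A B w : U A -> U B -> clm w -> cl A (cl B w) + cl B (cl A w) = - (2 * b A B) *: w.
Proof.
move=> UA UB [v [n [Mv Nn ->]]].
have e := flat_lie_sym nij UA UB.
have clD A' x y : cl A' (x + y) = cl A' x + cl A' y := lieDr _ _ _.
have eM : cl A (cl B v) + cl B (cl A v) = - (2 * b A B) *: v.
  rewrite (clME UB Mv) (clME UA Mv) (clNE UA (cl_UM UB Mv)) (clNE UB (cl_UM UA Mv)).
  rewrite -!cl_R // -lieDl e lieZl lieDl lieNl.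
  have [vj _ vs] := Mv; rewrite vj (vs i nij nir) scale0r scale1r sub0r scalerN.
  by rewrite scaleNr.
have eN : cl A (cl B n) + cl B (cl A n) = - (2 * b A B) *: n.
  rewrite (clNE UB Nn) (clNE UA Nn) (clME UA (cl_fN UB Nn)) (clME UB (cl_fN UA Nn)).
  have h A' B' : U A' -> U B' -> lie B' (lie (fl A') n) = - lie (lie (fl A') B') n.
    by move=> UA' UB'; rewrite lie_lie (cl_UN UB' Nn) lie0r sub0r opprK.
  rewrite !h // -opprD -lieDl addrC e lieZl lieDl lieNl.
  have [ni _ ns] := Nn; rewrite ni (ns j) // ?scale0r ?subr0 ?scale1r ?scaleNr // eq_sym.
  exact: nij.
by rewrite !clD addrACA eM eN scalerDr.
Qed.

Lemma cl_self A w : U A -> clm w -> cl A (cl A w) = - b A A *: w.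
Proof.
move=> UA hw; apply: (scalerI two0); rewrite scaler_nat mulr2n cl_rel // scalerA.
by rewrite mulrN.
Qed.

Lemma cl_anti A B w : U A -> U B -> b A B = 0 -> clm w -> cl A (cl B w) = - cl B (cl A w).
Proof.
move=> UA UB e hw; apply/eqP; rewrite -addr_eq0 cl_rel // e mulr0 oppr0 scale0r.
by [].
Qed.

Lemma clD A w w' : cl A (w + w') = cl A w + cl A w'. Proof. exact: lieDr. Qed.

Section Volume.
Variable s : F.
Hypothesis s2 : s * s = 1.

(** Volume element of the Clifford algebra. Its square is the discriminant (t c1 c3)^2 and it
    anticommutes with the vectors, so its eigenspaces are the half-spin modules; the one containing
    E(j,-r) decides the sign s. *)
Definition vol w := cl A1 (cl A2 (cl A3 (cl A4 w))).

Let S1 w (h : clm w) := cl_stable U1 h.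
Let S2 w (h : clm w) := cl_stable U2 h.
Let S3 w (h : clm w) := cl_stable U3 h.
Let S4 w (h : clm w) := cl_stable U4 h.
Let sw A B (UA : U A) (UB : U B) (e : b A B = 0) w (hw : clm w) :
  cl B (cl A w) = - cl A (cl B w).
Proof. by rewrite (cl_anti UA UB e hw) opprK. Qed.
Let a21 := sw U1 U2 b12.
Let a31 := sw U1 U3 b13.
Let a41 := sw U1 U4 b14.
Let a32 := sw U2 U3 b23.
Let a42 := sw U2 U4 b24.
Let a43 := sw U3 U4 b34.
Let q1 w (h : clm w) := cl_self U1 h.
Let q2 w (h : clm w) := cl_self U2 h.
Let q3 w (h : clm w) := cl_self U3 h.
Let q4 w (h : clm w) := cl_self U4 h.
Let norm := (a21, a31, a41, a32, a42, a43, q1, q2, q3, q4, clN, clZ).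

Ltac clmS := repeat first [assumption | apply: S1 | apply: S2 | apply: S3 | apply: S4 | apply: clmZ | apply: clmN].

Lemma vol_sq w : clm w -> vol (vol w) = (t * c1 * c3) ^+ 2 *: w.
Proof.
move=> hw; rewrite /vol !norm ?c2E ?c4E; try by clmS.
by rewrite -?scalerN ?scalerN ?opprK ?scalerA; congr (_ *: _); ring.
Qed.

Lemma vol_lin c w w' : vol (c *: w + w') = c *: vol w + vol w'.
Proof. by rewrite /vol !clD !clZ. Qed.

Lemma clLin x B B' w : cl (x *: B + B') w = x *: cl B w + cl B' w.
Proof.
by rewrite /cl linearP -lieZl -lieDl scalerDr addrACA.
Qed.

Lemma vol_anti x1 x2 x3 x4 w : clm w ->
  let B := x1 *: A1 + (x2 *: A2 + (x3 *: A3 + (x4 *: A4 + 0))) in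
  vol (cl B w) = - cl B (vol w).
Proof.
move=> hw /=; pose P B := vol (cl B w) = - cl B (vol w).
have PD x B B' : P B -> P B' -> P (x *: B + B').
  by rewrite /P !clLin vol_lin => -> ->; rewrite scalerN opprD.
do 4 (refine (PD _ _ _ _ _); [by rewrite /P /vol !norm; try (by clmS); rewrite ?opprK|]).
by rewrite /P /cl linear0 addr0 !lie0l oppr0 /vol /cl !lie0r.
Qed.

Definition chiral sg w := vol w = (sg * (t * c1 * c3)) *: w.

Lemma chiral_exists v : M v -> v != 0 -> exists sg v', [/\ sg * sg = 1, M v', v' != 0 & chiral sg v'].
Proof.
move=> Mv v0; have hv := clm_M Mv.
have Mvol : M (vol v).
  rewrite /vol (clME U4 Mv) (clNE U3 (cl_UM U4 Mv)).
  have M1 := cl_fN U3 (cl_UM U4 Mv).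
  by rewrite (clME U2 M1) (clNE U1 (cl_UM U2 M1)); exact: cl_fN U1 (cl_UM U2 M1).
have [e|n] := eqVneq (vol v + (t * c1 * c3) *: v) 0.
  exists (- 1), v; split=> //; first by ring.
  by rewrite /chiral mulN1r scaleNr; apply/eqP; rewrite -addr_eq0 e.
exists 1, (vol v + (t * c1 * c3) *: v); split=> //; first exact: mulr1.
  by apply: EijD => //; exact: EijZ.
by rewrite /chiral addrC vol_lin (vol_sq hv) mul1r scalerDr scalerA expr2 addrC.
Qed.

(** On E(j,-r) the rotations act as the Clifford products A1 A2 and A3 A4. Multiplying the chirality
    relation by A1 A2 makes the two images of v proportional, with the ratio that cancels the two
    terms of D. *)
Lemma turnD_M v : M v -> chiral s v -> lie (turnD s) v = 0.
Proof.
move=> Mv hc; have hv := clm_M Mv.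
have dE : lie (turnD s) v = (2 * c1)^-1 *: cl A1 (cl A2 v) + (s * (2 * c3)^-1) *: cl A3 (cl A4 v).
  rewrite /turnD lieDl !lieZl !cl_R // (clME U2 Mv) (clME U4 Mv).
  by rewrite (clNE U1 (cl_UM U2 Mv)) (clNE U3 (cl_UM U4 Mv)).
have e : (t * c1 * c1) *: cl A3 (cl A4 v) = - (s * (t * c1 * c3)) *: cl A1 (cl A2 v).
  have := congr1 (fun w => cl A1 (cl A2 w)) hc; rewrite /vol !norm ?c2E; try by clmS.
  rewrite -?scalerN ?scalerN ?opprK ?scalerA => e.
  rewrite scaleNr -e -?scaleNr; congr (_ *: _); ring.
have h0 : 2 * (t * c1 * c1) != 0 by exact: mulf_neq0 two0 (mulf_neq0 (mulf_neq0 t0 c10) c10).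
apply: (scalerI h0).
rewrite scaler0 dE scalerDr !scalerA.
have -> : 2 * (t * c1 * c1) * (s * (2 * c3)^-1) = (s / c3) * (t * c1 * c1).
  by field; rewrite two0 c30.
rewrite -[(s / c3 * _) *: _]scalerA e scalerA -scalerDl (_ : _ + _ = 0) ?scale0r //.
have -> : s / c3 * - (s * (t * c1 * c3)) = - (s * s) * (t * c1) by field.
by rewrite s2; field; rewrite two0 c10.
Qed.

Hypothesis spanU : forall B, U B -> exists x1 x2 x3 x4,
  B = x1 *: A1 + (x2 *: A2 + (x3 *: A3 + (x4 *: A4 + 0))).
Hypothesis anisoU : forall B, U B -> B != 0 -> b B B != 0.
Hypothesis dimE : \dim (Espace i j 1 (- 1)) = \dim (Espace i r 1 (- 1)).

(** The map sending B to [B, v] is injective, because B acts on v with square -b(B, B) and b is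
    anisotropic; the dimensions agree. *)
Lemma module_transitive v n : M v -> v != 0 -> N n -> exists2 B, U B & n = lie B v.
Proof.
move=> Mv v0 Nn; set US := Espace i j 1 (- 1).
have sub : (ad v @: US <= Espace i r 1 (- 1))%VS.
  apply/subvP => _ /memv_imgP[B /EspaceP UB ->]; rewrite adE lieC; apply/EspaceP.
  by rewrite -scaleN1r; exact: EijZ (cl_UM UB Mv).
have inj : (US :&: lker (ad v) = 0)%VS.
  apply/eqP; rewrite -subv0; apply/subvP => B; rewrite memv_cap memv_ker adE memv0.
  case/andP=> /EspaceP UB /eqP e; apply: contraT => B0.
  have := cl_self UB (clm_M Mv); rewrite (clME UB Mv) lieC e oppr0 /cl lie0r.
  by move/esym/eqP; rewrite scaler_eq0 oppr_eq0 (negPf (anisoU UB B0)) (negPf v0).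
have /eqP eN : (ad v @: US == Espace i r 1 (- 1))%VS.
  by rewrite eqEdim sub -dimE (limg_dim_eq inj) leqnn.
have /EspaceP : E i r 1 (- 1) n by [].
rewrite -eN => /memv_imgP[B /EspaceP UB ->]; exists (- B).
  by rewrite -scaleN1r; exact: EijZ.
by rewrite adE lieNl lieC.
Qed.

(** A1 w is B v for some vector B. The volume element anticommutes with both A1 and B, so w inherits
    the chirality of v once A1, of nonzero norm, is cancelled. *)
Lemma chiral_all v : M v -> v != 0 -> chiral s v -> forall w, M w -> chiral s w.
Proof.
move=> Mv v0 hc w Mw.
have [B UB eB] := module_transitive Mv v0 (cl_UM U1 Mw).
have hv := clm_M Mv; have hw := clm_M Mw.
have hB : vol (cl B v) = - cl B (vol v) by have [x1 [x2 [x3 [x4 ->]]]] := spanU UB; exact: vol_anti.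
have h1 u : clm u -> vol (cl A1 u) = - cl A1 (vol u).
  by move=> hu; rewrite /vol !norm; try (by clmS); rewrite ?opprK.
have e : cl A1 (vol w) = (s * (t * c1 * c3)) *: cl A1 w.
  apply: oppr_inj; rewrite -h1 // (clME U1 Mw) eB -(clME UB Mv) hB hc clZ.
  by [].
have hvw : clm (vol w) by rewrite /vol; clmS.
have := congr1 (cl A1) e; rewrite clZ !q1 // scalerA [X in _ = X *: _]mulrC -scalerA.
by apply: scalerI; rewrite oppr_eq0.
Qed.

End Volume.
End ThreeIndices.

Section Fixed.
Hypothesis spanU : forall B, U B -> exists x1 x2 x3 x4,
  B = x1 *: A1 + (x2 *: A2 + (x3 *: A3 + (x4 *: A4 + 0))).
Hypothesis aniso : forall i j B, i != j -> E i j 1 (- 1) B -> B != 0 -> bq i j B B != 0.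
Hypothesis dim4 : forall i j, i != j -> \dim (Espace i j 1 (- 1)) = 4%N.

Lemma dim4_neq0 a c : a != c -> exists2 v, E a c 1 (- 1) v & v != 0.
Proof.
move=> nac; have : Espace a c 1 (- 1) != 0%VS by rewrite -dimv_eq0 dim4.
rewrite -vpick0 => n0; exists (vpick (Espace a c 1 (- 1))) => //.
by apply/EspaceP; exact: memv_pick.
Qed.

(** One index r fixes s by chirality. For another index r', an anisotropic B of E_rr'(1,-1) commutes
    with D and carries E(j,-r') into E(j,-r), where D vanishes; applying the transpose of B returns
    a nonzero multiple of the image of D. *)
Lemma turn_exists : (exists r, r != i /\ r != j) -> exists s, s * s = 1 /\
  (forall r v, r != i -> r != j -> E j r 1 (- 1) v -> lie (turnD s) v = 0).
Proof.
move=> [r [ri rj]]; have jr : j != r by rewrite eq_sym.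
have ir : i != r by rewrite eq_sym.
have nji : j != i by rewrite eq_sym.
have [v0 Mv0 v00] := dim4_neq0 jr.
have [s [v [s2 Mv v_0 hc]]] := chiral_exists ri rj Mv0 v00.
exists s; split=> //; have iD := turnD_inner s.
have anU B : U B -> B != 0 -> b B B != 0 by exact: aniso.
have dimE : \dim (Espace i j 1 (- 1)) = \dim (Espace i r 1 (- 1)) by rewrite !dim4.
have DM w : E j r 1 (- 1) w -> lie (turnD s) w = 0.
  move=> Mw; have := chiral_all ri rj spanU anU dimE Mv v_0 hc Mw.
  exact: (turnD_M ri rj).
move=> r' u ri' rj' Eu; have [er|nr] := eqVneq r' r; first by apply: DM; rewrite -er.
have jr' : j != r' by rewrite eq_sym.
have [B EB B0] := dim4_neq0 nr.
have [Br Br' Bs] := EB; have B00 := Eij_g0 nr EB.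
have DB : lie (turnD s) B = 0.
  have zB A : U A -> lie A B = 0.
    move=> UA; have [Ai Aj As] := UA; apply: (zero_three nij ri' rj').
    - by exact: wt_lie0r (Eij_g0 nij UA) B00.
    - by apply: wt_lie0r Ai (Bs i _ _); rewrite eq_sym.
    - by apply: wt_lie0r Aj (Bs j _ _); rewrite eq_sym.
    - by apply: wt_lie0l (As r' _ _) Br.
  have zfB A : U A -> lie (fl A) B = 0.
    move=> UA; have [fi fj fs] := flat_E nij UA.
    apply: (zero_three nji rj' ri').
    - by exact: wt_lie0r (flat_H0 nij UA) B00.
    - by apply: wt_lie0r fj (Bs j _ _); rewrite eq_sym.
    - by apply: wt_lie0r fi (Bs i _ _); rewrite eq_sym.
    - by apply: wt_lie0l (fs r' _ _) Br.
  by rewrite /turnD lieDl !lieZl !lie_lie !(zfB, zB, lie0r, subrr) // !scaler0 addr0.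
have EDu := inner_E iD Eu.
have [uj ur us] := Eu; have [uj' ur' us'] := EDu.
have DuB : lie (lie (turnD s) u) B = 0.
  have EuB : E j r 1 (- 1) (lie u B).
    split.
    - by apply: wt_lie0r uj (Bs j _ _); rewrite // eq_sym.
    - by apply: wt_lie0l (us r _ _) Br'; rewrite // eq_sym.
    move=> q qj qr; have [->|qr'] := eqVneq q r'; first by rewrite -(addNr 1); exact: wt_lie.
    by apply: wt_lie0r (us q _ _) (Bs q _ _).
  by have := DM _ EuB; rewrite lieJ DB lie0r addr0.
have fBz : lie (flat r' r B) (lie (turnD s) u) = 0.
  have [fr' fr fs] := flat_E nr EB.
  apply: (zero_wtN2 (s := r')).
    apply: wt_lie0r (Eij_g0 jr' EDu).
    exact: (flat_H0 nr EB).
  by rewrite (_ : - 2 = - 1 + - 1); [exact: wt_lie | ring].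
have := congr1 (lie (flat r' r B)) DuB; rewrite lie0r lieJ fBz lie0l add0r.
rewrite (flat_lie_self nr EB) lieZr lieC lieDl lieNl.
rewrite ur' (us' r) 1?eq_sym // scale0r subr0 scaleN1r opprK => /eqP.
by rewrite scaler_eq0 (negPf (aniso nr EB B0)) => /eqP.
Qed.

Variable s : F.
Hypothesis s2 : s * s = 1.
Hypothesis Djr : forall r v, r != i -> r != j -> E j r 1 (- 1) v -> lie (turnD s) v = 0.
Let iD : inner (turnD s) := turnD_inner s.

Lemma turn_sq_span x1 x2 x3 x4 : let B := x1 *: A1 + (x2 *: A2 + (x3 *: A3 + (x4 *: A4 + 0))) in
  lie (turnD s) (lie (turnD s) B) = - t *: B.
Proof.
pose P B := lie (turnD s) (lie (turnD s) B) = - t *: B.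
have PD x B B' : P B -> P B' -> P (x *: B + B').
  rewrite /P => e e'; rewrite lieDr lieZr lieDr lieZr e e' scalerDr !scalerA.
  by rewrite [x * _]mulrC.
have e : - s * t * s = - t by rewrite -[RHS]mul1r -s2; ring.
refine (PD _ _ _ _ (PD _ _ _ _ (PD _ _ _ _ (PD _ _ _ _ _)))); rewrite /P.
- by rewrite turnD1 turnD2.
- by rewrite turnD2 lieZr turnD1.
- by rewrite turnD3 lieZr turnD4 scalerA [s * _]mulrC e.
- by rewrite turnD4 lieZr turnD3 scalerA e.
- by rewrite !lie0r scaler0.
Qed.

Let DJ m q : lie (turnD s) (lie m (X q)) = lie (lie (turnD s) m) (X q).
Proof. by have [_ DX _] := iD; rewrite lieJ DX lie0r addr0. Qed.

(** Components involving i are turned, the others fixed. For (i, r) with r other than j, the vectors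
    of E(i,-r) are products A1 m with m in E(j,-r), which D kills, so D acts through A1 alone. *)
Lemma turn_plus r q v : r != q -> E r q 1 1 v ->
  (lie (turnD s) (lie (turnD s) v) = - t *: v /\ wt (H i) 1 v) \/ (lie (turnD s) v = 0 /\ wt (H i) 0 v).
Proof.
have sq_ij v' : E i j 1 1 v' -> lie (turnD s) (lie (turnD s) v') = - t *: v'.
  move=> Ev; have [UA <-] := plus_U nij Ev.
  by rewrite !DJ; have [x1 [x2 [x3 [x4 ->]]]] := spanU UA; rewrite turn_sq_span lieZl.
have sq_ir r' v' : r' != i -> r' != j -> E i r' 1 1 v' -> lie (turnD s) (lie (turnD s) v') = - t *: v'.
  move=> ri rj Ev; have ir : i != r' by rewrite eq_sym.
  have [EA <-] := plus_U ir Ev.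
  set n := lie (Y r') v' in EA *; have Mm := cl_fN ri rj U1 EA.
  have en : - c1 *: n = lie A1 (lie (fl A1) n).
    have hn : clm r' n.
      exists 0, n; split=> //; last by rewrite add0r.
      by split=> *; exact: wt0.
    have := cl_self ri rj U1 hn.
    by rewrite (clNE ri U1 EA) (clME rj U1 Mm) => ->.
  have Dn : lie (turnD s) (lie (turnD s) n) = - t *: n.
    have h : lie (turnD s) (lie (turnD s) (- c1 *: n)) = - t *: (- c1 *: n).
      rewrite en [lie (turnD s) (lie A1 _)]lieJ turnD1 (Djr ri rj Mm) lie0r addr0.
      by rewrite lieJ turnD2 (Djr ri rj Mm) lie0r addr0 lieZl.
    have c1' : - c1 != 0 by rewrite oppr_eq0.
    by apply: (scalerI c1'); rewrite -2!lieZr h !scalerA [- c1 * _]mulrC.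
  by rewrite !DJ Dn lieZl.
have zero_jr r' v' : r' != i -> r' != j -> E j r' 1 1 v' -> lie (turnD s) v' = 0.
  move=> ri rj Ev; have jr : j != r' by rewrite eq_sym.
  have [EA <-] := plus_U jr Ev.
  by rewrite DJ (Djr ri rj EA) lie0l.
move=> nrq Ev; have [vr vq vs] := Ev.
have [er|ri] := eqVneq r i.
  subst r; left; split=> //; have [eq|qj] := eqVneq q j; first by subst q; exact: sq_ij.
  by apply: sq_ir Ev => //; rewrite eq_sym.
have [eq|qi] := eqVneq q i.
  subst q; left; split=> //; have Ev' := Eij_sym Ev.
  have [er|rj] := eqVneq r j; first by subst r; exact: sq_ij.
  exact: sq_ir Ev'.
right; split; last by apply: vs; rewrite eq_sym.
have [er|rj] := eqVneq r j; first by subst r; apply: zero_jr Ev => //; rewrite eq_sym.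
have [eq|qj] := eqVneq q j; first by subst q; exact: zero_jr (Eij_sym Ev).
have v2 := Eij_V nrq Ev.
have zA A : U A -> lie A v = 0.
  move=> UA; have [Ai Aj As] := UA; apply: (plus_wtN1 (j := j)).
    exact: (plus_g0 (U_H0 nij UA) v2).
  by apply: wt_lie0r Aj (vs j _ _); rewrite eq_sym.
have zfA A : U A -> lie (fl A) v = 0.
  move=> UA; have [fi fj fs] := flat_E nij UA.
  apply: (plus_wtN1 (j := i)).
    exact: (plus_g0 (flat_H0 nij UA) v2).
  by apply: wt_lie0r fi (vs i _ _); rewrite eq_sym.
by rewrite /turnD lieDl !lieZl !lie_lie !(zfA, zA, lie0r, subrr) // !scaler0 addr0.
Qed.

Lemma dop_turn (om I : L) (Psi : gL -> gL) : om * om = - iota t -> I * I = - 1 ->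
  elementary Psi -> Psi (tau H0) = tau H0 -> (forall j, Psi (tau (X j)) = tau (X j)) ->
  (forall W : {vspace g}, (forall v, turned i (turnD s) t Psi v -> v \in W) ->
    (forall v, torused i (turnD s) om I Psi v -> v \in W) ->
    forall p q v, p != q -> E p q 1 1 v -> v \in W) -> diagonal_of_product t.
Proof.
move=> omE I2 eP P0 PX; have [J0 _ _] := turnJ_inner s.
have K0 : wt H0 0 (turnK s) by have [] := innerD (inn U2 U3 b23) (innerZ s (inn U1 U4 b14)).
apply: (dop_quarter iD t0 (mulf_neq0 c10 c30) s2 omE I2 J0 K0 (turnDJ s2) (turnDK s2) _ eP P0 PX).
by rewrite turnJK //; congr (_ *: _); ring.
Qed.

End Fixed.
End QuarterTurn.

(** * Roots relative to a frame *)

Section Arrangement.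
Variable a : {vspace g}.
Hypothesis ha : maximal_split_abelian_in (g0 H0) a.
Hypothesis haH0 : H0 \in a.
Hypothesis Ha : forall j, H j \in a.
Variable lam : 'I_k.+1 -> dual a.
Hypothesis Xlam : forall j, X j \in root_space (lam j).
Hypothesis Ylam : forall j, Y j \in root_space (- lam j).
Let lamH0 j : root_eval (lam j) H0 = 2 :=
  root_eval_wt (Xlam j) (frame_X0 frame j) haH0 (X2 j).

Section LongRoots.
Implicit Types (i j s : 'I_k.+1) (u v w y z A B : g) (be : dual a).

Lemma root_cases be v : root_eval be H0 = 2 -> v \in root_space be -> v != 0 ->
  (exists2 j, be = lam j & exists c, v = c *: X j) \/
  exists i j, i != j /\ E i j 1 1 v.
Proof.
move=> be2 vb v0; have v2 : wt H0 2 v by rewrite -be2; exact: root_wt vb haH0.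
have nv j : wt (H j) (root_eval be (H j)) v by exact: root_wt vb (Ha j).
case: (weights_cases v2 v0 nv) => [[j nj no]|[j nj no]|[i [j [ne ni nj no]]]].
- left; have [|c ec] := frame_wt2 frame (j := j) v2; first by rewrite -nj.
  exists j; last by exists c.
  apply: (root_space_eq vb _ v0); rewrite ec; exact: memvZ.
- have := wt_H0_joint nv; rewrite (bigD1 j) //= nj big1 // addr0 => v1.
  case/eqP: v0; apply: (wt_uniq v1 v2).
  by nat_neq.
- right; exists i, j; split=> //; split; [by rewrite -ni | by rewrite -nj |] => s si sj.
  by rewrite -(no s si sj).
Qed.

(** [A, [A, X_j]] is a multiple of X_i but has root 2 be + lam_j, which differs from lam_i unless be
    is the half difference. *)
Lemma isotropic_root i j be A : i != j -> E i j 1 (- 1) A -> A \in root_space be ->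
  be != 2^-1 *: (lam i - lam j) -> bq i j A A = 0.
Proof.
move=> nij UA Ab ne; apply: contraNeq ne => q0; apply/eqP.
have e := bq_lie nij UA UA.
have h1 : lie A (lie A (X j)) \in root_space (be + (be + lam j)).
  by apply: root_space_lie Ab (root_space_lie Ab (Xlam j)).
have h2 : lie A (lie A (X j)) \in root_space (lam i) by rewrite e; exact: memvZ.
have n0 : lie A (lie A (X j)) != 0.
  rewrite e scaler_eq0 negb_or (frame_X0 frame i) andbT mulf_neq0 //.
have := root_space_eq h1 h2 n0 => <-.
rewrite (_ : be + _ - _ = 2 *: be); first by rewrite scalerA mulVf // scale1r.
by rewrite scaler_nat mulr2n addrA addrK.
Qed.

(** Roots of V+ that are not half sums; their root vectors are extremal. For e = 0 this is every
    root of V+. *)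
Definition long be := forall i j, i != j -> be != 2^-1 *: (lam i + lam j).

Lemma half_shift i j be : be != 2^-1 *: (lam i + lam j) ->
  be - lam j != 2^-1 *: (lam i - lam j).
Proof.
apply: contraNneq => e; apply/eqP; rewrite -[LHS](subrK (lam j)) e.
by lmodf F; rewrite // ?two0.
Qed.

Lemma long_extremal_plus be v : root_eval be H0 = 2 -> long be ->
  v \in root_space be -> v != 0 -> extremal v.
Proof.
move=> be2 lbe vb v0; case: (root_cases be2 vb v0) => [[j _ [c ->]]|[i [j [nij Ev]]]].
  move=> u; have [d e] := extremal_X j u.
  by exists (c * d); rewrite !lieZl lieZr e !scalerA mulrAC.
have [UA e] := plus_U nij Ev; rewrite -e.
apply: (extremal_plus nij UA).
  by apply: contraNneq v0 => A0; rewrite -e A0 lie0l.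
apply: (isotropic_root nij UA (be := be - lam j)).
  by rewrite addrC; apply: root_space_lie.
exact/half_shift/lbe.
Qed.

Lemma long_extremal_minus be y : root_eval be H0 = 2 -> long be ->
  y \in root_space (- be) -> y != 0 -> extremal y.
Proof.
move=> be2 lbe yb y0; have [v] := killing_root_dual ha yb y0; rewrite opprK => vb kyv.
have v0 : v != 0 by apply: contraNneq kyv => ->; rewrite killing0r.
have yn j : wt (H j) (- root_eval be (H j)) y by rewrite -root_evalN; exact: root_wt yb (Ha j).
have y2 : wt H0 (- 2) y by rewrite -be2 -root_evalN; exact: root_wt yb haH0.
case: (root_cases be2 vb v0) => [[j ej _]|[i [j [nij Ev]]]].
  have lj := root_eval_wt (Xlam j) (frame_X0 frame j) (Ha j) (wt_HXii j).
  have yj : wt (H j) (- 2) y by rewrite -lj -ej.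
  have [c ->] := minus_span y2 yj.
  move=> u; have [d e] := extremal_Y j u.
  by exists (c * d); rewrite !lieZl lieZr e !scalerA mulrAC.
have val s c : wt (H s) c v -> wt (H s) (- c) y.
  move=> vs; have [<- //|ne] := eqVneq (root_eval be (H s)) c.
  by case/eqP: v0; apply: (wt_uniq (root_wt vb (Ha s)) vs).
have Ey : E i j (- 1) (- 1) y.
  have [vi vj vs] := Ev; split; [exact: val | exact: val |] => s si sj.
  by rewrite -[0]oppr0; apply: val; exact: vs.
have [UA e] := minus_U nij Ey; rewrite -e.
apply: (extremal_minus nij UA).
  by apply: contraNneq y0 => A0; rewrite -e A0 lie0l.
apply: (isotropic_root nij UA (be := lam i - be)); first exact: root_space_lie.
have h := half_shift (lbe j i _); rewrite eq_sym in h.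
rewrite -(opprB be) -(inj_eq (@oppr_inj _)) opprK -scalerN opprB.
exact: h.
Qed.

Lemma triple_in_a be y v : root_eval be H0 = 2 -> v \in root_space be ->
  y \in root_space (- be) -> extremal v -> extremal y -> killing y v != 0 ->
  exists y' h, [/\ y' \in root_space (- be), h \in a, sl2_triple y' h v,
    extremal y' /\ killing y' v != 0 & forall w, w \in root_space be -> exists c, w = c *: v].
Proof.
move=> be2 vb yb ev ey kyv.
have v2 : wt H0 2 v by rewrite -be2; exact: root_wt vb haH0.
have y2 : wt H0 (- 2) y by rewrite -be2 -root_evalN; exact: root_wt yb haH0.
have v0 : v != 0 by apply: contraNneq kyv => ->; rewrite killing0r.
have [c s] := extremal_triple v2 y2 ev ey kyv.
set h := lie (c *: y) v in s.
have cy2 : wt H0 (- 2) (c *: y) by exact: wtZ.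
have h00 : h \in root_space (0 : dual a).
  by rewrite -(addNr be); apply: root_space_lie vb; exact: memvZ.
have hha : h \in a.
  apply: (max_split ha).
  - by have := root_wt h00 haH0; rewrite root_eval0.
  - by move=> x xa; rewrite (root_wt h00 xa) root_eval0 scale0r.
  - exact: (sl2_diagonalizable s v2 cy2).
have c0 : c != 0.
  apply: contraNneq v0 => c0; have [hv _ _] := s; move: hv.
  rewrite /h c0 scale0r lie0l => /esym/eqP; rewrite lie0l.
  by rewrite scaler_eq0 (negPf two0).
have hbe : root_eval be h = 2 by case: s => hv _ _; exact: root_eval_wt vb v0 hha hv.
have eyc : extremal (c *: y).
  move=> u; have [d e] := ey u.
  by exists (c * d); rewrite !lieZl lieZr e !scalerA mulrAC.
have kcy : killing (c *: y) v != 0 by rewrite killingZl mulf_neq0.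
exists (c *: y), h; split=> //; first exact: memvZ.
move=> w wb; pose d := killing (c *: y) w / killing (c *: y) v.
exists d; apply: subr0_eq.
have wdb : w - d *: v \in root_space be by rewrite memvB // memvZ.
apply: (extremal_weight2 s v2 cy2 eyc) => //.
- by rewrite -be2; exact: root_wt wdb haH0.
- by rewrite -hbe; exact: root_wt wdb hha.
- by rewrite killingDr killingNr killingZr /d divfK // subrr.
Qed.

Lemma long_root be v : root_eval be H0 = 2 -> long be -> v \in root_space be -> v != 0 ->
  exists y h, [/\ y \in root_space (- be), h \in a, sl2_triple y h v,
    extremal y /\ killing y v != 0 & forall w, w \in root_space be -> exists c, w = c *: v].
Proof.
move=> be2 lbe vb v0.
have [y yb kyv] := killing_root_dual ha vb v0; rewrite killingC in kyv.
have y0 : y != 0 by apply: contraNneq kyv => ->; rewrite killing0l.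
exact: (triple_in_a be2 vb yb (long_extremal_plus be2 lbe vb v0) (long_extremal_minus be2 lbe yb y0) kyv).
Qed.

(** An isotropic A, together with an isotropic partner B, would give extremal vectors in the root
    spaces of be and -be, and [triple_in_a] would make the root space a line. *)
Lemma half_root_anisotropic i j A : i != j ->
  (1 < \dim (root_space (2^-1 *: (lam i + lam j))))%N ->
  A \in root_space (2^-1 *: (lam i - lam j)) -> E i j 1 (- 1) A -> A != 0 ->
  bq i j A A != 0.
Proof.
move=> nij dim4 Ab UA A0; apply/eqP => qA; set be := 2^-1 *: (lam i + lam j) in dim4 *.
pose v := lie A (X j).
have be2 : root_eval be H0 = 2.
  by rewrite root_evalZ root_evalD !lamH0; field.
have ebe : 2^-1 *: (lam i - lam j) + lam j = be by rewrite /be; lmodf F; rewrite // ?two0.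
have ebe' : 2^-1 *: (lam i - lam j) - lam i = - be by rewrite /be; lmodf F; rewrite // ?two0.
have ebe'' : lam i - be = 2^-1 *: (lam i - lam j) by rewrite /be; lmodf F; rewrite // ?two0.
have vb : v \in root_space be by rewrite -ebe; exact: root_space_lie.
have v0 : v != 0 by apply: contraNneq A0 => e; rewrite -(U_Yj_X nij UA) -/v e lie0r.
have kN B : E i j 1 (- 1) B -> killing (lie B (Y i)) v =
    - (2 * bq i j B A * killing (Y i) (X i)).
  move=> UB; rewrite lieC killingNl killing_lie (bq_lie nij UB UA).
  by rewrite killingZr.
have [y0 y0b kyv] := killing_root_dual ha vb v0; rewrite killingC in kyv.
have Ev := U_X nij UA.
have Ey0 : E i j (- 1) (- 1) y0.
  have val s c : wt (H s) c v -> wt (H s) (- c) y0.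
    move=> vs; rewrite -(root_eval_wt vb v0 (Ha s) vs) -root_evalN.
    exact: root_wt y0b (Ha s).
  have [vi vj vs] := Ev; split; [exact: val | exact: val |] => s si sj.
  by rewrite -[0]oppr0; apply: val; exact: vs.
have [UB0 e0] := minus_U nij Ey0; set B0 := lie (X i) y0 in UB0 e0.
have B0b : B0 \in root_space (2^-1 *: (lam i - lam j)) by rewrite -ebe''; exact: root_space_lie.
have bB0 : bq i j B0 A != 0 by apply: contraNneq kyv => b0; rewrite -e0 kN // b0 mulr0 mul0r oppr0.
(* As A is isotropic, subtracting c A makes B0 isotropic without changing its product with A. *)
pose c := bq i j B0 B0 / (2 * bq i j B0 A).
pose B := B0 - c *: A.
have UB : E i j 1 (- 1) B by apply: EijD UB0 _; rewrite -scaleNr; exact: EijZ.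
have C := bqC nij.
have bAB0 := C _ _ UA UB0.
have bNl u w : bq i j (- u) w = - bq i j u w by rewrite -scaleN1r bqZl mulN1r.
have bBA : bq i j B A = bq i j B0 A by rewrite /B bqDl bNl bqZl qA mulr0 subr0.
have bBB : bq i j B B = 0.
  rewrite {1}/B bqDl bNl bqZl (C _ _ UB0 UB) (C _ _ UA UB) bBA.
  rewrite /B bqDl bNl bqZl (C _ _ UA UB0) /c; field.
  by rewrite two0 bB0.
have Bn0 : B != 0 by apply: contraNneq bB0 => e; rewrite -bBA e /bq lie0l killing0r mul0r.
have yb : lie B (Y i) \in root_space (- be).
  rewrite -ebe'; apply: root_space_lie => //.
  by rewrite memvB // memvZ.
have kyv' : killing (lie B (Y i)) v != 0.
  rewrite kN // oppr_eq0 bBA.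
  exact: mulf_neq0 (mulf_neq0 two0 bB0) (killing_YX i).
have ev := extremal_plus nij UA A0 qA.
have ey := extremal_minus nij UB Bn0 bBB.
have [y' [h [_ _ _ _ hw]]] := triple_in_a be2 vb yb ev ey kyv'.
have /dimvS : (root_space be <= <[v]>)%VS by apply/subvP => w /hw[d ->]; rewrite memvZ // memv_line.
by rewrite dim_vline; move: dim4; clear; case: (v != 0) => /=; lia.
Qed.

End LongRoots.

(** * The case e = 0 *)

Section SplitCase.
Implicit Types (u v w y z D : g) (be ga : dual a).

Lemma lamE i : root_eval (lam i) (H i) = 2.
Proof. exact: root_eval_wt (Xlam i) (frame_X0 frame i) (Ha i) (wt_HXii i). Qed.

Lemma killing_partner v : v != 0 -> exists be w, [/\ w \in root_space be, killing w v != 0 &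
  forall h c, h \in a -> wt h c v -> wt h (- c) w].
Proof.
move=> v0; have [be [w [wb kwv]]] : exists be w, w \in root_space be /\ killing w v != 0.
  apply: contrapT => no; case/eqP: v0; apply: killing_nondeg => y.
  pose Q z := killing v z = 0; suff : Q y by [].
  apply: (root_ind_all ha (Q := Q)) => [|x z|c x|be w wb]; rewrite /Q.
  - exact: killing0r.
  - by rewrite killingDr => -> ->; rewrite addr0.
  - by rewrite killingZr => ->; rewrite mulr0.
  - by rewrite killingC; apply: contrapT => /eqP kw; apply: no; exists be, w.
exists be, w; split=> // h c hh hv.
have hw := root_wt wb hh; have [<- //|ne] := eqVneq (root_eval be h) (- c).
by case/eqP: kwv; apply: (killing_wt hw hv); rewrite addr_eq0.
Qed.

Lemma root_in_E i j c d v : E i j c d v -> v != 0 ->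
  exists be w, [/\ w \in root_space be, w != 0 & E i j c d w].
Proof.
move=> Ev v0; have [be [w [wb kw hw]]] := killing_partner v0.
have w0 : w != 0 by apply: contraNneq kw => ->; rewrite killing0l.
have [ga [u [ub ku hu]]] := killing_partner w0.
exists ga, u; split=> //; first by apply: contraNneq ku => ->; rewrite killing0l.
have [vi vj vs] := Ev; have op s e : wt (H s) e v -> wt (H s) e u.
  by move=> vse; rewrite -[e]opprK; apply: hu => //; exact: hw.
by split; [exact: op | exact: op |] => s si sj; apply/op/vs.
Qed.

Lemma triple_killing be y h v : v \in root_space be -> sl2_triple y h v ->
  {in a, forall D, killing h D = - killing y v * root_eval be D}.
Proof.
move=> vb [_ _ <-] D Da; rewrite killing_lie lieC (root_wt vb Da).
by rewrite killingNr killingZr mulNr mulrC.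
Qed.

Hypothesis all_long : forall be v, v \in root_space be -> v != 0 -> long be.
Hypothesis linked : forall i j, i != j -> exists2 v, E i j 1 1 v & v != 0.

(** The Killing product of h and H_i is computed from either triple, with be(H_i) = 1. The value
    lam_i(h) is 1 too: 0 contradicts the nonzero pairing of y and v, and 2 is excluded by
    [extremal_weight2]. *)
Lemma plus_coroot_link i j be v y h : i != j -> E i j 1 1 v -> v \in root_space be ->
  wt H0 2 v -> wt H0 (- 2) y ->
  v != 0 -> y \in root_space (- be) -> h \in a -> sl2_triple y h v -> extremal y ->
  killing y v != 0 -> killing y v = killing (Y i) (X i).
Proof.
move=> nij Ev vb v2 y2 v0 yb hha s ey kyv; have [vi vj _] := Ev.
have bi := root_eval_wt vb v0 (Ha i) vi.
have e1 := triple_killing vb s (Ha i); rewrite bi mulr1 in e1.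
have e2 := triple_killing (Xlam i) (sl2 i) hha; rewrite killingC e1 in e2.
have hX := root_wt (Xlam i) hha; have X0 := frame_X0 frame i.
suff l1 : root_eval (lam i) h = 1 by move: e2; rewrite l1 mulr1 => /oppr_inj.
case: (plus_wt s v2 y2 (X2 i) X0 hX) => // l2.
  by case/eqP: kyv; apply/eqP; rewrite -oppr_eq0 e2 l2 mulr0.
rewrite l2 in hX; case/eqP: X0.
apply: (extremal_weight2 s v2 y2 ey (X2 i) hX kyv).
apply: (killing_root yb (Xlam i)); apply/eqP => e.
have := congr1 (fun m => root_eval m (H i)) e.
rewrite root_evalD root_evalN bi lamE root_eval0 => /eqP.
by rewrite (_ : - 1 + 2 = 1) ?oner_eq0 //; ring.
Qed.

Lemma killing_YX_const i j : killing (Y i) (X i) = killing (Y j) (X j).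
Proof.
have [->//|nij] := eqVneq i j; have [v Ev v0] := linked nij.
have [be [w [wb w0 Ew]]] := root_in_E Ev v0.
have w2 := Eij_V nij Ew.
have be2 := root_eval_wt wb w0 haH0 w2.
have [y [h [yb hha s [ey kyw] _]]] :=
  long_root be2 (all_long wb w0) wb w0.
have y2 : wt H0 (- 2) y by rewrite -be2 -root_evalN; exact: root_wt yb haH0.
have l := plus_coroot_link _ _ wb w2 y2 w0 yb hha s ey kyw.
rewrite -(l i j) // -(l j i) //; first by rewrite eq_sym.
exact: Eij_sym.
Qed.

(** For e = 0 all roots have the same length: the Killing form identifies every coroot with its root
    times this one constant. *)
Definition coroot_norm := - killing (Y ord0) (X ord0).

Lemma coroot_norm_neq0 : coroot_norm != 0.
Proof. by rewrite oppr_eq0; exact: killing_YX. Qed.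

Definition coroot_data be y h v :=
  [/\ [/\ v \in root_space be, v != 0, y \in root_space (- be) & h \in a],
      sl2_triple y h v, ad_nilpotent v /\ ad_nilpotent y,
      {in a, forall D, killing h D = coroot_norm * root_eval be D} &
      forall ga u, u \in root_space ga -> u != 0 -> exists n : int, root_eval ga h = n%:~R].

Lemma integral_weight y h v ga u : sl2_triple y h v -> wt H0 2 v -> wt H0 (- 2) y ->
  h \in a -> u \in root_space ga -> u != 0 -> exists n : int, root_eval ga h = n%:~R.
Proof.
move=> s v2 y2 hha ug u0; have hu := root_wt ug hha.
have uH := root_wt ug haH0; case: (wt_H0_eig uH u0) => e; rewrite e in uH.
- case: (minus_wt s v2 y2 uH u0 hu) => ->.
  + by exists 0.
  + by exists (-1).
  + by exists (-2).
- case: (zero_wt s v2 y2 uH u0 hu) => ->.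
  + by exists 0.
  + by exists 1.
  + by exists (-1).
- case: (plus_wt s v2 y2 uH u0 hu) => ->.
  + by exists 0.
  + by exists 1.
  + by exists 2.
Qed.

Lemma plus_coroot be v : root_eval be H0 = 2 -> v \in root_space be -> v != 0 ->
  exists y h, [/\ coroot_data be y h v, extremal y & killing y v != 0].
Proof.
move=> be2 vb v0.
have v2 : wt H0 2 v by rewrite -be2; exact: root_wt vb haH0.
have [y [h [yb hha s [ey kyv] _]]] :=
  long_root be2 (all_long vb v0) vb v0.
have y2 : wt H0 (- 2) y by rewrite -be2 -root_evalN; exact: root_wt yb haH0.
exists y, h; split=> //; split=> //.
- by split; [exact: nilp2 | exact: nilpN2].
- suff -> : coroot_norm = - killing y v by exact: triple_killing.
  congr (- _); case: (root_cases be2 vb v0).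
    case=> j ej [c ec]; have c0 : c != 0 by apply: contraNneq v0 => e; rewrite ec e scale0r.
    have e1 := triple_killing vb s (Ha j).
    have e2 := triple_killing (Xlam j) (sl2 j) hha; rewrite -ej in e2.
    have hbe := root_eval_wt vb v0 hha (let: And3 q _ _ := s in q).
    rewrite killingC e1 hbe ej lamE in e2; apply: oppr_inj; apply: (mulIf two0).
    by rewrite e2 (killing_YX_const ord0 j).
  case=> i [j [nij Ev]]; rewrite (killing_YX_const ord0 i).
  exact/esym/(plus_coroot_link nij Ev vb v2 y2 v0 yb hha s ey kyv).
- by move=> ga u; exact: integral_weight s v2 y2 hha.
Qed.

(* A root of g0 is the difference of two roots of V+, and it is the reflection of the
   first in the second. *)
Lemma zero_coroot ga x : root_eval ga H0 = 0 -> ga != 0 -> x \in root_space ga -> x != 0 ->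
  exists y h v, coroot_data ga y h v.
Proof.
move=> ga0 gn0 xg x0; have x00 : wt H0 0 x by rewrite -ga0; exact: root_wt xg haH0.
have [be' [v' [vb' v2' xv]]] : exists be' v', [/\ v' \in root_space be', wt H0 2 v' &
    lie x v' != 0].
  apply: contrapT => no; case/eqP: x0.
  have plus0 v : wt H0 2 v -> lie x v = 0.
    have sub : (Vplus H0 <= lker (ad x))%VS.
      apply: (root_ind (a_split ha)) => [h hh w /wt_eigen w2|mu w /wt_eigen w2 wmu].
        apply/wt_eigen; apply: wt_lie0l w2.
        by rewrite /wt (a_comm ha haH0 hh) scale0r.
      rewrite memv_ker adE; apply: contrapT => n0; apply: no; exists mu, w; split=> //.
      exact/negP.
    by move/wt_eigen/(subvP sub); rewrite memv_ker adE => /eqP.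
  exact: g0_faithful x00 plus0.
have v0' : v' != 0 by apply: contraNneq xv => ->; rewrite lie0r.
have be2' := root_eval_wt vb' v0' haH0 v2'.
have [y' [h' [[[_ _ yb' hha'] s' [nv' ny'] kh' int'] ey' kyv']]] := plus_coroot be2' vb' v0'.
have y2' : wt H0 (- 2) y' by rewrite -be2' -root_evalN; exact: root_wt yb' haH0.
set v := lie x v' in xv; pose be := ga + be'.
have vb : v \in root_space be by exact: root_space_lie.
have be2 : root_eval be H0 = 2 by rewrite root_evalD ga0 be2' add0r.
have v2 : wt H0 2 v by rewrite -be2; exact: root_wt vb haH0.
have [y [h [[[_ _ yb hha] s [nv ny] kh int] _ _]]] := plus_coroot be2 vb xv.
have hbe' : root_eval be' h' = 2 := root_eval_wt vb' v0' hha' (let: And3 q _ _ := s' in q).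
have bh' : root_eval be h' = 1.
  have hx := root_wt xg hha'.
  have := plus_wt s' v2' y2' v2 xv (root_wt vb hha').
  rewrite root_evalD hbe'; case=> // e.
    have := zero_wt s' v2' y2' x00 x0 hx.
    rewrite -(addrK 2 (root_eval ga h')) e; case=> /eqP.
    - by rewrite sub0r oppr_eq0 (negPf two0).
    - by rewrite (negPf (neq_natrN char0 (n := 2) _)) //; ring.
    - by rewrite (negPf (neq_natrN char0 (n := 0) _)) //; ring.
  case/eqP: xv; apply: (extremal_weight2 s' v2' y2' ey' v2 _ kyv').
    by rewrite -e -hbe' -root_evalD; exact: root_wt vb hha'.
  apply: (killing_root yb' vb); rewrite addrC /be addrK; exact: gn0.
pose th := sl2_theta y' v'.
have ath : lie_automorphism th := sl2_theta_aut nv' ny'.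
have tha := @sl2_theta_a a be' y' h' v' s' vb' yb' nv' ny'.
have throot := @sl2_theta_root a be' y' h' v' s' vb' yb' hha' v0' nv' ny'.
have thv : th v \in root_space ga.
  have := throot _ _ vb; rewrite bh' scale1r; by rewrite /be addrK.
have thy : th y \in root_space (- ga).
  have := throot _ _ yb; rewrite root_evalN bh' scaleN1r opprK /be opprD addrNK.
  by [].
have [hv hy hyv] := s.
have thn0 : th v != 0 by rewrite -memv_ker (eqP (introT eqP ath.1)) memv0.
have thh : th h = h - root_eval be' h *: h' := tha h hha.
exists (th y), (th h), (th v); split.
- by split=> //; rewrite thh memvB // memvZ.
- split; first by rewrite -(lie_autE ath) hv linearZ.
    by rewrite -(lie_autE ath) hy linearZ.
  by rewrite -(lie_autE ath) hyv.
- by split; exact: aut_ad_nilpotent.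
- move=> D Da; rewrite thh killingDl killingNl killingZl kh // kh' //.
  have -> : root_eval be' h = 1.
    apply: (mulfI coroot_norm_neq0); rewrite -kh' // killingC kh // bh'.
    by [].
  by rewrite mul1r -mulrBr /be root_evalD addrK.
move=> de u ud u0; rewrite thh root_evalBr root_evalZr.
have [n1 ->] := int _ _ ud u0; have [n2 ->] := int' _ _ ud u0.
have [n3 ->] := int _ _ vb' v0'.
by exists (n1 - n3 * n2); rewrite rmorphB rmorphM.
Qed.

Lemma coroot_data_opp be y h v : coroot_data be y h v -> coroot_data (- be) v (- h) y.
Proof.
case=> [[vb v0 yb hha] s [nv ny] kh int].
have y0 : y != 0.
  apply: contraNneq v0 => y0; have [hv _ hyv] := s; move: hv.
  by rewrite -hyv y0 lie0l lie0l => /esym/eqP; rewrite scaler_eq0 (negPf two0).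
split=> //.
- by rewrite opprK memvN.
- exact: sl2_swap.
- by move=> D Da; rewrite killingNl kh // root_evalN mulrN.
- move=> ga u ug u0; have [n e] := int ga u ug u0.
  by exists (- n); rewrite -scaleN1r root_evalZr e mulN1r rmorphN.
Qed.

Lemma coroot_exists be u : be != 0 -> u \in root_space be -> u != 0 ->
  exists y h v, coroot_data be y h v.
Proof.
move=> b0 ub u0; case: (wt_H0_eig (root_wt ub haH0) u0) => e.
- have : root_space (- be) != 0%VS by apply: (root_spaceN ha); exact: root_space_neq0 ub u0.
  move=> n0; have [v vb v0] : exists2 v, v \in root_space (- be) & v != 0.
    by exists (vpick (root_space (- be))); rewrite ?memv_pick ?vpick0.
  have [|y [h [/coroot_data_opp cd _ _]]] := plus_coroot _ vb v0.
    by rewrite root_evalN e opprK.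
  by rewrite opprK in cd; exists v, (- h), y.
- exact: zero_coroot e b0 ub u0.
- by have [y [h [cd _ _]]] := plus_coroot e ub u0; exists y, h, u.
Qed.

Variable Pi : seq (dual a).
Hypothesis hPi : root_basis Pi.
Hypothesis lamPi : forall j, nonneg_comb Pi (lam j).
Notation r := (size Pi).
Notation al i := (Pi`_i : dual a).

Lemma simple_root (i : 'I_r) : exists2 u, u \in root_space (al i) & u != 0.
Proof.
have [_ hr _] := hPi; have /andP[_ n0] := hr _ (mem_nth 0 (ltn_ord i)).
by exists (vpick (root_space (al i))); rewrite ?memv_pick ?vpick0.
Qed.

Lemma simple_coroots : exists h : 'I_r -> g, forall i : 'I_r, exists y v, coroot_data (al i) y (h i) v.
Proof.
have ex (i : 'I_r) : exists h y v, coroot_data (al i) y h v.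
  have [u ui u0] := simple_root i; have [_ hr _] := hPi.
  have /andP[b0 _] := hr _ (mem_nth 0 (ltn_ord i)).
  have [y [h [v cd]]] :=
    coroot_exists b0 ui u0.
  by exists h, y, v.
by have [h hh] := choice ex; exists h.
Qed.

Lemma root_combination be u : u \in root_space be -> u != 0 ->
  exists c : 'I_r -> int, be = \sum_(i < r) al i *~ c i.
Proof.
move=> ub u0; have [->|b0] := eqVneq be 0.
  by exists (fun=> 0); rewrite big1.
have [_ _ hr] := hPi; have rb : is_root be by rewrite /is_root /= b0; exact: root_space_neq0 ub u0.
case: (hr _ rb) => [[n e]|[n e]].
  by exists (fun i => (n i)%:Z); rewrite e; apply: eq_bigr => i _; rewrite -pmulrn.
exists (fun i => - (n i)%:Z); rewrite -[LHS]opprK e -sumrN.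
by apply: eq_bigr => i _; rewrite mulrNz -pmulrn.
Qed.

Lemma root_eval_Mz be n h : root_eval (be *~ n) h = root_eval be h *~ n.
Proof.
case: n => n; first by rewrite -!pmulrn root_evalMn.
by rewrite NegzE !mulrNz root_evalN -!pmulrn root_evalMn.
Qed.

Lemma simple_separate D : D \in a -> (forall i : 'I_r, root_eval (al i) D = 0) -> D = 0.
Proof.
move=> Da D0; apply: central0 => y.
pose Q z := lie D z = 0; suff : Q y by [].
apply: (root_ind_all ha (Q := Q)) => [|x z|c x|be w wb]; rewrite /Q.
- exact: lie0r.
- by rewrite lieDr => -> ->; rewrite addr0.
- by rewrite lieZr => ->; rewrite scaler0.
have [->|w0] := eqVneq w 0; first exact: lie0r.
have [c e] := root_combination wb w0; rewrite (root_wt wb Da) e root_eval_sum.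
by rewrite big1 ?scale0r // => i _; rewrite root_eval_Mz D0 mul0rz.
Qed.

Section Coroots.
Variable h : 'I_r -> g.
Hypothesis hcd : forall i : 'I_r, exists y v, coroot_data (al i) y (h i) v.

Let hha i : h i \in a.
Proof. by have [y [v [[_ _ _ ?] _ _ _ _]]] := hcd i. Qed.

Lemma torus_product (w : 'I_r -> int) (t : L) : t != 0 -> exists2 T : gL -> gL, elementary T &
  forall be u (z : 'I_r -> int), u \in root_space be ->
    (forall i, root_eval be (h i) = (z i)%:~R) ->
    T (tau u) = t ^ (\sum_i w i * z i) *: tau u.
Proof.
move=> t0; have step (s : seq 'I_r) : exists2 T : gL -> gL, elementary T &
  forall be u (z : 'I_r -> int), u \in root_space be ->
    (forall i, root_eval be (h i) = (z i)%:~R) ->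
    T (tau u) = t ^ (\sum_(i <- s) w i * z i) *: tau u.
  elim: s => [|i s [T eT TE]].
    exists id; first exact: elementary_id.
    by move=> be u z _ _; rewrite big_nil expr0z scale1r.
  have [y [v [_ sl [nv ny] _ _]]] := hcd i.
  have [S eS SE] := torus_rational sl nv ny (expfz_neq0 (w i) t0).
  exists (fun x => S (T x)); first exact: elementary_comp.
  move=> be u z ub hz; rewrite (TE be u z) // big_cons.
  have lS := elementary_linear eS.
  have S0 : S 0 = 0 by have := lS (-1) 0 0; rewrite scaler0 addr0 scaleN1r addNr.
  have := lS (t ^ (\sum_(j <- s) w j * z j)) (tau u) 0; rewrite !addr0 S0 addr0 => ->.
  rewrite (SE (z i)) ?scalerA; last by rewrite -hz; exact: root_wt ub (hha i).
  by rewrite exprz_exp -expfzDr // addrC.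
by have [T eT TE] := step (index_enum _); exists T.
Qed.

Variable Mz : 'M[int]_r.
Hypothesis hMz : forall i j : 'I_r, root_eval (al j) (h i) = (Mz i j)%:~R.

(** A linear relation among the rows gives a combination of simple coroots killed by all simple
    roots, hence zero; as coroots are proportional to roots with one constant, the same relation
    holds among the simple roots. *)
Lemma cartan_det : \det Mz != 0.
Proof.
pose M : 'M[F]_r := map_mx intr Mz.
suff uM : M \in unitmx by apply/eqP => e; move: uM; rewrite unitmxE /M det_map_mx e rmorph0 unitr0.
rewrite -row_free_unit; apply: inj_row_free => x xM.
have D0 : \sum_i x 0 i *: h i = 0.
  apply: simple_separate; first by apply: memv_suml => i _; exact: memvZ.
  move=> j; have /matrixP/(_ 0 j) := xM; rewrite !mxE => e; rewrite root_eval_sumr -[RHS]e.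
  by apply: eq_bigr => i _; rewrite root_evalZr hMz mxE.
have al0 : \sum_(i < r) x 0 i *: al i = 0.
  apply: dual_ext => D Da; rewrite root_eval_sum root_eval0.
  apply: (mulfI coroot_norm_neq0); rewrite mulr0.
  have e : \sum_i killing D (x 0 i *: h i) = 0 by rewrite -killing_sumr D0 killing0r.
  rewrite -[RHS]e mulr_sumr; apply: eq_bigr => i _; rewrite killingZr killingC.
  have [y [v [_ _ _ kh _]]] := hcd i.
  by rewrite kh // root_evalZ mulrCA.
have [fr _ _] := hPi; have /vector.freeP fr' : free (in_tuple Pi) := fr.
have x0 := fr' (fun i => x 0 i) al0.
 by apply/rowP => i; rewrite mxE x0.
Qed.

(** Row l of the adjugate is the determinant times the l-th fundamental coweight in terms of the
    simple coroots, with integral coefficients. *)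
Lemma adj_pairing l be (c z : 'I_r -> int) : be = \sum_(i < r) al i *~ c i ->
  (forall i, root_eval be (h i) = (z i)%:~R) ->
  \sum_i (\adj Mz) l i * z i = \det Mz * c l.
Proof.
move=> e hz; have inj : injective (intr : int -> F).
  move=> m n /eqP; rewrite -subr_eq0 -rmorphB => /eqP /(intr0_eq0 char0) /eqP.
  by rewrite subr_eq0 => /eqP.
have zE i : z i = \sum_j Mz i j * c j.
  apply: inj; rewrite -hz e root_eval_sum rmorph_sum; apply: eq_bigr => j _.
  by rewrite root_eval_Mz hMz rmorphM mulrzr.
under eq_bigr => i _ do rewrite zE mulr_sumr.
rewrite exchange_big /= (bigD1 l) //=.
have aM j : \sum_i (\adj Mz) l i * Mz i j = if l == j then \det Mz else 0.
  have /matrixP/(_ l j) := mul_adj_mx Mz; rewrite [LHS]mxE [RHS]mxE => ->.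
  by case: eqP.
rewrite [X in X + _](_ : _ = \det Mz * c l); last first.
  transitivity ((\sum_i (\adj Mz) l i * Mz i l) * c l); last by rewrite aM eqxx.
  by rewrite mulr_suml; apply: eq_bigr => i _; rewrite mulrA.
rewrite big1 ?addr0 // => j /negPf jl.
transitivity ((\sum_i (\adj Mz) l i * Mz i j) * c j).
  by rewrite mulr_suml; apply: eq_bigr => i _; rewrite mulrA.
by rewrite aM eq_sym jl mul0r.
Qed.

(** The fundamental coweight at t multiplies a root vector by t to the power of its coefficient at
    the simple root l. It is written as the determinant times that coweight, a product of coroot
    tori, taken at s with s^det = t in the algebraic closure; the result is rational although s need
    not be. *)
Lemma dop_coef (l : 'I_r) (N : 'I_k.+1 -> 'I_r -> nat) t :
  (forall j, lam j = \sum_(i < r) al i *+ N j i) -> t != 0 -> dop (t ^+ (\sum_j N j l)).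
Proof.
move=> lamN t0; pose m := \det Mz; have m0 : m != 0 := cartan_det.
have it0 : iota t != 0 by rewrite fmorph_eq0.
have [s s0 es] : exists2 s : L, s != 0 & s ^ m = iota t.
  have rt n (c : L) : (0 < n)%N -> c != 0 -> exists2 s, s != 0 & s ^+ n = c.
    move=> n0 c0; have [s es] := closed_root c n0; exists s => //.
    by apply: contraNneq c0 => e; rewrite -es e expr0n eqn0Ngt n0.
  case: m m0 => n n0; first by apply: rt => //; rewrite lt0n.
  have [|s s0 es] := rt n.+1 (iota t)^-1 isT; first by rewrite invr_eq0.
  by exists s => //; rewrite NegzE -exprnN es invrK.
have [T eT TE] := torus_product (fun i => (\adj Mz) l i) s0.
have TR be u (c : 'I_r -> int) : u \in root_space be -> u != 0 -> be = \sum_(i < r) al i *~ c i ->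
    T (tau u) = iota t ^ c l *: tau u.
  move=> ub u0 e; have ex (i : 'I_r) : exists z : int, root_eval be (h i) = z%:~R.
      by have [y [v [_ _ _ _ hint]]] := hcd i; exact: hint ub u0.
    have [z hz] := choice ex.
    by rewrite (TE be u z) // (adj_pairing l e hz) -es -exprz_exp.
have lT := elementary_linear eT.
have T0 : T 0 = 0 by have := lT (-1) 0 0; rewrite scaler0 addr0 scaleN1r addNr.
have TX j : T (tau (X j)) = tau (t ^+ N j l *: X j).
  rewrite (TR (lam j) (X j) (fun i => (N j i)%:Z)) ?(frame_X0 frame) //.
    by rewrite toBCZ rmorphXn.
have iotaz (c : int) : iota t ^ c = iota (t ^ c).
  by case: c => n; rewrite ?NegzE -?exprnN ?fmorphV rmorphXn.
have [||||phi Gphi phiE] := descent_rational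
  (a := fun j => t ^+ N j l) eT.
- have [e|n0] := eqVneq H0 0; first by rewrite e toBC0.
  rewrite (TR 0 H0 (fun=> 0)) ?expr0z ?scale1r // ?big1 //.
  by apply/root_spaceP => D Da; rewrite root_eval0 scale0r (a_comm ha Da haH0).
- by move=> j; rewrite expf_neq0.
- exact: TX.
- move=> v _; apply: (root_ind_all ha (Q := fun v => exists w, T (tau v) = tau w)).
  + by exists 0; rewrite toBC0.
  + move=> x y [wx ex] [wy ey]; exists (wx + wy); rewrite !toBCD -ex -ey.
    by have := lT 1 (tau x) (tau y); rewrite !scale1r.
  + move=> c x [wx ex]; exists (c *: wx); rewrite !toBCZ -ex.
    by have := lT (iota c) (tau x) 0; rewrite T0 !addr0.
  move=> be w wb; have [->|w0] := eqVneq w 0; first by exists 0; rewrite toBC0.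
  have [c e] := root_combination wb w0.
  by exists (t ^ c l *: w); rewrite (TR be w c) // toBCZ iotaz.
exists phi => //; exists (fun j => t ^+ N j l) => [j|]; last by rewrite prodrXr.
by apply: (@toBC_inj _ _ iota g); rewrite -phiE TX.
Qed.

End Coroots.

(** H0 is the sum of the H_j, and the Killing form identifies coroots with roots by one constant. *)
Lemma lam_sum_coroot be y h v : coroot_data be y h v ->
  root_eval (\sum_j lam j) h = root_eval be H0.
Proof.
case=> [[_ _ _ hha] _ _ kh _].
have lamk j : killing (H j) h = coroot_norm * root_eval (lam j) h.
  rewrite (triple_killing (Xlam j) (fam_sl2 (frame_triples frame) j)) //.
  by rewrite (killing_YX_const j ord0).
apply: (mulfI coroot_norm_neq0).
rewrite -kh // killingC {1}(H0_sum) root_eval_sum mulr_sumr.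
by rewrite killingC killing_sumr; apply: eq_bigr => j _; rewrite -lamk killingC.
Qed.

(* Otherwise half the sum of the lambda_j would be a sum of roots; in a sum of minimal
   length all the pairings are nonnegative, so that its pairing with the coroot of one
   of the terms is at least 2, whereas it is half a value of H0. *)
Lemma odd_coefficient (N : 'I_k.+1 -> 'I_r -> nat) :
  (forall j, lam j = \sum_(i < r) al i *+ N j i) -> exists l, odd (\sum_j N j l).
Proof.
move=> lamN; apply: contrapT => no.
have ev l : ~~ odd (\sum_j N j l) by apply/negP => o; apply: no; exists l.
pose rt be := exists2 u, u \in root_space be & u != 0 /\ be != 0.
pose S := \sum_j lam j.
pose Q n := `[< exists s : seq (dual a), [/\ size s = n, {in s, forall be, rt be} &
  (\sum_(be <- s) be) *+ 2 = S] >].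
have exQ : exists n, Q n.
  pose s := flatten [seq nseq (\sum_j N j l)./2 (al l) | l <- index_enum 'I_r].
  exists (size s); apply/asboolP; exists s; split=> //.
    move=> be /flattenP[l' /mapP[l _ ->]] /nseqP[-> _].
    have [u ul u0] := simple_root l; exists u => //; split=> //.
    by have [_ hr _] := hPi; have /andP[] := hr _ (mem_nth 0 (ltn_ord l)).
  rewrite /s big_flatten big_map -sumrMnl.
  rewrite /S; under [RHS]eq_bigr => j _ do rewrite lamN.
  rewrite exchange_big /=; apply: eq_bigr => l _.
  rewrite big_nseq iter_addr_0 -mulrnA muln2 sumrMnr.
  by rewrite -[in RHS](odd_double_half (\sum_j N j l)) (negPf (ev l)).
case: (ex_minnP exQ) => n /asboolP[s [sz srt sS]] min_n.
have S0 : root_eval S H0 != 0.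
  rewrite root_eval_sum (eq_bigr (fun=> 2)) ?sumr_const ?card_ord => [|j _]; last exact: lamH0.
  rewrite (_ : 2 *+ k.+1 = 2 * k.+1%:R :> F); last by rewrite mulr_natr.
  exact: mulf_neq0.
case: s => [|b1 s] in sz srt sS *.
  by case/eqP: S0; rewrite -sS big_nil mul0rn root_eval0.
have [u1 u1b [u10 b10]] := srt b1 (mem_head _ _).
have [y [h [v cd]]] := coroot_exists b10 u1b u10.
have [[vb v0 yb hha] sl [nv ny] _ hint] := cd.
have hb1 : root_eval b1 h = 2 := root_eval_wt vb v0 hha (let: And3 q _ _ := sl in q).
have rt_int be : be \in s -> exists z : int, root_eval be h = z%:~R.
  by move=> bs; have [|u ub [u0 _]] := srt be; [rewrite inE bs orbT | exact: hint ub u0].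
have pos be : be \in s -> exists z : nat, root_eval be h = z%:R.
  move=> bs; have [[z|z] ez] := rt_int be bs; first by exists z.
  have [|u ub [u0 _]] := srt be; first by rewrite inE bs orbT.
  have hu := root_wt ub hha; rewrite ez NegzE rmorphN /= in hu.
  have vu := sl2_string char0 sl ny hu u0.
  have vub : lie v u \in root_space (b1 + be) by exact: root_space_lie.
  have es : \sum_(x <- s) x = be + \sum_(x <- rem be s) x.
    by rewrite (perm_big _ (perm_to_rem bs)) big_cons.
  have sub x : x \in rem be s -> rt x by move/mem_rem => xs; apply: srt; rewrite inE xs orbT.
  have szr : size (rem be s) = (size s).-1 by exact: size_rem.
  have s0 : (0 < size s)%N by case: (s) bs.
  (* A negative pairing makes b1 + be zero or a root, by [sl2_string]; dropping both terms, or
     replacing them by their sum, would shorten the sum. *)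
  have [e0|e0] := eqVneq (b1 + be) 0.
    have : Q (size (rem be s)).
      apply/asboolP; exists (rem be s); split=> //.
      by rewrite -sS big_cons es addrA e0 add0r.
    by move/min_n; rewrite szr -sz /=; move: s0; clear; lia.
  have : Q (size (rem be s)).+1.
    apply/asboolP; exists (b1 + be :: rem be s); split=> //.
      move=> x; rewrite inE => /orP[/eqP->|/sub //].
      by exists (lie v u).
    by rewrite -sS !big_cons es addrA.
  by move/min_n; rewrite szr -sz /=; move: s0; clear; lia.
have [z ez] : exists z : nat, root_eval (\sum_(x <- s) x) h = z%:R.
  rewrite root_eval_sum big_seq.
  elim/big_rec: _ => [|x w xs [z ->]]; first by exists 0%N.
  by have [z' ->] := pos x xs; exists (z' + z)%N; rewrite natrD.
have := lam_sum_coroot cd; rewrite -/S -sS root_evalMn big_cons root_evalD hb1 ez.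
have := wt_H0_eig (root_wt u1b haH0) u10.
(* The pairing 2 (2 + z) would equal c, a value of H0 in {-2, 0, 2}; [m.+1] is the positive integer
   4 - c. *)
have neg m (c : F) : c + m.+1%:R - 4 = 0 -> (2 + z%:R) *+ 2 = c -> False.
  move=> e q; case/eqP: (nat0 (m + z.*2)); rewrite -addSn natrD -[RHS]e -q -muln2 natrM.
  by rewrite -mulr_natr; ring.
by case=> ->; [apply: (neg 5%N) | apply: (neg 3%N) | apply: (neg 1%N)]; ring.
Qed.

Lemma dop_split t : t != 0 -> dop t.
Proof.
move=> t0; have [N lamN] := choice lamPi.
have [l odd_l] := odd_coefficient lamN.
have [h hcd] := simple_coroots.
have [Mz hMz] : exists Mz : 'M[int]_r, forall i j : 'I_r, root_eval (al j) (h i) = (Mz i j)%:~R.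
  have ex (ij : 'I_r * 'I_r) : exists z : int, root_eval (al ij.2) (h ij.1) = z%:~R.
    have [u ul u0] := simple_root ij.2.
    by have [y [v [_ _ _ _ hint]]] := hcd ij.1; exact: hint ul u0.
  have [z hz] := choice ex; exists (\matrix_(i, j) z (i, j)) => i j.
  by rewrite mxE -hz.
have := dop_coef hcd hMz l lamN t0; set n := (\sum_j N j l)%N in odd_l * => dn.
have -> : t = t ^+ n * (t^-1 ^+ n./2) ^+ 2.
  have := odd_double_half n; rewrite odd_l add1n => en.
  by rewrite -exprM muln2 -[in t ^+ n]en exprS exprVn mulfK // expf_neq0.
apply: dop_mul => //; apply: dop_sqr.
by rewrite expf_neq0 ?invr_eq0.
Qed.

End SplitCase.

(** * The case e = 4 *)

Section HalfRoots.
Implicit Types (i j r : 'I_k.+1) (v w y z : g) (be ga : dual a).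

Definition half i j := root_space (2^-1 *: (lam i - lam j)).

Lemma lam_val i j : root_eval (lam i) (H j) = if j == i then 2 else 0.
Proof.
exact: root_eval_wt (Xlam i) (frame_X0 frame i) (Ha j) (wt_HX j i).
Qed.

Lemma half_E i j A : i != j -> A \in half i j -> E i j 1 (- 1) A.
Proof.
move=> nij Ah; have v s := root_wt Ah (Ha s).
have e s : root_eval (2^-1 *: (lam i - lam j)) (H s) =
    2^-1 * ((if s == i then 2 else 0) - (if s == j then 2 else 0)).
  by rewrite root_evalZ root_evalD root_evalN !lam_val.
split=> [||s si sj].
- by have := v i; rewrite e eqxx (negPf nij) subr0 mulVf.
- by have := v j; rewrite e eqxx eq_sym (negPf nij) sub0r mulrN mulVf.
- by have := v s; rewrite e (negPf si) (negPf sj) subrr mulr0.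
Qed.

Lemma half_sum i j : 2^-1 *: (lam i - lam j) + lam j = 2^-1 *: (lam i + lam j).
Proof. by lmodf F; rewrite // ?two0. Qed.

Lemma dim_half i j : i != j ->
  \dim (half i j) = \dim (root_space (2^-1 *: (lam i + lam j))).
Proof.
move=> nij; apply/eqP; rewrite eqn_leq; apply/andP; split.
  apply: (dim_injective (f := - ad (X j))) => A Ah; have UA := half_E nij Ah;
    rewrite opp_lfunE adE -(lieC A).
    by rewrite -half_sum; exact: root_space_lie.
  by move=> e; rewrite -(U_Yj_X nij UA) e lie0r.
apply: (dim_injective (f := ad (Y j))) => v vb; rewrite adE.
  rewrite /half (_ : 2^-1 *: _ = - lam j + 2^-1 *: (lam i + lam j)); first exact: root_space_lie.
  by lmodf F; rewrite // ?two0.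
have val s : root_eval (2^-1 *: (lam i + lam j)) (H s) =
    2^-1 * ((if s == i then 2 else 0) + (if s == j then 2 else 0)).
  by rewrite root_evalZ root_evalD !lam_val.
have vw s := root_wt vb (Ha s).
have Ev : E i j 1 1 v.
  split=> [||s si sj].
  - by have := vw i; rewrite val eqxx (negPf nij) addr0 mulVf.
  - by have := vw j; rewrite val eqxx eq_sym (negPf nij) add0r mulVf.
  - by have := vw s; rewrite val (negPf si) (negPf sj) addr0 mulr0.
by have [_ e] := plus_U nij Ev => e0; rewrite -e e0 lie0l.
Qed.

Lemma E_root_ind i j c d (W' : {vspace g}) :
  (forall ga w, w \in root_space ga -> w != 0 -> E i j c d w -> w \in W') ->
  forall v, E i j c d v -> v \in W'.
Proof.
move=> hW v /EspaceP vE; suff /subvP -> : (Espace i j c d <= W')%VS by [].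
apply: (root_ind (a_split ha)) => [h hh w /EspaceP[wi wj ws]|mu w /EspaceP wE wmu].
  have hH s : lie (H s) h = 0 := a_comm ha (Ha s) hh.
  have st s e : wt (H s) e w -> wt (H s) e (lie h w).
    by move=> we; apply: wt_lie0l we; rewrite /wt hH scale0r.
  by apply/EspaceP; split; [exact: st | exact: st |] => s si sj; apply/st/ws.
by have [->|w0] := eqVneq w 0; [exact: mem0v | exact: hW wmu w0 wE].
Qed.

Hypothesis dim4 : forall i j, i != j -> \dim (root_space (2^-1 *: (lam i + lam j))) = 4%N.

Lemma half_dim4 i j : i != j -> \dim (half i j) = 4%N.
Proof. by move=> nij; rewrite dim_half // dim4. Qed.

Lemma half_aniso i j A : i != j -> A \in half i j -> A != 0 -> bq i j A A != 0.
Proof.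
move=> nij Ah; apply: half_root_anisotropic => //.
- by rewrite dim4.
- exact: half_E.
Qed.

Lemma bqDr i j A B C : bq i j C (A + B) = bq i j C A + bq i j C B.
Proof. by rewrite /bq lieDl lieDr killingDr mulrDl. Qed.

Lemma bqZr i j c A B : bq i j A (c *: B) = c * bq i j A B.
Proof. by rewrite /bq lieZl lieZr killingZr mulrA. Qed.

Lemma half_bqC i j : i != j -> {in half i j &, forall A B, bq i j A B = bq i j B A}.
Proof.
move=> nij A B Ah Bh; apply: (bqC nij); exact: half_E.
Qed.

Lemma universal_e4 : five_isotropic F -> universal.
Proof.
move=> h5 i j nij t t0.
have [A Ah eA] := aniso_represents (W := half i j) (@bqDl i j) (@bqZl i j)
  (half_bqC nij) (@bqDr i j) (@bqZr i j) (fun A Ah => half_aniso nij Ah) h5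
  (eq_leq (esym (half_dim4 nij))) t.
by exists A => //; exact: half_E.
Qed.

(* For three indices, a root vector of E_ij(1,-1) outside the half root would kill a
   nonzero, hence anisotropic, element of the half root space of (j, r). *)
Lemma E_half i j r A : i != j -> r != i -> r != j -> E i j 1 (- 1) A -> A \in half i j.
Proof.
move=> nij nri nrj; move: A; apply: E_root_ind => ga B Bg B0 UB.
have [e|ne] := eqVneq ga (2^-1 *: (lam i - lam j)); first by rewrite /half -e.
have njr : j != r by rewrite eq_sym.
pose be := ga + 2^-1 *: (lam j + lam r).
have [Bi Bj Bs] := UB.
have gi := root_eval_wt Bg B0 (Ha i) Bi; have gj := root_eval_wt Bg B0 (Ha j) Bj.
have gr : root_eval ga (H r) = 0 := root_eval_wt Bg B0 (Ha r) (Bs r nri nrj).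
have bi : root_eval be (H i) = 1.
  rewrite root_evalD root_evalZ root_evalD !lam_val gi (negPf nij).
  by rewrite eq_sym (negPf nri) addr0 mulr0 addr0.
have br : root_eval be (H r) = 1.
  rewrite root_evalD root_evalZ root_evalD !lam_val gr eqxx (negPf nrj).
  by rewrite !add0r mulVf.
have lbe : long be.
  move=> i' j' nij'; apply/eqP => e.
  have v s : root_eval be (H s) =
      2^-1 * ((if s == i' then 2 else 0) + (if s == j' then 2 else 0)).
    by rewrite e root_evalZ root_evalD !lam_val.
  have mem s : root_eval be (H s) = 1 -> s = i' \/ s = j'.
    rewrite v; case: eqP => [->|_]; first by left.
    case: eqP => [->|_]; first by right.
    by rewrite addr0 mulr0 => /esym/eqP; rewrite oner_eq0.
  have ei : be = 2^-1 *: (lam i + lam r).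
    case: (mem i bi) (mem r br) => [ei|ei] [er|er].
    - by case/eqP: nri; rewrite ei er.
    - by rewrite e ei er.
    - by rewrite e ei er addrC.
    - by case/eqP: nri; rewrite ei er.
  case/eqP: ne; rewrite -(addrK (2^-1 *: (lam j + lam r)) ga) -/be ei.
  by lmodf F; rewrite // ?two0.
have dim1 : (\dim (root_space be) <= 1)%N.
  have [->|n0] := eqVneq (root_space be) 0%VS; first by rewrite dimv0.
  pose v := vpick (root_space be); have vb : v \in root_space be := memv_pick _.
  have v0 : v != 0 by rewrite vpick0.
  have g00 := Eij_g0 nij UB.
  have be2 : root_eval be H0 = 2.
    rewrite root_evalD (root_eval_wt Bg B0 haH0 g00) add0r root_evalZ root_evalD !lamH0.
    by field.
  have [y [h [_ _ _ _ hw]]] := long_root be2 lbe vb v0.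
  have : (root_space be <= <[v]>)%VS by apply/subvP => w /hw[d ->]; rewrite memvZ // memv_line.
  by move/dimvS => h1; apply: leq_trans h1 _; rewrite dim_vline leq_b1.
have [C [Ch C0 BC]] : exists C, [/\ C \in half j r, C != 0 & lie B C = 0].
  apply: contrapT => no.
  have : (\dim (half j r) <= \dim (root_space be))%N.
    apply: (dim_injective (f := (- ad (X r)) \o ad B)%VF) => C Ch;
      rewrite comp_lfunE opp_lfunE !adE -(lieC (lie B C)).
      rewrite /be -half_sum addrA; apply: root_space_lie => //; exact: root_space_lie.
    move=> e; apply: contrapT => /eqP C0; apply: no; exists C; split=> //.
    have UC := half_E njr Ch.
    have [_ Cr _] := UC; apply: zero_of_X (wt_lie0r (Eij_g0 nij UB) (Eij_g0 njr UC)) _ e.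
    exact: wt_lie0l (Bs r nri nrj) Cr.
  by rewrite half_dim4 // => h; have := leq_trans h dim1.
have UC := half_E njr Ch; have c0 := half_aniso njr Ch C0.
have fC := flat_E njr UC.
have fB : lie (flat j r C) B = 0.
  have [fj _ _] := fC; apply: (zero_wtN2 (s := j)).
    exact: wt_lie0r (flat_H0 njr UC) (Eij_g0 nij UB).
  by rewrite (_ : - 2 = - 1 + - 1); [exact: wt_lie | ring].
have := lie_lie (flat j r C) C B.
rewrite fB lie0r subr0 (lieC C) BC oppr0 lie0r.
rewrite (flat_lie_self njr UC) lieZl lieDl lieNl Bj (Bs r nri nrj).
rewrite scale0r subr0 scaleN1r => /eqP; rewrite scaler_eq0 (negPf c0) oppr_eq0.
by rewrite (negPf B0).
Qed.

Hypothesis square4 : four_square F.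

Section Pair.
Variables i j : 'I_k.+1.
Hypothesis nij : i != j.
Variable t : F.
Hypotheses (t0 : t != 0) (ns : forall s, - t != s ^+ 2).

Lemma half_basis : exists A1 A2 A3 A4,
  [/\ [/\ A1 \in half i j, A2 \in half i j, A3 \in half i j & A4 \in half i j],
    [/\ bq i j A1 A2 = 0, bq i j A1 A3 = 0, bq i j A1 A4 = 0, bq i j A2 A3 = 0 & bq i j A2 A4 = 0],
    bq i j A3 A4 = 0 /\ (bq i j A1 A1 != 0 /\ bq i j A3 A3 != 0),
    bq i j A2 A2 = t * bq i j A1 A1 /\ bq i j A4 A4 = t * bq i j A3 A3 &
    forall B, B \in half i j -> exists x1 x2 x3 x4,
      B = x1 *: A1 + (x2 *: A2 + (x3 *: A3 + (x4 *: A4 + 0)))].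
Proof.
exact: (@adapted_basis _ _ _ (half i j) (@bqDl i j) (@bqZl i j) (half_bqC nij) (bqDr i j) (bqZr i j)
  (fun A => @half_aniso i j A nij) t square4 (half_dim4 nij) t0 ns).
Qed.

(** With a third index, [E_half] reduces each E_pq(1,-1) to its half root space; V+ then consists of
    turned vectors and vectors killed by D of weight 0 for H_i, so that [Psi] can be the
    identity. *)
Lemma dop_third r : r != i -> r != j -> diagonal_of_product t.
Proof.
move=> ri rj.
have EH p q : p != q -> Espace p q 1 (- 1) = half p q.
  move=> npq; apply/vspaceP => v; apply/idP/idP => [/EspaceP|/(half_E npq)/EspaceP //].
  have [u [up uq]] := avoid_two p q nij ri rj.
  exact: (E_half npq up uq).
have [A1 [A2 [A3 [A4 [[W1 W2 W3 W4] [b12 b13 b14 b23 b24] [b34 [c1 c3]] [c2 c4] sp]]]]] := half_basis.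
have [U1 U2 U3 U4] := And4 (half_E nij W1) (half_E nij W2) (half_E nij W3) (half_E nij W4).
have an p q B : p != q -> E p q 1 (- 1) B -> B != 0 -> bq p q B B != 0.
  by move=> npq /EspaceP; rewrite EH //; exact: half_aniso.
have d4 p q : p != q -> \dim (Espace p q 1 (- 1)) = 4%N by move=> npq; rewrite EH // half_dim4.
have spU B : E i j 1 (- 1) B -> exists x1 x2 x3 x4,
    B = x1 *: A1 + (x2 *: A2 + (x3 *: A3 + (x4 *: A4 + 0))).
  by move=> /EspaceP; rewrite EH //; exact: sp.
have th : exists r, r != i /\ r != j by exists r.
have [s [s2 Djr]] := turn_exists nij U1 U2 U3 U4
  b12 b13 b14 b23 b24 b34 c1 c3 c2 c4 t0 spU an d4 th.
have [om omE] := closed_sqrt (- iota t).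
have [I I2] := closed_sqrt (- 1 : L).
apply: (dop_turn nij U1 U2 U3 U4 b12 b13 b14 b23 b24 b34 c1 c3 c2 c4 t0 s2 omE I2
  (elementary_id gL)) => // W h1 h2 p q v npq Ev.
have [[e e1]|[e e0]] := turn_plus nij U1 U2 U3 U4
  b12 b13 b14 b23 b24 b34 c1 c3 c2 c4 spU s2 Djr npq Ev; first exact: h1.
by apply: h2; split=> //; exists 0 => //; exists v; rewrite scale1r.
Qed.

(** * Exactly two indices: the roots outside the half sum *)

Section Two.
Hypothesis only2 : forall q, q = i \/ q = j.
Notation conj be := (lam i + lam j - be).
(** Apart from the half sum, D kills the vectors of these roots while the torus of H_i multiplies
    them by om/I, which may be irrational. The involution [conj] pairs them, and a torus multiplying
    one member of each pair by om/I and the other by its inverse leaves the factors t and 1. *)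
Definition mixed (be : dual a) := exists v, [/\ v \in root_space be, v != 0 & E i j 1 1 v].

Let lamH p q : root_eval (lam p) (H q) = if q == p then 2 else 0 :=
  lam_val p q.
Let nji : j != i. Proof. by rewrite eq_sym. Qed.

Lemma mixed_H be : mixed be -> [/\ root_eval be (H i) = 1, root_eval be (H j) = 1 &
  root_eval be H0 = 2].
Proof.
move=> [v [vb v0 Ev]]; have [vi vj _] := Ev; split.
- exact: root_eval_wt vb v0 (Ha i) vi.
- exact: root_eval_wt vb v0 (Ha j) vj.
exact: root_eval_wt vb v0 haH0 (Eij_V nij Ev).
Qed.

Lemma conjK be : conj (conj be) = be. Proof. by rewrite subKr. Qed.

Lemma mixed_conj be : mixed be -> mixed (conj be).
Proof.
move=> mb; have [b1 b2 _] := mixed_H mb; have [v [vb v0 Ev]] := mb.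
have [UA eA] := plus_U nij Ev.
have A0 : lie (Y j) v != 0 by apply: contraNneq v0 => e; rewrite -eA e lie0l.
pose y := lie (Y i) (lie (Y j) v).
have y0 : y != 0.
  apply: contraNneq A0 => e; rewrite -[lie _ _]opprK -(U_Yi nij UA).
  by rewrite [lie (lie (Y j) v) _]lieC -/y e oppr0 lie0l oppr0.
have yb : y \in root_space (- conj be).
  have := root_space_lie (Ylam i) (root_space_lie (Ylam j) vb).
  by rewrite (_ : - lam i + _ = - conj be) // opprB opprD addrA addrC.
have := root_spaceN ha (root_space_neq0 yb y0).
rewrite opprK -vpick0 => w0; set w := vpick _ in w0.
have wb : w \in root_space (conj be) := memv_pick _.
exists w; split=> //; split.
- have := root_wt wb (Ha i); rewrite root_evalD root_evalN root_evalD b1 !lamH.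
  by rewrite eqxx (negPf nij) (_ : 2 + 0 - 1 = 1) //; ring.
- have := root_wt wb (Ha j); rewrite root_evalD root_evalN root_evalD b2 !lamH.
  by rewrite eqxx (negPf nji) (_ : 0 + 2 - 1 = 1) //; ring.
by move=> s si sj; case: (only2 s) => e; rewrite e eqxx in si sj.
Qed.

Lemma conj_half be : conj be = be -> be = 2^-1 *: (lam i + lam j).
Proof.
move=> e; have -> : lam i + lam j = be + be by rewrite -{1}e subrK.
by rewrite -mulr2n -scaler_nat scalerA mulVf // scale1r.
Qed.

Lemma mixed_long be : be != 2^-1 *: (lam i + lam j) -> long be.
Proof.
move=> nb p q npq; case: (only2 p) => ep; case: (only2 q) => eq.
- by rewrite ep eq eqxx in npq.
- rewrite ep eq; exact: nb.
- rewrite ep eq [lam j + _]addrC; exact: nb.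
by rewrite ep eq eqxx in npq.
Qed.

(** Roots of V+ other than be take the values 0 and 1 at h. Since lam_i + lam_j - be takes one of
    them and be(h) = 2, both lam_i and lam_j take the value 1; so the values at a mixed root and at
    its conjugate add up to 2. *)
Lemma mixed_coroot be : mixed be -> be != 2^-1 *: (lam i + lam j) -> exists y h v,
  [/\ sl2_triple y h v, h \in a, wt H0 (- 2) y, wt H0 2 v &
   forall ga w, w \in root_space ga -> w != 0 -> wt H0 2 w ->
     root_eval ga h = (1 + (ga == be)%:Z - (conj ga == be)%:Z)%:~R].
Proof.
move=> mb nb; have [b1 b2 b0] := mixed_H mb; have [v [vb v0 Ev]] := mb.
have lb := mixed_long nb.
have [y [h [yb hha tr [ey ky] _]]] := long_root b0 lb vb v0.
have v2 : wt H0 2 v by have := root_wt vb haH0; rewrite b0.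
have y2 : wt H0 (- 2) y by have := root_wt yb haH0; rewrite root_evalN b0.
exists y, h, v; split=> //.
have vals ga w : w \in root_space ga -> w != 0 -> wt H0 2 w -> ga != be ->
    root_eval ga h = 0 \/ root_eval ga h = 1.
  move=> wg w0 w2 ng; have hw := root_wt wg hha.
  case: (plus_wt tr v2 y2 w2 w0 hw) => e; [by left | by right |].
  rewrite e in hw; have kw : killing y w = 0.
    by apply: (killing_root yb wg); rewrite addrC subr_eq0.
  by have := extremal_weight2 tr v2 y2 ey w2 hw ky kw => /eqP; rewrite (negPf w0).
have X0 := frame_X0 frame.
have [l1 l2] : root_eval (lam i) h = 1 /\ root_eval (lam j) h = 1.
  have ni : lam i != be by apply: contraTneq isT => e; move: b1; rewrite -e lamH eqxx => /eqP;
    rewrite (negPf (neq_natr char0 (n := 0) _)) //; ring.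
  have nj : lam j != be by apply: contraTneq isT => e; move: b2; rewrite -e lamH eqxx => /eqP;
    rewrite (negPf (neq_natr char0 (n := 0) _)) //; ring.
  have [w [wb w0 Ew]] := mixed_conj mb.
  have w2 := Eij_V nij Ew.
  have nc : conj be != be by apply: contra_neq nb => /conj_half.
  have := vals _ _ wb w0 w2 nc; rewrite root_evalD root_evalN root_evalD.
  have bh : root_eval be h = 2 by case: tr => tr _ _; exact: root_eval_wt vb v0 hha tr.
  rewrite bh.
  have := vals _ _ (Xlam i) (X0 i) (fam_X2 fam i) ni.
  have := vals _ _ (Xlam j) (X0 j) (fam_X2 fam j) nj.
  by case=> -> [] -> // [] /eqP e; exfalso; move: e; apply/negP; nat_neq.
move=> ga w wg w0 w2; have bh : root_eval be h = 2 by case: tr => tr _ _; exact: root_eval_wt vb v0 hha tr.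
have nc : conj be != be by apply: contra_neq nb => /conj_half.
have [->|ng] := eqVneq ga be.
  by rewrite (negPf nc) bh (_ : 1 + true%:Z - false%:Z = 2).
have [eg|ncg] := eqVneq (conj ga) be.
  rewrite -[ga]conjK eg root_evalD root_evalN root_evalD bh l1 l2.
  by rewrite (_ : 1 + false%:Z - true%:Z = 0) // mulr0z; ring.
rewrite (_ : 1 + false%:Z - false%:Z = 1) //.
have g0' : root_eval ga H0 = 2 by exact: root_eval_wt wg w0 haH0 w2.
have [[q -> _]|[p [q [npq Ew]]]] := root_cases g0' wg w0.
  by case: (only2 q) => ->.
have mg : mixed ga.
  exists w; split=> //; case: (only2 p) (only2 q) npq Ew => -> [] ->; rewrite ?eqxx // => _.
  exact: Eij_sym.
have [w' [wg' w0' Ew']] := mixed_conj mg.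
have w2' := Eij_V nij Ew'.
have := vals _ _ wg' w0' w2' ncg; rewrite root_evalD root_evalN root_evalD l1 l2.
by case: (vals _ _ wg w0 w2 ng) => -> // [] /eqP e; exfalso; move: e; apply/negP; nat_neq.
Qed.

(** For each root of S, the coroot torus at c is combined with the scalar c^-1, the torus of H0 at a
    square root of c^-1: the exponents 2, 1, 0 become 1, 0, -1. *)
Lemma mixed_torus (c : L) (S : seq (dual a)) : c != 0 -> uniq S ->
  (forall be, be \in S -> mixed be /\ be != 2^-1 *: (lam i + lam j)) ->
  exists2 Psi : gL -> gL, elementary Psi & Psi (tau H0) = tau H0 /\
  forall ga w, w \in root_space ga -> w != 0 -> wt H0 2 w ->
    Psi (tau w) = c ^ ((ga \in S)%:Z - (conj ga \in S)%:Z) *: tau w.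
Proof.
move=> c0; elim: S => [_ _|be S IH].
  by exists id; [exact: elementary_id | split=> // ga w _ _ _; rewrite scale1r].
rewrite cons_uniq => /andP[nS uS] hS.
have [Psi eP [P0 PE]] := IH uS (fun b hb => hS b (mem_behead (s := be :: S) hb)).
have [mb nb] := hS be (mem_head _ _).
have [y [h [v [tr hha y2 v2 vals]]]] := mixed_coroot mb nb.
have [T eT TE] := torus_V tr v2 y2 c0.
have [Im [Ip [/wt_eigen Im2 /wt_eigen Ip2 tr0]]] := graded_sl2 hgraded.
have [sg sgE] := closed_root c^-1 (isT : (0 < 2)%N).
have sg0 : sg != 0 by apply: contra_eq_neq sgE => ->; rewrite expr0n /= eq_sym invr_eq0.
have [T0 eT0 T0E] := torus_V tr0 Ip2 Im2 sg0.
exists (fun u => Psi (T (T0 u))).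
  by apply: elementary_comp eP _; exact: elementary_comp eT eT0.
split=> [|ga w wg w0 w2].
  by rewrite (T0E 0 _ wt_H0_H0) scale1r (TE 0 _ (a_wt ha hha haH0)) scale1r.
have hw := root_wt wg hha; rewrite (vals _ _ wg w0 w2) in hw.
rewrite (T0E 2 _ w2) !(elementaryZ _ _ eT, elementaryZ _ _ eP) (TE _ _ hw) (elementaryZ _ _ eP) (PE _ _ wg w0 w2) !scalerA.
congr (_ *: _); rewrite -[sg ^ 2]/(sg ^+ 2) sgE -[c^-1]/(c ^ (-1)) -!expfzDr //; congr (_ ^ _).
rewrite !inE; case: eqVneq => [->|_]; case: eqVneq => [->|_]; rewrite ?(negPf nS) /=; ring.
Qed.

Lemma dop_two : diagonal_of_product t.
Proof.
have [A1 [A2 [A3 [A4 [[W1 W2 W3 W4] [b12 b13 b14 b23 b24] [b34 [c1 c3]] [c2 c4] sp]]]]] := half_basis.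
have [U1 U2 U3 U4] := And4 (half_E nij W1) (half_E nij W2) (half_E nij W3) (half_E nij W4).
have [om omE] := closed_sqrt (- iota t).
have [I I2] := closed_sqrt (- 1 : L).
have om0 : om != 0 by apply: contra_eq_neq omE => ->; rewrite mul0r eq_sym oppr_eq0 fmorph_eq0.
have I0 : I != 0 by apply: contra_eq_neq I2 => ->; rewrite mul0r eq_sym oppr_eq0 oner_eq0.
have c0 : om / I != 0 by rewrite mulf_neq0 ?invr_eq0.
pose b0 : dual a := 2^-1 *: (lam i + lam j).
have spa : split_abelian a by case: ha.
have [rs rsE] := finite_roots spa.
have mrs be : mixed be -> be \in rs by case=> v [vb v0 _]; apply: rsE; exact: root_space_neq0 vb v0.
(* One root from each pair of distinct conjugates, the one met first in [rs]. *)
pose S := [seq be <- undup rs | [&& `[< mixed be >], be != b0 & (index be rs < index (conj be) rs)%N]].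
have SE be : be \in S = [&& `[< mixed be >], be != b0 & (index be rs < index (conj be) rs)%N].
  rewrite mem_filter mem_undup andb_idr // => /and3P[/asboolP mb _ _]; exact: mrs.
have uS : uniq S by rewrite filter_uniq // undup_uniq.
have hS be : be \in S -> mixed be /\ be != b0 by rewrite SE => /and3P[/asboolP].
have [Psi eP [P0 PE]] := mixed_torus c0 uS hS.
have s2 : (1 : F) * 1 = 1 := mulr1 1.
have iD := turnD_inner nij U1 U2 U3 U4 b12 b34 1.
have conjb0 : conj b0 = b0 by rewrite /b0; lmodf F; rewrite two0.
have nS ga : ~ mixed ga \/ ga = b0 -> ga \in S = false.
  by case=> h; apply/negP => /hS[]; rewrite ?h ?eqxx.
apply: (dop_turn nij U1 U2 U3 U4 b12 b13 b14 b23 b24 b34 c1 c3 c2 c4 t0 s2 omE I2 eP P0).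
- have nm q : ~ mixed (lam q).
    move=> mq; have [e1 e2 _] := mixed_H mq; case: (only2 q) e1 e2 => -> e1 e2.
      by move: e2; rewrite lamH (negPf nji) => /eqP; rewrite eq_sym oner_eq0.
    by move: e1; rewrite lamH (negPf nij) => /eqP; rewrite eq_sym oner_eq0.
  move=> q; rewrite (PE _ _ (Xlam q) (frame_X0 frame q) (fam_X2 fam q)).
  have nc : ~ mixed (conj (lam q)) by move/mixed_conj; rewrite conjK; exact: nm.
  by rewrite (nS _ (or_introl (nm q))) (nS _ (or_introl nc)) scale1r.
have [DX0 DX DY] := iD; set D := turnD _ _ _ _ _ _ _ in iD DX0 DX DY *.
have RD A B : A \in half i j -> B \in half i j -> lie (flat i j A) B \in root_space (0 : dual a).
  move=> WA WB; have := root_space_lie (root_space_lie (Ylam i) (root_space_lie WA (Xlam j))) WB.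
  rewrite (_ : _ + _ = 0); first by move=> h; rewrite /flat lieNl memvN.
  by lmodf F; rewrite two0.
have D00 : D \in root_space (0 : dual a) by apply: memvD; apply: memvZ; exact: RD.
move=> W h1 h2 p q v npq Epq.
have Ev : E i j 1 1 v.
  by case: (only2 p) (only2 q) npq Epq => -> [] ->; rewrite ?eqxx // => _; exact: Eij_sym.
apply: (E_root_ind (W' := W) _ Ev) => ga w wg w0 Ew.
have mg : mixed ga by exists w.
have [UA eA] := plus_U nij Ew.
have w2 := Eij_V nij Ew.
have DJ m r : lie D (lie m (X r)) = lie (lie D m) (X r) by rewrite lieJ DX lie0r addr0.
have [eg|ng] := eqVneq ga b0.
  apply: h1; split; last 2 first.
  - by case: Ew.
  - have [->|Dw0] := eqVneq (lie D w) 0.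
      by rewrite toBC0 elementary0.
    have Dwg : lie D w \in root_space ga by rewrite -[ga]add0r; exact: root_space_lie D00 wg.
    have gc : conj ga = b0 by rewrite eg.
    rewrite (PE _ _ Dwg Dw0 (plus_g0 DX0 w2)).
    by rewrite (nS _ (or_intror eg)) (nS _ (or_intror gc)) scale1r.
  rewrite -eA !DJ; have Wn : lie (Y j) w \in half i j.
    have := root_space_lie (Ylam j) wg; rewrite eg (_ : _ + _ = 2^-1 *: (lam i - lam j)) //.
    by rewrite /b0; lmodf F; rewrite two0.
  have [x1 [x2 [x3 [x4 ->]]]] := sp _ Wn.
  rewrite (turn_sq_span nij U1 U2 U3 U4
    b12 b13 b14 b23 b24 b34 c1 c3 c2 c4 s2).
  by rewrite lieZl.
apply: h2; split.
  (* Weights of roots: [A, [[Y_j, w], X_j]] has a root other than lam_i, so it is orthogonal to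
     Y_i. *)
  have bz A : A \in half i j -> bq i j A (lie (Y j) w) = 0.
    move=> WA; rewrite /bq (killing_root (Ylam i) (root_space_lie WA
      (root_space_lie (root_space_lie (Ylam j) wg) (Xlam j)))) ?mul0r //.
    apply: contra_neq ng => e; apply/eqP; rewrite -subr_eq0 -e; apply/eqP.
    by rewrite /b0; lmodf F; rewrite two0.
  rewrite -eA DJ /D /turnD lieDl !lieZl (orth_act nij U1 U2 UA b12).
  rewrite (orth_act nij U3 U4 UA b34) !bz //.
  by rewrite !mulr0 !scale0r subrr !scaler0 addr0 lie0l.
exists 1; first by case: Ew.
have ncb : conj ga != b0 by apply: contra_neq ng => e; rewrite -[ga]conjK e conjb0.
have nc : conj ga != ga by apply: contra_neq ng => /conj_half.
have mga : `[< mixed ga >] by apply/asboolP.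
have mgc : `[< mixed (conj ga) >] by apply/asboolP; exact: mixed_conj.
rewrite elementaryZ // (PE _ _ wg w0 w2) !SE conjK mga mgc ng ncb /=.
have nidx : index ga rs != index (conj ga) rs.
  apply: contra_neq nc => e; rewrite -[conj ga](nth_index 0 (mrs _ (mixed_conj mg))) -e.
  exact: nth_index (mrs _ mg).
(* The total factor is (om/I)^2 = t on the roots of S and 1 on their conjugates. *)
rewrite scalerA -expfzDr //; case: ltngtP nidx => // _ _.
  exists (t *: w); rewrite toBCZ; congr (_ *: _).
  by rewrite -[_ ^ _]/((om / I) ^+ 2) expr2 mulf_div omE I2 invrN1 mulrN1 opprK.
by exists w; rewrite scale1r.
Qed.

End Two.
End Pair.

Lemma dop_nonsquare t : (0 < k)%N -> t != 0 -> (forall s, - t != s ^+ 2) ->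
  diagonal_of_product t.
Proof.
move=> k0 t0 ns; have nij : ord0 != ord_max :> 'I_k.+1 by rewrite -val_eqE /= eq_sym -lt0n.
have [r /andP[r1 r2]|h] := pickP (fun r : 'I_k.+1 => (r != ord0) && (r != ord_max)).
  by apply: (dop_third nij _ _ r1 r2).
apply: (dop_two nij) => // q; have := h q; case: eqVneq => [|_]; first by left.
by case: eqVneq => // ->; right.
Qed.

(** If -t is a square, t is the product of t/w and w: -w is not a square by hypothesis, and -(t/w)
    is not one since it has the class of w. *)
Lemma dop_four (w t : F) : (0 < k)%N -> w != 0 -> (forall s, w != s ^+ 2) ->
  (forall s, - w != s ^+ 2) -> t != 0 -> diagonal_of_product t.
Proof.
move=> k0 w0 nw nw' t0.
have [[s e]|ns] := pselect (exists s, - t = s ^+ 2); last first.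
  by apply: dop_nonsquare => // s; apply/eqP => e; apply: ns; exists s.
rewrite -[t](divfK w0); apply: dop_mul; last exact: dop_nonsquare.
apply: dop_nonsquare => //; first by rewrite mulf_neq0 ?invr_eq0.
move=> r; apply/eqP => er; have r0 : r != 0.
  apply: contra_eq_neq er => ->; rewrite expr0n /= oppr_eq0.
  by rewrite mulf_neq0 ?invr_eq0.
have := nw (s / r); rewrite expr_div_n -er -e.
by rewrite invrN invfM invrK mulrNN mulrA divff // mul1r eqxx.
Qed.
End HalfRoots.
Section SplitFrame.
Hypothesis aniso : forall i j, i != j -> exists2 A, Eij i j 1 (- 1) A & bq i j A A != 0.
Hypothesis e0 : forall i j, i != j -> \dim (root_space (2^-1 *: (lam i + lam j))) = 0%N.

Lemma e0_long be v : v \in root_space be -> v != 0 -> long be.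
Proof.
move=> vb v0 i j nij; apply: contraNneq v0 => e; move: vb.
by have /eqP := e0 nij; rewrite dimv_eq0 -e => /eqP->; rewrite memv0.
Qed.

Lemma e0_linked i j : i != j -> exists2 v, Eij i j 1 1 v & v != 0.
Proof.
move=> nij; have [A UA c0] := aniso nij.
exists (lie A (X j)); first exact: (U_X nij UA).
apply: contraNneq c0 => e; have := bq_lie nij UA UA.
rewrite e lie0r => /esym/eqP; rewrite scaler_eq0 (negPf (frame_X0 frame i)) orbF.
by rewrite mulf_eq0 (negPf two_neq0).
Qed.

Lemma universal_e0 : universal.
Proof.
move=> i j nij t _; have [v0 Ev0 v00] := e0_linked nij.
have [be [v [vb vn0 Ev]]] := root_in_E Ev0 v00.
have [UA AE] := plus_U nij Ev.
apply: (universal_of_isotropic nij UA).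
  by apply: contraNneq vn0 => e; rewrite -AE e lie0l.
apply: (isotropic_root nij UA (be := be - lam j)).
  by rewrite addrC; exact: root_space_lie.
by apply: half_shift; exact: e0_long vb vn0 i j nij.
Qed.

End SplitFrame.
End Arrangement.

(** * The relative invariant *)

Section RelativeInvariant.
Hypothesis univ : universal.
Hypothesis torus : torus_surjective.

Variables (D : g -> F) (chi : 'End(g) -> F).
Hypothesis Dpoly : polyfun D.
Hypothesis Dchi : forall phi Z, G phi -> wt H0 2 Z -> D (phi Z) = chi phi * D Z.
Hypothesis Dneq0 : exists2 Z, wt H0 2 Z & D Z != 0.

Notation base := (\sum_j X j).
Notation d := (D base).
Let base2 : wt H0 2 base. Proof. by apply: wt_sum => j _; exact: X2. Qed.
Let baseE : base = dX (fun=> 1). Proof. by apply: eq_bigr => j _; rewrite scale1r. Qed.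

Lemma D_orbit Z Z' : wt H0 2 Z -> Gorbit iota H0 Z Z' -> D Z != 0 -> D Z' != 0.
Proof.
move=> Z2 hZ; have [psi Gs e] := Gorbit_sym hZ; have [phi Gp ep] := hZ.
move=> n0; apply: contraNneq n0 => e0.
by rewrite -e (Dchi Gs) ?e0 ?mulr0 // -ep; exact: Ggrp_wt Gp Z2.
Qed.

(** Some diagonal element has D nonzero. Moving it in the direction of the missing X_j keeps D
    nonzero outside finitely many parameters, and an element without zero coefficient is conjugate
    to the base point by the torus. *)
Lemma D_base : d != 0.
Proof.
have [Z Z2 n0] := Dneq0; have [phi [Gp [b eb]]] := diagonalize Z2.
have nb : D (dX b) != 0 by apply: D_orbit Z2 _ n0; exists phi.
pose e j : F := if b j == 0 then 1 else 0.
have [p hp] := polyfun_const_line (dX b) (dX e) Dpoly.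
have [n hn] : exists n, p.[n.+1%:R] != 0.
  apply: contrapT => no; case/eqP: nb; have := hp 0; rewrite scale0r addr0 => ->.
  suff -> : p = 0 by rewrite horner0.
  apply: (poly_eq_natS char0) => n; rewrite horner0; apply/eqP; apply: contrapT => /negP h.
  by apply: no; exists n.
pose b' j := b j + n.+1%:R * e j.
have b'0 j : b' j != 0.
  rewrite /b' /e; case: ifP => [/eqP->|/negbT h]; last by rewrite mulr0 addr0.
  by rewrite add0r mulr1 char0_natr.
have eb' : dX b + n.+1%:R *: dX e = dX b'.
  by rewrite /diagX scaler_sumr -big_split; apply: eq_bigr => j _ /=; rewrite scalerA -scalerDl.
rewrite -hp eb' in hn.
have [psi Gs hpsi] := torus b'0.
have o : Gorbit iota H0 base (dX b').
  by exists psi => //; rewrite linear_sum; apply: eq_bigr => j _ /=; rewrite hpsi.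
exact: D_orbit (wt_diagX _) (Gorbit_sym o) hn.
Qed.

Lemma chi_base phi : G phi -> chi phi = D (phi base) / d.
Proof. by move=> Gp; rewrite Dchi // mulfK // D_base. Qed.

Lemma chiM phi psi : G phi -> G psi -> chi (phi \o psi)%VF = chi phi * chi psi.
Proof.
move=> Gp Gs; rewrite (chi_base (Ggrp_comp Gp Gs)) comp_lfunE Dchi //; last exact: Ggrp_wt Gs base2.
by rewrite Dchi // mulrA mulfK // D_base.
Qed.

Lemma chi1 : chi \1%VF = 1.
Proof. by rewrite (chi_base Ggrp_id) id_lfunE divff // D_base. Qed.

Lemma chi_ext phi psi : G phi -> G psi -> phi base = psi base -> chi phi = chi psi.
Proof. by move=> Gp Gs e; rewrite !chi_base // e. Qed.

(** The character of exp (w B) is a polynomial in w whose inverse, the character of exp (-w B), is a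
    polynomial as well; so it is constant. *)
Lemma chi_exp B : wt H0 0 B -> ad_nilpotent B -> chi (expE B) = 1.
Proof.
move=> B0 nB.
have line C : wt H0 0 C -> ad_nilpotent C -> exists p : {poly F}, forall w, chi (expE (w *: C)) = p.[w].
  move=> C0 nC; pose u i := (i`!%:R)^-1 *: iter i (lie C) base.
  have [p hp] := polyfun_curve (\dim {:g}).+1 u Dpoly.
  exists (d^-1 *: p) => w; rewrite chi_base; last first.
    by apply: Ggrp_exp => //; [exact: wtZ | exact: ad_nilpotentZ].
  rewrite hornerZ -hp mulrC expEE /exp_ad; congr (_ * D _); apply: eq_bigr => i _.
  have -> : iter i (lie (w *: C)) base = w ^+ i *: iter i (lie C) base.
    elim: (nat_of_ord i) => [|n IH] /=; first by rewrite scale1r.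
    by rewrite IH lieZl lieZr scalerA exprS.
  by rewrite /u !scalerA mulrC.
have [p hp] := line B B0 nB.
have [q hq] := line (- B) (wtN B0) (ad_nilpotentN nB).
have e : p * q = 1.
  apply: (poly_eq_natS char0) => n; rewrite hornerM hornerC -hp -hq.
  set C := n.+1%:R *: B; have C0 : wt H0 0 C := wtZ _ B0.
  have nC : ad_nilpotent C := ad_nilpotentZ _ nB.
  have GC : G (expE C) by exact: Ggrp_exp.
  have GN : G (expE (- C)) by apply: Ggrp_exp; [exact: wtN|exact: ad_nilpotentN].
  rewrite scalerN -/C mulrC -chiM // -chi1.
  apply: chi_ext; [exact: Ggrp_comp | exact: Ggrp_id |].
  by rewrite id_lfunE comp_lfunE !expEE exp_adNK.
have up : p \is a GRing.unit by apply/unitrP; exists q; split=> //; rewrite mulrC.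
rewrite poly_unitE in up; case/andP: up => /size_poly1P[c c0 pE] _.
have := hp 0; have := hp 1; rewrite pE !hornerC scale1r scale0r => -> <-.
rewrite -chi1; apply: chi_ext; rewrite ?id_lfunE; [| exact: Ggrp_id|].
  by apply: Ggrp_exp => //; [exact: wt0 | exists 1%N => y; exact: lie0l].
by rewrite expEE exp_ad1 ?lie0l //; exists 1%N => y; exact: lie0l.
Qed.

Let at_j j z : base + (z - 1) *: X j = dX (fun i => if i == j then z else 1).
Proof.
rewrite baseE /diagX (bigD1 j) //= [RHS](bigD1 j) //= eqxx scale1r addrAC; congr (_ + _).
  by rewrite -[X in X + _]scale1r -scalerDl addrC subrK.
by apply: eq_bigr => i /negPf->.
Qed.

Lemma D_power_j j : exists n, forall z, D (base + (z - 1) *: X j) = d * z ^+ n.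
Proof.
have d0 := D_base.
have [p0 hp0] := polyfun_const_line (base - X j) (X j) Dpoly.
pose p := d^-1 *: p0.
have hp z : D (base + (z - 1) *: X j) = d * p.[z].
  rewrite /p hornerZ mulrA mulfV // mul1r -hp0; congr D.
  by rewrite scalerBl scale1r addrA addrAC.
have act z : z != 0 -> exists2 phi, G phi & chi phi = p.[z] /\
    forall i, phi (X i) = (if i == j then z else 1) *: X i.
  move=> z0; have [|phi Gp hphi] := torus (d := fun i => if i == j then z else 1).
    by move=> i; case: ifP; rewrite ?oner_eq0.
  exists phi => //; split=> //; rewrite chi_base //.
  have -> : phi base = dX (fun i => if i == j then z else 1).
    by rewrite linear_sum; apply: eq_bigr => i _; exact: hphi.
  by rewrite -at_j hp mulrC mulKf.
have [n pE] : exists n, p = 'X^n.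
  apply: (multiplicative_monomial char0) => [z z0|z z' z0 z0'].
    have [phi Gp [<- _]] := act z z0; rewrite chi_base // mulf_neq0 ?invr_eq0 //.
    by apply: D_orbit base2 _ d0; exists phi.
  have [phi Gp [<- h]] := act z z0; have [psi Gs [<- h']] := act z' z0'.
  have [ph Gh [<- h'']] := act (z * z') (mulf_neq0 z0 z0').
  rewrite -chiM //; apply: chi_ext => //; first exact: Ggrp_comp.
  rewrite comp_lfunE !linear_sum; apply: eq_bigr => i _ /=.
  by rewrite h'' h' linearZ /= h scalerA; case: ifP; rewrite ?mulr1 // mulrC.
by exists n => z; rewrite hp pE hornerXn.
Qed.

(** The exponent found along X_0 serves every j: the exchange element of an A with b(A, A) = 1 fixes
    the base point, so has character 1, and swaps X_0 and X_j. *)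
Lemma D_power : exists n, forall j z, D (base + (z - 1) *: X j) = d * z ^+ n.
Proof.
have [n hn] := D_power_j ord0; exists n => j z.
have [->|nj] := eqVneq j ord0; first exact: hn.
have n0j : ord0 != j by rewrite eq_sym.
have [A UA bA] := univ n0j (oner_neq0 _).
have bA0 : bq ord0 j A A != 0 by rewrite bA oner_neq0.
have Gx := exch_G n0j UA.
have [e1 e2 e3] := exch_X n0j UA bA0.
set ex := exch ord0 j A in Gx e1 e2 e3.
have eb : ex base = base.
  rewrite linear_sum (bigD1 ord0) //= (bigD1 j) //= [RHS](bigD1 j) //=.
  rewrite [X in _ = _ + X](bigD1 ord0) /= ?n0j // e1 e2 bA invr1 !scale1r.
  congr (_ + (_ + _)); apply: eq_big => i; first by rewrite andbC.
  by case/andP=> i0 ij; rewrite e3.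
have c1 : chi ex = 1 by rewrite -chi1; apply: chi_ext; rewrite ?id_lfunE //; exact: Ggrp_id.
rewrite -hn -[LHS]mul1r -c1 -Dchi //; last by apply: wtD => //; apply: wtZ; exact: X2.
by rewrite linearD linearZ /= eb e1 bA scale1r.
Qed.

Section Power.
Variable n : nat.
Hypothesis hn : forall j z, D (base + (z - 1) *: X j) = d * z ^+ n.

Definition tail (j : nat) Z := wt H0 2 Z /\ forall i : 'I_k.+1, (i < j)%N -> wt (H i) 0 Z.
Notation front j := (\sum_(i < k.+1 | (i < j)%N) X i).

Lemma chi_torus_H j s phi : s != 0 -> G phi -> phi (X j) = s ^+ 2 *: X j ->
  (forall i, i != j -> phi (X i) = X i) -> chi phi = (s ^+ 2) ^+ n.
Proof.
move=> s0 Gp h1 h2; rewrite chi_base // (_ : phi base = base + (s ^+ 2 - 1) *: X j).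
  by rewrite hn mulrC mulKf // D_base.
rewrite at_j linear_sum; apply: eq_bigr => i _ /=.
by case: eqVneq => [->|ni]; rewrite ?h1 // (h2 _ ni) scale1r.
Qed.

Lemma front_succ (j : 'I_k.+1) : front j.+1 = front j + X j.
Proof.
rewrite (bigD1 j) //= addrC; congr (_ + _); apply: eq_bigl => i.
by rewrite ltnS ltn_neqAle andbC -val_eqE.
Qed.

(** [eliminate] clears Z1 by an exponential, of character 1; the torus of H_j, which fixes the
    weight-0 part of V+, then brings the pivot to 1, whence the restriction to square pivots. *)
Lemma D_reduce (j : 'I_k.+1) s Z1 Z0 : s != 0 -> tail j Z1 -> tail j Z0 ->
  wt (H j) 1 Z1 -> wt (H j) 0 Z0 ->
  D (front j + (s ^+ 2 *: X j + Z1 + Z0)) =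
  (s ^+ 2) ^+ n * D (front j.+1 + (Z0 - (2 * s ^+ 2)^-1 *: lie (lie (Y j) Z1) Z1)).
Proof.
move=> s0 [Z12 Z1i] [Z02 Z0i] Z1j Z0j; have c0 : s ^+ 2 != 0 by rewrite expf_neq0.
have [B [B0 nB eB fB]] := eliminate c0 Z12 Z02 Z1j Z0j.
have GB := Ggrp_exp B0 nB.
have fr2 : wt H0 2 (front j) by apply: wt_sum => i _; exact: X2.
have lt_ne (i : 'I_k.+1) : (i < j)%N -> i != j by move=> h; rewrite -val_eqE neq_ltn h.
set W := Z0 - _.
have W2 : wt H0 2 W.
  apply: wtD => //; apply: wtN; apply: wtZ; apply: plus_g0 => //.
  by rewrite -(addNr 2); apply: wt_lie (Y2 j) Z12.
have Wj : wt (H j) 0 W.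
  apply: wtD => //; apply: wtN; apply: wtZ; rewrite (_ : 0 = - 2 + 1 + 1); last by ring.
  exact: (wt_lie (wt_lie (wt_HYii j) Z1j) Z1j).
have [phi Gp [p1 p2 p3]] := torus_H j s0.
have e : phi (front j.+1 + W) = expE B (front j + (s ^+ 2 *: X j + Z1 + Z0)).
  rewrite linearD [RHS]linearD /= eB (p3 _ W2 Wj) [RHS]addrA; congr (_ + _).
  rewrite front_succ linearD /= p1; congr (_ + _); rewrite !linear_sum.
  by apply: eq_bigr => i /lt_ne ij /=; rewrite p2 ?fB.
rewrite -[LHS]mul1r -(chi_exp B0 nB) -Dchi //; last first.
  apply: wtD => //; apply: wtD => //; apply: wtD => //; exact: wtZ.
rewrite -e Dchi //; last by apply: wtD => //; apply: wt_sum => i _; exact: X2.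
by rewrite (chi_torus_H s0 Gp p1 p2).
Qed.

Let zf (j : 'I_k.+1) (v : g) : F^o := killing (Y j) v / killing (Y j) (X j).
Let zf_linear j : linear (zf j).
Proof.
move=> c u v; rewrite /zf killingDr killingZr mulrDl.
by rewrite -mulrA.
Qed.
HB.instance Definition _ j := GRing.isLinear.Build F g F^o *:%R (zf j) (zf_linear j).

Let pr0_linear (h : g) : linear (pr0 h).
Proof. by move=> c u v; rewrite /pr0 /pr1 /pr2 !(lieDr, lieZr); lmodf F; rewrite two0. Qed.
HB.instance Definition _ h := GRing.isLinear.Build F g g *:%R (pr0 h) (pr0_linear h).
Let pr1_linear (h : g) : linear (pr1 h).
Proof. by move=> c u v; rewrite /pr1 !(lieDr, lieZr); lmod F. Qed.
HB.instance Definition _ h := GRing.isLinear.Build F g g *:%R (pr1 h) (pr1_linear h).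

Lemma polymap_lie A B : polymap A -> polymap B -> polymap (fun v : g => lie (A v) (B v)).
Proof.
move=> hA hB f; pose b := vbasis {:g}; pose c i : {linear g -> F^o} := coord b i.
have h : polyfun (fun v => \sum_i \sum_j c i (A v) * c j (B v) * f (lie b`_i b`_j)).
  apply: polyfun_sum => i; apply: polyfun_sum => j; apply: polyfun_mul; last exact: polyfun_const.
  by apply: polyfun_mul; [exact: hA | exact: hB].
apply: polyfun_ext h => v.
rewrite {2}(coord_vbasis (memvf (A v))) {2}(coord_vbasis (memvf (B v))).
rewrite lie_suml linear_sum; apply: eq_bigr => i _.
rewrite lie_sumr linear_sum; apply: eq_bigr => j _.
by rewrite lieZl lieZr scalerA linearZ.
Qed.

Lemma frame_components j Z : wt H0 2 Z -> Z = (zf j Z : F) *: X j + pr1 (H j) Z + pr0 (H j) Z.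
Proof.
move=> Z2; have w2 := wt_pr2 (sl2 j) (X2 j) (Y2 j) Z2.
have w1 := wt_pr1 (sl2 j) (X2 j) (Y2 j) Z2.
have w0 := wt_pr0 (sl2 j) (X2 j) (Y2 j) Z2.
have [_ _ Z22] : [/\ wt H0 2 (pr0 (H j) Z), wt H0 2 (pr1 (H j) Z) & wt H0 2 (pr2 (H j) Z)].
  by apply: (wt_pr_stable j) => //; have := wt_H0_H j; rewrite /wt scale0r.
have [c cE] := frame_wt2 frame Z22 w2.
have YHj := wt_HYii j.
have n1 : - 2 + 1 != 0 :> F by nat_neq.
have n0 : - 2 + 0 != 0 :> F by rewrite addr0 oppr_eq0.
have e : zf j Z = c.
  rewrite /zf {1}(pr_sum (H j) Z) 2!killingDr (killing_wt YHj w0 n0) (killing_wt YHj w1 n1).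
  by rewrite !add0r cE killingZr mulfK // killing_YX.
by rewrite e -cE {1}(pr_sum (H j) Z); lmod F.
Qed.

(** By elimination the values of D on the line in direction X_j are z^n d P(Z0 + z^-1 q)^n at
    squares z. They form a polynomial in z, so after clearing denominators a power of X to the n
    divides another n-th power; comparing bases, z P(Z0 + z^-1 q) is itself a polynomial, of degree
    at most 1, with coefficients polynomial in Z. *)
Lemma invariant_root_step (j : 'I_k.+1) P : polyfun P ->
  (forall Z, tail j.+1 Z -> D (front j.+1 + Z) = d * P Z ^+ n) ->
  exists2 P', polyfun P' & forall Z, tail j Z -> D (front j + Z) = d * P' Z ^+ n.
Proof.
move=> hP PE; pose q v := - 2^-1 *: lie (lie (Y j) (pr1 (H j) v)) (pr1 (H j) v).
have hq : polymap q.
  have h1 : polymap (pr1 (H j)) by exact: (polymap_linear (pr1 (H j))).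
  apply: polymap_scale; first exact: polyfun_const.
  exact: (polymap_lie (polymap_lie (polymap_const _) h1) h1).
have h0 : polymap (pr0 (H j)) by exact: (polymap_linear (pr0 (H j))).
have [m [c hc cE]] := polyfun_line hP h0 hq.
pose C i v := if (i < m)%N then c i v else 0.
(* The value at the X_j-coordinate of the linear polynomial Q found below. The case n = 0 is apart,
   since zeroth powers say nothing about their bases. *)
pose P' v := if n == 0%N then 1 else zf j v * C 0%N v + C 1%N v.
have hP' : polyfun P'.
  rewrite /P'; case: eqP => _; first exact: polyfun_const.
  by apply: polyfun_add; [apply: polyfun_mul; [exact: (polyfun_linear (zf j)) |] |]; exact: polyfun_if.
exists P' => // Z [Z2 Zi].
have w1 := wt_pr1 (sl2 j) (X2 j) (Y2 j) Z2.
have w0 := wt_pr0 (sl2 j) (X2 j) (Y2 j) Z2.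
have [t0 t1 _] : [/\ wt H0 2 (pr0 (H j) Z), wt H0 2 (pr1 (H j) Z) & wt H0 2 (pr2 (H j) Z)].
  by apply: (wt_pr_stable j) => //; have := wt_H0_H j; rewrite /wt scale0r.
have st (i : 'I_k.+1) : (i < j)%N -> wt (H i) 0 (pr0 (H j) Z) /\ wt (H i) 0 (pr1 (H j) Z).
  by move=> /Zi hi; have [] := @wt_pr_stable j (H j) (H i) 0 Z (HH i j) hi.
set Z1 := pr1 (H j) Z in w1 t1 st *; set Z0 := pr0 (H j) Z in w0 t0 st *.
have [Gp hG] := polyfun_const_line (front j + (Z1 + Z0)) (X j) Dpoly.
have hG' z : Gp.[z] = D (front j + (z *: X j + Z1 + Z0)).
  by rewrite -hG; congr D; rewrite -!addrA; congr (_ + _); rewrite [RHS]addrC -!addrA.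
have PEs s : s != 0 -> Gp.[s ^+ 2] = (s ^+ 2) ^+ n * (d * P (Z0 + (s ^+ 2)^-1 *: q Z) ^+ n).
  move=> s0; rewrite hG' D_reduce //; try by split=> // i /st[].
  have e : Z0 - (2 * s ^+ 2)^-1 *: lie (lie (Y j) Z1) Z1 = Z0 + (s ^+ 2)^-1 *: q Z.
    by rewrite /q -/Z1 scalerA -scaleNr; congr (_ + _ *: _); rewrite invfM; ring.
  rewrite e PE //; have W2 : wt H0 2 (lie (lie (Y j) Z1) Z1).
    by apply: plus_g0 => //; rewrite -(addNr 2); apply: wt_lie (Y2 j) _.
  split=> [|i]; first by apply: wtD => //; do 2!apply: wtZ.
  rewrite ltnS leq_eqVlt => /orP[/eqP/val_inj->|hi].
    apply: wtD => //; do 2!apply: wtZ; rewrite (_ : 0 = - 2 + 1 + 1); last by ring.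
    exact: (wt_lie (wt_lie (wt_HYii j) w1) w1).
  have [i0 i1] := st i hi; have ij : i != j by rewrite -val_eqE neq_ltn hi.
  apply: wtD => //; do 2!apply: wtZ; rewrite (_ : 0 = 0 + 0 + 0); last by ring.
  exact: (wt_lie (wt_lie (wt_HYij ij) i1) i1).
have -> : D (front j + Z) = Gp.[zf j Z] by rewrite hG' -frame_components.
rewrite /P'; case: eqP => n0.
  rewrite expr1n mulr1; suff -> : Gp = d%:P by rewrite hornerC.
  by apply: (poly_eq_sqr char0) => s s0; rewrite PEs // n0 !expr0 mul1r mulr1 hornerC.
(* The coefficients in reversed order, so that N(z) = z^(m+1) P(Z0 + z^-1 q). *)
pose N : {poly F} := \poly_(l < m.+2) C (m.+1 - l)%N Z.
have NE z : z != 0 -> N.[z] = z ^+ m.+1 * P (Z0 + z^-1 *: q Z).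
  move=> z0; rewrite cE -/Z0.
  have -> : \poly_(i < m) c i Z = \poly_(i < m.+2) C i Z.
    apply/polyP => i; rewrite !coef_poly /C; case: ltnP => hi; last by rewrite if_same.
    by rewrite (leq_trans hi) // -addn2 leq_addr.
  rewrite !horner_poly mulr_sumr (reindex_inj rev_ord_inj) /=; apply: eq_bigr => i _.
  have hi : (i <= m.+1)%N by rewrite -ltnS.
  rewrite subSS subKn // mulrCA; congr (_ * _).
  by rewrite exprB ?unitfE // exprVn.
have key : Gp * ('X^(m.+1)) ^+ n = d *: ('X * N) ^+ n.
  apply: (poly_eq_sqr char0) => s s0; have c0 : s ^+ 2 != 0 by rewrite expf_neq0.
  rewrite hornerM hornerZ !horner_exp hornerM !hornerX NE // PEs // !exprMn.
  ring.
have d0 := D_base.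
have : ('X^(m.+1)) ^+ n %| ('X * N) ^+ n by rewrite -(dvdpZr _ _ d0) -key dvdp_mull.
rewrite dvdp_pexp2r ?lt0n //; last exact/eqP.
case/Pdiv.Field.dvdpP => Q QE.
have GE : Gp = d *: Q ^+ n.
  apply: (mulIf (_ : ('X^(m.+1)) ^+ n != 0)); first by rewrite expf_neq0 // monic_neq0 ?monicXn.
  by rewrite key QE exprMn scalerAl.
have -> : Gp.[zf j Z] = d * Q.[zf j Z] ^+ n by rewrite GE hornerZ horner_exp.
congr (_ * _ ^+ n); have -> : Q = C 0%N Z *: 'X + (C 1%N Z)%:P.
  apply/polyP => i; have := congr1 (fun r : {poly F} => r`_(i + m.+1)) QE.
  rewrite coefMXn ltnNge leq_addl addnK /= => <-.
  rewrite coefXM addnS /= coefD coefZ coefX coefC coef_poly /=.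
  case: i => [|[|i]] /=; rewrite ?mulr0 ?mulr1 ?addr0 ?add0r.
  - by rewrite add0n ltnS leqnSn subSnn.
  - by rewrite add1n ltnS leqnn subnn.
  by rewrite !addSn !ltnS ltnNge leq_addl.
by rewrite hornerD hornerZ hornerX hornerC mulrC.
Qed.

Lemma invariant_root : exists2 P, polyfun P & forall Z, wt H0 2 Z -> D Z = d * P Z ^+ n.
Proof.
have step i : (i <= k.+1)%N -> exists2 P, polyfun P &
    forall Z, tail (k.+1 - i) Z -> D (front (k.+1 - i)%N + Z) = d * P Z ^+ n.
  elim: i => [_|i IH hi].
    exists (fun=> 1) => [|Z [Z2 Zi]]; first exact: polyfun_const.
    rewrite (frame_stop frame Z2) => [|j]; last by apply: Zi; rewrite subn0.
    rewrite addr0 expr1n mulr1 subn0; congr D; apply: eq_bigl => j.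
    by rewrite ltn_ord.
  have [P hP PE] := IH (ltnW hi); have hj : (k.+1 - i.+1 < k.+1)%N by lia.
  apply: (@invariant_root_step (Ordinal hj) P hP) => Z /=.
  by rewrite (_ : (k.+1 - i.+1).+1 = k.+1 - i)%N; [exact: PE | lia].
have [P hP PE] := step k.+1 (leqnn _); exists P => // Z Z2.
rewrite -PE ?subnn; last by split=> // i; rewrite subnn ltn0.
by rewrite big_pred0 ?add0r // => j; rewrite ltn0.
Qed.

Lemma chi_scale j c : n = 1%N -> c != 0 -> exists2 phi, G phi &
  chi phi = c /\ forall i, phi (X i) = (if i == j then c else 1) *: X i.
Proof.
move=> n1 c0; have [|phi Gp hphi] := torus (d := fun i => if i == j then c else 1).
  by move=> i; case: ifP; rewrite ?oner_eq0.
exists phi => //; split=> //; rewrite chi_base // (_ : phi base = base + (c - 1) *: X j).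
  by rewrite hn n1 expr1 mulrC mulKf // D_base.
by rewrite at_j linear_sum; apply: eq_bigr => i _; exact: hphi.
Qed.

(** A representative lacking the last X_j is fixed by the element scaling that X_j by 2, whose
    character is 2; hence D = 2 D vanishes there. *)
Lemma D_full Z : n = 1%N -> wt H0 2 Z -> (D Z != 0 <-> Gorbit iota H0 base Z).
Proof.
move=> n1 Z2; split=> [nz|h]; last exact: D_orbit base2 h D_base.
have an i j : i != j -> exists2 A, Eij i j 1 (- 1) A & bq i j A A != 0.
  by move=> ij; have [A UA e] := univ ij (oner_neq0 _); exists A; rewrite ?e ?oner_eq0.
have [m hm hZ] := initial_orbit an torus Z2.
have nm := D_orbit Z2 hZ nz; move: hm; rewrite leq_eqVlt => /orP[/eqP em|hm].
  by rewrite em initial_full in hZ; exact: Gorbit_sym.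
have [phi Gp [cp hphi]] := chi_scale ord_max n1 two0.
have e : phi (initial m) = initial m.
  rewrite linear_sum; apply: eq_bigr => i _ /=; rewrite linearZ /= hphi.
  case: ifP => [im|_]; last by rewrite !scale0r.
  rewrite (_ : (i == ord_max) = false) ?scale1r //.
  by apply/negbTE; rewrite -val_eqE /= neq_ltn (leq_trans im).
have := Dchi Gp (wt_initial m); rewrite e cp => /eqP.
rewrite -subr_eq0 -{1}[D _]mul1r -mulrBl mulf_eq0 (negPf nm) orbF.
by rewrite (_ : 1 - 2 = - 1) ?oppr_eq0 ?oner_eq0 //; ring.
Qed.

End Power.
End RelativeInvariant.
Section Character.
Hypothesis univ : universal.
Hypothesis torus : torus_surjective.
Variables (Delta : {mpoly F[\dim (Vplus H0)]}) (chi : 'End(g) -> F).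
Hypothesis irr : abs_irreducible iota Delta.
Hypothesis inv : relatively_invariant iota Delta chi.

Lemma character_image : chi @` Ggrp iota H0 = [set c | c != 0] /\
  exists2 D : g -> F, polyfun D &
    forall Z, wt H0 2 Z -> (D Z != 0 <-> Gorbit iota H0 (\sum_j X j) Z).
Proof.
pose D : g -> F := eval_on Delta.
have Dp : polyfun D := polyfun_eval Delta.
have Dchi phi Z : Ggrp iota H0 phi -> wt H0 2 Z -> D (phi Z) = chi phi * D Z.
  by move=> Gp /wt_eigen Z2; exact: inv.
have [irr0 irrU irrF] := irr.
have D0 : exists2 Z, wt H0 2 Z & D Z != 0.
  apply: contrapT => no; case/eqP: irr0.
  rewrite (_ : Delta = 0) ?raddf0 //; apply: (eval_on_eq0 char0) => Z /wt_eigen Z2.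
  by apply/eqP; apply: contrapT => /negP h; apply: no; exists Z.
have d0 := D_base torus Dp Dchi D0.
have [n hn] := D_power univ torus Dp Dchi D0.
have [P hP PE] := invariant_root torus Dp Dchi D0 hn.
have [Q QE] := polyfun_mpoly (Vplus H0) hP.
set d := D (\sum_j X j) in d0 PE.
have DE : Delta = d *: Q ^+ n.
  apply: subr0_eq; apply: (eval_on_eq0 char0) => Z hZ.
  have /wt_eigen Z2 := hZ; rewrite /eval_on mevalB mevalZ -!/(eval_on _ Z).
  have -> : eval_on (Q ^+ n) Z = eval_on Q Z ^+ n by rewrite /eval_on rmorphXn.
  by rewrite QE // -PE // subrr.
have n1 : n = 1%N.
  set Q' := map_mpoly iota Q; have DE' : map_mpoly iota Delta = (iota d)%:MP * Q' ^+ n.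
    by rewrite DE -mul_mpolyC rmorphM rmorphXn /= map_mpolyC.
  have ud : ((iota d)%:MP : {mpoly L[\dim (Vplus H0)]}) \is a GRing.unit.
    apply/unitrP; exists ((iota d)^-1)%:MP.
    by rewrite -!mpolyCM mulVf ?mulfV ?fmorph_eq0 // mpolyC1.
  have nQ : Q' \isn't a GRing.unit by apply: contra irrU => uQ; rewrite DE' unitrM ud unitrX.
  case: n DE' {hn PE DE} => [|[|n]] //= DE'; first by case/negP: irrU; rewrite DE' expr0 mulr1.
  have /irrF [] : map_mpoly iota Delta = Q' * ((iota d)%:MP * Q' ^+ n.+1).
  - by rewrite DE' exprS; exact: mulrCA.
  - by move=> uQ; rewrite uQ in nQ.
  by rewrite unitrM ud unitrX_pos //= => uQ; rewrite uQ in nQ.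
split; last first.
  exists D => // Z Z2; exact: (D_full univ torus Dp Dchi D0 hn n1 Z2).
apply/seteqP; split=> [_ /= [phi Gp <-]|c /= c0].
  rewrite (chi_base torus Dp Dchi D0) // mulf_neq0 ?invr_eq0 //.
  have b2 : wt H0 2 (\sum_j X j) by apply: wt_sum => j _; exact: fam_X2 (frame_triples frame) j.
  by apply: (D_orbit Dchi b2 _ d0); exists phi.
have [phi Gp [e _]] := chi_scale torus Dp Dchi D0 hn ord0 n1 c0.
by exists phi.
Qed.

End Character.
End Frame.
End Regular.

(** * The p-adic absolute value *)

Lemma bernoulli (R : archiRealFieldType) (r : R) n : 0 <= r -> 1 + n%:R * r <= (1 + r) ^+ n.
Proof.
move=> r0; elim: n => [|n IH]; first by rewrite mul0r addr0 expr0.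
rewrite exprS; apply: le_trans (ler_wpM2l (addr_ge0 ler01 r0) IH).
rewrite -subr_ge0 (_ : _ - _ = n%:R * r ^+ 2); last by rewrite -natr1; ring.
by rewrite mulr_ge0 ?ler0n ?sqr_ge0.
Qed.

(** If x/M = 1 + r with r > 0, squaring Bernoulli's inequality at exponent n makes (1 + r)^(2n) grow
    quadratically, beyond 2n + 1. *)
Lemma power_bound (R : archiRealFieldType) (x M : R) : 0 <= x -> 0 < M -> (forall n, x ^+ n <= n.+1%:R * M ^+ n) -> x <= M.
Proof.
move=> x0 M0 h; rewrite leNgt; apply/negP => hx.
pose r := x / M - 1; have r0 : 0 < r by rewrite subr_gt0 ltr_pdivlMr // mul1r.
have xE : x / M = 1 + r by rewrite /r; ring.
have h' n : (1 + r) ^+ n <= n.+1%:R by rewrite -xE expr_div_n ler_pdivrMr ?exprn_gt0.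
pose n := Num.bound (3 / r ^+ 2).
have hn : 3 / r ^+ 2 < n%:R by apply: archi_boundP; rewrite divr_ge0 ?sqr_ge0.
have := h' (n + n)%N; rewrite exprD leNgt => /negP; apply.
have n1 : 0 < n%:R :> R by apply: le_lt_trans hn; rewrite divr_ge0 ?sqr_ge0.
have b1 : 1 + n%:R * r <= (1 + r) ^+ n by apply: bernoulli; exact: ltW.
have b0 : 0 <= 1 + n%:R * r by rewrite addr_ge0 ?ler01 ?mulr_ge0 ?ltW.
have b2 := ler_pM b0 b0 b1 b1; apply: lt_le_trans b2.
have e : 3 < n%:R * r ^+ 2 by rewrite -ltr_pdivrMr ?exprn_gt0.
have nr : 0 < n%:R * r by rewrite mulr_gt0.
have nn : 3 * n%:R < n%:R * r ^+ 2 * n%:R by rewrite ltr_pM2r.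
have n1' : 1 <= n%:R :> R by move: n1; rewrite ltr0n ler1n.
rewrite -natr1 natrD; nra.
Qed.

Section LocalField.
Variables (p : nat) (K : fieldType) (nu : K -> rat).
Hypothesis hK : is_Qp p nu.

Section AbsoluteValue.
Let nuM := Qp_absM hK.
Let pr := Qp_prime hK.
Let p0 : (0 < p%:R :> rat). Proof. by rewrite ltr0n prime_gt0. Qed.

Lemma nu0 : nu 0 = 0.
Proof. by have := Qp_abs_rat hK 0%:R; rewrite ratr_nat /padic_abs_rat eqxx. Qed.

Lemma nu_nat n : nu n.+1%:R = (p%:R ^+ logn p n.+1)^-1.
Proof.
have := Qp_abs_rat hK n.+1%:R; rewrite ratr_nat => ->.
rewrite /padic_abs_rat pnatr_eq0 /= (_ : n.+1%:R = (n.+1 : int)%:~R) // numq_int denq_int.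
by rewrite logn1 expr0 div1r.
Qed.

Lemma nu1 : nu 1 = 1.
Proof. by rewrite (nu_nat 0) logn1 expr0 invr1. Qed.

Lemma nu_eq0 x : (nu x == 0) = (x == 0).
Proof. by apply/eqP/eqP => [/(Qp_abs_eq0 hK)|->] //; exact: nu0. Qed.

Lemma nu_N1 : nu (- 1) = 1.
Proof.
have := Qp_abs_rat hK (- 1)%:~R; rewrite ratr_int => ->.
by rewrite /padic_abs_rat numq_int denq_int /= logn1 expr0 divr1.
Qed.

Lemma nuN x : nu (- x) = nu x. Proof. by rewrite -mulN1r nuM nu_N1 mul1r. Qed.

Lemma nu_ge0 x : 0 <= nu x.
Proof.
have := Qp_absD hK x (- x); rewrite subrr nu0 nuN -mulr2n.
by rewrite pmulrn_lge0.
Qed.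

Lemma nuV x : nu x^-1 = (nu x)^-1.
Proof.
have [->|x0] := eqVneq x 0; first by rewrite invr0 nu0 invr0.
by apply: (mulIf (_ : nu x != 0)); rewrite ?nu_eq0 // -nuM !mulVf ?nu_eq0 // nu1.
Qed.

Lemma nuX x n : nu (x ^+ n) = nu x ^+ n.
Proof. by elim: n => [|n IH]; rewrite ?expr0 ?nu1 // !exprS nuM IH. Qed.

Lemma nu_nat_le1 n : nu n%:R <= 1.
Proof.
case: n => [|n]; first by rewrite nu0.
by rewrite nu_nat invf_le1 ?exprn_gt0 // exprn_ege1 // ler1n prime_gt0.
Qed.

Lemma char0_Qp : [pchar K] =i pred0.
Proof.
move=> q; rewrite inE /=; apply/negP => /andP[qp /eqP q0].
have := nu_nat q.-1; rewrite prednK ?prime_gt0 // q0 nu0 => /esym/eqP.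
by rewrite invr_eq0 expf_eq0 gt_eqF // andbF.
Qed.

Lemma nu_p : nu p%:R = p%:R^-1.
Proof. by have := nu_nat p.-1; rewrite prednK ?prime_gt0 // logn_prime // eqxx expr1. Qed.

Lemma p_neq0 : (p%:R : K) != 0.
Proof. by rewrite -nu_eq0 nu_p invr_eq0 gt_eqF. Qed.

(** The completion is given with the triangle inequality. As integers have absolute value at most 1,
    the binomial expansion of (x + y)^n has n + 1 terms bounded by the n-th power of the maximum;
    [power_bound] removes the factor n + 1. *)
Lemma nuD_max x y : nu (x + y) <= Num.max (nu x) (nu y).
Proof.
set M := Num.max _ _; have Mx : nu x <= M by rewrite le_max lexx.
have My : nu y <= M by rewrite le_max lexx orbT.
have M0 : 0 <= M := le_trans (nu_ge0 x) Mx.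
have [M00|Mn0] := eqVneq M 0.
  have /eqP : nu x = 0 by apply/eqP; rewrite eq_le nu_ge0 andbT -M00.
  rewrite nu_eq0 => /eqP ->; rewrite add0r; exact: My.
have Mgt : 0 < M by rewrite lt_def Mn0.
apply: power_bound => //; first exact: nu_ge0.
move=> n; rewrite -nuX exprDn.
have sum_le (I : Type) (r : seq I) (E : I -> K) : nu (\sum_(i <- r) E i) <= \sum_(i <- r) nu (E i).
  elim: r => [|i r IH]; first by rewrite !big_nil nu0.
  by rewrite !big_cons; apply: le_trans (Qp_absD hK _ _) _; rewrite lerD2l.
apply: le_trans (sum_le _ _ _) _.
have -> : n.+1%:R * M ^+ n = \sum_(i < n.+1) M ^+ n by rewrite sumr_const card_ord mulr_natl.
apply: ler_sum => i _; rewrite -mulr_natr !nuM !nuX.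
have hi : (i <= n)%N by rewrite -ltnS.
rewrite -[in leRHS](subnK hi) exprD -[leRHS]mulr1.
apply: ler_pM; rewrite ?nu_nat_le1 ?nu_ge0 ?mulr_ge0 ?exprn_ge0 ?nu_ge0 //.
by apply: ler_pM; rewrite ?exprn_ge0 ?nu_ge0 // lerXn2r ?nnegrE ?nu_ge0.
Qed.

Lemma nu_add_le c x y : nu x <= c -> nu y <= c -> nu (x + y) <= c.
Proof. by move=> hx hy; apply: le_trans (nuD_max x y) _; rewrite ge_max hx hy. Qed.

Lemma nu_sub_le c x y : nu x <= c -> nu y <= c -> nu (x - y) <= c.
Proof. by move=> hx hy; apply: nu_add_le; rewrite ?nuN. Qed.

Lemma nu_int_le1 (z : int) : nu z%:~R <= 1.
Proof. by case: z => n; [exact: nu_nat_le1 | rewrite NegzE mulrNz nuN; exact: nu_nat_le1]. Qed.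

Lemma nu_coprime (z : int) : ~~ (p %| `|z|)%N -> nu z%:~R = 1.
Proof.
move=> nz; apply/eqP; rewrite eq_le nu_int_le1 leNgt; apply/negP => lt1.
have /coprimezP[[u v] /= e] : coprimez z p by rewrite coprimezE coprime_sym prime_coprime.
have := nu1; have -> : (1 : K) = u%:~R * z%:~R + v%:~R * p%:R.
  by rewrite -[LHS](rmorph1 (intr : int -> K)) -e rmorphD !rmorphM.
move=> e1; have : (1 : rat) < 1; last by rewrite ltxx.
rewrite -{1}e1; apply: le_lt_trans (nuD_max _ _) _; rewrite gt_max !nuM nu_p; apply/andP; split.
  by apply: le_lt_trans lt1; rewrite ler_piMl ?nu_ge0 // nu_int_le1.
apply: (@le_lt_trans _ _ (1 * p%:R^-1)); last by rewrite mul1r invf_lt1 // ltr1n prime_gt1.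
by apply: ler_wpM2r; [rewrite invr_ge0 ltW | exact: nu_int_le1].
Qed.

(** By density a may be replaced by a fraction n/D with D prime to p, and a Bezout relation u D + v
    p = 1 gives the residue n u modulo p. *)
Lemma digit a : nu a <= 1 -> exists2 j, (j < p)%N & nu (a - j%:R) <= p%:R^-1.
Proof.
move=> ha; have pV : 0 < p%:R^-1 :> rat by rewrite invr_gt0.
have p1 : p%:R^-1 <= 1 :> rat by rewrite invf_le1 // ler1n prime_gt0.
have [q hq] := Qp_dense hK a pV; have q1 : nu (ratr q) <= 1.
  rewrite (_ : ratr q = a - (a - ratr q)); last by ring.
  by apply: nu_sub_le => //; apply: le_trans (ltW hq) p1.
set n := numq q; set D := denq q; have qE : ratr q = n%:~R / D%:~R :> K by [].
have D0 : D%:~R != 0 :> K by apply/eqP => /(intr0_eq0 char0_Qp)/eqP; rewrite denq_eq0.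
have pD : ~~ (p %| `|D|)%N.
  apply/negP => pd; have pn : ~~ (p %| `|n|)%N.
    apply/negP => pn; have := coprime_num_den q; rewrite /coprime => /eqP g1.
    by have : (p %| 1)%N by [rewrite -g1 dvdn_gcd pn pd]; rewrite dvdn1; case: (p) pr => [|[]].
  move: q1; rewrite qE nuM nuV (nu_coprime pn) mul1r => h.
  have /dvdnP[c cE] := pd.
  have eD : D%:~R = p%:R * c%:R :> K.
    have -> : D = (c * p)%N :> int by rewrite -cE gtz0_abs // denq_gt0.
    by rewrite -[LHS]/((c * p)%N%:R) natrM mulrC.
  have : nu D%:~R <= p%:R^-1.
    by rewrite eD nuM nu_p -[leRHS]mulr1; apply: ler_wpM2l; [exact: ltW | exact: nu_nat_le1].
  have Dp : 0 < nu D%:~R by rewrite lt_def nu_eq0 D0 nu_ge0.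
  move: h; rewrite invf_le1 // => h1 h2.
  have := le_trans h1 h2; rewrite leNgt invf_lt1 // ltr1n prime_gt1 //.
have /coprimezP[[u v] /= e] : coprimez D p by rewrite coprimezE coprime_sym prime_coprime.
pose j := `|(n * u %% p)%Z|%N; have pz : (p : int) != 0 by rewrite eqz_nat -lt0n prime_gt0.
have jE : (j : int) = (n * u %% p)%Z by rewrite gez0_abs // modz_ge0.
exists j; first by rewrite -ltz_nat jE ltz_pmod // ltz_nat prime_gt0.
have hj : nu (ratr q - j%:R) <= p%:R^-1.
  have eq1 : ratr q - j%:R = p%:R * (n * v + (n * u %/ p)%Z * D)%:~R / D%:~R :> K.
    apply: (mulIf D0); rewrite divfK // mulrBl qE divfK //.
    have -> : (j%:R : K) = (n * u - (n * u %/ p)%Z * p)%:~R.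
      by rewrite -[j%:R]/((j : int)%:~R) jE; congr (_%:~R); rewrite {2}(divz_eq (n * u) p); ring.
    rewrite -[p%:R]/((p : int)%:~R) -!rmorphM -rmorphB; congr (_%:~R).
    have e' : n = n * (u * D) + n * (v * p) by rewrite -mulrDr e mulr1.
    rewrite {1}e'; ring.
  rewrite eq1 !nuM nu_p nuV (nu_coprime pD) invr1 mulr1 -[leRHS]mulr1.
  by apply: ler_wpM2l; [exact: ltW | exact: nu_int_le1].
rewrite (_ : a - j%:R = (a - ratr q) + (ratr q - j%:R)); last by ring.
by apply: nu_add_le => //; exact: ltW.
Qed.

Lemma nu_lt1 a : nu a < 1 -> nu a <= p%:R^-1.
Proof.
move=> ha; have [j hj h] := digit (ltW ha).
have [j0|j0] := eqVneq j 0%N; first by rewrite j0 subr0 in h.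
have : nu (j : int)%:~R = 1 by apply: nu_coprime; rewrite gtnNdvd // lt0n.
have p1 : p%:R^-1 < 1 :> rat by rewrite invf_lt1 // ltr1n prime_gt1.
have e : (j : int)%:~R = a - (a - j%:R) :> K by rewrite -[(j : int)%:~R]/(j%:R); ring.
move=> e1; have : (1 : rat) < 1; last by rewrite ltxx.
rewrite -{1}e1 e; apply: le_lt_trans (nuD_max _ _) _; rewrite nuN gt_max ha.
exact: le_lt_trans h p1.
Qed.

End AbsoluteValue.

(** * The valuation ring *)

Variable F : fieldExtType K.
Notation inF := (in_alg F).
Notation O := (@valuation_ring K nu F).
Notation pF := (p%:R : F).

(** The unit ball is made a ring so that the theory of integral elements applies to O. The proof [h]
    is a parameter because the closure properties depend on it. *)
Definition Zp_pred (h : is_Qp p nu) : {pred K} := fun x => nu x <= 1.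
Fact Zp_subring : subring_closed (Zp_pred hK).
Proof.
split=> [|x y|x y]; rewrite !unfold_in /Zp_pred.
- by rewrite nu1.
- exact: nu_sub_le.
by move=> hx hy; rewrite (Qp_absM hK) mulr_ile1 ?nu_ge0.
Qed.
HB.instance Definition _ := GRing.isSubringClosed.Build K (Zp_pred hK) Zp_subring.
Record Zp (h : is_Qp p nu) := MkZp { zp_val :> K; zp_valP : zp_val \in Zp_pred h }.
HB.instance Definition _ := [isSub for @zp_val hK].
HB.instance Definition _ := [Choice of Zp hK by <:].
HB.instance Definition _ := [SubChoice_isSubComNzRing of Zp hK by <:].

Definition Zp_val (x : Zp hK) : K := val x.
HB.instance Definition _ := GRing.isZmodMorphism.Build (Zp hK) K Zp_val (fun x y => erefl).
HB.instance Definition _ := GRing.isMonoidMorphism.Build (Zp hK) K Zp_val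
  (conj erefl (fun x y => erefl)).

Definition Zp_to_F (x : Zp hK) : F := inF (Zp_val x).
Fact Zp_to_F_zmod : zmod_morphism Zp_to_F.
Proof. by move=> x y; exact: (rmorphB inF (Zp_val x) (Zp_val y)). Qed.
Fact Zp_to_F_monoid : monoid_morphism Zp_to_F.
Proof.
by split=> [|x y]; [exact: (rmorph1 inF) | exact: (rmorphM inF (Zp_val x) (Zp_val y))].
Qed.
HB.instance Definition _ := GRing.isZmodMorphism.Build (Zp hK) F Zp_to_F Zp_to_F_zmod.
HB.instance Definition _ := GRing.isMonoidMorphism.Build (Zp hK) F Zp_to_F Zp_to_F_monoid.

Lemma valuation_ringE x : O x <-> integralOver Zp_to_F x.
Proof.
split=> [[P [mP cP rP]]|[P mP rP]]; last first.
  exists (map_poly Zp_val P); split; first exact: monic_map.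
    by move=> i; rewrite coef_map; exact: (zp_valP P`_i).
  by rewrite -map_poly_comp.
pose c i : Zp hK := MkZp (cP i : P`_i \in Zp_pred hK).
pose Q := \poly_(i < size P) c i.
have QE : map_poly Zp_val Q = P.
  apply/polyP => i; rewrite coef_map coef_poly; case: ltnP => h; first by [].
  exact: esym (nth_default 0 h).
exists Q; last by rewrite (map_poly_comp inF Zp_val) QE.
rewrite monicE; apply/eqP/val_inj; rewrite -lead_coef_map_inj ?QE ?raddf0 //.
by rewrite (monicP mP).
Qed.

Lemma Oadd x y : O x -> O y -> O (x + y).
Proof. by rewrite !valuation_ringE; exact: integral_add. Qed.
Lemma Omul x y : O x -> O y -> O (x * y).
Proof. by rewrite !valuation_ringE; exact: integral_mul. Qed.
Lemma Oopp x : O x -> O (- x).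
Proof. by rewrite !valuation_ringE; exact: integral_opp. Qed.
Lemma Osub x y : O x -> O y -> O (x - y).
Proof. by rewrite !valuation_ringE; exact: integral_sub. Qed.
Lemma O_nat n : O n%:R. Proof. by rewrite valuation_ringE; exact: integral_nat. Qed.
Lemma O1 : O 1. Proof. exact: (O_nat 1). Qed.
Lemma O0 : O 0. Proof. exact: (O_nat 0). Qed.
Lemma Oexp x n : O x -> O (x ^+ n).
Proof. by move=> hx; elim: n => [|n IH]; [exact: O1 | rewrite exprS; exact: Omul]. Qed.
Lemma O_sum I (r : seq I) (P : pred I) (E : I -> F) :
  (forall i, P i -> O (E i)) -> O (\sum_(i <- r | P i) E i).
Proof. by move=> h; apply: big_ind => //; [exact: O0 | exact: Oadd]. Qed.
Lemma O_scalar (a : K) : nu a <= 1 -> O (a%:A).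
Proof. by move=> ha; rewrite valuation_ringE; exact: (integral_id Zp_to_F (MkZp (ha : a \in Zp_pred hK))). Qed.

Lemma O_scale (a : K) x : nu a <= 1 -> O x -> O (a *: x).
Proof. by move=> ha hx; rewrite -mulr_algl; apply: Omul => //; exact: O_scalar. Qed.

Lemma O_root_monic (q : {poly F}) u : q \is monic -> root q u -> (forall i, O q`_i) -> O u.
Proof.
move=> mq rq hq; rewrite valuation_ringE; apply: integral_root_monic mq rq _ => x xq.
by have := hq (index x q); rewrite nth_index // valuation_ringE.
Qed.

Lemma pF_neq0 : pF != 0.
Proof. by rewrite -(rmorph_nat inF) fmorph_eq0 p_neq0. Qed.

Lemma char0_F : [pchar F] =i pred0.
Proof. by move=> q; rewrite -(char0_Qp q) -(fmorph_pchar inF). Qed.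

(** An integral equation for 1/p, multiplied by p^n, would write -1 as a sum of terms of absolute
    value at most 1/p. *)
Lemma pV_notin_O : ~ O pF^-1.
Proof.
case=> P [mP cP rP]; set n := (size P).-1.
have sP : size P = n.+1 by rewrite prednK // size_poly_gt0 monic_neq0.
have : \sum_(i < n.+1) P`_i * p%:R ^- i = 0 :> K.
  apply: (fmorph_inj inF); rewrite rmorph0 -[RHS](rootP rP) horner_coef size_map_inj_poly ?rmorph0 //; last exact: fmorph_inj.
  rewrite sP rmorph_sum; apply: eq_bigr => i _.
  by rewrite coef_map rmorphM fmorphV rmorphXn rmorph_nat exprVn.
have pn0 := p_neq0.
rewrite big_ord_recr /= (_ : P`_n = 1); last by rewrite -[n]/((n.+1).-1) -sP -lead_coefE (monicP mP).
rewrite mul1r => /eqP; rewrite addr_eq0 => /eqP e.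
have /(congr1 (fun x => x * p%:R ^+ n)) := e.
rewrite mulNr mulVf ?expf_neq0 // mulr_suml => e1.
have : nu (-1) <= p%:R^-1.
  rewrite -e1; apply: (big_ind (fun x => nu x <= p%:R^-1)) => [|x y|i _].
  - by rewrite nu0 invr_ge0 ler0n.
  - exact: nu_add_le.
  have hi := ltnW (ltn_ord i).
  rewrite -mulrA [_^-1 * _]mulrC -exprB ?unitfE // (Qp_absM hK) -[leRHS]mul1r.
  apply: ler_pM; rewrite ?nu_ge0 ?cP //.
  have -> : (n - i = (n - i).-1.+1)%N by rewrite prednK // subn_gt0.
  rewrite exprS (Qp_absM hK) nu_p -[leRHS]mulr1.
  apply: ler_wpM2l; first by rewrite invr_ge0 ler0n.
  by rewrite -natrX; exact: nu_nat_le1.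
by rewrite nu_N1 leNgt invf_lt1 ?ltr0n ?ltr1n ?prime_gt1 ?prime_gt0 ?(Qp_prime hK).
Qed.

Lemma O_denominator x : exists N, forall M, (N <= M)%N -> O (pF ^+ M * x).
Proof.
have [P PE] := polyOver1P (minPolyOver 1 x).
have mP : P \is monic by rewrite -(map_monic inF) -PE monic_minPoly.
have rP : root (map_poly inF P) x by rewrite -PE root_minPoly.
pose n := (size P).-1; have sP : size P = n.+1 by rewrite prednK // size_poly_gt0 monic_neq0.
have P1 : P`_n = 1 by rewrite -[n]/((n.+1).-1) -sP -lead_coefE (monicP mP).
pose S := \sum_(i < n) nu P`_i; exists (Num.bound S) => M hM.
have S0 : 0 <= S by apply: sumr_ge0 => i _; exact: nu_ge0.
have hS : S <= p%:R ^+ M.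
  apply: le_trans (ltW (archi_boundP S0)) _; rewrite -natrX ler_nat.
  by apply: leq_trans hM _; apply: ltnW; apply: ltn_expl; exact: prime_gt1 (Qp_prime hK).
pose Q : {poly K} := \poly_(i < n.+1) (P`_i * (p%:R ^+ M) ^+ (n - i)).
have Qn : Q`_n = 1 by rewrite coef_poly ltnSn P1 subnn mulr1.
have sQ : size Q = n.+1.
  by apply/eqP; rewrite eqn_leq size_poly ltnNge; apply/negP => /(nth_default 0);
    rewrite Qn => /eqP; rewrite oner_eq0.
exists Q; split; first by rewrite monicE lead_coefE sQ Qn.
  move=> i; rewrite coef_poly; case: ltnP => [|_]; last by rewrite nu0.
  rewrite ltnS leq_eqVlt => /orP[/eqP->|hi].
    by rewrite P1 subnn mulr1 nu1.
  have -> : (n - i = (n - i).-1.+1)%N by rewrite prednK // subn_gt0.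
  have p1 : 0 < p%:R ^+ M :> rat by rewrite exprn_gt0 // ltr0n prime_gt0 ?(Qp_prime hK).
  rewrite exprS mulrA (Qp_absM hK) -[leRHS]mulr1.
  apply: ler_pM; rewrite ?nu_ge0 //; last by rewrite -!natrX; exact: nu_nat_le1.
  rewrite (Qp_absM hK) nuX nu_p exprVn ler_pdivrMr // mul1r.
  apply: le_trans hS; rewrite /S (bigD1 (Ordinal hi)) //= lerDl.
  by apply: sumr_ge0 => j _; exact: nu_ge0.
apply/rootP; rewrite horner_coef size_map_inj_poly ?rmorph0 //; last exact: fmorph_inj.
rewrite sQ; have e := rootP rP.
rewrite horner_coef size_map_inj_poly ?rmorph0 // ?sP in e; last exact: fmorph_inj.
rewrite -[RHS](mulr0 (pF ^+ M ^+ n)) -[in RHS]e mulr_sumr; apply: eq_bigr => i _.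
have e1 c : inF (c * (p%:R ^+ M) ^+ (n - i)) = inF c * (pF ^+ M) ^+ (n - i).
  by rewrite rmorphM !rmorphXn rmorph_nat.
have eQ : (map_poly inF Q)`_i = inF P`_i * (pF ^+ M) ^+ (n - i).
  by rewrite -e1 coef_map coef_poly ltn_ord.
rewrite eQ (_ : (map_poly inF P)`_i = inF P`_i) ?coef_map //.
move: (GRing.in_alg F P`_i) => c; rewrite exprMn.
have hi : (i <= n)%N by rewrite -ltnS.
rewrite exprB ?unitfE ?expf_neq0 ?pF_neq0 //.
have h := expf_neq0 i (expf_neq0 M pF_neq0).
by rewrite /=; field.
Qed.

Lemma O_infinitely_divisible x : (forall N, O (x / pF ^+ N)) -> x = 0.
Proof.
move=> h; apply/eqP; apply: contraT => x0.
have [N hN] := O_denominator x^-1.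
case: pV_notin_O; rewrite (_ : pF^-1 = (x / pF ^+ N.+1) * (pF ^+ N * x^-1)).
  by apply: Omul (h _) (hN _ (leqnn _)).
have pN := expf_neq0 N pF_neq0; have p0 := pF_neq0; rewrite exprSr.
by field; rewrite pN p0 x0.
Qed.

Lemma scale_pn n (w : F) : (p%:R ^+ n : K) *: w = pF ^+ n * w.
Proof. by rewrite -mulr_algl -[_%:A]/(inF _) rmorphXn rmorph_nat. Qed.

Lemma scale_div_pn n (d : K) (w : F) : d *: (w / pF ^+ n) = (d / p%:R ^+ n) *: w.
Proof.
have e : (p%:R ^+ n : K) *: (w / pF ^+ n) = w.
  by rewrite scale_pn mulrC divfK // expf_neq0 // pF_neq0.
by rewrite -[in RHS]e scalerA divfK // expf_neq0 // p_neq0.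
Qed.

Lemma Zp_unit (a : K) : nu a <= 1 -> nu a != 1 -> exists2 b, nu b <= 1 & a = p%:R * b.
Proof.
move=> a1 n1; exists (a / p%:R); last by rewrite mulrC divfK // p_neq0.
have h : nu a <= p%:R^-1 by apply: nu_lt1; rewrite lt_def eq_sym n1.
have pg : 0 < p%:R :> rat by rewrite ltr0n prime_gt0 ?(Qp_prime hK).
by rewrite (Qp_absM hK) nuV nu_p invrK -ler_pdivlMr // mul1r.
Qed.

(** Linear independence in O/pO over the residue field of the p-adic integers, expressed without
    quotients. *)
Definition pindep r (x : 'I_r -> F) := (forall i, O (x i)) /\
  forall a : 'I_r -> K, (forall i, nu (a i) <= 1) ->
    O ((\sum_i a i *: x i) / pF) -> forall i, nu (a i) != 1.

(** A family independent modulo p is independent over K, as a relation can be divided by its largest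
    coefficient; so a family of maximal length exists, and it generates O modulo p. *)
Lemma O_generators_mod : exists r, exists2 x : 'I_r -> F, forall i, O (x i) &
  forall y, O y -> exists2 a : 'I_r -> K, forall i, nu (a i) <= 1 &
    exists2 z, O z & y = \sum_i a i *: x i + pF * z.
Proof.
have p0 := pF_neq0.
have dep r (x : 'I_r -> F) : pindep x -> (r <= \dim {:F})%N.
  case=> hx ind; rewrite leqNgt; apply/negP => hr.
  pose X := [tuple x i | i < r].
  have nf : ~ free X.
    move=> /eqP e; have := dimvS (subvf <<X>>%VS).
    by rewrite e size_tuple leqNgt hr.
  apply: nf; apply/vector.freeP => c.
  under eq_bigr => i _ do rewrite -tnth_nth tnth_mktuple.
  move=> e i; apply: contrapT => /eqP ci.
  have [j _ jmax] : exists2 j : 'I_r, true & forall i', nu (c i') <= nu (c j).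
    by have := @arg_maxP _ _ _ i xpredT (fun i => nu (c i)) isT; case=> j _ h; exists j => // i'; exact: h.
  have cj : c j != 0.
    apply: contra_neq ci => cj; apply/eqP; rewrite -nu_eq0 eq_le nu_ge0 andbT.
    by rewrite -nu0 -cj.
  have nj : 0 < nu (c j) by rewrite lt_def nu_eq0 cj nu_ge0.
  have h1 i' : nu (c i' / c j) <= 1 by rewrite (Qp_absM hK) nuV ler_pdivrMr // mul1r.
  have h2 := ind (fun i => c i / c j) h1.
  suff /h2/(_ j) : O ((\sum_i (c i / c j) *: x i) / pF) by rewrite divff // nu1 eqxx.
  rewrite (_ : \sum_i _ = 0) ?mul0r; first exact: O0.
  under eq_bigr do rewrite mulrC -scalerA; rewrite -scaler_sumr.
  by rewrite (_ : \sum_i _ = 0) ?scaler0 // -[RHS]e.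
have [r [x hx mx]] : exists r, exists2 x : 'I_r -> F, pindep x &
    forall x' : 'I_r.+1 -> F, ~ pindep x'.
  apply: contrapT => no; have all r : exists x : 'I_r -> F, pindep x.
    elim: r => [|r [x hx]].
      by exists (fun=> 0); split=> [i|a _ _ i]; case: i.
    apply: contrapT => no'; apply: no; exists r, x => // x' hx'; apply: no'; by exists x'.
  by have [x /dep] := all (\dim {:F}).+1; rewrite ltnn.
have [Ox ind] := hx; exists r, x => // y Oy.
pose x' (i : 'I_r.+1) := if unlift ord0 i is Some i' then x i' else y.
have Ox' i : O (x' i) by rewrite /x'; case: unlift.
have [a [ha [hs [i hi]]]] : exists a : 'I_r.+1 -> K, (forall i, nu (a i) <= 1) /\
    (O ((\sum_i a i *: x' i) / pF) /\ exists i, nu (a i) = 1).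
  apply: contrapT => no; apply: (mx x'); split=> // a ha hs i; apply/eqP => e.
  by apply: no; exists a; split=> //; split=> //; exists i.
have sE : \sum_i a i *: x' i = a ord0 *: y + \sum_i a (lift ord0 i) *: x i.
  rewrite big_ord_recl /x' unlift_none; congr (_ + _); apply: eq_bigr => j _.
  by rewrite liftK.
have a0 : nu (a ord0) = 1.
  apply/eqP; apply: contraT => n1; have [b hb eb] := Zp_unit (ha ord0) n1.
  have h2 : O ((\sum_i a (lift ord0 i) *: x i) / pF).
    have -> : (\sum_i a (lift ord0 i) *: x i) / pF = (\sum_i a i *: x' i) / pF - b *: y.
      have e3 : ((p%:R * b) *: y) / pF = b *: y.
        by have := scale_pn 1 (b *: y); rewrite !expr1 -scalerA => ->; rewrite mulrAC mulfV ?mul1r.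
      by rewrite sE mulrDl eb e3 addrAC subrr add0r.
    by apply: Osub => //; exact: O_scale.
  case: (unliftP ord0 i) hi => [i'|] -> hi; last by rewrite hi eqxx in n1.
  by have := ind (fun i => a (lift ord0 i)) (fun i => ha _) h2 i'; rewrite hi eqxx.
have a00 : a ord0 != 0 by rewrite -nu_eq0 a0 oner_eq0.
have na : nu (a ord0)^-1 = 1 by rewrite nuV a0 invr1.
exists (fun i => - ((a ord0)^-1 * a (lift ord0 i))) => [j|].
  by rewrite nuN (Qp_absM hK) na mul1r.
exists ((a ord0)^-1 *: ((\sum_i a i *: x' i) / pF)); first by apply: O_scale; rewrite ?na.
rewrite -scalerAr [pF * _]mulrC divfK // sE scalerDr scalerA mulVf // scale1r.
under eq_bigr do rewrite scaleNr -scalerA; rewrite sumrN -scaler_sumr addrC.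
by rewrite addrK.
Qed.

Lemma Zp_limit (u : nat -> K) : (forall n, nu (u n) <= 1) ->
  exists2 l, nu l <= 1 & forall n, nu (l - \sum_(i < n) p%:R ^+ i * u i) <= p%:R ^- n.
Proof.
move=> hu; pose s n := \sum_(i < n) p%:R ^+ i * u i.
have pg : 0 < p%:R :> rat by rewrite ltr0n prime_gt0 ?(Qp_prime hK).
have p1 : 1 < p%:R :> rat by rewrite ltr1n prime_gt1 ?(Qp_prime hK).
have tail m n : (n <= m)%N -> nu (s m - s n) <= p%:R ^- n.
  elim: m => [|m IH].
    by rewrite leqn0 => /eqP->; rewrite subrr nu0 invr_ge0 exprn_ge0 // ltW.
  rewrite leq_eqVlt => /orP[/eqP->|hn]; first by rewrite subrr nu0 invr_ge0 exprn_ge0 // ltW.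
  rewrite /s big_ord_recr /= -/(s m) addrAC; apply: nu_add_le; first exact: IH.
  rewrite (Qp_absM hK) nuX nu_p exprVn -[leRHS]mulr1.
  apply: ler_pM; rewrite ?nu_ge0 //; first by rewrite invr_ge0 exprn_ge0 // ltW.
  by rewrite lef_pV2 ?posrE ?exprn_gt0 // ler_eXn2l.
have small eps : 0 < eps -> exists n, p%:R ^- n < eps :> rat.
  move=> e0; exists (Num.bound eps^-1); rewrite invf_plt ?posrE ?exprn_gt0 //.
  apply: lt_le_trans (archi_boundP _) _; first by rewrite invr_ge0 ltW.
  rewrite -natrX ler_nat; apply: ltnW; apply: ltn_expl; exact: prime_gt1 (Qp_prime hK).
have [l hl] : exists l, forall eps : rat, 0 < eps -> exists N, forall n, (N <= n)%N -> nu (s n - l) < eps.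
  apply: (Qp_complete hK) => eps e0; have [N hN] := small eps e0; exists N => m n hm hn.
  apply: le_lt_trans hN; rewrite (_ : s m - s n = (s m - s N) - (s n - s N)); last by ring.
  by apply: nu_sub_le; exact: tail.
have lim n : nu (l - s n) <= p%:R ^- n.
  have [|N hN] := hl (p%:R ^- n); first by rewrite invr_gt0 exprn_gt0.
  have h1 := ltW (hN _ (leq_maxl N n)); have h2 := tail _ _ (leq_maxr N n).
  rewrite (_ : l - s n = (s (maxn N n) - s n) - (s (maxn N n) - l)); last by ring.
  exact: nu_sub_le.
by exists l => //; have := lim 0%N; rewrite /s big_ord0 subr0 expr0 invr1.
Qed.

Lemma combination_limit r (x : 'I_r -> F) (C : nat -> 'I_r -> K) :
  (forall i, O (x i)) -> (forall n i, nu (C n i) <= 1) ->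
  exists2 c : 'I_r -> K, forall i, nu (c i) <= 1 &
    forall n, O ((\sum_i c i *: x i - \sum_(m < n) pF ^+ m * \sum_i C m i *: x i) / pF ^+ n).
Proof.
move=> Ox hC.
have lim i : exists l, nu l <= 1 /\ forall n, nu (l - \sum_(m < n) p%:R ^+ m * C m i) <= p%:R ^- n.
  by have [l h1 h2] := Zp_limit (hC^~ i); exists l.
have [c hc] := choice lim; exists c => [i|n]; first by case: (hc i).
have -> : \sum_(m < n) pF ^+ m * (\sum_i C m i *: x i) =
    \sum_i (\sum_(m < n) p%:R ^+ m * C m i) *: x i.
  under eq_bigr do rewrite mulr_sumr.
  rewrite exchange_big; apply: eq_bigr => i _; rewrite scaler_suml; apply: eq_bigr => m _ /=.
  by rewrite -scalerA scale_pn.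
rewrite -sumrB mulr_suml; apply: O_sum => i _; rewrite -scalerBl -scalerAl.
rewrite scale_div_pn; apply: O_scale => //; rewrite (Qp_absM hK) nuV nuX nu_p exprVn invrK.
have [_ h] := hc i; rewrite -ler_pdivlMr ?mul1r //.
by rewrite exprn_gt0 // ltr0n prime_gt0 ?(Qp_prime hK).
Qed.

(** Iterating [O_generators_mod] writes every integer of F as an exact combination of the generators
    with coefficients in the unit ball of K; convergence is then checked on coefficients. *)
Lemma O_complete (u : nat -> F) : (forall n, O (u n)) ->
  exists2 l, O l & forall n, O ((l - \sum_(i < n) pF ^+ i * u i) / pF ^+ n).
Proof.
move=> Ou; have p0 := pF_neq0; have [r [x Ox hx]] := O_generators_mod.
have rep y : O y -> exists c : 'I_r -> K, (forall i, nu (c i) <= 1) /\ y = \sum_i c i *: x i.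
  move=> Oy.
  have ex y' : exists az : ('I_r -> K) * F, O y' -> [/\ forall i, nu (az.1 i) <= 1, O az.2 &
      y' = \sum_i az.1 i *: x i + pF * az.2].
    have [Oy'|nO] := pselect (O y'); last by exists (fun=> 0, 0).
    by have [a ha [z hz e]] := hx y' Oy'; exists (a, z).
  have [f hf] := choice ex; pose Y n := iter n (fun y => (f y).2) y.
  have OY n : O (Y n) by elim: n => [|n IH] //=; have [_] := hf _ IH.
  have [|c hc lim] := @combination_limit _ x (fun n => (f (Y n)).1) Ox.
    by move=> n i; have [h _ _] := hf _ (OY n); exact: h.
  exists c; split=> //.
  have part n : y = \sum_(m < n) pF ^+ m * (\sum_i (f (Y m)).1 i *: x i) + pF ^+ n * Y n.
    elim: n => [|n IH]; first by rewrite big_ord0 mul1r add0r.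
    have [_ _ eY] := hf _ (OY n).
    by rewrite {1}IH {1}eY big_ord_recr mulrDr addrA mulrA -exprSr.
  apply/subr0_eq/O_infinitely_divisible => n.
  have := Osub (OY n) (lim n); congr O.
  by rewrite [in RHS](part n); field; rewrite expf_neq0.
have [C hC] := choice (fun n => rep _ (Ou n)).
have [c hc lim] := combination_limit Ox (fun n => (hC n).1).
exists (\sum_i c i *: x i) => [|n]; first by apply: O_sum => i _; exact: O_scale.
rewrite (eq_bigr (fun m : 'I_n => pF ^+ m * \sum_i C m i *: x i)) => [|m _]; first exact: lim.
by rewrite -(hC m).2.
Qed.

(** * The structure of a local field *)

Hypothesis hF : residue_char_neq2 nu F.
Let p0 := pF_neq0.
Let pr := Qp_prime hK.

Lemma p_odd : odd p.
Proof.
apply: contraT => /negPf even; have p2 : p = 2%N by have := even_prime pr; rewrite even; case.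
case: hF; split=> [|y Oy e]; first exact: O_nat.
case: pV_notin_O; rewrite (_ : pF^-1 = y) //.
by apply: (mulfI p0); rewrite mulfV // p2.
Qed.

Lemma O_half : O 2^-1.
Proof.
have -> : 2^-1 = (2^-1)%:A :> F by rewrite -[RHS]/(in_alg F 2^-1) fmorphV rmorph_nat.
apply: O_scalar; rewrite nuV -[2%:R]/((2 : int)%:~R) nu_coprime ?invr1 //.
by rewrite dvdn_prime2 //; apply/eqP => e; have := p_odd; rewrite e.
Qed.

Let two0 : (2 : F) != 0 := char0_natr char0_F 1.
Let Onat := O_nat.
Let Oone := O1.
Let Ozero := O0.

(** Contraction principle: consecutive iterates of 0 differ by multiples of growing powers of p. *)
Lemma O_fixpoint (T : F -> F) : (forall y, O y -> O (T y)) ->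
  (forall y z, O y -> O z -> exists2 c, O c & T y - T z = pF * (c * (y - z))) ->
  exists2 t, O t & T t = t.
Proof.
move=> OT hT; pose y n := iter n T 0; have Oy n : O (y n) by elim: n => // n; exact: OT.
have step n : O ((y n.+1 - y n) / pF ^+ n).
  elim: n => [|n IH]; first by rewrite expr0 invr1 mulr1; exact: Osub.
  have [c Oc e] := hT _ _ (Oy n.+1) (Oy n).
  rewrite (_ : _ / _ = c * ((y n.+1 - y n) / pF ^+ n)); first exact: Omul.
  by rewrite [LHS](_ : _ = (pF * (c * (y n.+1 - y n))) / pF ^+ n.+1) -?e // exprS e;
    field; rewrite p0 expf_neq0.
have [l Ol hl] := O_complete step; exists l => //.
have sE n : \sum_(i < n) pF ^+ i * ((y i.+1 - y i) / pF ^+ i) = y n.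
  elim: n => [|n IH]; first by rewrite big_ord0.
  by rewrite big_ord_recr /= IH mulrC divfK ?expf_neq0 // addrC subrK.
apply/subr0_eq/O_infinitely_divisible => n.
have [c Oc e] := hT _ _ Ol (Oy n).
have h1 := hl n; have h2 := hl n.+1; rewrite !sE in h1 h2.
have -> : T l - l = (T l - T (y n)) - (l - y n.+1) by rewrite /y /=; ring.
rewrite e mulrBl; apply: Osub.
  by rewrite -!mulrA; apply: Omul (O_nat p) _; apply: Omul.
have -> : (l - y n.+1) / pF ^+ n = pF * ((l - y n.+1) / pF ^+ n.+1).
  by rewrite exprS; field; rewrite p0 expf_neq0.
exact: Omul.
Qed.

Lemma sqrt_1p w : O w -> exists2 t, O t & (1 + pF * t) ^+ 2 = 1 + pF * w.
Proof.
move=> Ow; have OhT := O_half.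
have [y Oy|y z Oy Oz|t Ot e] := @O_fixpoint (fun t => 2^-1 * (w - pF * t ^+ 2)).
- by apply: Omul => //; apply: Osub => //; apply: Omul => //; exact: Oexp.
- exists (- (2^-1 * (y + z))); first by apply: Oopp; apply: Omul => //; exact: Oadd.
  by ring.
exists t => //; have e2 : 2 * t = w - pF * t ^+ 2 by rewrite -{1}e mulVKf.
rewrite (_ : (1 + pF * t) ^+ 2 = 1 + pF * (2 * t + pF * t ^+ 2)); last by ring.
by rewrite e2; ring.
Qed.

Lemma inv_1p w : O w -> exists2 t, O t & (1 + pF * w) * (1 + pF * t) = 1.
Proof.
move=> Ow; have [y Oy|y z Oy Oz|t Ot e] := @O_fixpoint (fun t => - w - pF * (w * t)).
- by apply: Osub; [exact: Oopp | apply: Omul => //; exact: Omul].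
- by exists (- w); [exact: Oopp | ring].
exists t => //; rewrite (_ : _ * _ = 1 + pF * (w + pF * (w * t) + t)); last by ring.
by rewrite -{2}e; ring.
Qed.

Lemma O_finite : exists (T : finType) (r : T -> F), forall y, O y -> exists i, O ((y - r i) / pF).
Proof.
have [r [x Ox hx]] := O_generators_mod.
exists {ffun 'I_r -> 'I_p}, (fun f : {ffun 'I_r -> 'I_p} => \sum_i (f i : nat)%:R * x i) => y Oy.
have [a ha [z Oz yE]] := hx y Oy.
have ex i : exists j : 'I_p, nu (a i - j%:R) <= p%:R^-1.
  by have [j hj h] := digit (ha i); exists (Ordinal hj).
have [f hf] := choice ex; exists (finfun f).
rewrite yE addrAC -sumrB mulrDl [pF * z]mulrC mulfK //; apply: Oadd => //.
rewrite mulr_suml; apply: O_sum => i _; rewrite ffunE.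
have -> : a i *: x i - (f i : nat)%:R * x i = (a i - (f i)%:R) *: x i.
  by rewrite scalerBl scaler_nat mulr_natl.
rewrite -scalerAl -[pF]expr1 scale_div_pn; apply: O_scale => //.
rewrite (Qp_absM hK) nuV nuX nu_p expr1 invrK -ler_pdivlMr ?mul1r //.
by rewrite ltr0n prime_gt0.
Qed.

Lemma pigeonhole (u : nat -> F) : (forall n, O (u n)) ->
  exists i d, O ((u (i + d.+1)%N - u i) / pF).
Proof.
move=> Ou; have [T [r hr]] := O_finite.
have [f hf] := choice (fun n => hr _ (Ou n)).
have [/injectiveP/leq_card|/injectivePn[i [j nij fij]]] :=
    boolP (injectiveb (fun i : 'I_#|T|.+1 => f i)); first by rewrite card_ord ltnn.
wlog lt : i j nij fij / (i < j)%N.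
  move=> h; case: (ltngtP i j) => [|lt|/val_inj e]; first exact: h.
    by apply: (h j i) => //; rewrite eq_sym.
  by rewrite e eqxx in nij.
exists i, (j - i).-1; rewrite prednK ?subn_gt0 // subnKC 1?ltnW //.
rewrite (_ : u j - u i = (u j - r (f j)) - (u i - r (f i))); last by rewrite fij; ring.
by rewrite mulrBl; apply: Osub.
Qed.

Notation mi := (@maximal_ideal K nu F).

Lemma mi_mul x y : mi x -> O y -> mi (x * y).
Proof.
by case=> Ox hx Oy; split=> [|z Oz]; [exact: Omul | rewrite -mulrA; apply/hx/Omul].
Qed.

(** As O/pO is finite, some power e of x is idempotent modulo p. Then (2 e - 1)^2 = 1 + 4 (e^2 - e)
    is also the square of some 1 + p t, and F being a field, 2 e - 1 is 1 + p t or its opposite: e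
    is 1 or 0 modulo p. *)
Lemma nilpotent_or_unit x : O x -> (exists N, O (x ^+ N.+1 / pF)) \/ exists2 y, O y & x * y = 1.
Proof.
move=> Ox; have [|i [d h]] := @pigeonhole (fun n => x ^+ n); first by move=> n; exact: Oexp.
have step m : O ((x ^+ (i + m * d.+1) - x ^+ i) / pF).
  elim: m => [|m IH]; first by rewrite mul0n addn0 subrr mul0r.
  rewrite (_ : _ - _ = x ^+ d.+1 * (x ^+ (i + m * d.+1) - x ^+ i) + (x ^+ (i + d.+1) - x ^+ i)).
    by rewrite mulrDl -mulrA; apply: Oadd => //; apply: Omul => //; exact: Oexp.
  by rewrite mulSn addnCA !exprD; ring.
pose n := (i.+1 * d.+1).-1; have nE : n.+1 = (i.+1 * d.+1)%N by [].
have Ow : O (((x ^+ n.+1) ^+ 2 - x ^+ n.+1) / pF).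
  have le_i : (i <= n.+1)%N by rewrite nE; apply: leq_trans (leq_pmulr _ _).
  rewrite (_ : _ - _ = x ^+ (n.+1 - i) * (x ^+ (i + i.+1 * d.+1) - x ^+ i)).
    by rewrite -mulrA; apply: Omul => //; exact: Oexp.
  by rewrite mulrBr -!exprD addnA subnK // -nE -exprM muln2 addnn.
set e := x ^+ n.+1 in Ow; have [t Ot te] := sqrt_1p (Omul (O_nat 4) Ow).
have /eqP : (2 * e - 1) ^+ 2 = (1 + pF * t) ^+ 2 by rewrite te; field.
have Ot2 := Omul Ot O_half; rewrite eqf_sqr => /orP[]/eqP ee.
  right; have [s Os ts] := inv_1p Ot2.
  exists (x ^+ n * (1 + pF * s)).
    by apply: Omul; [exact: Oexp | apply: Oadd => //; exact: Omul (O_nat p) Os].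
  rewrite mulrA -exprS -/e -[RHS]ts; congr (_ * _); apply: (mulfI two0).
  by rewrite -[2 * e](subrK 1) ee; field.
left; exists n; rewrite -/e (_ : e / pF = - (t / 2)); first exact: Oopp.
apply: (mulfI two0); rewrite mulrA -[2 * e](subrK 1) ee.
by field; rewrite ?p0 ?two0.
Qed.

Lemma mi_nilp x : mi x -> exists N, O (x ^+ N.+1 / pF).
Proof. by case=> Ox hx; have [//|[y Oy /hx]] := nilpotent_or_unit Ox. Qed.

Lemma nilp_mi x N : O x -> O (x ^+ N / pF) -> mi x.
Proof.
move=> Ox ON; split=> // y Oy e; case: pV_notin_O.
rewrite (_ : pF^-1 = x ^+ N / pF * y ^+ N); first by apply: Omul => //; exact: Oexp.
by rewrite mulrAC -exprMn e expr1n mul1r.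
Qed.

Lemma p_mi : mi pF.
Proof. by apply: (@nilp_mi _ 1); rewrite ?expr1 ?mulfV. Qed.

Lemma unit_or_mi x : O x -> mi x \/ exists2 y, O y & x * y = 1.
Proof. by move=> Ox; have [[N /(nilp_mi Ox)]|] := nilpotent_or_unit Ox; [left|right]. Qed.

(** Two of these multiples agree modulo p, so the difference of two powers of z is an integer, which
    gives a monic equation for z. *)
Lemma bounded_powers z : (forall n, O (pF * z ^+ n)) -> O z.
Proof.
move=> hz; have [i [d h]] := pigeonhole hz.
have {}h : O (z ^+ (i + d.+1) - z ^+ i).
  by rewrite (_ : _ - _ = (pF * z ^+ (i + d.+1) - pF * z ^+ i) / pF) // -mulrBr mulrC mulKf.
apply: (@O_root_monic ('X^(i + d.+1) - 'X^i - (z ^+ (i + d.+1) - z ^+ i)%:P)).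
- rewrite monicE -addrA lead_coefDl ?lead_coefXn // -opprD size_polyN size_polyXn.
  apply: leq_ltn_trans (size_polyD _ _) _; rewrite gtn_max size_polyXn size_polyC.
  by case: (_ == 0) => /=; lia.
- by rewrite rootE !hornerE subrr.
move=> m; rewrite !coefB !coefXn coefC; apply: Osub; last by case: ifP.
by apply: Osub; exact: O_nat.
Qed.

(** Inversion of the maximal ideal: b/p maps it into O without being integral. If it mapped the
    ideal into itself, [bounded_powers] would make b/p integral; so some y in the ideal goes to a
    unit, and y times the inverse of that unit is a generator. *)
Lemma uniformizer : exists2 pi, mi pi & pi != 0 /\ forall x, mi x -> O (x / pi).
Proof.
have [b [Ob nb hb]] : exists b, [/\ O b, ~ O (b / pF) & forall x, mi x -> O (b * x / pF)].
  (* Otherwise 1 could be multiplied forever by elements of the maximal ideal without entering pO.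
     Two such products agree modulo p, u' = u mu with mu in the ideal; 1 - mu is invertible modulo
     p, and u would lie in pO. *)
  apply: contrapT => no.
  have ex b : exists m, O b -> ~ O (b / pF) -> mi m /\ ~ O (b * m / pF).
    have [[Ob nb]|nO] := pselect (O b /\ ~ O (b / pF)); last by exists 0 => *; case: nO.
    apply: contrapT => no'; apply: no; exists b; split=> // x mx; apply: contrapT => nx.
    by apply: no'; exists x.
  have [f hf] := choice ex; pose u n := iter n (fun b => b * f b) 1.
  have hu n : O (u n) /\ ~ O (u n / pF).
    elim: n => [|n [Ou nu']] /=; first by split=> //; rewrite mul1r; exact: pV_notin_O.
    by have [[Of _] h] := hf _ Ou nu'; split=> //; exact: Omul.
  have hm n : mi (f (u n)) by case: (hu n) => h1 h2; case: (hf _ h1 h2).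
  have [i [d h]] := pigeonhole (fun n => (hu n).1).
  have [mu mm mE] : exists2 mu, mi mu & u (i + d.+1)%N = u i * mu.
    elim: d {h} => [|d [mu mm mE]]; first by exists (f (u i)); rewrite // addn1.
    exists (mu * f (u (i + d.+1)%N)); first by apply: mi_mul => //; case: (hm (i + d.+1)%N).
    by rewrite addnS /= mE mulrA.
  have [N ON] := mi_nilp mm; have Omu := mm.1.
  have geom n : exists2 c, O c & 1 - mu ^+ n = (1 - mu) * c.
    elim: n => [|n [c Oc ce]]; first by exists 0; rewrite ?subrr ?mulr0.
    exists (1 + mu * c); first by apply: Oadd => //; exact: Omul.
    have -> : 1 - mu ^+ n.+1 = 1 - mu + mu * (1 - mu ^+ n) by rewrite exprS; ring.
    by rewrite ce; ring.
  have [c Oc ce] := geom N.+1; case: (hu i) => Oui; apply.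
  rewrite (_ : u i / pF = - ((u (i + d.+1)%N - u i) / pF * c) + u i * (mu ^+ N.+1 / pF)).
    by apply: Oadd; [apply: Oopp; exact: Omul | exact: Omul].
  have -> : mu ^+ N.+1 = 1 - (1 - mu) * c by rewrite -ce; ring.
  by rewrite mE; field.
have b0 : b != 0 by apply: contra_notN nb => /eqP->; rewrite mul0r.
have [y my [v Ov yv]] : exists2 y, mi y & exists2 v, O v & b * y / pF * v = 1.
  apply: contrapT => no; apply: nb; apply: bounded_powers => n.
  suff []: mi (pF * (b / pF) ^+ n) by [].
  elim: n => [|n IH]; first by rewrite mulr1; exact: p_mi.
  have -> : pF * (b / pF) ^+ n.+1 = b * (pF * (b / pF) ^+ n) / pF by rewrite exprS; ring.
  by have [//|[v Ov e]] := unit_or_mi (hb _ IH); case: no; exists (pF * (b / pF) ^+ n) => //; exists v.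
exists (y * v); first exact: mi_mul.
have e x : b * x / pF * (y * v) = x by rewrite -[RHS]mulr1 -[X in _ = _ * X]yv; ring.
have yv0 : y * v != 0 by apply: contra_eq_neq (e 1) => ->; rewrite mulr0 eq_sym oner_eq0.
by split=> // x /hb; rewrite -{2}(e x) mulfK.
Qed.

(** * Square classes and quadratic forms over a local field *)

Section Uniformizer.
Variable pi : F.
Hypotheses (mpi : mi pi) (pi0 : pi != 0) (hpi : forall x, mi x -> O (x / pi)).

Lemma miE x : mi x <-> O (x / pi).
Proof. by split=> [/hpi //|Ox]; rewrite -[x](divfK pi0) mulrC; exact: mi_mul. Qed.

Lemma mi_add x y : mi x -> mi y -> mi (x + y).
Proof. by rewrite !miE mulrDl; exact: Oadd. Qed.

Lemma mi_opp x : mi x -> mi (- x).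
Proof. by rewrite !miE mulNr; exact: Oopp. Qed.

Definition unit u := O u /\ ~ mi u.

Lemma unitV u : unit u -> [/\ O u^-1, u != 0 & unit u^-1].
Proof.
case=> Ou nu'; have [//|[v Ov e]] := unit_or_mi Ou.
have u0 : u != 0 by apply: contra_eq_neq e => ->; rewrite mul0r eq_sym oner_eq0.
have vE : u^-1 = v by rewrite -[v](mulKf u0) e mulr1.
by rewrite vE; split=> //; split=> // -[_ /(_ u Ou)]; rewrite mulrC e.
Qed.

Lemma unitM u v : unit u -> unit v -> unit (u * v).
Proof.
move=> [Ou nu'] uv; have [Ov v0 _] := unitV uv; split=> [|h]; first by case: uv => ? _; exact: Omul.
by apply: nu'; rewrite -(mulfK v0 u); exact: mi_mul.
Qed.

Lemma unit1 : unit 1. Proof. by split=> // -[_ /(_ 1 O1)]; rewrite mulr1. Qed.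

Lemma unitN u : unit u -> unit (- u).
Proof. by case=> Ou nu'; split; [exact: Oopp | move/mi_opp; rewrite opprK]. Qed.

Lemma unitD_small u y : unit u -> mi y -> unit (u + y).
Proof.
move=> [Ou nu'] my; have [Oy _] := my; split=> [|h]; first exact: Oadd.
by apply: nu'; rewrite -(addrK y u); apply: mi_add => //; exact: mi_opp.
Qed.

Lemma mi_prime x y : O x -> O y -> mi (x * y) -> mi x \/ mi y.
Proof.
move=> Ox Oy h; have [mx|nx] := pselect (mi x); first by left.
by have [my|ny] := pselect (mi y); [right | case: (@unitM x y)].
Qed.

Definition square x := exists s : F, x = s ^+ 2.

Lemma squareM x y : square x -> square y -> square (x * y).
Proof. by case=> s -> [r ->]; exists (s * r); rewrite exprMn. Qed.

Lemma square_cancel s x : s != 0 -> square (s ^+ 2 * x) -> square x.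
Proof.
by move=> s0 [r e]; exists (r / s); rewrite expr_div_n -e mulrAC mulfV ?mul1r // expf_neq0.
Qed.

(* One step of Newton's iteration for the square root of 1 + y. *)
Lemma square_1mi y : mi y -> square (1 + y).
Proof.
move=> my; have [N hN] := mi_nilp my.
have {hN} : O (y ^+ (2 ^ N.+1) / pF).
  rewrite -(subnK (ltnW (ltn_expl N.+1 (isT : (1 < 2)%N)))) exprD -mulrA.
  by apply: Omul => //; apply: Oexp; case: my.
elim: N.+1 y my => [|n IH] y my h.
  have [t _ te] := sqrt_1p h; exists (1 + pF * t).
  by rewrite te expr1 mulrC divfK.
have Oh := O_half; have mh : mi (y / 2) by exact: mi_mul.
have us : unit (1 + y / 2) := unitD_small unit1 mh; set s := 1 + _ in us.
have [Os s0 _] := unitV us; pose c := - (2^-1 ^+ 2 / s ^+ 2).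
have Oc : O c by apply: Oopp; apply: Omul; rewrite -?exprVn; exact: Oexp.
have e : 1 + y = s ^+ 2 * (1 + y ^+ 2 * c).
  by rewrite /c mulrN mulrBr mulr1 mulrCA [s ^+ 2 * _]mulrC divfK ?expf_neq0 // /s; field.
rewrite e; apply: squareM; first by exists s.
apply: IH; first by apply: mi_mul => //; rewrite expr2; apply: mi_mul => //; case: my.
rewrite exprMn -exprM -expnS mulrAC; apply: Omul => //; exact: Oexp.
Qed.

Lemma square_close u v : unit u -> mi (v - u) -> square u -> square v.
Proof.
move=> uu m su; have [Ou u0 _] := unitV uu.
rewrite (_ : v = u * (1 + (v - u) / u)); last by rewrite mulrDr mulr1 mulrC divfK // addrC subrK.
by apply: squareM su _; apply: square_1mi; exact: mi_mul.
Qed.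

(* The maps x -> x^2 and x -> a x^2 on the units of the residue field have
   disjoint images and fibers {x, - x}, so their images cover the units. *)
Lemma nonsquareM a b : unit a -> unit b -> ~ square a -> ~ square b -> square (a * b).
Proof.
move=> ua ub na nb; apply: contrapT => nab; have [T [r hr]] := O_finite.
pose cl y := [pick i | `[< mi (y - r i) >]].
have Oa := ua.1.
have clE y z : O y -> cl y = cl z -> mi (y - z).
  move=> Oy; rewrite /cl; case: pickP => [i /asboolP hi|no _]; last first.
    have [i Oi] := hr y Oy; case/negP: (no i); apply/asboolP.
    by rewrite -(divfK p0 (y - r i)) mulrC; exact: mi_mul p_mi _.
  case: pickP => [j /asboolP hj [e]|//]; rewrite -e in hj.
  rewrite (_ : y - z = (y - r i) - (z - r i)); last by ring.
  by apply: mi_add => //; exact: mi_opp.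
have clE' y z : mi (y - z) -> cl y = cl z.
  move=> h; apply: eq_pick => i; apply/asboolP/asboolP => h'.
    rewrite (_ : z - r i = (y - r i) - (y - z)); last by ring.
    by apply: mi_add => //; exact: mi_opp.
  by rewrite (_ : y - r i = (z - r i) + (y - z)); [exact: mi_add | ring].
pose S := finset (fun i => `[< exists2 y, unit y & cl y = i >]).
have ex i : exists y, i \in S -> unit y /\ cl y = i.
  have [|_] := boolP (i \in S); last by exists 0.
  by rewrite inE => /asboolP[y uy e]; exists y.
have [rho hrho] := choice ex.
pose v (x : bool * option T) := (if x.1 then a else 1) * rho x.2 ^+ 2.
have uv x : x.2 \in S -> unit (v x).
  move=> /hrho[ur _]; rewrite /v expr2; apply: unitM; last exact: unitM.
  by case: x.1 => //; exact: unit1.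
pose D := finset.setX [set: bool]%SET S.
have vS x : x \in D -> cl (v x) \in (S :\ cl b)%SET.
  case: x => e i; rewrite finset.in_setX finset.in_setT => /= iS; have u := uv (e, i) iS.
  rewrite finset.in_setD1 [_ \in S]inE; apply/andP; split; last by apply/asboolP; exists (v (e, i)).
  apply/eqP => /(clE _ _ u.1) m; case: e u m => u m; rewrite /v /= in u m.
    apply: nab; apply: (@square_close ((a * rho i) ^+ 2)); last by exists (a * rho i).
      by rewrite exprMn expr2 -mulrA; exact: unitM.
    rewrite -opprB; apply: mi_opp; rewrite (_ : _ - _ = (a * rho i ^+ 2 - b) * a); last by ring.
    exact: mi_mul.
  apply: nb; apply: square_close u _ _; first by rewrite -opprB; exact: mi_opp.
  by rewrite mul1r; exists (rho i).
have fib y : (\sum_(x in D | cl (v x) == y) 1 <= 2)%N.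
  rewrite sum1dep_card; have [->|[[e i]]] := set_0Vmem [set x | (x \in D) && (cl (v x) == y)]%SET.
    by rewrite cards0.
  rewrite inE finset.in_setX finset.in_setT => /= /andP[iS /eqP ey].
  apply: leq_trans (_ : #|[set (e, i); (e, cl (- rho i))]%SET| <= 2)%N; last first.
    by rewrite cards2; case: (_ != _).
  apply/subset_leq_card/fintype.subsetP => -[e' i'].
  rewrite inE finset.in_setX finset.in_setT finset.in_set2 => /= /andP[iS' /eqP]; rewrite -ey => /(clE _ _ (uv (e', i') _).1).
  have [ui ei] := hrho i iS; have [ui' ei'] := hrho i' iS' => /(_ iS').
  have one (w w' : F) : unit w -> unit w' -> ~ mi (a * w ^+ 2 - w' ^+ 2).
    move=> uw uw' m; apply: na; apply: (@square_close ((w' / w) ^+ 2)); last by exists (w' / w).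
      by have [_ _ h] := unitV uw; apply: unitM; apply: unitM.
    have [Ow w0 _] := unitV uw; rewrite (_ : _ - _ = (a * w ^+ 2 - w' ^+ 2) * w^-1 ^+ 2).
      by apply: mi_mul => //; exact: Oexp.
    by field.
  rewrite /v /= => m; have {m} [<- m] : e = e' /\ mi (rho i' ^+ 2 - rho i ^+ 2).
    case: e e' m {ey} => -[] m; rewrite ?mul1r -?mulrBr in m.
    - split=> //; have Od : O (rho i' ^+ 2 - rho i ^+ 2) by apply: Osub; apply: Oexp; [case: ui' | case: ui].
      by case: (mi_prime Oa Od m) => // /(proj2 ua).
    - by case: (one _ _ ui ui'); rewrite -opprB; exact: mi_opp.
    - by case: (one _ _ ui' ui).
    - by split.
  rewrite subr_sqr in m; have [Oi Oi'] := (ui.1, ui'.1).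
  rewrite -ei' -[in (_, i)]ei; apply/orP.
  case: (mi_prime (Osub Oi' Oi) (Oadd Oi' Oi) m) => h; [left | right].
    by rewrite (clE' _ _ h).
  by rewrite (clE' (rho i') (- rho i)) // opprK.
have : (#|D| <= 2 * #|(S :\ cl b)%SET|)%N.
  rewrite -sum1_card (partition_big (fun x => cl (v x)) (mem (S :\ cl b)%SET)) //=.
  by rewrite mulnC -sum_nat_const; apply: leq_sum => y _; exact: fib.
rewrite cardsX cardsT card_bool leq_pmul2l //.
have bS : cl b \in S by rewrite inE; apply/asboolP; exists b.
by rewrite (cardsD1 (cl b) S) bS add1n ltnn.
Qed.
(** If -1 is not a square and n is a square while n + 1 < p is not, then -(n + 1) is a square and
    provides s and r. Otherwise 1, ..., p - 1 are all squares, and -1 is close to p - 1. *)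
Lemma sum_two_squares : square (- 1) \/ exists s r : F, s ^+ 2 + 1 + r ^+ 2 = 0.
Proof.
have [|n1] := pselect (square (- 1)); [by left | right; apply: contrapT => no].
have nat_unit n : (0 < n < p)%N -> unit n%:R.
  case/andP=> n0 np; split=> [|[_ h]]; first exact: O_nat.
  have n0F : (n%:R : F) != 0 by case: n n0 {np h} => // n _; exact: (char0_natr char0_F).
  case: (h n%:R^-1); last exact: mulfV.
  have -> : n%:R^-1 = (n%:R^-1)%:A :> F by rewrite -[RHS]/(in_alg F n%:R^-1) fmorphV rmorph_nat.
  apply: O_scalar; rewrite nuV -[n%:R]/((n : int)%:~R) nu_coprime ?invr1 //.
  by rewrite gtnNdvd.
have sqn n : (0 < n < p)%N -> square n%:R.
  elim: n => // -[_ _|n IH]; first by exists 1; rewrite expr1n.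
  move=> /= np; have [s es] := IH (ltnW np); apply: contrapT => nn.
  have [r er] := nonsquareM (nat_unit n.+2 np) (unitN unit1) nn n1.
  by apply: no; exists s, r; rewrite -es -er -[n.+2%:R]natr1; ring.
apply: n1; have p1 : (0 < p.-1 < p)%N by have := prime_gt1 pr; lia.
apply: square_close (nat_unit _ p1) _ (sqn _ p1).
rewrite -opprD nat1r prednK ?prime_gt0 //; exact: mi_opp p_mi.
Qed.

Definition isotropic3 (a b c : F) := exists x y z,
  (x != 0) || (y != 0) || (z != 0) /\ a * x ^+ 2 + b * y ^+ 2 + c * z ^+ 2 = 0.

(** If none of the three binary subforms is isotropic, a b and a c are squares by [nonsquareM], and
    the form is a multiple of a sum of three squares. *)
Lemma unit_isotropic3 a b c : unit a -> unit b -> unit c -> isotropic3 a b c.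
Proof.
move=> ua ub uc.
have [[[_ a0 _] [_ b0 _]] [_ c0 _]] := (unitV ua, unitV ub, unitV uc).
have [[s e]|nab] := pselect (square (- (a * b))).
  by exists s, a, 0; rewrite a0 orbT -e; split=> //; ring.
have [[s e]|nbc] := pselect (square (- (b * c))).
  by exists 0, s, b; rewrite b0 !orbT -e; split=> //; ring.
have [[s e]|nac] := pselect (square (- (a * c))).
  by exists s, 0, a; rewrite a0 orbT -e; split=> //; ring.
have prodE u v w : unit u -> unit v -> unit w -> ~ square (- (u * v)) -> ~ square (- (v * w)) ->
    square (u * w).
  move=> uu uv uw n1 n2; have [_ v0 _] := unitV uv; apply: (square_cancel v0).
  rewrite (_ : _ * _ = - (u * v) * - (v * w)); last by ring.
  by apply: nonsquareM => //; apply: unitN; exact: unitM.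
have [ga Ec] : square (a * c) by exact: prodE nab nbc.
have [al Eb] : square (a * b) by apply: prodE nac _ => //; rewrite mulrC.
have ga0 : ga != 0 by rewrite -sqrf_eq0 -Ec mulf_neq0.
have al0 : al != 0 by rewrite -sqrf_eq0 -Eb mulf_neq0.
have [[s es]|[s [r e]]] := sum_two_squares.
  by case: nab; rewrite -mulN1r; apply: squareM; [exists s | exists al].
exists (s / a), al^-1, (r / ga); split; first by rewrite invr_eq0 al0 orbT.
apply: (mulfI a0); rewrite mulr0 -[RHS]e !expr_div_n -exprVn.
rewrite [LHS](_ : _ = s ^+ 2 + a * b * al^-1 ^+ 2 + a * c / ga ^+ 2 * r ^+ 2); last by field; rewrite ?a0 ?al0 ?ga0.
by rewrite Eb Ec exprVn !mulfV ?expf_neq0 // mul1r.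
Qed.

(** Parity of the valuation, in a form that shows the class of x modulo squares. *)
Definition parity (e : bool) x := exists s u, [/\ s != 0, unit u & x = s ^+ 2 * (u * pi ^+ e)].

Lemma parityP x : x != 0 -> exists e, parity e x.
Proof.
move=> x0; have [M hM] := O_denominator x; have pM := expf_neq0 M p0.
have Oy : O ((pF ^+ M) ^+ 2 * x) by rewrite -exprM; apply: hM; rewrite muln2 -addnn leq_addr.
set y := _ * x in Oy; have y0 : y != 0 by rewrite mulf_neq0 ?expf_neq0.
have nn : exists n, `[< ~ O (y / pi ^+ n) >].
  apply: contrapT => no; case/eqP: y0; apply: O_infinitely_divisible => n.
  have [N hN] := mi_nilp mpi; have : O (y / pi ^+ (N.+1 * n)).
    by apply: contrapT => h; apply: no; exists (N.+1 * n)%N; apply/asboolP.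
  move/Omul => /(_ ((pi ^+ N.+1 / pF) ^+ n)); rewrite expr_div_n -exprM mulrA divfK ?expf_neq0 //.
  by apply; rewrite exprM -expr_div_n; exact: Oexp.
case: (ex_minnP nn) => -[/asboolP|m /asboolP nO hm]; first by rewrite expr0 divr1.
have uu : unit (y / pi ^+ m).
  split; last by rewrite miE -mulrA -invfM -exprSr.
  by apply: contrapT => h; have := hm m; rewrite ltnn => /(_ (asboolT h)).
exists (odd m), (pi ^+ m./2 / pF ^+ M), (y / pi ^+ m); split=> //.
  by rewrite mulf_neq0 ?invr_eq0 ?expf_neq0.
have pm := expf_neq0 m./2 pi0.
rewrite -[X in _ / pi ^+ X]odd_double_half -muln2 exprD exprM /y.
by case: (odd m); field; rewrite pM ?pi0 pm.
Qed.

Lemma parity_isotropic3 e a b c : parity e a -> parity e b -> parity e c -> isotropic3 a b c.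
Proof.
case=> s [u [s0 uu ->]] [s' [u' [s'0 uu' ->]]] [s'' [u'' [s''0 uu'' ->]]].
have [x [y [z [nz h]]]] := unit_isotropic3 uu uu' uu''.
exists (x / s), (y / s'), (z / s''); rewrite !mulf_eq0 !invr_eq0.
rewrite (negPf s0) (negPf s'0) (negPf s''0) !orbF; split=> //.
by rewrite -[RHS](mul0r (pi ^+ e)) -[in RHS]h; field; rewrite s0 s'0 s''0.
Qed.

Lemma parity_product e a b : parity e a -> parity e b -> exists s u,
  [/\ s != 0, unit u & a * b = s ^+ 2 * u].
Proof.
case=> s [u [s0 uu ->]] [r [v [r0 uv ->]]].
exists (s * r * pi ^+ e), (u * v); split; [|exact: unitM | by ring].
by rewrite !mulf_neq0 ?expf_neq0.
Qed.

Lemma square_product4 e e' a b c d : parity e a -> parity e b -> parity e' c -> parity e' d ->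
  ~ square (- (a * b)) -> ~ square (- (c * d)) -> square (a * b * (c * d)).
Proof.
move=> pa pb pc pd; have [s [u [s0 uu ->]]] := parity_product pa pb.
have [r [v [r0 uv ->]]] := parity_product pc pd; rewrite -!mulrN => n1 n2.
have cl q w : ~ square (q ^+ 2 * w) -> ~ square w by move=> h h'; apply: h; apply: squareM => //; exists q.
rewrite mulrACA; apply: squareM; first by apply: squareM; [exists s | exists r].
by rewrite -mulrNN; apply: nonsquareM (unitN uu) (unitN uv) (cl _ _ n1) (cl _ _ n2).
Qed.

Lemma nonsquare_uniformizer c : c = 1 \/ c = - 1 -> ~ square (c * pi).
Proof.
move=> c1 [s e]; have cc : c * c = 1 by case: c1 => ->; ring.
have Oc : O c by case: c1 => ->; [|apply: Oopp].
have ms : mi s.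
  have Os : O s.
    apply: (@O_root_monic ('X^2 - (s ^+ 2)%:P)); first exact: monicXnsubC.
      by rewrite rootE !hornerE subrr.
    move=> i; rewrite coefB coefXn coefC -e; apply: Osub; first exact: O_nat.
    by case: ifP => // _; apply: Omul => //; case: mpi.
  apply: contrapT => ns; have us : unit s by [].
  by have [_ []] := unitM us us; rewrite -expr2 -e mulrC; exact: mi_mul.
have Oq := hpi ms; case: mpi => _ /(_ (c * (s / pi) ^+ 2)); case.
  by apply: Omul => //; exact: Oexp.
by rewrite expr_div_n -e -cc; field.
Qed.

Lemma isotropic3_sub n (a : 'I_n -> F) i j l : i != j -> j != l -> l != i ->
  isotropic3 (a i) (a j) (a l) -> exists2 x : 'I_n -> F, exists m, x m != 0 & \sum_m a m * x m ^+ 2 = 0.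
Proof.
move=> ij jl li [x [y [z [nz h]]]].
have [ji lj] : j != i /\ l != j by rewrite eq_sym ij eq_sym jl.
exists (fun s => if s == i then x else if s == j then y else if s == l then z else 0).
  by case/orP: nz => [/orP[]|] n0; [exists i | exists j | exists l];
    rewrite ?(negPf ji) ?(negPf li) ?(negPf lj) eqxx.
rewrite (bigD1 i) //= eqxx (bigD1 j) //= (negPf ji) eqxx.
rewrite (bigD1 l) /= ?li // (negPf li) (negPf lj) eqxx big1 ?addr0 ?addrA //.
by move=> s /andP[/andP[/negPf-> /negPf->] /negPf->]; rewrite expr0n mulr0.
Qed.

Lemma odd_residue_five : five_isotropic F.
Proof.
move=> a; have [/existsP[i /eqP ai]|] := boolP [exists i, a i == 0].
  exists (fun j => (j == i)%:R); first by exists i; rewrite eqxx oner_neq0.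
  rewrite (bigD1 i) //= ai mul0r add0r big1 // => j /negPf->.
  by rewrite expr0n mulr0.
rewrite negb_exists => /forallP a0; have [e he] := choice (fun i => parityP (a0 i)).
have [b /card_gt2P[i [j [l [[]]]]]] : exists b, (2 < #|finset (fun i => e i == b)|)%N.
  have h : (#|finset (fun i => e i == true)| + #|finset (fun i => e i == false)| = 5)%N.
    rewrite -[RHS]card_ord -(cardsC (finset (fun i => e i == true))); congr (_ + _)%N.
    by apply: eq_card => i; rewrite !inE; case: (e i).
  by have [lt|le] := ltnP 2 #|finset (fun i => e i == true)|; [exists true | exists false; lia].
rewrite !inE => /eqP ei /eqP ej /eqP el [ij jl li].
have P m : e m = b -> parity b (a m) by move=> <-.
exact: isotropic3_sub ij jl li (parity_isotropic3 (P _ ei) (P _ ej) (P _ el)).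
Qed.

(** Three coefficients of the same parity would give an isotropic ternary form, so there are two of
    each. In each pair minus the product is not a square, since the binary form is anisotropic; the
    product of two such nonsquare units is a square. *)
Lemma odd_residue_four : four_square F.
Proof.
move=> a an; have a0 i : a i != 0.
  apply/eqP => ai; have := an (fun j => (j == i)%:R); rewrite (bigD1 i) //= ai mul0r add0r big1.
    by move/(_ erefl i)/eqP; rewrite eqxx oner_eq0.
  by move=> j /negPf->; rewrite expr0n mulr0.
have [e he] := choice (fun i => parityP (a0 i)).
have P m b : e m = b -> parity b (a m) by move=> <-.
have le2 b : (#|finset (fun i => e i == b)| <= 2)%N.
  rewrite leqNgt; apply/negP => /card_gt2P[i [j [l [[]]]]].
  rewrite !inE => /eqP ei /eqP ej /eqP el [ij jl li].
  have [x [m xm] h] := isotropic3_sub ij jl li (parity_isotropic3 (P _ _ ei) (P _ _ ej) (P _ _ el)).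
  by rewrite (an _ h) eqxx in xm.
have sum4 : (#|finset (fun i => e i == true)| + #|finset (fun i => e i == false)| = 4)%N.
  rewrite -[RHS]card_ord -(cardsC (finset (fun i => e i == true))); congr (_ + _)%N.
  by apply: eq_card => i; rewrite !inE; case: (e i).
have eq2 b : #|finset (fun i => e i == b)| == 2.
  by have := (le2 true, le2 false); case: b; case; lia.
have nsq i j : i != j -> ~ square (- (a i * a j)).
  move=> ij [s es]; have ji : j != i by rewrite eq_sym.
  have := an (fun m => if m == i then s else if m == j then a i else 0).
  rewrite (bigD1 i) //= eqxx (bigD1 j) //= (negPf ji) eqxx big1 => [|m].
    rewrite -es addr0 (_ : _ + _ = 0); last by ring.
    by move/(_ erefl j)/eqP; rewrite (negPf ji) eqxx (negPf (a0 i)).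
  by case/andP=> /negPf-> /negPf->; rewrite expr0n mulr0.
have /cards2P[i [j [ij Et]]] := eq2 true; have /cards2P[l [m [lm Ef]]] := eq2 false.
have eE b r : r \in finset (fun i => e i == b) -> e r = b by rewrite inE => /eqP.
have [ei ej] : e i = true /\ e j = true by split; apply: eE; rewrite Et !inE eqxx ?orbT.
have [el em] : e l = false /\ e m = false by split; apply: eE; rewrite Ef !inE eqxx ?orbT.
have [s es] := square_product4 (P _ _ ei) (P _ _ ej) (P _ _ el) (P _ _ em) (nsq _ _ ij) (nsq _ _ lm).
exists s; rewrite -es (bigID (mem [set i; j]%SET)) /=; congr (_ * _).
  by rewrite big_setU1 ?inE //= big_set1.
rewrite (eq_bigl (mem [set l; m]%SET)) ?big_setU1 ?inE //= ?big_set1 // => r.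
by rewrite -Et -Ef !inE; case: (e r).
Qed.

End Uniformizer.

Lemma local_square_classes : [/\ five_isotropic F, four_square F &
  exists2 w : F, w != 0 & forall s, w != s ^+ 2 /\ - w != s ^+ 2].
Proof.
have [pi mpi [pi0 hpi]] := uniformizer; split; [exact: odd_residue_five mpi pi0 hpi | exact: odd_residue_four mpi pi0 hpi |].
exists pi => // s; have h := nonsquare_uniformizer mpi pi0 hpi.
split; apply/eqP => e; first by apply: (h 1 (or_introl erefl)); exists s; rewrite mul1r.
by apply: (h _ (or_intror erefl)); exists s; rewrite mulN1r.
Qed.

(** * Openness *)

Section Openness.
Variable V : vectType F.

Definition near N (x y : V) := forall i, O (coord (vbasis {:V}) i (y - x) / pF ^+ N).

Lemma O_div_le m n w : (m <= n)%N -> O (w / pF ^+ n) -> O (w / pF ^+ m).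
Proof.
move=> le_mn h; rewrite (_ : w / _ = w / pF ^+ n * pF ^+ (n - m)).
  by apply: Omul => //; apply: Oexp; exact: O_nat.
have pm := expf_neq0 m pF_neq0; have pn := expf_neq0 (n - m) pF_neq0.
by rewrite -{1}(subnK le_mn) exprD; field; rewrite pm pn.
Qed.

Lemma div_shift (c w u z : F) : z != 0 -> c * w / u = c / (u * z) * (z * w).
Proof. by move=> z0; rewrite invfM !mulrA divfK // mulrAC. Qed.

Lemma polyfun_continuous P x : polyfun P ->
  exists M, forall N y, near (N + M) x y -> O ((P y - P x) / pF ^+ N).
Proof.
elim=> {P} [c|f|P Q _ [M hM] _ [M' hM']|P Q _ [M hM] _ [M' hM']|P Q e _ [M hM]].
- by exists 0%N => N y _; rewrite subrr mul0r; exact: O0.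
- have [M hM] := choice (fun i : 'I_(\dim {:V}) => O_denominator (f (vbasis {:V})`_i : F)).
  exists (\max_i M i) => N y h; rewrite -linearB [y - x](coord_vbasis (memvf _)) linear_sum mulr_suml.
  apply: O_sum => i _; rewrite linearZ /=; set c := coord _ _ _.
  rewrite (_ : _ / _ = c / pF ^+ (N + \max_i M i) * (pF ^+ (\max_i M i) * (f (vbasis {:V})`_i : F))).
    by apply: Omul (h i) (hM i _ _); exact: leq_bigmax.
  by rewrite exprD; apply: div_shift; exact: expf_neq0.
- exists (maxn M M') => N y h; rewrite opprD addrACA mulrDl; apply: Oadd.
    by apply: hM => i; apply: O_div_le (h i); rewrite leq_add2l leq_maxl.
  by apply: hM' => i; apply: O_div_le (h i); rewrite leq_add2l leq_maxr.
- have [A hA] := O_denominator (P x); have [B hB] := O_denominator (Q x).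
  exists (A + B + (M + M'))%N => N y h.
  have {}hM : O ((P y - P x) / pF ^+ (N + (A + B))) by apply: hM => i; apply: O_div_le (h i); lia.
  have {}hM' : O ((Q y - Q x) / pF ^+ (N + (A + B))) by apply: hM' => i; apply: O_div_le (h i); lia.
  have hx n w : (n <= A + B)%N -> O (w / pF ^+ (N + (A + B))) -> forall q, O (pF ^+ n * q) -> O (w * q / pF ^+ N).
    move=> le_n hw q hq; have {hw} := O_div_le (leq_add (leqnn N) le_n) hw.
    by move/Omul/(_ hq); rewrite exprD -div_shift ?expf_neq0.
  rewrite (_ : P y * Q y - P x * Q x = (P y - P x) * (Q y - Q x) + (P y - P x) * Q x + (Q y - Q x) * P x).
    rewrite 2!(mulrDl _ _ (pF ^+ N)^-1); apply: Oadd; first apply: Oadd.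
    - apply: (hx 0%N _ isT hM); rewrite mul1r -[_ - _]divr1 -(expr0 pF).
      exact: O_div_le hM'.
    - exact: (hx B _ (leq_addl _ _) hM _ (hB _ (leqnn _))).
    - exact: (hx A _ (leq_addr _ _) hM' _ (hA _ (leqnn _))).
  by ring.
by exists M => N y h; rewrite -!e; exact: hM.
Qed.

Lemma polyfun_neq0_near P x : polyfun P -> P x != 0 -> exists n, forall y, near n x y -> P y != 0.
Proof.
move=> hP Px; have [M hM] := polyfun_continuous x hP.
have [N hN] : exists N, ~ O (P x / pF ^+ N).
  apply: contrapT => no; case/eqP: Px; apply: O_infinitely_divisible => N.
  by apply: contrapT => h; apply: no; exists N.
exists (N + M)%N => y /hM h; apply/eqP => e; apply: hN; move/Oopp: h.
by rewrite e sub0r mulNr opprK.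
Qed.

Lemma near_line n x v : exists M, forall j, (M <= j)%N -> near n x (x + pF ^+ j *: v).
Proof.
have [M hM] := choice (fun i : 'I_(\dim {:V}) => O_denominator (coord (vbasis {:V}) i v)).
exists (n + \max_i M i)%N => j hj i; rewrite addrAC subrr add0r linearZ /= -{1}(subnK (leq_trans (leq_addr _ _) hj)).
rewrite exprD mulrAC mulfK ?expf_neq0 //; apply: hM.
by have := @leq_bigmax _ M i; lia.
Qed.

(** The restriction of P to the line through x with direction v vanishes at x + p^j v for all large
    j, hence everywhere on the line. *)
Lemma polyfun_eq0_near P x v n : polyfun P -> (forall y, y - x \in <[v]>%VS -> near n x y -> P y = 0) ->
  P (x + v) = 0.
Proof.
move=> hP h; have [q qE] := polyfun_const_line x v hP; have [M hM] := near_line n x v.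
have -> : P (x + v) = q.[1] by rewrite -qE scale1r.
suff -> : q = 0 by rewrite horner0.
apply: (poly_eq_on (u := fun j => pF ^+ (M + j))) => [i j|j].
  rewrite -!natrX => /(natr_inj0 char0_F)/eqP.
  by rewrite eqn_exp2l ?prime_gt1 ?(Qp_prime hK) // eqn_add2l => /eqP.
rewrite -qE horner0; apply: h; last by apply: hM; exact: leq_addr.
by rewrite addrAC subrr add0r memvZ // memv_line.
Qed.

End Openness.
End LocalField.

Theorem theorem3p8p8
  (p : nat) (K : fieldType) (nu : K -> rat) (hK : is_Qp p nu)
  (F : fieldExtType K) (hF : residue_char_neq2 nu F)
  (Fbar : closedFieldType) (iota : {rmorphism F -> Fbar})
  (hFbar : forall x : Fbar, algebraicOver iota x)
  (g : lieAlgType F) (H0 : g)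
  (hgraded : regular_graded iota H0) (hsimple : lie_simple g)
  (a : {vspace g}) (ha : maximal_split_abelian_in (g0 H0) a) (haH0 : H0 \in a)
  (Pi : seq (dual a)) (hPi : root_basis Pi)
  (hPiH0 : {in Pi, forall alpha, root_eval alpha H0 = 0 \/ root_eval alpha H0 = 2})
  (k : nat) (lam : 'I_k.+1 -> dual a) (hlam : descent H0 Pi lam)
  (H : 'I_k.+1 -> g) (hH : forall j, is_coroot (lam j) (H j))
  (l e : nat) (hl : forall j, \dim (root_space (lam j)) = l)
  (he : forall i j : 'I_k.+1, i != j ->
     \dim (root_space (2^-1 *: (lam i + lam j))) = e)
  (X : 'I_k.+1 -> g) (hX : normalized iota H0 lam H X)
  (Delta0 : {mpoly F[\dim (Vplus H0)]}) (chi0 : 'End(g) -> F)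
  (hDelta0 : abs_irreducible iota Delta0)
  (hchi0 : relatively_invariant iota Delta0 chi0)
  (hrank : (2 <= k.+1)%N) (hl1 : l = 1%N) (he04 : e = 0%N \/ e = 4%N) :
  [/\ chi0 @` Ggrp iota H0 = [set c | c != 0],
      [set Gorbit iota H0 Z | Z in [set Z | Z \in Vplus H0 /\ Z != 0]]
        #= `I_k.+1,
      forall Z Z', Z \in Vplus H0 -> Z != 0 -> Z' \in Vplus H0 -> Z' != 0 ->
        (Gorbit iota H0 Z = Gorbit iota H0 Z' <->
         orbit_rank iota H0 lam Z = orbit_rank iota H0 lam Z'),
      open_orbit p nu iota H0 (\sum_j X j) /\
      (forall Z, Z \in Vplus H0 -> open_orbit p nu iota H0 Z ->
         Gorbit iota H0 Z = Gorbit iota H0 (\sum_j X j)) &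
      forall Y Y',
        Y \in (\sum_j root_space (lam j))%VS ->
        Y' \in (\sum_j root_space (lam j))%VS ->
        generic p nu iota H0 Y -> generic p nu iota H0 Y' ->
        exists2 phi, Lgrp iota H0 H phi & phi Y = Y'].
Proof.
have char0 := char0_F hK F; have [hXr hXeq hXone] := hX.
have hdim j : \dim (root_space (lam j)) = 1%N by rewrite hl.
have [Y frame Ylam] := descent_frame char0 hgraded hsimple ha haH0 hPi hPiH0 hlam hH hXr hdim.
have Xlam j : X j \in root_space (lam j) by case: (hXr j).
have Ha' := Ha hH; have X2 := fam_X2 (frame_triples frame).
have aniso i j : i != j -> exists2 A, Eij H i j 1 (- 1) A & bq X Y i j A A != 0.
  move=> nij; have [Z hZ q1] := hXone i j nij.
  exact: (anisotropic_of_normalized char0 hgraded hsimple frame nij hZ q1).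
have [h5 h4 [w w0 nw]] := local_square_classes hK hF.
have [univ dop] : universal H X Y /\ forall t, t != 0 -> diagonal_of_product iota H0 X t.
  case: he04 => e0; subst e.
    split; first exact: (universal_e0 char0 hgraded hsimple frame ha Ha' Xlam Ylam aniso he).
    apply: (dop_split char0 hgraded hsimple frame ha haH0 Ha' Xlam Ylam _ _ hPi).
    - exact: (e0_long he).
    - exact: (e0_linked char0 hgraded hsimple frame aniso).
    by move=> j; have [[[_ ?] _] _] := descent_lam hlam j.
  split; first exact: (universal_e4 char0 hgraded hsimple frame ha haH0 Ha' Xlam Ylam he h5).
  move=> t t0; have [ok|ek] := boolP (odd k); last exact: (dop_even char0 hgraded hsimple frame).
  apply: (dop_four char0 hgraded hsimple frame ha haH0 Ha' Xlam Ylam he h4 _ w0) => // s;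
    by case: (nw s).
have torus := torus_of_products char0 hgraded hsimple frame univ dop.
have [chiG [D Dp DE]] := character_image char0 hgraded hsimple frame univ torus hDelta0 hchi0.
pose base := \sum_j X j; have base2 : wt H0 2 base by exact: wt_sum.
have init := initial_orbit char0 hgraded hsimple frame aniso torus.
have inj := initial_inj char0 hgraded hsimple frame.
have Gsym := @Gorbit_sym _ _ iota _ H0 char0; have Gtr := @Gorbit_trans _ _ iota _ H0.
have Geq Z Z' := @Gorbit_eq _ _ iota _ H0 char0 Z Z'.
have rankE Z : wt H0 2 Z -> (orbit_rank iota H0 lam Z <= k.+1)%N /\
    Gorbit iota H0 Z (initial X (orbit_rank iota H0 lam Z)).
  move=> /init[m le_m hm]; rewrite /orbit_rank; case: xgetP => [_ -> [le_n [W [hW]]]|/(_ m)]; last first.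
    case; split=> //; exists X; split=> [i _|]; first exact: hXr.
    rewrite (_ : \sum_(i < _ | _) _ = initial X m) // big_mkcond; apply: eq_bigr => i _.
    by case: ifP; rewrite ?scale1r ?scale0r.
  set n := xget _ _ in hW *; move=> hZ; split=> //; apply: Gtr hZ _.
  (* Beyond n the coefficient is given the default value 1, because [initX_orbit] asks for
     coefficients without zeros. *)
  have ex (i : 'I_k.+1) : exists b : F, b != 0 /\ ((i < n)%N -> W i = b *: X i).
    have [/hW[Wi W0]|_] := ltnP i n; last by exists 1; rewrite oner_neq0.
    have [b eW] := lam_X hXr hdim Wi; exists b; split=> //.
    by apply: contraNneq W0 => b0; rewrite eW b0 scale0r.
  have [b hb] := choice ex; rewrite (_ : \sum_(i < _ | _) _ = initX X n b).
    by apply: initX_orbit => // i; [case: (hb i) | exact: oner_neq0].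
  rewrite big_mkcond; apply: eq_bigr => i _.
  by case: ifP => [/(hb i).2|_]; rewrite ?scale0r.
(* If D vanished at Z it would vanish on its orbit, hence near Z, and by [polyfun_eq0_near] at the
   base point. *)
have near_zero Z : wt H0 2 Z -> open_orbit p nu iota H0 Z -> D Z != 0.
  move=> Z2 [_ opn]; have [n hn] := opn Z (Gorbit_refl iota H0 Z).
  apply/eqP => DZ; have : D base != 0 by apply/DE => //; exact: Gorbit_refl.
  rewrite -[base](subrK Z) addrC => /eqP; apply.
  apply: (polyfun_eq0_near hK (n := n) Dp) => y yv yn.
  have y2 : wt H0 2 y.
    have /vlineP[c ey] := yv; rewrite -(subrK Z y) ey; apply: wtD => //; apply: wtZ.
    by apply: wtD => //; exact: wtN.
  have oy : Gorbit iota H0 Z y by apply: hn => //; exact/wt_eigen.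
  apply/eqP; apply: contraT => /(DE _ y2) h.
  by move: DZ => /eqP; rewrite -[_ == 0]negbK (iffRL (DE _ Z2)) //; apply: Gtr h (Gsym _ _ oy).
have generic_base Z : wt H0 2 Z -> open_orbit p nu iota H0 Z -> Gorbit iota H0 base Z.
  by move=> Z2 /(near_zero _ Z2)/(DE _ Z2).
split=> //.
- exact: (nonzero_orbits char0 hgraded hsimple frame aniso torus).
- move=> Z Z' /wt_eigen Z2 _ /wt_eigen Z'2 _.
  have [le_m hm] := rankE _ Z2; have [le_m' hm'] := rankE _ Z'2.
  split=> [/Geq h|em].
    by apply: inj => //; exact: Gtr (Gsym _ _ hm) (Gtr _ _ _ h hm').
  by apply/Geq; apply: Gtr hm _; rewrite em; exact: Gsym.
- split; last by move=> Z /wt_eigen Z2 /(generic_base _ Z2) h; apply/Geq; exact: Gsym.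
  split=> [_ [phi Gphi <-]|x hx]; first by apply/wt_eigen/(Ggrp_wt Gphi).
  have x2 : wt H0 2 x by case: hx => phi Gphi <-; exact: (Ggrp_wt Gphi).
  have [n hn] := polyfun_neq0_near hK Dp (iffRL (DE _ x2) hx).
  by exists n => y /wt_eigen y2 /hn /(DE _ y2).
move=> Z Z' hZ hZ' gZ gZ'.
(* A generic W is conjugate to the base point, so its quadratic operator is onto V+; [imsq_full]
   then says that no coefficient of W vanishes. *)
have diagE W : W \in (\sum_j root_space (lam j))%VS -> generic p nu iota H0 W ->
    exists2 b, W = diagX X b & forall j, b j != 0.
  move=> hW [/wt_eigen W2 /(generic_base _ W2)[phi Gphi phiE]].
  have /memv_sumP[f hf fE] := hW.
  have [b hb] := choice (fun j => lam_X hXr hdim (hf j isT)).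
  have WE : W = diagX X b by rewrite fE; apply: eq_bigr => j _.
  exists b => //; apply/forallP; rewrite -(imsq_full char0 hgraded hsimple frame) -WE -phiE.
  have full : imsq H0 base = Vplus H0.
    have -> : base = diagX X (fun=> 1) by apply: eq_bigr => j _; rewrite scale1r.
    by apply/eqP; rewrite (imsq_full char0 hgraded hsimple frame); apply/forallP => j; exact: oner_neq0.
  rewrite eqEdim (dim_imsq_G char0 _ Gphi) full leqnn andbT phiE WE; apply/subvP => v.
  by case/(imsq_diag char0 hgraded hsimple frame) => v2 _; apply/wt_eigen.
have [b ZE b0] := diagE _ hZ gZ; have [b' ZE' b'0] := diagE _ hZ' gZ'.
have c0 j : b' j / b j != 0 by rewrite mulf_neq0 ?invr_eq0.
have [phi Gphi phiX] := torus _ c0; exists phi.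
  exact: (diag_Lgrp char0 hgraded hsimple frame Gphi c0 phiX).
rewrite ZE ZE' (diagX_act _ phiX); apply: eq_bigr => j _.
by rewrite mulrC divfK.
Qed.
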